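(* Let $\alpha\in(0,1)$ and let $p>1$ be real, and let $n$ be either of the nonlinearities (abs) $n(x)=|x|^p$ or (sgn) $n(x)=x|x|^{p-1}$. Then there exists a nontrivial $2\pi$-periodic travelling-wave solution $\varphi$ of $u_t+(|\mathrm{D}|^{-\alpha}u+n(u))_x=0$ with positive speed $c<\frac{p}{p-1}\|K_\alpha\|_{L^1(\mathbb{T})}$. The solution is even (about $2\pi\mathbb{Z}$), has zero mean, and satisfies $$\max\varphi=\varphi(0)=\mu\qquad\text{and}\qquad \varphi\in C^\alpha(\mathbb{T}),$$ where $\mu:=(c/p)^{1/(p-1)}$. It is also smooth (except possibly at the point where it vanishes) and strictly increasing on $(-\pi,0)$, and it is exactly $\alpha$-Hölder continuous at every $x\in2\pi\mathbb{Z}$, that is, for each $\ell\in\mathbb{Z}$ there are constants $\lambda,\delta>0$ such that $$\lambda^{-1}|x-2\pi\ell|^\alpha\le \mu-\varphi(x)\le\lambda|x-2\pi\ell|^\alpha\qquad\text{for all } |x-2\pi\ell|<\delta .$$ Moreover, in case (abs) $\varphi$ is smooth in a neighbourhood of $-\pi$, while in case (sgn) $\varphi$ is antisymmetric about $-\frac{\pi}{2}$ (i.e. $\varphi(\cdot+\pi)=-\varphi$) and therefore also exactly $\alpha$-Hölder continuous at all points of $\pi\mathbb{Z}$, with $\min\varphi=\varphi(-\pi)=-\mu$.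
   Context: $\mathbb{T}=\mathbb{R}/2\pi\mathbb{Z}$; functions on $\mathbb{T}$ are identified with $2\pi$-periodic functions on $\mathbb{R}$. For $\varphi$ on $\mathbb{T}$ with zero mean, $|\mathrm{D}|^{-\alpha}\varphi$ is the zero-mean function with Fourier coefficients $|k|^{-\alpha}\widehat\varphi(k)$, $k\neq0$, where $\widehat\varphi(k)=\int_{\mathbb{T}}\varphi(x)e^{-ikx}\,dx$. Equivalently $|\mathrm{D}|^{-\alpha}\varphi(x)=\int_{\mathbb{T}}K_\alpha(x-y)\varphi(y)\,dy$ with the integrable kernel $K_\alpha(x)=\frac{1}{2\pi}\sum_{k\ne0}|k|^{-\alpha}e^{ikx}$. A travelling-wave solution with speed $c$ is $u(t,x)=\varphi(x-ct)$ where $\varphi$ is a continuous zero-mean function on $\mathbb{T}$ satisfying the integrated steady equation $$|\mathrm{D}|^{-\alpha}\varphi=c\varphi-n(\varphi)+\frac1{2\pi}\int_{\mathbb{T}}n(\varphi(y))\,dy .$$ ''Nontrivial'' means not identically zero. $C^\alpha(\mathbb{T})$ is the space of $\alpha$-Hölder continuous functions on $\mathbb{T}$. *)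

(* Defs.v *)
From mathcomp Require Import all_boot all_order all_algebra.
From mathcomp Require Import complex.
From mathcomp Require Import all_classical all_reals all_analysis.

Set Implicit Arguments.
Unset Strict Implicit.
Unset Printing Implicit Defensive.

Import Order.TTheory GRing.Theory Num.Theory.
Import numFieldNormedType.Exports.

Local Open Scope classical_set_scope.
Local Open Scope complex_scope.
Local Open Scope ring_scope.

(* Functions on the torus R/2piZ are 2pi-periodic functions R -> R, and
   integrals over the torus are Lebesgue integrals over [-pi, pi]. *)

Section Torus.
Context {R : realType}.
Implicit Types (alpha p c : R) (f phi psi : R -> R).

Definition intT f : R :=
  \int[@lebesgue_measure R]_(x in `[- pi, pi]) f x.

Definition L1normT f : R := intT (fun x => `|f x|).

Definition intTC (f : R -> R[i]) : R[i] :=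
  intT (fun x => complex.Re (f x)) +i* intT (fun x => complex.Im (f x)).

(* e^{i t} *)
Definition expi (t : R) : R[i] := cos t +i* sin t.

Definition fourier phi (k : int) : R[i] :=
  intTC (fun x => (phi x)%:C * expi (- (k%:~R * x))).

(* psi is the continuous representative of |D|^{-alpha} phi; it is unique,
   since a continuous periodic function is determined by its Fourier
   coefficients. *)
Definition is_absDN alpha phi psi : Prop :=
  [/\ periodic psi (2 * pi), continuous psi, intT psi = 0 &
      forall k : int, k != 0 ->
        fourier psi k = (`|k%:~R : R| `^ (- alpha))%:C * fourier phi k].

(* The series over k <> 0 is the limit of its symmetric partial sums, the terms
   k and -k being grouped together; the sums are real, and converge for x
   outside 2piZ.  On the null set 2piZ, where they diverge, the value is
   irrelevant. *)
Definition kernelK alpha (x : R) : R :=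
  limn (fun N : nat => (2 * pi)^-1 *
    complex.Re (\sum_(1 <= k < N.+1)
      (k%:R `^ (- alpha))%:C * (expi (k%:R * x) + expi (- (k%:R * x))))).

Inductive nonlinearity := nl_abs | nl_sgn.

Definition nonlin (n : nonlinearity) p (x : R) : R :=
  match n with
  | nl_abs => `|x| `^ p
  | nl_sgn => x * `|x| `^ (p - 1)
  end.

(* u(t, x) = phi (x - c t) solves u_t + (|D|^{-alpha} u + n(u))_x = 0, in the
   integrated form of the equation. *)
Definition travelling_wave alpha (n : R -> R) c phi : Prop :=
  [/\ periodic phi (2 * pi), continuous phi, intT phi = 0 &
      is_absDN alpha phi
        (fun x => c * phi x - n (phi x)
                  + (2 * pi)^-1 * intT (fun y => n (phi y)))].

(* For periodic functions, the global bound on R is the same as the one in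
   terms of the distance of the torus. *)
Definition holderT alpha f : Prop :=
  exists C : R, forall x y, `|f x - f y| <= C * `|x - y| `^ alpha.

(* Meaningful for open A only. *)
Definition smooth_on (A : set R) f : Prop :=
  forall (m : nat) x, A x -> derivable (derive1n m f) x 1.

Definition exactly_holder_at alpha f (a : R) : Prop :=
  exists lambda delta : R, [/\ 0 < lambda, 0 < delta &
    forall x, `|x - a| < delta ->
      lambda^-1 * `|x - a| `^ alpha <= `|f a - f x|
        <= lambda * `|x - a| `^ alpha].

End Torus.

(* Main.v *)
(** Put u = 1 - phi / mu and lam = 1 / c.  With W(u) the strictly increasing
   function obtained from x - n(x) / p, the steady equation for an even profile
   with maximum mu at 0 becomes W(u) = lam (L u - L u(0)), L = |D|^-alpha, where
   W'(0) = 0: this degeneracy produces the cusp.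

   Existence.  On the Hilbert cube of (lam, Fourier coefficients of u), the
   equation with L u - L u(0) replaced by its running maximum on [0, pi] plus
   eps (1 - cos x) is solved by the Poincare-Miranda theorem, from Kuhn's
   cubical lemma.  The profile is then nondecreasing on [0, pi], and since the
   kernel of L is decreasing there so is L u: the running maximum is L u - L u(0)
   itself.  Testing with cos bounds lam and an L^1 estimate bounds u, uniformly
   as eps -> 0; the normalisation int u = 2 pi, u(0) = 0 makes u nonconstant.

   Regularity.  Everything rests on
     L f(m + h) - L f(m - h) =
       int (K(s - h) - K(s + h)) (f(m + s) - f(m - s)) ds  over [0, pi],
   with positive weight.  Since W(u) ~ u^2 near 0, it gives a lower and an upper
   bound of order |x|^alpha for u and, where W'(u) > 0, an increase of the
   Hoelder exponent, then C^k for all k by differentiating u near x as a smooth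
   function of L u.  As K is decreasing, it is bounded away from 0 somewhere,
   which makes the bound on the speed strict. *)
Require Import Defs.
From mathcomp Require Import all_boot all_order all_algebra.
From mathcomp Require Import complex ring lra zify.
From mathcomp Require Import all_classical all_reals all_analysis measurable_realfun.
Set Implicit Arguments.
Unset Strict Implicit.
Unset Printing Implicit Defensive.
Import Order.TTheory GRing.Theory Num.Theory.
Import numFieldNormedType.Exports.
Local Open Scope classical_set_scope.
Local Open Scope ring_scope.

(** * Real-valued integrals over intervals *)

Section Toolbox.
Context {R : realType}.
Implicit Types (i : interval R) (f g : R -> R) (a b c : R).

Notation mu := (@lebesgue_measure R).

(** Why a cube of sequences: a nonnegative profile that increases on [0, pi] and is at most M has
    cosine coefficients at most pi M / k, so the candidates fill a box that is compact for the
    product topology. The running maximum makes every point of the box, not only a solution, produce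
    such a profile, and this gives the signs on the faces. The inverse speed is one more coordinate,
    paired with the equation for the mean; the term eps (1 - cos x) pushes the mean above 1 when
    that coordinate is large, which is the sign missing on its last face.

    Why the cusp can be measured: at an extremum z of u / x^alpha over [x, pi] the estimate of L u
    is linear in the extremal quotient, while W(u) is of order u^2. Comparing the two bounds the
    quotient by constants that do not depend on x, and no derivative at 0 enters. For Hoelder
    continuity near the crest the usual bound h^alpha on increments of L u is too weak, because it
    gets divided by W'(u), which is of order m^alpha at distance m; the increments are therefore
    shown to be of order m^alpha h^alpha. *)

Definition integ i f := mu.-integrable [set` i] (EFin \o f).

(* Locked, so that conversion never unfolds the Lebesgue integral. *)
Fact Int_key : unit. Proof. exact: tt. Qed.
Definition Int i f : R := locked_with Int_key (\int[mu]_(x in [set` i]) f x).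

Lemma IntE i f : Int i f = \int[mu]_(x in [set` i]) f x.
Proof. by rewrite /Int locked_withE. Qed.

Lemma eq_integ i f g : {in i, f =1 g} -> integ i f -> integ i g.
Proof.
move=> fg; apply: eq_integrable => // x; rewrite inE => /= xi.
by rewrite fg.
Qed.

Lemma eq_Int i f g : {in i, f =1 g} -> Int i f = Int i g.
Proof. by move=> fg; rewrite !IntE; apply: eq_Rintegral => x; rewrite inE => /fg. Qed.

Lemma integD i f g : integ i f -> integ i g -> integ i (fun x => f x + g x).
Proof.
move=> fi gi; rewrite /integ; apply: (@eq_integrable _ _ _ mu _ _ ((EFin \o f) \+ (EFin \o g))%E) => //.
exact: integrableD.
Qed.

Lemma integB i f g : integ i f -> integ i g -> integ i (fun x => f x - g x).
Proof. move=> fi gi; rewrite /integ; apply: (@eq_integrable _ _ _ mu _ _ ((EFin \o f) \- (EFin \o g))%E) => //.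
exact: integrableB. Qed.

Lemma integZ i k f : integ i f -> integ i (fun x => k * f x).
Proof. move=> fi; rewrite /integ; apply: (@eq_integrable _ _ _ mu _ _ (fun x => k%:E * (EFin \o f) x)%E) => //.
exact: integrableZl. Qed.

Lemma integN i f : integ i f -> integ i (fun x => - f x).
Proof. by move=> /(integZ (-1)); apply: eq_integ => x _; rewrite mulN1r. Qed.

Lemma integ_norm i f : integ i f -> integ i (fun x => `|f x|).
Proof. exact: integrable_norm. Qed.

Lemma integ_meas i f : integ i f -> measurable_fun [set` i] f.
Proof. by move=> /integrableP[/measurable_EFinP]. Qed.

Lemma integ_le i f g : integ i g -> measurable_fun [set` i] f ->
  {in i, forall x, `|f x| <= g x} -> integ i f.
Proof.
move=> gi mf fg; apply: (@le_integrable _ _ _ mu _ _ _ (EFin \o g)) => //.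
  exact/measurable_EFinP.
by move=> x xi /=; rewrite lee_fin (le_trans (fg x xi))// ler_norm.
Qed.

Lemma integS i j f : {subset i <= j} -> integ j f -> integ i f.
Proof. by move=> ij; apply: integrableS => // x /= /ij. Qed.

Lemma integ_cst a b k : integ `[a, b] (fun=> k).
Proof.
apply: continuous_compact_integrable; first exact: segment_compact.
by apply: continuous_subspaceT => x; apply: cst_continuous.
Qed.

Lemma integ_cont a b f : {within `[a, b], continuous f} -> integ `[a, b] f.
Proof. by move=> cf; apply: continuous_compact_integrable => //; apply: segment_compact. Qed.

Lemma integ_bnd a b f M : measurable_fun [set` `[a, b]] f ->
  {in `[a, b], forall x, `|f x| <= M} -> integ `[a, b] f.
Proof. by move=> mf fM; apply: (integ_le (integ_cst a b M)). Qed.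

Lemma integM i f g M : integ i f -> measurable_fun [set` i] g ->
  {in i, forall x, `|g x| <= M} -> integ i (fun x => f x * g x).
Proof.
move=> fi mg gM; apply: (integ_le (integZ M (integ_norm fi))).
  by apply: measurable_funM => //; apply: integ_meas.
by move=> x xi; rewrite normrM mulrC ler_wpM2r// gM.
Qed.

Lemma IntD i f g : integ i f -> integ i g ->
  Int i (fun x => f x + g x) = Int i f + Int i g.
Proof. by move=> fi gi; rewrite !IntE RintegralD. Qed.

Lemma IntB i f g : integ i f -> integ i g ->
  Int i (fun x => f x - g x) = Int i f - Int i g.
Proof. by move=> fi gi; rewrite !IntE RintegralB. Qed.

Lemma IntZ i k f : integ i f -> Int i (fun x => k * f x) = k * Int i f.
Proof. by move=> fi; rewrite !IntE RintegralZl. Qed.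

Lemma IntN i f : integ i f -> Int i (fun x => - f x) = - Int i f.
Proof.
move=> fi; rewrite -mulN1r -IntZ//; apply: eq_Int => x _; by rewrite mulN1r.
Qed.

Lemma Int_sum (I : Type) (r : seq I) i (F : I -> R -> R) :
  (forall k, integ i (F k)) ->
  Int i (fun x => \sum_(k <- r) F k x) = \sum_(k <- r) Int i (F k) /\
  integ i (fun x => \sum_(k <- r) F k x).
Proof.
move=> Fi; elim: r => [|k r [IH1 IH2]].
  have i0 : integ i (fun=> \sum_(k <- [::]) F k 0).
    rewrite /integ big_nil; apply: (@eq_integrable _ _ _ mu _ _ (cst 0%E)) => //.
    exact: integrable0.
  split; last by apply: eq_integ i0 => x _; rewrite !big_nil.
  rewrite big_nil IntE /Rintegral.
  under eq_integral do rewrite big_nil.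
  by rewrite integral0.
have e x : \sum_(j <- k :: r) F j x = F k x + \sum_(j <- r) F j x by rewrite big_cons.
split.
  rewrite big_cons -IH1 -IntD//; apply: eq_Int => x _; exact: e.
by apply: eq_integ (integD (Fi k) IH2) => x _; rewrite e.
Qed.

Lemma Int_le i f g : integ i f -> integ i g -> {in i, forall x, f x <= g x} ->
  Int i f <= Int i g.
Proof. by move=> fi gi fg; rewrite !IntE; apply: le_Rintegral. Qed.

Lemma Int_ge0 i f : {in i, forall x, 0 <= f x} -> 0 <= Int i f.
Proof. by move=> f0; rewrite IntE; apply: Rintegral_ge0. Qed.

Lemma Int_norm i f : integ i f -> `|Int i f| <= Int i (fun x => `|f x|).
Proof. by move=> fi; rewrite !IntE; apply: le_normr_Rintegral. Qed.

Lemma Int_norm_le i f g : integ i f -> integ i g ->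
  {in i, forall x, `|f x| <= g x} -> `|Int i f| <= Int i g.
Proof.
by move=> fi gi fg; apply: le_trans (Int_norm fi) _; apply: Int_le => //; apply: integ_norm.
Qed.

Lemma Int_cst a b k : a <= b -> Int `[a, b] (fun=> k) = k * (b - a).
Proof.
move=> ab; rewrite IntE Rintegral_cst//= lebesgue_measure_itv/= lte_fin.
move: ab; rewrite le_eqVlt => /predU1P[->|ab]; first by rewrite ltxx subrr.
by rewrite ab -EFinB.
Qed.

Lemma Int_split a b c f : a <= b -> b <= c -> integ `[a, c] f ->
  Int `[a, c] f = Int `[a, b] f + Int `[b, c] f.
Proof.
move=> ab bc fi; rewrite !IntE -(@Rintegral_itv_obnd_cbnd _ b); last first.
  apply: (@integS _ _ f _ fi) => x; rewrite !in_itv/= => /andP[/ltW bx ->].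
  by rewrite (le_trans ab).
by rewrite -(@Rintegral_itvB _ _ (BLeft a) (BRight c) b)// addrC subrK.
Qed.

Lemma integ_split a b c f : integ `[a, b] f -> integ `[b, c] f -> integ `[a, c] f.
Proof.
move=> f1 f2.
have e : [set` `[a, c]] `<=` [set` `[a, b]] `|` [set` `]b, c]].
  move=> x /=; rewrite !in_itv/= => /andP[-> ->].
  by case: (leP x b) => h; [left|right].
have f3 : integ `]b, c] f.
  by apply: integS f2 => x; rewrite !in_itv/= => /andP[/ltW-> ->].
apply: (@integrableS _ _ _ mu ([set` `[a, b]] `|` [set` `]b, c]])) => //.
  exact: measurableU.
have m1 := integ_meas f1; have m3 := integ_meas f3.
apply/integrableP; split.
  by apply/measurable_EFinP; apply/measurable_funU.
rewrite ge0_integral_setU//.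
- apply: lte_add_pinfty; first by case/integrableP : f1.
  by case/integrableP : f3.
- apply: measurableT_comp => //; apply/measurable_EFinP.
  by apply/measurable_funU.
- apply/disj_setPS => y [/=]; rewrite !in_itv/= => /andP[_ yx] /andP[].
  by rewrite ltNge yx.
Qed.

Lemma Int_sub a b c d f : a <= c -> c <= d -> d <= b -> integ `[a, b] f ->
  {in `[a, b], forall x, 0 <= f x} -> Int `[c, d] f <= Int `[a, b] f.
Proof.
move=> ac cd db fi f0; rewrite (Int_split (b := c))//; last exact: le_trans db.
have fi' : integ `[c, b] f.
  by apply: integS fi => x; rewrite !in_itv/= => /andP[h ->]; rewrite (le_trans ac).
rewrite (Int_split cd db)// addrCA lerDl addr_ge0//; apply: Int_ge0 => x.
  by rewrite in_itv/= => /andP[h1 h2]; apply: f0; rewrite in_itv/= h1 (le_trans h2)// (le_trans cd).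
by rewrite in_itv/= => /andP[h1 h2]; apply: f0; rewrite in_itv/= h2 (le_trans ac)// (le_trans cd).
Qed.

Lemma Int_dct i (F : nat -> R -> R) f g : (forall n, measurable_fun [set` i] (F n)) ->
  {in i, forall x, F n x @[n --> \oo] --> f x} -> integ i g ->
  (forall n, {in i, forall x, `|F n x| <= g x}) ->
  integ i f /\ Int i (F n) @[n --> \oo] --> Int i f.
Proof.
move=> mF Ff gi Fg.
have mF' n : measurable_fun [set` i] (fun x => (F n x)%:E).
  exact/measurable_EFinP.
have cF : {ae mu, forall x, [set` i] x -> (F n x)%:E @[n --> \oo] --> (f x)%:E}.
  apply: aeW => x xi; apply: cvg_EFin; first exact: nearW.
  exact: Ff.
have mf : measurable_fun [set` i] (fun x => (f x)%:E).
  apply: (@emeasurable_fun_cvg _ _ _ _ (fun n x => (F n x)%:E)) => // x xi.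
  by apply: cvg_EFin; [exact: nearW|exact: Ff].
have dF : {ae mu, forall x n, [set` i] x -> (`|(F n x)%:E| <= (g x)%:E)%E}.
  by apply: aeW => x n xi; rewrite lee_fin; apply: Fg.
have [fi _ H] := @dominated_convergence _ _ _ mu _ (measurable_itv i) _ _ _ mF' mf cF gi dF.
split; first exact: fi.
rewrite IntE; under eq_fun do rewrite IntE.
by apply: fine_cvg; rewrite fineK//; apply: integrable_fin_num.
Qed.

(** Serves translations and the reflection. Both preserve Lebesgue measure, so the change of
    variables is a statement on pushforwards and holds for every integrable f. *)
Lemma Int_push (phi : R -> R) (i j : interval R) f :
  measurable_fun setT phi ->
  (forall A, measurable A -> pushforward mu (phi : _ -> measurableTypeR R) A = mu A) ->
  phi @^-1` [set` j] = [set` i] -> measurable_fun setT f ->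
  integ i (f \o phi) -> integ j f /\ Int j f = Int i (f \o phi).
Proof.
move=> mphi pushE ij mf fi.
have mf' : measurable_fun setT (EFin \o f) by apply/measurable_EFinP.
have fi' : mu.-integrable (phi @^-1` [set` j]) ((EFin \o f) \o phi) by rewrite ij.
have e B : measurable B -> B `<=` [set` j] ->
  pushforward mu (phi : _ -> measurableTypeR R) B = mu B by move=> mB _; exact: pushE.
split.
  apply/integrableP; split; first exact: measurable_funTS.
  have := @integrable_pushforward _ _ (measurableTypeR R) (measurableTypeR R) R _ mphi mu _ _ mf' fi' (measurable_itv j).
  move=> /integrableP[_]; apply: le_lt_trans.
  rewrite le_eqVlt; apply/orP; left; apply/eqP.
  by apply: eq_measure_integral => B mB jB; apply/esym/e.
rewrite !IntE /Rintegral; congr fine; rewrite -ij.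
rewrite -(@integral_pushforward _ _ (measurableTypeR R) (measurableTypeR R) R _ mphi mu _ _ mf' fi')//.
by apply: eq_measure_integral => B mB jB; apply/esym/e.
Qed.

Lemma Int_shift a b c f : measurable_fun setT f ->
  integ `[a, b] (fun x => f (x + c)) ->
  integ `[a + c, b + c] f /\
  Int `[a + c, b + c] f = Int `[a, b] (fun x => f (x + c)).
Proof.
move=> mf fi; apply: (@Int_push (fun x => x + c)) => //.
- exact: measurable_funD.
- move=> A mA; apply/esym; apply: lebesgue_measure_unique mA => //=.
    exact: measurable_funD.
  move=> mp _ [[u v]] _ <-.
  rewrite /pushforward.
  have -> : (fun x : R => x + c) @^-1` [set` `]u, v]] = [set` `]u - c, v - c]].
    by apply/seteqP; split => x /=; rewrite !in_itv/= ltrBlDr lerBrDr.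
  rewrite !lebesgue_measure_itv/= !lte_fin ltrD2r.
  by case: ifP => // _; rewrite -!EFinB opprB addrA subrK.
- by apply/seteqP; split => x /=; rewrite !in_itv/= !lerD2r.
Qed.

Lemma Int_refl a b f : measurable_fun setT f -> integ `[a, b] (fun x => f (- x)) ->
  integ `[- b, - a] f /\ Int `[- b, - a] f = Int `[a, b] (fun x => f (- x)).
Proof.
move=> mf fi; apply: (@Int_push -%R) => //.
- exact: lebesgue_measureN.
- by apply/seteqP; split => x /=; rewrite !in_itv/= !lerN2 andbC.
Qed.

Lemma Int_FTC a b (F f : R -> R) : a <= b -> (forall x : R, is_derive x 1 F (f x)) ->
  continuous f -> Int `[a, b] f = F b - F a.
Proof.
move=> ab dF cf; move: ab; rewrite le_eqVlt => /predU1P[->|ab].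
  by rewrite subrr IntE set_itv1 Rintegral_set1.
have cF : continuous F.
  by move=> x; apply/differentiable_continuous/derivable1_diffP; case: (dF x).
rewrite IntE /Rintegral (@continuous_FTC2 _ f F)//.
- exact: continuous_subspaceT.
- split.
  + by move=> x _; case: (dF x).
  + by apply: cvg_at_right_filter; apply: cF.
  + by apply: cvg_at_left_filter; apply: cF.
- by move=> x _; rewrite derive1E; case: (dF x).
Qed.

Lemma Int_derive_under i (F dF : R -> R -> R) (G : R -> R) (u v x : R) : u < x < v ->
  (forall y, u < y < v -> integ i (F y)) ->
  (forall y s, u < y < v -> s \in i -> is_derive y 1 (F^~ s) (dF y s)) ->
  integ i G -> (forall y s, u < y < v -> s \in i -> `|dF y s| <= G s) ->
  is_derive x 1 (fun y => Int i (F y)) (Int i (dF x)).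
Proof.
move=> uxv iF DF iG dFG.
have e : (fun y => Int i (F y)) = (fun y => \int[mu]_(s in [set` i]) F y s).
  by apply/funext => y; rewrite IntE.
have Ix : ([set` `]u, v[] : set R) x by rewrite /= in_itv.
have H1 y : ([set` `]u, v[] : set R) y -> mu.-integrable [set` i] (EFin \o F y).
  by move=> /=; rewrite in_itv/= => h; exact: iF.
have H2 y s : ([set` `]u, v[] : set R) y -> [set` i] s -> derivable (F ^~ s) y 1.
  by move=> /=; rewrite in_itv/= => h si; case: (DF y s h si).
have iG' := integ_norm iG.
have H3 y s : ([set` `]u, v[] : set R) y -> [set` i] s ->
    `|partial1of2 F y s| <= (fun s => `|G s|) s.
  move=> /=; rewrite in_itv/= => h si; rewrite partial1of2E.
  case: (DF y s h si) => _ ->; apply: le_trans (dFG _ _ h si) _; exact: ler_norm.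
have G0 s : 0 <= `|G s| by [].
have D1 := @derivable_under_integral R _ _ mu F _ (measurable_itv i) x u v Ix H1 H2 _ G0 iG' H3.
have D2 := @differentiation_under_integral R _ _ mu F _ (measurable_itv i) x u v Ix H1 H2 _ G0 iG' H3.
rewrite e; apply: DeriveDef => //; rewrite -derive1E D2 IntE.
apply: eq_Rintegral => s; rewrite inE => si; rewrite partial1of2E.
by case: (DF x s uxv si).
Qed.

End Toolbox.

(** * Rules for derivatives in one variable *)

Section DeriveRules.
Context {R : realType}.
Implicit Types (f g : R -> R) (x : R).

(* Not a class, contrary to is_derive: the rules below must not trigger
   instance search on their premises. *)
Definition der f x (d : R) : Prop := is_derive x 1 f d.

Lemma derC (k x : R) : der (fun=> k) x 0.
Proof. exact: is_derive_cst. Qed.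

Lemma der_id x : der (fun y => y) x 1.
Proof. exact: is_derive_id. Qed.

Lemma der_sin x : der sin x (cos x).
Proof. exact: is_derive_sin. Qed.

Lemma der_cos x : der cos x (- sin x).
Proof. exact: is_derive_cos. Qed.

Lemma der_powR (r x : R) : 0 < x -> der (fun y => y `^ r) x (r * x `^ (r - 1)).
Proof. exact: is_derive1_powR. Qed.

Lemma derD f g x (df dg : R) : der f x df -> der g x dg ->
  der (fun y => f y + g y) x (df + dg).
Proof. exact: is_deriveD. Qed.

Lemma derN f x (df : R) : der f x df -> der (fun y => - f y) x (- df).
Proof. exact: is_deriveN. Qed.

Lemma derB f g x (df dg : R) : der f x df -> der g x dg ->
  der (fun y => f y - g y) x (df - dg).
Proof. exact: is_deriveB. Qed.

Lemma derM f g x (df dg : R) : der f x df -> der g x dg ->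
  der (fun y => f y * g y) x (f x * dg + g x * df).
Proof. exact: is_deriveM. Qed.

Lemma derZ (k : R) f x (df : R) : der f x df -> der (fun y => k * f y) x (k * df).
Proof. exact: is_deriveZ. Qed.

Lemma der_comp f g x (df dg : R) : der f x df -> der g (f x) dg ->
  der (fun y => g (f y)) x (dg * df).
Proof. by move=> h1 h2; exact: (@is_derive1_comp R g f). Qed.

Lemma derV f x (df : R) : f x != 0 -> der f x df ->
  der (fun y => (f y)^-1) x (- (df / f x ^+ 2)).
Proof.
move=> f0 h; apply: is_derive_eq (is_deriveV f0 h) _.
by rewrite /GRing.scale/= mulNr mulrC.
Qed.

Lemma der_eq f x (d d' : R) : der f x d -> d = d' -> der f x d'.
Proof. by move=> h <-. Qed.

Lemma der_ext f g x (d : R) : (\forall y \near x, f y = g y) -> der f x d -> der g x d.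
Proof. exact: near_eq_is_derive. Qed.

Lemma der_cont f x (d : R) : der f x d -> {for x, continuous f}.
Proof. by case=> h _; apply/differentiable_continuous/derivable1_diffP. Qed.

Lemma der_derivable f x (d : R) : der f x d -> derivable f x 1.
Proof. by case. Qed.

Lemma der_derive1 f x (d : R) : der f x d -> derive1 f x = d.
Proof. by rewrite derive1E; case. Qed.

Lemma derP f x : derivable f x 1 -> der f x (derive1 f x).
Proof. by move=> h; rewrite /der derive1E; exact: DeriveDef. Qed.

End DeriveRules.

(** * Elementary inequalities for sine and cosine; integrals over half-lines *)

Section Calculus.
Context {R : realType}.
Implicit Types (f g : R -> R) (a b c x y : R).

Lemma mvt f (df : R -> R) a b : a < b ->
  (forall x, a <= x <= b -> der f x (df x)) ->
  exists2 c, a < c < b & f b - f a = df c * (b - a).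
Proof.
move=> ab dF.
have [||c cab ->] := @MVT R f df a b ab.
- by move=> x; rewrite in_itv/= => /andP[/ltW ax /ltW xb]; apply: dF; rewrite ax.
- apply: derivable_within_continuous => x; rewrite in_itv/= => xab.
  by case: (dF x xab).
- by exists c => //; move: cab; rewrite in_itv.
Qed.

Lemma derive_mono f (df : R -> R) a b : a <= b ->
  (forall x, a <= x <= b -> der f x (df x)) ->
  (forall x, a < x < b -> 0 <= df x) -> f a <= f b.
Proof.
rewrite le_eqVlt => /predU1P[->//|ab] dF df0.
have [c cab e] := mvt ab dF.
by rewrite -subr_ge0 e mulr_ge0 ?df0// subr_ge0 ltW.
Qed.

Lemma pi_le4 : pi <= 4 :> R.
Proof. by have [/andP[_]] := @pihalf_02_cos_pihalf R; lra. Qed.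

Lemma sin_le x : 0 <= x -> sin x <= x.
Proof.
move=> x0.
have := @derive_mono (fun y => y - sin y) (fun y => 1 - cos y) 0 x x0 _ _.
rewrite sin0 subr0 subr_ge0; apply.
  by move=> y _; apply: derB; [exact: der_id|exact: der_sin].
by move=> y _; rewrite subr_ge0 cos_le1.
Qed.

Lemma cos_half x : 1 - cos x = 2 * sin (x / 2) ^+ 2.
Proof.
have -> : cos x = cos (x / 2 + x / 2) by congr cos; lra.
rewrite cosD; have := cos2Dsin2 (x / 2); nra.
Qed.

Lemma cosB_prod a b : cos a - cos b = 2 * sin ((a + b) / 2) * sin ((b - a) / 2).
Proof.
have -> : cos a = cos ((a + b) / 2 - (b - a) / 2) by congr cos; lra.
have -> : cos b = cos ((a + b) / 2 + (b - a) / 2) by congr cos; lra.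
rewrite cosB cosD; ring.
Qed.

Lemma cos_ge x : 0 <= x -> 1 - x ^+ 2 / 2 <= cos x.
Proof.
move=> x0; have := cos_half x; have h : sin (x / 2) <= x / 2 by apply: sin_le; lra.
have h1 : - (x / 2) <= sin (x / 2).
  have [x4|x4] := leP x 4; last by have := @sin_geN1 _ (x / 2); lra.
  have [xp|xp] := leP (x / 2) pi.
    have : 0 <= sin (x / 2) by apply: sin_ge0_pi; lra.
    lra.
  by have := @pi_ge2 R; lra.
by nra.
Qed.

(** Jordan's inequality with 2/5 in place of the sharp 2 / pi. On [0, 1] it follows from x - x^3 / 6
    <= sin x; beyond 1, from sin x >= sin 1 >= 5/6 and 2/5 * pi / 2 <= 4/5. *)
Lemma sin_jordan x : 0 <= x <= pi / 2 -> 2 / 5 * x <= sin x.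
Proof.
move=> /andP[x0 xp].
have h y : 0 <= y -> y - y * (y * y) * 6^-1 <= sin y.
  move=> y0.
  have D (z : R) : der (fun z => sin z - (z - z * (z * z) * 6^-1)) z (cos z - (1 - z ^+ 2 / 2)).
    apply: derB; first exact: der_sin.
    apply: der_eq.
      apply: derB; first exact: der_id.
      by repeat (apply: derM || apply: der_id || apply: derC).
    by rewrite /=; field.
  have D0 (z : R) : 0 < z < y -> 0 <= cos z - (1 - z ^+ 2 / 2).
    by move=> /andP[/ltW z0 _]; rewrite subr_ge0 cos_ge.
  have := @derive_mono _ _ 0 y y0 (fun z _ => D z) D0.
  by rewrite sin0 !mul0r !subr0 subr_ge0.
have [x1|x1] := leP x 1.
  by have := h x x0; nra.
have s1 : sin 1 <= sin x.
  rewrite leNgt; apply/negP => H; have : x < 1; last by lra.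
  rewrite -ltr_sin // in_itv/=; have := @pi_ge2 R; lra.
have := h 1 ler01; have := pi_le4; lra.
Qed.

Lemma cos_le x : `|x| <= pi -> 2 / 25 * x ^+ 2 <= 1 - cos x.
Proof.
move=> xp.
have -> : cos x = cos `|x|.
  by case: (ger0P x) => // _; rewrite cosN.
rewrite -(real_normK (num_real x)) cos_half.
have : 2 / 5 * (`|x| / 2) <= sin (`|x| / 2) by apply: sin_jordan; have := normr_ge0 x; lra.
by have := normr_ge0 x; nra.
Qed.

Lemma cosB_le a b : 0 <= a -> a <= b -> b <= pi -> cos a - cos b <= (a + b) * (b - a) / 2.
Proof.
move=> a0 ab bp; rewrite cosB_prod.
have h1 : sin ((a + b) / 2) <= (a + b) / 2 by apply: sin_le; lra.
have h2 : sin ((b - a) / 2) <= (b - a) / 2 by apply: sin_le; lra.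
have h3 : 0 <= sin ((a + b) / 2) by apply: sin_ge0_pi; lra.
have h4 : 0 <= sin ((b - a) / 2) by apply: sin_ge0_pi; lra.
nra.
Qed.

Lemma cosB_ge a b : 0 <= a -> a <= b -> b <= 1 -> (a + b) * (b - a) / 20 <= cos a - cos b.
Proof.
move=> a0 ab b1; rewrite cosB_prod; have := @pi_ge2 R => p2.
have h1 : 2 / 5 * ((a + b) / 2) <= sin ((a + b) / 2) by apply: sin_jordan; lra.
have h2 : 2 / 5 * ((b - a) / 2) <= sin ((b - a) / 2) by apply: sin_jordan; lra.
have h3 : (2 / 5 * ((a + b) / 2)) * (2 / 5 * ((b - a) / 2)) <=
    sin ((a + b) / 2) * sin ((b - a) / 2).
  by apply: ler_pM => //; lra.
have h4 : 0 <= (a + b) * (b - a) by apply: mulr_ge0; lra.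
nra.
Qed.

Lemma cos_decr a b : 0 <= a -> a < b -> b <= pi -> cos b < cos a.
Proof. by move=> a0 ab bp; rewrite ltr_cos ?in_itv//=; lra. Qed.

Lemma powR_abs_continuous r : 0 < r -> continuous (fun x : R => `|x| `^ r).
Proof.
move=> r0 x; have [->|x0] := eqVneq x 0.
  apply/cvgrPdist_lt => e e0; near=> y.
  rewrite normr0 powR0 ?gt_eqF// sub0r normrN ger0_norm ?powR_ge0//.
  have -> : e = (e `^ r^-1) `^ r by rewrite -powRrM mulVf ?gt_eqF// powRr1// ltW.
  rewrite gt0_ltr_powR ?nnegrE ?powR_ge0//.
  near: y; apply/nbhs_ballP; exists (e `^ r^-1); first by rewrite /= powR_gt0.
  by move=> y /=; rewrite /ball/= sub0r normrN.
apply: (@continuous_comp _ _ _ (fun y : R => `|y|) (fun y => y `^ r)).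
  exact: norm_continuous.
have x0' : 0 < `|x| by rewrite normr_gt0.
exact: der_cont (der_powR r x0').
Unshelve. all: by end_near. Qed.

Lemma powR_cvgy0 r : 0 < r -> (x `^ (- r)) @[x --> +oo] --> (0 : R).
Proof.
move=> r0; apply/cvgrPdist_lt => e e0; near=> y.
have y0 : 0 < y by near: y; apply: nbhs_pinfty_gt; rewrite num_real.
rewrite sub0r normrN ger0_norm ?powR_ge0//.
have -> : e = ((e^-1) `^ r^-1) `^ (- r).
  by rewrite -powRrM mulrN mulVf ?gt_eqF// powR_inv1 ?invrK// invr_ge0 ltW.
rewrite !powRN ltf_pV2 ?posrE ?powR_gt0 ?invr_gt0//.
rewrite gt0_ltr_powR ?nnegrE ?powR_ge0 ?(ltW y0)//.
Unshelve. all: by end_near. Qed.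

Lemma ge0_integ_FTCy f (F : R -> R) a l : {within `[a, +oo[, continuous f} ->
  (forall x, a <= x -> 0 <= f x) -> (F x @[x --> +oo] --> l) ->
  (forall x, a <= x -> der F x (f x)) ->
  integ `[a, +oo[ f /\ Int `[a, +oo[ f = l - F a.
Proof.
move=> cf f0 Fl dF.
have e : (\int[@lebesgue_measure R]_(x in `[a, +oo[) (f x)%:E = l%:E - (F a)%:E)%E.
  apply: ge0_continuous_FTC2y => //.
  - by move=> x /ltW /dF[].
  - apply: cvg_at_right_filter.
    exact: der_cont (dF a (lexx a)).
  - by move=> x; rewrite in_itv/= andbT derive1E => /ltW /dF[].
split; last by rewrite IntE /Rintegral e.
apply/integrableP; split.
  by apply/measurable_EFinP; apply: subspace_continuous_measurable_fun.
under eq_integral.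
  move=> x; rewrite inE/= in_itv/= andbT => ax.
  rewrite /= ger0_norm ?f0//; over.
by rewrite e -EFinB ltry.
Qed.

Lemma powR_tail b r : 0 < b -> 1 < r ->
  integ `[b, +oo[ (fun x => x `^ (- r)) /\
  Int `[b, +oo[ (fun x => x `^ (- r)) = b `^ (1 - r) / (r - 1).
Proof.
move=> b0 r1; pose F x : R := - (r - 1)^-1 * x `^ (- (r - 1)).
have h : (F x @[x --> +oo] --> 0).
  rewrite -(mulr0 (- (r - 1)^-1)); apply: cvgM; first exact: cvg_cst.
  by apply: powR_cvgy0; rewrite subr_gt0.
have dF x : b <= x -> der F x (x `^ (- r)).
  move=> bx; have x0 : 0 < x by apply: lt_le_trans bx.
  have H := der_powR (- (r - 1)) x0.
  have -> : x `^ (- r) = - (r - 1)^-1 * (- (r - 1) * x `^ (- (r - 1) - 1)).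
    rewrite mulrA mulrNN mulVf ?mul1r; last by rewrite gt_eqF// subr_gt0.
    by congr (_ `^ _); ring.
  exact: derZ.
have [||i1 ->] := @ge0_integ_FTCy (fun x => x `^ (- r)) F b 0 _ _ h dF.
- apply: continuous_in_subspaceT => x; rewrite inE/= in_itv/= andbT => bx.
  have x0 : 0 < x by apply: lt_le_trans bx.
  exact: der_cont (der_powR (- r) x0).
- by move=> x _; exact: powR_ge0.
- split => //; rewrite /F sub0r mulNr opprK mulrC; congr (_ `^ _ / _); ring.
Qed.

Lemma integ_splity f b : 0 <= b -> integ `[0, b] f -> integ `[b, +oo[ f ->
  integ `[0, +oo[ f /\ Int `[0, +oo[ f = Int `[0, b] f + Int `[b, +oo[ f.
Proof.
move=> b0 f1 f2.
have f3 : integ `]b, +oo[ f.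
  by apply: integS f2 => x; rewrite !in_itv/= !andbT => /ltW.
have e : [set` `[0, +oo[] = [set` `[0, b]] `|` [set` `]b, +oo[] :> set R.
  by apply: itv_bndbnd_setU; rewrite bnd_simp.
have dis : [disjoint [set` `[0, b]] & [set` `]b, +oo[]] .
  apply/disj_setPS => y [/=]; rewrite !in_itv/= andbT => /andP[_ yx].
  by rewrite ltNge yx.
have m1 := integ_meas f1; have m3 := integ_meas f3.
have fi : integ `[0, +oo[ f.
  rewrite /integ e; apply/integrableP; split.
    by apply/measurable_EFinP; apply/measurable_funU.
  rewrite ge0_integral_setU//.
  - apply: lte_add_pinfty; first by case/integrableP : f1.
    by case/integrableP : f3.
  - apply: measurableT_comp => //; apply/measurable_EFinP.
    by apply/measurable_funU.
split => //; rewrite !IntE e Rintegral_setU//; last by rewrite -e.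
by rewrite Rintegral_itv_obnd_cbnd.
Qed.

Lemma Iy_bound f A B b r : 0 < b -> 1 < r -> measurable_fun setT f ->
  (forall s, 0 <= s <= b -> `|f s| <= A) ->
  (forall s, b <= s -> `|f s| <= B * s `^ (- r)) ->
  integ `[0, +oo[ f /\ `|Int `[0, +oo[ f| <= A * b + B / (r - 1) * b `^ (1 - r).
Proof.
move=> b0 r1 mf fA fB.
have mf' i : measurable_fun [set` i] f by apply: measurable_funTS.
have [t1 t2] := powR_tail b0 r1.
have fA' : {in `[0, b], forall s, `|f s| <= A}.
  by move=> s; rewrite in_itv/=; exact: fA.
have fB' : {in `[b, +oo[, forall s, `|f s| <= B * s `^ (- r)}.
  by move=> s; rewrite in_itv/= andbT; exact: fB.
have f1 : integ `[0, b] f by apply: integ_bnd fA'.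
have f2 : integ `[b, +oo[ f by apply: integ_le (integZ B t1) _ fB'.
have [f3 ->] := integ_splity (ltW b0) f1 f2; split => //.
apply: le_trans (ler_normD _ _) _; apply: lerD.
  have := Int_norm_le f1 (integ_cst 0 b A) fA'; rewrite Int_cst ?subr0//; exact: ltW.
have := Int_norm_le f2 (integZ B t1) fB'; rewrite IntZ// t2.
by rewrite mulrA mulrAC.
Qed.

Lemma Iy_lower f A a b : 0 <= a -> a <= b -> integ `[0, +oo[ f ->
  (forall s, 0 <= s -> 0 <= f s) -> (forall s, a <= s <= b -> A <= f s) ->
  A * (b - a) <= Int `[0, +oo[ f.
Proof.
move=> a0 ab fi f0 fA; have b0 := le_trans a0 ab.
have f1 : integ `[0, b] f by apply: integS fi => x; rewrite !in_itv/= => /andP[->].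
have f2 : integ `[b, +oo[ f.
  by apply: integS fi => x; rewrite !in_itv/= !andbT; apply: le_trans.
have [_ ->] := integ_splity b0 f1 f2.
have h2 : 0 <= Int `[b, +oo[ f.
  by apply: Int_ge0 => x; rewrite in_itv/= andbT => bx; apply: f0; apply: le_trans bx.
have h1 : Int `[a, b] f <= Int `[0, b] f.
  by apply: Int_sub => // x; rewrite in_itv/= => /andP[x0 _]; exact: f0.
have f3 : integ `[a, b] f.
  by apply: integS f1 => x; rewrite !in_itv/= => /andP[/(le_trans a0)-> ->].
have : Int `[a, b] (fun=> A) <= Int `[a, b] f.
  by apply: Int_le => //; exact: integ_cst.
by rewrite Int_cst// => h; lra.
Qed.

Lemma Iy_scale f a : 0 < a -> continuous f -> (forall x, 0 <= f x) ->
  Int `[0, +oo[ (fun x => f (a * x)) = a^-1 * Int `[0, +oo[ f.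
Proof.
move=> a0 cf f0.
have dF : derive1 ( *%R a) = cst a.
  apply/funext => x; apply: der_derive1; apply: der_eq (derZ a (der_id x)) _.
  by rewrite mulr1.
have cF x : {for x, continuous ( *%R a)}.
  exact: der_cont (derZ a (der_id x)).
have := @increasing_ge0_integration_by_substitutiony R ( *%R a) f 0.
rewrite mulr0 dF => H.
rewrite !IntE /Rintegral H; last first.
- by move=> x _; exact: f0.
- exact: continuous_subspaceT.
- apply/cvgryPge => A; near=> x; by rewrite -ler_pdivrMl.
- split; last exact: (cvg_at_right_filter (cF 0)).
  by move=> x _; exact: der_derivable (derZ a (der_id x)).
- by apply: is_cvg_cst.
- by apply: is_cvg_cst.
- by move=> x _; exact: cst_continuous.
- by move=> x y _ _; rewrite ltr_pM2l.
- have mf : measurable_fun setT (fun x => f (a * x)).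
    by apply: continuous_measurable_fun => x; apply: continuous_comp; [exact: cF|exact: cf].
  have -> : (\int[@lebesgue_measure R]_(x in `[0%R, +oo[) (((f \o *%R a) * cst a) x)%:E =
      \int[@lebesgue_measure R]_(x in `[0%R, +oo[) (a%:E * (f (a * x))%:E))%E.
    by apply: eq_integral => x _; rewrite -EFinM mulrC.
  rewrite ge0_integralZl//=; last first.
  all: try by apply/measurable_EFinP; apply: measurable_funTS.
  all: try by rewrite lee_fin ltW.
  all: try by move=> *; rewrite lee_fin.
  case: (\int[_]_(x in _) _)%E => [r||] /=; first by rewrite mulKf// gt_eqF.
  + by rewrite gt0_muley ?lte_fin//= mulr0.
  + by rewrite gt0_muleNy ?lte_fin//= mulr0.
Unshelve. all: by end_near. Qed.
End Calculus.

(** * Partial sums of r^k cos(k x), uniformly in their length *)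

Section Poisson.
Context {R : realType}.
Implicit Types (r x a b : R) (N : nat).

(** [PD r x] is |1 - r e^(i x)|^2, and [PP r x] is the real part of r e^(i x) / (1 - r e^(i x)), the
    sum of r^k cos(k x) over all k >= 1; [SS] are its partial sums. *)
Definition PD r x : R := 1 - 2 * r * cos x + r ^+ 2.
Definition PP r x : R := (r * cos x - r ^+ 2) / PD r x.
Definition SS N r x : R := \sum_(1 <= k < N.+1) r ^+ k * cos (k%:R * x).

Lemma PDE r x : PD r x = (cos x - r) ^+ 2 + sin x ^+ 2.
Proof. by rewrite /PD; have := cos2Dsin2 x; nra. Qed.

Lemma PD_le4 r x : 0 <= r <= 1 -> PD r x <= 4.
Proof.
move=> /andP[r0 r1]; rewrite /PD; have := cos_geN1 x.
have := cos_le1 x; nra.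
Qed.

Lemma SS_PD N r x : SS N r x * PD r x =
  r * cos x - r ^+ 2 - r ^+ N.+1 * cos (N.+1%:R * x) + r ^+ N.+2 * cos (N%:R * x).
Proof.
elim: N => [|N IH].
  by rewrite /SS big_geq// mul0r mul1r mul0r cos0 expr1; ring.
rewrite /SS big_nat_recr//= -/(SS N r x) mulrDl IH /PD.
have -> : cos (N.+2%:R * x) = 2 * cos x * cos (N.+1%:R * x) - cos (N%:R * x).
  have -> : N.+2%:R * x = N.+1%:R * x + x by rewrite -[N.+2%:R]natr1; ring.
  have -> : N%:R * x = N.+1%:R * x - x by rewrite -[N.+1%:R]natr1; ring.
  by rewrite cosD cosB; ring.
by rewrite !exprS; ring.
Qed.

Lemma PD_ge : exists2 K : R, 0 < K & forall r x, 0 <= r <= 1 -> `|x| <= pi ->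
  (1 - r + `|x|) ^+ 2 <= K * PD r x.
Proof.
(* 130 = 2 (1 + 64): both (1 - r)^2 and x^2 / 64 are at most [PD r x]. *)
exists 130; first by [].
move=> r x /andP[r0 r1] xp; have x0 := normr_ge0 x.
have e : PD r x = (1 - r) ^+ 2 + 2 * r * (1 - cos x) by rewrite /PD; ring.
have c := cos_le xp; rewrite -(real_normK (num_real x)) in c.
have p4 := @pi_le4 R.
have h : `|x| ^+ 2 / 64 <= PD r x.
  have [r2|r2] := leP (1/2) r; rewrite e; nra.
have h2 : (1 - r) ^+ 2 <= PD r x by rewrite e; have := cos_le1 x; nra.
nra.
Qed.

Lemma PD_gt0 r x : 0 <= r <= 1 -> `|x| <= pi -> 0 < 1 - r + `|x| -> 0 < PD r x.
Proof.
move=> r01 xp rx; have [K K0 /(_ r x r01 xp) h] := PD_ge.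
by rewrite -(pmulr_rgt0 _ K0); apply: lt_le_trans h; rewrite exprn_gt0.
Qed.

(** The numerator of the closed form of [SS] vanishes to first order at the singular point r = 1, x
    = 0, uniformly in N; grouping it around cos x - r and sin x exhibits this. *)
Lemma numer_le N r x : 0 <= r <= 1 ->
  `|r * cos x - r ^+ 2 - r ^+ N.+1 * cos (N.+1%:R * x) + r ^+ N.+2 * cos (N%:R * x)| <=
  2 * r * (`|cos x - r| + `|sin x|).
Proof.
move=> /andP[r0 r1].
have -> : r * cos x - r ^+ 2 - r ^+ N.+1 * cos (N.+1%:R * x) + r ^+ N.+2 * cos (N%:R * x)
   = r * (cos x - r) + r ^+ N.+1 * ((r - cos x) * cos (N%:R * x) + sin x * sin (N%:R * x)).
  have -> : N.+1%:R * x = N%:R * x + x by rewrite -[N.+1%:R]natr1; ring.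
  by rewrite cosD !exprS; ring.
have h1 : `|(r - cos x) * cos (N%:R * x) + sin x * sin (N%:R * x)| <= `|cos x - r| + `|sin x|.
  apply: le_trans (ler_normD _ _) _; rewrite !normrM [`|r - _|]distrC.
  apply: lerD; rewrite ler_piMr// ler_norml ?cos_geN1 ?cos_le1 ?sin_geN1 ?sin_le1//.
have h2 : r ^+ N.+1 <= r by rewrite exprS ler_piMr// exprn_ile1.
apply: le_trans (ler_normD _ _) _.
rewrite !normrM (ger0_norm r0) (ger0_norm (exprn_ge0 _ r0)).
have := ler_pM (exprn_ge0 N.+1 r0) (normr_ge0 _) h2 h1.
have := normr_ge0 (sin x); nra.
Qed.

(** [PD] dominates the squares of |cos x - r| + |sin x|, by [PDE], and of 1 - r + |x|, by
    hypothesis. Hence it dominates their product, and the quotient keeps a single power of 1 - r +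
    |x| in the denominator. *)
Lemma frac_bound (K r x num : R) : 0 < K -> 0 <= r <= 1 -> `|x| <= pi -> 0 < 1 - r + `|x| ->
  (1 - r + `|x|) ^+ 2 <= K * PD r x ->
  `|num| <= 2 * r * (`|cos x - r| + `|sin x|) ->
  `|num / PD r x| <= (8 * K + 2) * (r / (1 - r + `|x|)).
Proof.
move=> K0 r01 xp; set y := 1 - r + `|x|; set D := PD r x; set E := `|_| + `|_| => y0 yD hn.
have D0 : 0 < D by apply: PD_gt0.
have /andP[r0 _] := r01.
have E0 : 0 <= E by rewrite addr_ge0.
have ED : E ^+ 2 <= 2 * D.
  rewrite /D PDE -(real_normK (num_real (cos x - r))) -(real_normK (num_real (sin x))).
  rewrite /E; have := sqr_ge0 (`|cos x - r| - `|sin x|); nra.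
rewrite normrM normfV (gtr0_norm D0) ler_pdivrMr//.
apply: le_trans hn _; have -> : (8 * K + 2) * (r / y) * D = (8 * K + 2) * r * D / y by ring.
rewrite ler_pdivlMr//.
have hE : E * y <= (2 * K + 1) * D.
  have h : (E * y) ^+ 2 <= ((2 * K + 1) * D) ^+ 2.
    have := ler_pM (sqr_ge0 E) (sqr_ge0 y) ED yD.
    rewrite !exprMn; have : 0 < D ^+ 2 by rewrite exprn_gt0.
    nra.
  by rewrite ler_sqr ?nnegrE// in h; rewrite mulr_ge0 ?(ltW D0) ?(ltW y0)//; lra.
have h : r * (E * y) <= r * ((2 * K + 1) * D) by rewrite ler_wpM2l.
have := mulr_ge0 r0 (ltW D0); have := mulr_ge0 (mulr_ge0 r0 (ltW D0)) (ltW K0); nra.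
Qed.

(** One majorant serves all partial sums and their limit. The factor r is kept because it is what
    decays at infinity once r becomes a function of s. *)
Lemma SS_bound : exists2 C : R, 0 < C & forall N r x, 0 <= r <= 1 -> `|x| <= pi ->
  0 < 1 - r + `|x| ->
  `|SS N r x| <= C * (r / (1 - r + `|x|)) /\ `|PP r x| <= C * (r / (1 - r + `|x|)).
Proof.
have [K K0 KD] := PD_ge; exists (8 * K + 2); first by lra.
move=> N r x r01 xp y0; have D0 := PD_gt0 r01 xp y0; split.
  have -> : SS N r x = (SS N r x * PD r x) / PD r x by rewrite mulfK// gt_eqF.
  by apply: frac_bound => //; [exact: KD|rewrite SS_PD; exact: numer_le].
apply: frac_bound => //; first exact: KD.
have /andP[r0 r1] := r01.
have -> : r * cos x - r ^+ 2 = r * (cos x - r) by ring.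
rewrite normrM (ger0_norm r0); have := normr_ge0 (sin x); have := normr_ge0 (cos x - r); nra.
Qed.

(** Decrease, steepness and Lipschitz bounds of the kernel are all read off this product: for 0 <= r
    <= 1 every factor other than cos a - cos b is nonnegative. *)
Lemma PPB r a b : PD r a != 0 -> PD r b != 0 ->
  PP r a - PP r b = r * (1 - r ^+ 2) * (cos a - cos b) / (PD r a * PD r b).
Proof. by move=> a0 b0; rewrite /PP -[- (_ / PD r b)]mulNr addf_div//; congr (_ / _); rewrite /PD; ring. Qed.

End Poisson.

(** * The kernel as an integral of Poisson-type sums *)

Section Kernel.
Context {R : realType} (alpha : R) (h0 : 0 < alpha) (h1 : alpha < 1).
Implicit Types (s x a b : R) (N : nat).

(** The substitution t = s^(1 / alpha) turns the Gamma integral for k^(-alpha) into the integral of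
    [rr s ^+ k] with no singular weight t^(alpha - 1); [IG] is Gamma(1 + alpha). *)
Definition tt s : R := `|s| `^ alpha^-1.
Definition rr s : R := expR (- tt s).
Definition IG : R := Int `[0, +oo[ rr.

Let ta0 : 0 < alpha^-1. Proof. by rewrite invr_gt0. Qed.
Let ta1 : 1 < alpha^-1. Proof. by rewrite invf_gt1. Qed.

Lemma tt_ge0 s : 0 <= tt s. Proof. exact: powR_ge0. Qed.

Lemma tt_continuous : continuous tt.
Proof. exact: powR_abs_continuous. Qed.

Lemma rr_continuous : continuous rr.
Proof.
move=> s; apply: (@continuous_comp _ _ _ (fun s => - tt s) expR).
  by apply: continuousN; exact: tt_continuous.
exact: continuous_expR.
Qed.

Lemma rr_gt0 s : 0 < rr s. Proof. exact: expR_gt0. Qed.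

Lemma rr_le1 s : rr s <= 1.
Proof. by rewrite /rr -expR0 ler_expR oppr_le0 tt_ge0. Qed.

Lemma rr01 s : 0 <= rr s <= 1.
Proof. by rewrite rr_le1 ltW ?rr_gt0. Qed.

Lemma rr_ge s : 1 - rr s <= tt s.
Proof. by have := expR_ge1Dx (- tt s); rewrite -/(rr s); lra. Qed.

Lemma rr_div s : tt s * rr s <= 1 - rr s.
Proof.
have e : expR (tt s) * rr s = 1 by rewrite /rr expRxMexpNx_1.
by have := expR_ge1Dx (tt s); have := rr_gt0 s; nra.
Qed.

(** The inequality t e^(-t) <= 1 - e^(-t) of [rr_div], taken at t / 2 and squared. *)
Lemma rr_div2 s : tt s ^+ 2 * rr s <= 4 * (1 - rr s) ^+ 2.
Proof.
set q := expR (- (tt s / 2)).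
have q0 : 0 < q by exact: expR_gt0.
have e : expR (tt s / 2) * q = 1 by rewrite /q expRxMexpNx_1.
have er : rr s = q ^+ 2 by rewrite /rr /q expr2 -expRD; congr expR; lra.
have := expR_ge1Dx (tt s / 2); have := tt_ge0 s; rewrite er => t0 ht.
have h : tt s / 2 * q <= 1 - q by nra.
have h' : (tt s / 2 * q) ^+ 2 <= (1 - q) ^+ 2.
  by rewrite ler_sqr ?nnegrE ?subr_ge0; first exact: h; nra.
have q1 : (1 - q) ^+ 2 <= (1 - q ^+ 2) ^+ 2.
  rewrite (_ : 1 - q ^+ 2 = (1 - q) * (1 + q)); last by ring.
  by rewrite exprMn ler_peMr ?sqr_ge0//; nra.
nra.
Qed.

Lemma rr_half s : tt s <= 1 -> tt s / 2 <= 1 - rr s.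
Proof.
have := rr_div s; have := rr_gt0 s; have := tt_ge0 s => t0 r0 h t1.
have h2 : rr s * (1 + tt s) <= 1 by lra.
nra.
Qed.

Lemma rr_lt1 s : s != 0 -> rr s < 1.
Proof. by move=> s0; rewrite /rr expR_lt1 oppr_lt0 powR_gt0 ?normr_gt0. Qed.

Lemma rr_pow k s : (0 < k)%N -> rr s ^+ k = rr (k%:R `^ alpha * s).
Proof.
move=> k0; rewrite /rr -expRM_natl /tt normrM ger0_norm ?powR_ge0//.
rewrite powRM ?powR_ge0// -powRrM mulfV ?gt_eqF// powRr1 ?ler0n//.
by congr expR; ring.
Qed.

Lemma rr_meas : measurable_fun setT rr.
Proof. exact: continuous_measurable_fun rr_continuous. Qed.

(* The two ranges of s correspond to tt s <= x and tt s >= x. *)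
Lemma Iy_tt_bound (f : R -> R) (A x : R) m : (0 < m)%N -> 0 < x -> 0 <= A ->
  measurable_fun setT f ->
  (forall s, `|f s| <= A / x ^+ m) ->
  (forall s, 0 < s -> `|f s| <= A / tt s ^+ m) ->
  integ `[0, +oo[ f /\
  `|Int `[0, +oo[ f| <= (1 + (m%:R / alpha - 1)^-1) * (A * x `^ (alpha - m%:R)).
Proof.
move=> m0 x0 A0 mf fx ft; have b0 : 0 < x `^ alpha by rewrite powR_gt0.
have r1 : 1 < m%:R / alpha.
  by rewrite ltr_pdivlMr// mul1r (lt_le_trans h1)// ler1n.
have H1 s : 0 <= s <= x `^ alpha -> `|f s| <= A / x ^+ m by move=> _; exact: fx.
have H2 s : x `^ alpha <= s -> `|f s| <= A * s `^ (- (m%:R / alpha)).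
  move=> bs; have s0 : 0 < s by apply: lt_le_trans bs.
  apply: le_trans (ft s s0) _; rewrite powRN ler_wpM2l//.
  rewrite /tt (gtr0_norm s0) -powR_mulrn ?powR_ge0// -powRrM.
  by rewrite (mulrC _ m%:R).
have [fi H] := Iy_bound b0 r1 mf H1 H2; split=> //; apply: le_trans H _.
have e1 : A / x ^+ m * x `^ alpha = A * x `^ (alpha - m%:R).
  rewrite powRB ?(gt_eqF x0) ?implybT// powR_mulrn ?(ltW x0)//; ring.
have e2 : (x `^ alpha) `^ (1 - m%:R / alpha) = x `^ (alpha - m%:R).
  by rewrite -powRrM mulrBr mulr1 mulrCA mulfV ?mulr1// gt_eqF.
rewrite e1 e2 le_eqVlt; apply/orP; left; apply/eqP; ring.
Qed.

Lemma rr_integ : integ `[0, +oo[ rr.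
Proof.
have H1 s : `|rr s| <= 1 / 1 ^+ 1.
  by rewrite ger0_norm ?(ltW (rr_gt0 _))// expr1 divr1 rr_le1.
have H2 s : 0 < s -> `|rr s| <= 1 / tt s ^+ 1.
  move=> s0; rewrite ger0_norm ?(ltW (rr_gt0 _))// expr1.
  rewrite ler_pdivlMr ?powR_gt0 ?normr_gt0 ?gt_eqF//.
  by have := rr_div s; have := rr_gt0 s; lra.
by have [] := @Iy_tt_bound rr 1 1 1 isT ltr01 ler01 rr_meas H1 H2.
Qed.

Lemma IG_gt0 : 0 < IG.
Proof.
have : expR (-1) * (1 - 0) <= IG.
  apply: Iy_lower => //; first exact: rr_integ.
    by move=> s _; exact: ltW (rr_gt0 s).
  move=> s /andP[s0 s1]; rewrite /rr ler_expR lerN2 /tt.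
  have e : (1 : R) `^ alpha^-1 = 1 by rewrite powR1.
  rewrite -[leRHS]e.
  by apply: ge0_ler_powR; rewrite ?nnegrE ?ger0_norm// ltW.
by have := expR_gt0 (-1 : R); lra.
Qed.

Lemma rr_pow_integ k : (0 < k)%N -> integ `[0, +oo[ (fun s => rr s ^+ k).
Proof.
move=> k0; apply: (integ_le rr_integ).
  by apply: measurable_funTS; apply: measurable_funX; exact: rr_meas.
move=> s _; rewrite ger0_norm ?exprn_ge0 ?(ltW (rr_gt0 _))//.
by case: k k0 => // k _; rewrite exprS ler_piMr ?exprn_ile1 ?rr_le1 ?(ltW (rr_gt0 _)).
Qed.

Lemma Int_rr_pow k : (0 < k)%N -> Int `[0, +oo[ (fun s => rr s ^+ k) = k%:R `^ (- alpha) * IG.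
Proof.
move=> k0; under eq_Int do rewrite rr_pow//.
rewrite Iy_scale; first by rewrite powRN.
- by apply: powR_gt0; rewrite ltr0n.
- exact: rr_continuous.
- by move=> s; exact: ltW (rr_gt0 s).
Qed.

Definition KN N x : R := pi^-1 * \sum_(1 <= k < N.+1) k%:R `^ (- alpha) * cos (k%:R * x).
(* The limit of KN, from k^(-alpha) IG = int_0^oo e^(-k s^(1/alpha)) ds: summing
   over k under the integral gives a mixture of Poisson-type kernels. *)
Definition KK x : R := (pi * IG)^-1 * Int `[0, +oo[ (fun s => PP (rr s) x).

Let C0 : 0 < (pi * IG)^-1.
Proof. by rewrite invr_gt0 mulr_gt0 ?pi_gt0 ?IG_gt0. Qed.

Lemma KN_Int N x : KN N x = (pi * IG)^-1 * Int `[0, +oo[ (fun s => SS N (rr s) x).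
Proof.
(* [Int_sum] asks for integrability at every index, and r^0 = 1 is not integrable on the half-line;
   the index 0, absent from the sum, is therefore sent to 0. *)
pose F (k : nat) s := (if (0 < k)%N then rr s ^+ k else 0) * cos (k%:R * x).
have iF k : integ `[0, +oo[ (F k).
  rewrite /F; case: k => [|k] /=.
    by apply: (eq_integ _ (integZ 0 rr_integ)) => s _; rewrite !mul0r.
  by apply: (eq_integ _ (integZ (cos (k.+1%:R * x)) (rr_pow_integ (ltn0Sn k)))) => s _; rewrite mulrC.
have [e _] := Int_sum (index_iota 1 N.+1) iF.
have -> : Int `[0, +oo[ (fun s => SS N (rr s) x) =
    Int `[0, +oo[ (fun s => \sum_(k <- index_iota 1 N.+1) F k s).
  apply: eq_Int => s _; rewrite /SS; apply: eq_big_nat => k /andP[k1 _].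
  by rewrite /F k1.
rewrite e invfM -mulrA; congr (_ * _); rewrite mulr_sumr; apply: eq_big_nat => k /andP[k1 _].
have -> : Int `[0, +oo[ (F k) = cos (k%:R * x) * Int `[0, +oo[ (fun s => rr s ^+ k).
  rewrite -IntZ; last exact: rr_pow_integ.
  by apply: eq_Int => s _; rewrite /F k1 mulrC.
by rewrite Int_rr_pow//; field; rewrite gt_eqF ?IG_gt0.
Qed.

Lemma PP_rr_continuous x : x != 0 -> `|x| <= pi -> continuous (fun s => PP (rr s) x).
Proof.
move=> x0 xp s; have cr : {for s, continuous rr} by exact: rr_continuous.
have c2 : {for s, continuous (fun s => rr s ^+ 2)}.
  by apply: (@continuousM _ _ rr rr).
have cc (k : R -> R) : {for s, continuous k} -> {for s, continuous (fun s => k s * cos x)}.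
  by move=> ck; apply: continuousM => //; exact: cst_continuous.
apply: (@continuousM _ _ (fun s => rr s * cos x - rr s ^+ 2) (fun s => (PD (rr s) x)^-1)).
  by apply: continuousB => //; exact: cc.
apply: (@continuousV _ _ (fun s => PD (rr s) x)).
  rewrite gt_eqF// PD_gt0 ?rr01//.
  have : 0 < `|x| by rewrite normr_gt0.
  by have := rr_le1 s; lra.
apply: (@continuousD _ _ _ (fun s => 1 - 2 * rr s * cos x) (fun s => rr s ^+ 2)) => //.
apply: (@continuousB _ _ _ (fun=> 1 : R) (fun s => 2 * rr s * cos x)); first exact: cst_continuous.
apply: cc; apply: (@continuousM _ _ (fun=> 2 : R) rr) => //; exact: cst_continuous.
Qed.

End Kernel.

(** * Convergence of the kernel series and its singularity at 0 *)

Section KernelBounds.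
Context {R : realType} (alpha : R) (h0 : 0 < alpha) (h1 : alpha < 1).
Implicit Types (s x a b : R) (N : nat).

Notation rr := (rr alpha).
Notation tt := (tt alpha).
Notation IG := (IG alpha).
Notation KN := (KN alpha).
Notation KK := (KK alpha).

Let C0 : 0 < (pi * IG)^-1.
Proof. by rewrite invr_gt0 mulr_gt0 ?pi_gt0 ?IG_gt0. Qed.

Let rm := rr_meas h0.

Lemma SS_meas N x : measurable_fun setT (fun s => SS N (rr s) x).
Proof.
elim: N => [|N IH].
  rewrite (_ : (fun s => _) = cst 0)//; apply/funext => s.
  by rewrite /SS big_geq.
rewrite (_ : (fun s => _) = (fun s => SS N (rr s) x + rr s ^+ N.+1 * cos (N.+1%:R * x))).
  apply: measurable_funD => //; apply: measurable_funM => //.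
  by apply: measurable_funX; exact: rm.
by apply/funext => s; rewrite /SS big_nat_recr.
Qed.

Lemma rho_div s : 0 < s -> rr s / (1 - rr s) <= (tt s)^-1.
Proof.
move=> s0; have t0 : 0 < tt s by rewrite powR_gt0 ?normr_gt0 ?gt_eqF.
have r1 : rr s < 1 by rewrite rr_lt1 ?gt_eqF.
rewrite ler_pdivrMr ?subr_gt0// ler_pdivlMl//; exact: rr_div.
Qed.

Lemma frac_tt s x : x != 0 -> rr s / (1 - rr s + `|x|) <= `|x|^-1 /\
  (0 < s -> rr s / (1 - rr s + `|x|) <= (tt s)^-1).
Proof.
move=> x0; have x0' : 0 < `|x| by rewrite normr_gt0.
have /andP[r0 r1] := rr01 alpha s.
have y0 : 0 < 1 - rr s + `|x| by lra.
split=> [|s0].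
  by rewrite ler_pdivrMr// ler_pdivlMl//; nra.
apply: le_trans (rho_div s0); have r1' : rr s < 1 by rewrite rr_lt1 ?gt_eqF.
by rewrite ler_wpM2l// lef_pV2 ?posrE//; lra.
Qed.

(** The majorant r / (1 - r + |x|) is at most 1 / |x| and at most 1 / [tt s]. The two bounds cross
    at s = |x|^alpha, and integrating the smaller one gives |x|^(alpha - 1). *)
Lemma KN_bound : exists2 C : R, 0 < C & forall N x, 0 < `|x| -> `|x| <= pi ->
  [/\ `|KN N x| <= C * `|x| `^ (alpha - 1), `|KK x| <= C * `|x| `^ (alpha - 1),
      integ `[0, +oo[ (fun s => SS N (rr s) x) & integ `[0, +oo[ (fun s => PP (rr s) x)].
Proof.
have [C Cp CS] := @SS_bound R.
set D := 1 + (1%:R / alpha - 1)^-1.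
have D0 : 0 < D.
  by rewrite addr_gt0// invr_gt0 subr_gt0 ltr_pdivlMr// mul1r.
exists ((pi * IG)^-1 * (D * C)); first by rewrite !mulr_gt0.
move=> N x x0 xp; have x0' : x != 0 by rewrite -normr_gt0.
have y0 s : 0 < 1 - rr s + `|x| by have := rr_le1 alpha s; lra.
have key (f : R -> R) : measurable_fun setT f ->
    (forall s, `|f s| <= C * (rr s / (1 - rr s + `|x|))) ->
    integ `[0, +oo[ f /\ `|Int `[0, +oo[ f| <= D * (C * `|x| `^ (alpha - 1)).
  move=> mf fC; apply: (Iy_tt_bound h0 h1 (m := 1)) => //; first exact: ltW.
    move=> s; apply: le_trans (fC s) _; rewrite ler_wpM2l ?(ltW Cp)// expr1.
    by have [] := frac_tt s x0'.
  move=> s s0; apply: le_trans (fC s) _; rewrite ler_wpM2l ?(ltW Cp)// expr1.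
  by have [_ ->] := frac_tt s x0'.
have [i1 b1] := key _ (SS_meas N x) (fun s => (CS N _ _ (rr01 alpha s) xp (y0 s)).1).
have [i2 b2] := key _ (continuous_measurable_fun (PP_rr_continuous h0 x0' xp))
  (fun s => (CS N _ _ (rr01 alpha s) xp (y0 s)).2).
split=> //; rewrite ?KN_Int// ?/KK normrM gtr0_norm// -mulrA ler_wpM2l ?(ltW C0)// -mulrA//.
Qed.

Lemma KN_cvg x : 0 < `|x| -> `|x| <= pi -> KN N x @[N --> \oo] --> KK x.
Proof.
move=> x0 xp; have x0' : x != 0 by rewrite -normr_gt0.
have [C Cp CS] := @SS_bound R.
have y0 s : 0 < 1 - rr s + `|x| by have := rr_le1 alpha s; lra.
under eq_fun do rewrite KN_Int//.
rewrite /KK; apply: cvgM; first exact: cvg_cst.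
have [B Bp HB] := KN_bound.
(* At s = 0 one has r = 1 and the sums [SS N 1 x] need not converge, so this point is removed before
   the dominated convergence theorem is applied. *)
have Ie f : integ `[0, +oo[ f -> Int `[0, +oo[ f = Int `]0, +oo[ f.
  move=> fi; rewrite !IntE Rintegral_itv_obnd_cbnd//.
  by apply: integS fi => s; rewrite !in_itv/= !andbT => /ltW.
rewrite Ie; last by have [] := HB 0%N x x0 xp.
have -> : (fun N => Int `[0, +oo[ (fun s => SS N (rr s) x)) =
    (fun N => Int `]0, +oo[ (fun s => SS N (rr s) x)).
  by apply/funext => N; rewrite Ie//; have [] := HB N x x0 xp.
have ig : integ `]0, +oo[ (fun s => C / `|x| * rr s).
  apply: (@integS _ _ `[0, +oo[); last by apply: integZ; exact: rr_integ.
  by move=> s; rewrite !in_itv/= !andbT => /ltW.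
have [] := @Int_dct R `]0, +oo[ (fun N s => SS N (rr s) x) (fun s => PP (rr s) x) _ _ _ ig _ => //.
- by move=> N; apply: measurable_funTS; exact: SS_meas.
- move=> s; rewrite in_itv/= andbT => s0.
  have /andP[r0 _] := rr01 alpha s.
  have r1 : rr s < 1 by rewrite rr_lt1 ?gt_eqF.
  have D0 : 0 < PD (rr s) x by apply: PD_gt0 => //; exact: rr01.
  apply/cvgrPdist_le => e e0.
  have cr : rr s ^+ N @[N --> \oo] --> 0 by apply: cvg_expr; rewrite ger0_norm.
  have e0' : 0 < e * PD (rr s) x / 2 by rewrite divr_gt0 ?mulr_gt0.
  move/cvgrPdist_le: cr => /(_ _ e0')[M _ HM]; exists M => // N /= MN.
  have := HM N MN; rewrite sub0r normrN ger0_norm ?exprn_ge0// => hN.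
  have -> : PP (rr s) x - SS N (rr s) x =
      (rr s ^+ N.+1 * cos (N.+1%:R * x) - rr s ^+ N.+2 * cos (N%:R * x)) / PD (rr s) x.
    have -> : SS N (rr s) x = (SS N (rr s) x * PD (rr s) x) / PD (rr s) x by rewrite mulfK// gt_eqF.
    rewrite SS_PD /PP -mulrBl; congr (_ / _); ring.
  rewrite normrM normfV (gtr0_norm D0) ler_pdivrMr//.
  apply: le_trans (ler_normB _ _) _; rewrite !normrM !(ger0_norm (exprn_ge0 _ r0)).
  have c1 : `|cos (N.+1%:R * x)| <= 1 by rewrite ler_norml cos_geN1 cos_le1.
  have c2 : `|cos (N%:R * x)| <= 1 by rewrite ler_norml cos_geN1 cos_le1.
  have p0 : 0 <= rr s ^+ N by rewrite exprn_ge0.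
  have p1 : rr s ^+ N.+1 <= rr s ^+ N by rewrite exprS ler_piMl// ltW.
  have p2 : rr s ^+ N.+2 <= rr s ^+ N.
    by apply: le_trans p1; rewrite exprS ler_piMl ?exprn_ge0// ltW.
  have q1 : rr s ^+ N.+1 * `|cos (N.+1%:R * x)| <= rr s ^+ N * 1 by apply: ler_pM => //; rewrite exprn_ge0.
  have q2 : rr s ^+ N.+2 * `|cos (N%:R * x)| <= rr s ^+ N * 1 by apply: ler_pM => //; rewrite exprn_ge0.
  rewrite (ger0_norm r0) -exprS; lra.
- move=> N s _; have [/le_trans + _] := CS N _ _ (rr01 alpha s) xp (y0 s); apply.
  rewrite -mulrA ler_wpM2l ?(ltW Cp)// mulrC ler_wpM2r ?(ltW (rr_gt0 _ _))//.
  rewrite lef_pV2 ?posrE//.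
  by have := rr_le1 alpha s; lra.
Qed.

Lemma kernelK_KK x : 0 < `|x| -> `|x| <= pi -> kernelK alpha x = KK x.
Proof.
move=> x0 xp; apply: cvg_lim => //.
apply: cvg_trans (KN_cvg x0 xp); apply: near_eq_cvg; near=> N.
rewrite /KN (raddf_sum (@complex.Re R)) /= !mulr_sumr; apply: eq_bigr => k _.
rewrite /expi /= cosN sinN mul0r subr0.
have p0 : pi != 0 :> R by rewrite gt_eqF// pi_gt0.
by move: p0; generalize (pi : R) => p p0; field.
Unshelve. all: by end_near. Qed.

End KernelBounds.

(** * Decrease, Lipschitz bound and steepness of the kernel *)

Section KernelMonotone.
Context {R : realType} (alpha : R) (h0 : 0 < alpha) (h1 : alpha < 1).
Implicit Types (s x a b : R) (N : nat).

Notation rr := (rr alpha).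
Notation tt := (tt alpha).
Notation IG := (IG alpha).
Notation KN := (KN alpha).
Notation KK := (KK alpha).

Let C0 : 0 < (pi * IG)^-1.
Proof. by rewrite invr_gt0 mulr_gt0 ?pi_gt0 ?IG_gt0. Qed.

Lemma KKB a b : 0 < a -> a <= b -> b <= pi ->
  let g s := rr s * (1 - rr s ^+ 2) * (cos a - cos b) / (PD (rr s) a * PD (rr s) b) in
  integ `[0, +oo[ g /\ KK a - KK b = (pi * IG)^-1 * Int `[0, +oo[ g.
Proof.
move=> a0 ab bp g.
have [B Bp HB] := (KN_bound h0 h1).
have nz x : 0 < x -> `|x| = x by move=> /gtr0_norm.
have b0 : 0 < b by apply: lt_le_trans ab.
have [||_ _ _ ia] := HB 0%N a; rewrite ?nz//; first exact: le_trans bp.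
have [||_ _ _ ib] := HB 0%N b; rewrite ?nz//.
have D0 x s : 0 < x -> x <= pi -> PD (rr s) x != 0.
  move=> x0 xp; rewrite gt_eqF// PD_gt0 ?rr01 ?nz//.
  by have := rr_le1 alpha s; lra.
have e s : PP (rr s) a - PP (rr s) b = g s.
  by rewrite PPB// D0// (le_trans ab).
split; first by apply: eq_integ (integB ia ib) => s _.
by rewrite /KK -mulrBr -IntB//; congr (_ * _); apply: eq_Int => s _.
Qed.

(** Since [PD] is at most 4, the denominators in [KKB] are at most 16; what remains is the integral
    of r - r^2, positive because 2^(-alpha) < 1. Measuring the drop by cosines lets the estimate
    extend to all real arguments, as the kernel depends on x through cos x only. *)
Lemma KK_del : exists2 d : R, 0 < d &
  forall a b, 0 < a -> a <= b -> b <= pi -> d * (cos a - cos b) <= KK a - KK b.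
Proof.
pose w s := rr s - rr s ^+ 2.
have iw : integ `[0, +oo[ w by apply: integB; [exact: rr_integ|exact: rr_pow_integ].
have w0 : 0 < Int `[0, +oo[ w.
  rewrite IntB; [|exact: rr_integ|exact: rr_pow_integ].
  rewrite Int_rr_pow// -/IG subr_gt0 gtr_pMl ?IG_gt0//.
  have e1 : (1 : R) `^ alpha = 1 by rewrite powR1.
  rewrite powRN invf_lt1 ?powR_gt0// -[ltLHS]e1.
  by apply: gt0_ltr_powR; rewrite ?nnegrE ?ltr1n.
exists ((pi * IG)^-1 * (16^-1 * Int `[0, +oo[ w)); first by rewrite !mulr_gt0.
move=> a b a0 ab bp; have [ig ->] := KKB a0 ab bp.
rewrite -mulrA ler_wpM2l ?(ltW C0)// mulrAC -IntZ//.
have cab : 0 <= cos a - cos b.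
  by rewrite subr_ge0; move: ab; rewrite le_eqVlt => /predU1P[->//|ab]; rewrite ltW// cos_decr// ltW.
apply: Int_le => //; first exact: integZ.
move=> s _; have /andP[r0 r1] := rr01 alpha s.
have b0 : 0 < b by apply: lt_le_trans ab.
have ap : a <= pi by apply: le_trans bp.
have D0 x : 0 < x -> x <= pi -> 0 < PD (rr s) x.
  by move=> x0 xp; apply: PD_gt0; rewrite ?gtr0_norm ?rr01//; lra.
have Da := D0 a a0 ap; have Db := D0 b b0 bp.
have D16 : PD (rr s) a * PD (rr s) b <= 16.
  have := PD_le4 a (rr01 alpha s); have := PD_le4 b (rr01 alpha s) => hb ha.
  by apply: le_trans (ler_pM (ltW Da) (ltW Db) ha hb) _; lra.
have n0 : 0 <= w s * (cos a - cos b) by apply: mulr_ge0 => //; rewrite /w; nra.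
have n1 : w s * (cos a - cos b) <= rr s * (1 - rr s ^+ 2) * (cos a - cos b).
  by rewrite ler_wpM2r// /w; nra.
rewrite ler_pdivlMr ?mulr_gt0//; set P := PD _ _ * _ in D16 *.
have P0 : 0 < P by rewrite mulr_gt0.
apply: le_trans n1.
have : w s * (cos a - cos b) * P <= w s * (cos a - cos b) * 16 by rewrite ler_wpM2l.
by move=> h; lra.
Qed.

Lemma KK_lip : exists2 C : R, 0 < C & forall a b, 0 < a -> a <= b -> b <= pi ->
  KK a - KK b <= C * (b - a) * a `^ (alpha - 2).
Proof.
have [Q Q0 QD] := @PD_ge R.
set D := 1 + (2%:R / alpha - 1)^-1.
have D0 : 0 < D.
  by rewrite addr_gt0// invr_gt0 subr_gt0 ltr_pdivlMr// mul1r (lt_trans h1)// ltr1n.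
exists ((pi * IG)^-1 * (D * (8 * Q ^+ 2))); first by rewrite !mulr_gt0 ?exprn_gt0.
move=> a b a0 ab bp; have [ig ->] := KKB a0 ab bp; set g := fun s => _ in ig *.
rewrite -!mulrA ler_wpM2l ?(ltW C0)//.
have b0 : 0 < b by apply: lt_le_trans ab.
have ap : a <= pi by apply: le_trans bp.
(* T stands for the two denominators [a] and [tt s] that [Iy_tt_bound] wants with exponent 2; the
   cubic condition is checked for each of them below. *)
have key s : 0 <= g s /\ forall T : R, 0 < T ->
    (T ^+ 2 * (rr s * (1 - rr s)) <= 4 * (1 - rr s + a) ^+ 3) ->
    g s <= 8 * Q ^+ 2 * (b - a) / T ^+ 2.
  have /andP[r0 r1] := rr01 alpha s.
  have pos x : 0 < x -> x <= pi -> 0 < PD (rr s) x /\ (1 - rr s + x) ^+ 2 <= Q * PD (rr s) x.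
    move=> x0 xp; split; first by apply: PD_gt0; rewrite ?gtr0_norm ?rr01//; lra.
    by have := QD (rr s) x (rr01 alpha s); rewrite (gtr0_norm x0); apply.
  have [Da qa] := pos a a0 ap; have [Db qb] := pos b b0 bp.
  have cab : 0 <= cos a - cos b.
    by rewrite subr_ge0; move: ab; rewrite le_eqVlt => /predU1P[->//|ab']; rewrite ltW// cos_decr// ltW.
  have cab2 := cosB_le (ltW a0) ab bp.
  split; first by rewrite /g divr_ge0 ?mulr_ge0 ?(ltW Da) ?(ltW Db)//; nra.
  move=> T T0 HT; rewrite /g; set ra := 1 - rr s + a in qa HT; set rb := 1 - rr s + b in qb.
  set P := PD _ a in Da qa *; set P' := PD _ b in Db qb *.
  have ra0 : 0 < ra by rewrite /ra; lra.
  have rb0 : 0 < rb by rewrite /rb; lra.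
  rewrite ler_pdivrMr ?mulr_gt0//.
  have -> : 8 * Q ^+ 2 * (b - a) / T ^+ 2 * (P * P') = 8 * Q ^+ 2 * (b - a) * (P * P') / T ^+ 2 by ring.
  rewrite ler_pdivlMr ?exprn_gt0//.
  set ab1 := b - a; have ab0 : 0 <= ab1 by rewrite /ab1; lra.
  have s1 : rr s * (1 - rr s ^+ 2) * (cos a - cos b) <= 2 * (rr s * (1 - rr s)) * (b * ab1).
    have u1 : 0 <= rr s * (1 - rr s ^+ 2) by nra.
    have u2 : rr s * (1 - rr s ^+ 2) <= 2 * (rr s * (1 - rr s)) by nra.
    apply: ler_pM => //; apply: le_trans cab2 _.
    by have := mulr_ge0 ab0 ab0; rewrite /ab1; nra.
  have s2 : (ra ^+ 2) * (rb ^+ 2) <= (Q * P) * (Q * P') by apply: ler_pM => //; exact: sqr_ge0.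
  have s3 : ra ^+ 3 * b <= ra ^+ 2 * rb ^+ 2.
    rewrite exprSr -mulrA ler_wpM2l ?sqr_ge0// expr2; apply: ler_pM => //; rewrite ?(ltW ra0) ?(ltW b0)//.
      by rewrite /ra /rb; lra.
    by rewrite /rb; lra.
  have s4 : 2 * (b * ab1) * (T ^+ 2 * (rr s * (1 - rr s))) <= 2 * (b * ab1) * (4 * ra ^+ 3).
    by rewrite ler_wpM2l// !mulr_ge0// ltW.
  have T2 : 0 <= T ^+ 2 by exact: sqr_ge0.
  have s5 := ler_wpM2r T2 s1.
  have s6 : 8 * ab1 * (ra ^+ 3 * b) <= 8 * ab1 * ((Q * P) * (Q * P')).
    by rewrite ler_wpM2l ?mulr_ge0//; apply: le_trans s2.
  apply: le_trans s5 _; lra.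
have mg : measurable_fun setT g.
  have -> : g = (fun s => PP (rr s) a - PP (rr s) b).
    apply/funext => s; rewrite PPB// gt_eqF// PD_gt0 ?rr01 ?gtr0_norm//; have := rr_le1 alpha s; lra.
  by apply: measurable_funB; apply: continuous_measurable_fun;
    apply: PP_rr_continuous; rewrite ?gt_eqF ?gtr0_norm.
have A0 : 0 <= 8 * Q ^+ 2 * (b - a) by rewrite !mulr_ge0 ?exprn_ge0 ?subr_ge0// ltW.
have [||_] := @Iy_tt_bound _ _ h0 h1 g _ a 2 isT a0 A0 mg.
- move=> s; have [g0 hg] := key s; rewrite ger0_norm//; apply: hg => //.
  have /andP[r0 r1] := rr01 alpha s; have q0 : 0 <= 1 - rr s by lra.
  have : rr s * (1 - rr s) <= 1 - rr s by nra.
  by have := mulr_ge0 q0 q0; have := mulr_ge0 q0 (ltW a0); nra.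
- move=> s s0; have [g0 hg] := key s; rewrite ger0_norm//; apply: hg.
    by rewrite powR_gt0// normr_gt0 gt_eqF.
  have /andP[r0 r1] := rr01 alpha s; have q0 : 0 <= 1 - rr s by lra.
  have h := ler_wpM2r q0 (rr_div2 alpha s).
  rewrite mulrA; apply: le_trans h _.
  have : (1 - rr s) ^+ 3 <= (1 - rr s + a) ^+ 3 by rewrite lerXn2r ?nnegrE//; lra.
  by rewrite -mulrA -exprSr; lra.
- move=> /(le_trans (ler_norm _)) /le_trans; apply.
  by rewrite le_eqVlt; apply/orP; left; apply/eqP; rewrite /D; ring.
Qed.

(** The integrand is nonnegative, so only the s with b / 2 <= [tt s] <= b are kept. There 1 - r is
    of order b and [PD] at most of order b^2, so the integrand is at least a multiple of (b - a) /
    b^2, on an s-interval of length k b^alpha. *)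
Lemma KK_steep : exists2 c : R, 0 < c & forall a b, 0 < a -> a <= b -> b <= 1 ->
  c * (b - a) * b `^ (alpha - 2) <= KK a - KK b.
Proof.
set e := expR (-1) : R; have e0 : 0 < e by exact: expR_gt0.
set k := 1 - 2^-1 `^ alpha; have k0 : 0 < k.
  have e1 : (1 : R) `^ alpha = 1 by rewrite powR1.
  rewrite /k subr_gt0 -[ltRHS]e1; apply: gt0_ltr_powR; rewrite ?nnegrE//.
  by rewrite invf_lt1 ?ltr1n.
(* On the kept range 1 - r >= b / 4, cos a - cos b >= b (b - a) / 20, and the product of the two
   [PD] is at most 4 b^4: these are the three factors. *)
have [q q0 hq] : exists2 q : R, 0 < q & q <= 1 / 4 / 20 / 4.
  exists (8^-1 * 8^-1 * 8^-1); first by rewrite !mulr_gt0.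
  lra.
exists ((pi * IG)^-1 * (e * q * k)); first by rewrite !mulr_gt0.
move=> a b a0 ab b1; have bp : b <= pi by have := @pi_ge2 R; lra.
have [ig ->] := KKB a0 ab bp; set g := fun s => _ in ig *.
rewrite -!mulrA ler_wpM2l ?(ltW C0)//.
have b0 : 0 < b by apply: lt_le_trans ab.
have ap : a <= pi by apply: le_trans bp.
have pos s x : 0 < x -> x <= pi -> 0 < PD (rr s) x.
  move=> x0 xp; have := rr_le1 alpha s.
  by move=> ?; apply: PD_gt0; rewrite ?gtr0_norm ?rr01//; lra.
have cab : 0 <= cos a - cos b.
  by rewrite subr_ge0; move: ab; rewrite le_eqVlt => /predU1P[->//|ab']; rewrite ltW// cos_decr// ltW.
have g0 s : 0 <= s -> 0 <= g s.
  move=> _; have /andP[r0 r1] := rr01 alpha s.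
  rewrite /g divr_ge0 ?mulr_ge0 ?(ltW (pos _ _ _ _))//; nra.
have hb : b / 2 <= b by lra.
have lo s : (b / 2) `^ alpha <= s <= b `^ alpha -> e * q * ((b - a) * b ^- 2) <= g s.
  move=> /andP[s1 s2]; have s0 : 0 < s by apply: lt_le_trans s1; rewrite powR_gt0; lra.
  have ea x : 0 < x -> x = (x `^ alpha) `^ alpha^-1.
    by move=> x0; rewrite -powRrM mulfV ?gt_eqF// powRr1// ltW.
  have t1 : b / 2 <= tt s.
    rewrite /tt gtr0_norm// [leLHS]ea; last lra.
    by apply: ge0_ler_powR; rewrite ?nnegrE ?powR_ge0 ?(ltW s0)// invr_ge0 ltW.
  have t2 : tt s <= b.
    rewrite /tt gtr0_norm// [leRHS]ea//.
    by apply: ge0_ler_powR; rewrite ?nnegrE ?powR_ge0 ?(ltW s0)// invr_ge0 ltW.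
  have /andP[r0 r1] := rr01 alpha s.
  have rlo : b / 4 <= 1 - rr s by have := @rr_half _ alpha s; lra.
  have rhi : 1 - rr s <= b by have := rr_ge alpha s; lra.
  have er : e <= rr s by rewrite /e /rr ler_expR; lra.
  have Dle x : 0 < x -> x <= b -> PD (rr s) x <= 2 * b ^+ 2.
    move=> x0 xb; have -> : PD (rr s) x = (1 - rr s) ^+ 2 + 2 * rr s * (1 - cos x) by rewrite /PD; ring.
    have := cos_ge (ltW x0); have := cos_le1 x; nra.
  have Da := Dle a a0 ab; have Db := Dle b b0 (lexx b).
  have Pa := pos s a a0 ap; have Pb := pos s b b0 bp.
  have DD : PD (rr s) a * PD (rr s) b <= (2 * b ^+ 2) * (2 * b ^+ 2).
    by apply: ler_pM => //; exact: ltW.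
  have cge := cosB_ge (ltW a0) ab b1.
  have num : e * (b / 4) * (b * (b - a) / 20) <= rr s * (1 - rr s ^+ 2) * (cos a - cos b).
    have ab0 : 0 <= b - a by rewrite subr_ge0.
    apply: ler_pM.
    - by rewrite !mulr_ge0 ?(ltW e0) ?(ltW b0).
    - by rewrite !mulr_ge0 ?(ltW e0) ?(ltW b0).
    - apply: ler_pM; rewrite ?(ltW e0)//; first lra.
      by nra.
    - apply: le_trans cge; have := mulr_ge0 (ltW a0) ab0; lra.
  rewrite /g ler_pdivlMr ?mulr_gt0//; apply: le_trans num.
  have E0 : 0 <= e * q * ((b - a) / b ^+ 2).
    by apply: mulr_ge0; [rewrite mulr_ge0// ltW|apply: divr_ge0; [rewrite subr_ge0|exact: sqr_ge0]].
  apply: le_trans (ler_wpM2l E0 DD) _.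
  have b0' : b != 0 by rewrite gt_eqF.
  have m0 : 0 <= e * (b - a) * b ^+ 2.
    by apply: mulr_ge0; [apply: mulr_ge0; [exact: ltW|rewrite subr_ge0]|exact: sqr_ge0].
  have -> : e * q * ((b - a) / b ^+ 2) * (2 * b ^+ 2 * (2 * b ^+ 2)) = e * (b - a) * b ^+ 2 * (4 * q).
    by field.
  have -> : e * (b / 4) * (b * (b - a) / 20) = e * (b - a) * b ^+ 2 * (1 / 4 / 20) by ring.
  by rewrite ler_wpM2l//; lra.
have pa : (b / 2) `^ alpha <= b `^ alpha.
  apply: ge0_ler_powR; [exact: ltW|rewrite nnegrE; lra|rewrite nnegrE; lra|lra].
have := Iy_lower (powR_ge0 _ _) pa ig g0 lo; apply: le_trans.
rewrite le_eqVlt; apply/orP; left; apply/eqP.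
rewrite powRM ?invr_ge0 ?(ltW b0)//.
rewrite powRB ?(gt_eqF b0) ?implybT// powR_mulrn ?(ltW b0)// /k; ring.
Qed.

End KernelMonotone.

(** * Smoothness of the kernel off the points where cos x = 1 *)

Section KernelSmooth.
Context {R : realType}.
Implicit Types (s x r : R) (f g : R -> R -> R).

(* A class of integrands closed under d/dx, all of them bounded away from x = 0. *)
Inductive nice : (R -> R -> R) -> Prop :=
| nice_cst c : nice (fun _ _ => c)
| nice_r : nice (fun r _ => r)
| nice_cos : nice (fun _ x => cos x)
| nice_sin : nice (fun _ x => sin x)
| nice_inv : nice (fun r x => (PD r x)^-1)
| nice_add f g : nice f -> nice g -> nice (fun r x => f r x + g r x)
| nice_mul f g : nice f -> nice g -> nice (fun r x => f r x * g r x).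

Lemma nice_der f : nice f -> exists2 f', nice f' &
  forall r x, PD r x != 0 -> der (f r) x (f' r x).
Proof.
elim=> {f}.
- by move=> c; exists (fun _ _ => 0); [exact: nice_cst|move=> r x _; exact: derC].
- by exists (fun _ _ => 0); [exact: nice_cst|move=> r x _; exact: derC].
- exists (fun r x => (-1) * sin x); first by apply: nice_mul; [exact: nice_cst|exact: nice_sin].
  by move=> r x _; rewrite mulN1r; exact: der_cos.
- by exists (fun _ x => cos x); [exact: nice_cos|move=> r x _; exact: der_sin].
- exists (fun r x => (-2) * (r * (sin x * ((PD r x)^-1 * (PD r x)^-1)))).
    apply: nice_mul; first exact: nice_cst.
    apply: nice_mul; first exact: nice_r.
    apply: nice_mul; first exact: nice_sin.
    by apply: nice_mul; exact: nice_inv.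
  move=> r x D0.
  have dD : der (PD r) x (0 - (2 * r) * (- sin x) + 0).
    by apply: derD; [apply: derB; [exact: derC|exact: derZ (der_cos x)]|exact: derC].
  apply: der_eq (derV D0 dD) _; field; exact: D0.
- move=> f g _ [f' nf' df] _ [g' ng' dg]; exists (fun r x => f' r x + g' r x).
    exact: nice_add.
  by move=> r x D0; apply: derD; [exact: df|exact: dg].
- move=> f g nf [f' nf' df] ng [g' ng' dg]; exists (fun r x => f r x * g' r x + g r x * f' r x).
    by apply: nice_add; apply: nice_mul.
  by move=> r x D0; apply: derM; [exact: df|exact: dg].
Qed.

Lemma PD_ge_cos r x e : 0 < e <= 1 -> 0 <= r <= 1 -> cos x <= 1 - e -> e <= PD r x.
Proof.
move=> /andP[e0 e1] /andP[r0 r1] cx.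
have -> : PD r x = (1 - r) ^+ 2 + 2 * r * (1 - cos x) by rewrite /PD; ring.
have h : 2 * r * e <= 2 * r * (1 - cos x) by rewrite ler_wpM2l ?mulr_ge0//; lra.
have := sqr_ge0 (1 - r - e); nra.
Qed.

Lemma nice_bnd f : nice f -> forall e, 0 < e <= 1 -> exists C, forall r x, 0 <= r <= 1 ->
  cos x <= 1 - e -> `|f r x| <= C.
Proof.
move=> nf e e01; elim: nf => {f}.
- by move=> c; exists `|c|.
- by exists 1 => r x /andP[r0 r1] _; rewrite ger0_norm.
- by exists 1 => r x _ _; rewrite ler_norml cos_geN1 cos_le1.
- by exists 1 => r x _ _; rewrite ler_norml sin_geN1 sin_le1.
- exists e^-1 => r x r01 cx; have h := PD_ge_cos e01 r01 cx; have /andP[e0 _] := e01.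
  by rewrite normfV ger0_norm ?(le_trans _ h) ?(ltW e0)// lef_pV2 ?posrE// (lt_le_trans e0).
- move=> f g _ [C HC] _ [D HD]; exists (C + D) => r x r01 cx.
  by rewrite (le_trans (ler_normD _ _))// lerD ?HC ?HD.
- move=> f g _ [C HC] _ [D HD]; exists (C * D) => r x r01 cx.
  by rewrite normrM ler_pM ?HC ?HD.
Qed.

Context (alpha : R) (h0 : 0 < alpha) (h1 : alpha < 1).

Lemma nice_continuous f x : nice f -> cos x < 1 -> continuous (fun s => f (rr alpha s) x).
Proof.
move=> nf cx s; elim: nf => {f}.
- by move=> c; exact: cst_continuous.
- exact: rr_continuous.
- exact: cst_continuous.
- exact: cst_continuous.
- apply: (@continuousV _ _ (fun s => PD (rr alpha s) x)).
    rewrite gt_eqF//; have e01 : 0 < (1 - cos x) / 2 <= 1 by have := cos_geN1 x; lra.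
    have /andP[e0 _] := e01; apply: lt_le_trans e0 _.
    by apply: (PD_ge_cos e01 (rr01 alpha s)); lra.
  have cr : {for s, continuous (rr alpha)} by exact: rr_continuous.
  apply: (@continuousD _ _ _ (fun s => 1 - 2 * rr alpha s * cos x) (fun s => rr alpha s ^+ 2)).
    apply: (@continuousB _ _ _ (fun=> 1 : R) (fun s => 2 * rr alpha s * cos x)); first exact: cst_continuous.
    apply: (@continuousM _ _ (fun s => 2 * rr alpha s) (fun=> cos x)); last exact: cst_continuous.
    by apply: (@continuousM _ _ (fun=> 2 : R) (rr alpha)) => //; exact: cst_continuous.
  by apply: (@continuousM _ _ (rr alpha) (rr alpha)).
- by move=> f g _ cf _ cg; apply: continuousD.
- by move=> f g _ cf _ cg; apply: continuousM.
Qed.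

(** The factor r, common to all the integrands, supplies integrability at infinity; the function f
    itself is merely bounded where cos x stays away from 1. *)
Definition niceInt f x := Int `[0, +oo[ (fun s => rr alpha s * f (rr alpha s) x).

Lemma nice_integ f x : nice f -> cos x < 1 ->
  integ `[0, +oo[ (fun s => rr alpha s * f (rr alpha s) x).
Proof.
move=> nf cx; have e01 : 0 < (1 - cos x) / 2 <= 1 by have := cos_geN1 x; lra.
have [C HC] := nice_bnd nf e01.
apply: (@integM _ _ _ _ C); first exact: rr_integ.
  by apply: measurable_funTS; apply: continuous_measurable_fun; exact: nice_continuous.
by move=> s _; apply: HC; [exact: rr01|lra].
Qed.

Lemma niceInt_bnd f : nice f -> forall e, 0 < e <= 1 -> exists C, forall x,
  cos x <= 1 - e -> `|niceInt f x| <= C.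
Proof.
move=> nf e e01; have [C HC] := nice_bnd nf e01.
exists (C * IG alpha) => x cx; have /andP[e0 _] := e01.
rewrite /IG -IntZ; last exact: rr_integ.
apply: Int_norm_le; first by apply: nice_integ => //; lra.
  by apply: integZ; exact: rr_integ.
move=> s _; rewrite normrM ger0_norm ?(ltW (rr_gt0 _ _))// mulrC.
by rewrite ler_wpM2r ?(ltW (rr_gt0 _ _))// HC// rr01.
Qed.

Lemma cos_near x : cos x < 1 -> exists2 e : R, 0 < e <= 1 &
  exists2 d : R, 0 < d & forall y, `|y - x| < d -> cos y <= 1 - e.
Proof.
move=> cx; exists ((1 - cos x) / 2); first by have := cos_geN1 x; lra.
have [d d0 H] : exists2 d : R, 0 < d & forall y, `|y - x| < d -> `|cos y - cos x| < (1 - cos x) / 2.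
  have := @continuous_cos R x; move=> /cvgrPdist_lt /(_ ((1 - cos x) / 2)).
  have e0 : 0 < (1 - cos x) / 2 by lra.
  move=> /(_ e0) /nbhs_ballP[d /= d0 H]; exists d => // y yx.
  by rewrite distrC; apply: H; rewrite /ball/= distrC.
by exists d => // y /H; rewrite ltr_norml => /andP[_]; lra.
Qed.

Lemma niceInt_der f f' x : nice f -> nice f' ->
  (forall r x, PD r x != 0 -> der (f r) x (f' r x)) -> cos x < 1 ->
  der (niceInt f) x (niceInt f' x).
Proof.
move=> nf nf' df cx; have [e e01 [d d0 H]] := cos_near cx.
have [C HC] := nice_bnd nf' e01; have /andP[e0 _] := e01.
have cy y : x - d < y < x + d -> cos y <= 1 - e.
  by move=> h; apply: H; rewrite ltr_norml; lra.
apply: (@Int_derive_under _ _ (fun y s => rr alpha s * f (rr alpha s) y)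
  (fun y s => rr alpha s * f' (rr alpha s) y) (fun s => C * rr alpha s) (x - d) (x + d)).
- lra.
- by move=> y /cy h; apply: nice_integ => //; lra.
- move=> y s /cy h _; apply: derZ; apply: df.
  by rewrite gt_eqF// (lt_le_trans e0)// (PD_ge_cos e01 (rr01 alpha s)).
- by apply: integZ; exact: rr_integ.
- move=> y s /cy h _; rewrite normrM ger0_norm ?(ltW (rr_gt0 _ _))// mulrC.
  by rewrite ler_wpM2r ?(ltW (rr_gt0 _ _))// HC// rr01.
Qed.

(* KK has a junk value on 2 pi Z, where the kernel is infinite. *)
Definition Ker x : R := if cos x == 1 then 0 else KK alpha x.

Lemma KerE x : cos x < 1 -> Ker x = KK alpha x.
Proof. by move=> cx; rewrite /Ker lt_eqF. Qed.

Lemma Ker_smooth : exists Kd : nat -> R -> R,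
  [/\ (forall x, cos x < 1 -> Kd 0%N x = Ker x),
      (forall j x, cos x < 1 -> der (Kd j) x (Kd j.+1 x)) &
      (forall j e, 0 < e <= 1 -> exists C, forall x, cos x <= 1 - e -> `|Kd j x| <= C)].
Proof.
have /choice[next Hn] : forall f : {f | nice f}, exists g : {f | nice f},
    forall r x, PD r x != 0 -> der (sval f r) x (sval g r x).
  by move=> [f nf]; have [g ng H] := nice_der nf; exists (exist _ g ng).
(* [PP r x] is r times this function, so [KK] is a multiple of its [niceInt]. *)
have nf0 : nice (fun r x => (cos x + (-1) * r) * (PD r x)^-1).
  apply: nice_mul; last exact: nice_inv.
  apply: nice_add; first exact: nice_cos.
  by apply: nice_mul; [exact: nice_cst|exact: nice_r].
pose F j := iter j next (exist _ _ nf0).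
exists (fun j x => (pi * IG alpha)^-1 * niceInt (sval (F j)) x); split.
- move=> x cx; rewrite KerE// /KK; congr (_ * _); apply: eq_Int => s _ /=.
  by rewrite /PP; ring.
- move=> j x cx; apply: derZ; apply: niceInt_der => //; first exact: (proj2_sig (F j)).
    exact: (proj2_sig (F j.+1)).
  by move=> r y D0; exact: Hn.
- move=> j e e01; have [C HC] := niceInt_bnd (proj2_sig (F j)) e01.
  exists (`|(pi * IG alpha)^-1| * C) => x cx; rewrite normrM ler_wpM2l//; exact: HC.
Qed.

Lemma Ker_cos x y : cos x = cos y -> Ker x = Ker y.
Proof.
move=> e; rewrite /Ker e /KK; congr (if _ then _ else _ * _).
by apply: eq_Int => s _; rewrite /PP /PD e.
Qed.

Lemma KerN x : Ker (- x) = Ker x.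
Proof. by apply: Ker_cos; rewrite cosN. Qed.

Lemma Ker_periodic x : Ker (x + 2 * pi) = Ker x.
Proof. by apply: Ker_cos; rewrite mulr_natl cosD2pi. Qed.

Lemma Ker_continuous x : cos x < 1 -> {for x, continuous Ker}.
Proof.
move=> cx; have [Kd [K0 dK _]] := Ker_smooth.
have [e /andP[e0 _] [d d0 H]] := cos_near cx.
apply: (@der_cont _ _ _ (Kd 1%N x)); apply: der_ext (dK 0%N x cx).
apply/nbhs_ballP; exists d => // y; rewrite /ball/= distrC => /H h.
by apply: K0; lra.
Qed.

Lemma Ker_meas : measurable_fun setT Ker.
Proof.
have cU : open [set x : R | cos x < 1].
  rewrite (_ : [set x | _] = cos @^-1` [set y | y < 1])//.
  by apply: open_comp; [move=> x _; exact: continuous_cos|exact: open_lt].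
have mU : measurable [set x : R | cos x < 1] by exact: open_measurable.
rewrite -(setUv [set x : R | cos x < 1]); apply/measurable_funU => //.
  exact: measurableC.
split.
  by apply: open_continuous_measurable_fun => // x; rewrite inE; exact: Ker_continuous.
apply: (eq_measurable_fun (cst (0 : R))) => // x; rewrite inE/= => /negP.
by rewrite -leNgt => c1; rewrite /Ker (@le_anti _ _ (cos x) 1) ?eqxx ?cos_le1.
Qed.

End KernelSmooth.

(** * Singular powers, exceptional points, and integrals over a period *)

Section PeriodicIntegrals.
Context {R : realType}.
Implicit Types (f g : R -> R) (a b c x : R).

Notation mu := (@lebesgue_measure R).

(** Monotone convergence over [1 / (n + 1), b], because the primitive x^al / al is differentiable
    only away from 0. *)
Lemma integ_powR0 b (al : R) : 0 < b -> 0 < al -> al < 1 ->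
  integ `[0, b] (fun x => x `^ (al - 1)) /\
  Int `[0, b] (fun x => x `^ (al - 1)) <= b `^ al / al.
Proof.
move=> b0 al0 al1; pose f x := x `^ (al - 1).
have mf : measurable_fun setT f by exact: measurable_powR.
pose B n : set R := [set` `[n.+1%:R^-1, b]].
pose g n x : \bar R := (EFin \o (f \_ (B n))) x.
have mB n : measurable (B n) by exact: measurable_itv.
have mg n : measurable_fun [set` `[0, b]] (g n).
  apply/measurable_EFinP/measurable_funTS.
  apply: (iffLR (measurable_restrictT f (mB n))).
  by apply: measurable_funTS.
have g0 n x : (0 <= g n x)%E.
  by rewrite /g /= lee_fin /restrict; case: ifP => // _; exact: powR_ge0.
have ndg x : forall k n : nat, (k <= n)%N -> (g k x <= g n x)%E.
  move=> k n mn; rewrite /g /= lee_fin /restrict.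
  case: ifPn => [xm|_]; last by case: ifP => // _; exact: powR_ge0.
  rewrite ifT//; move: xm; rewrite !inE /B/= !in_itv/= => /andP[xm ->].
  by rewrite andbT (le_trans _ xm)// lef_pV2 ?posrE// ler_nat.
have ig n : (\int[mu]_(x in [set` `[0%R, b]]) g n x <= (b `^ al / al)%:E)%E.
  have n0 : 0 < n.+1%:R^-1 :> R by rewrite invr_gt0.
  have -> : (\int[mu]_(x in [set` `[0%R, b]]) g n x =
      \int[mu]_(x in [set` `[0%R, b]]) ((EFin \o f) \_ (B n)) x)%E.
    by apply: eq_integral => x _; rewrite /g -restrict_EFin.
  rewrite -integral_mkcondr (_ : _ `&` _ = B n); last first.
    by apply/setIidPr => x; rewrite /B/= !in_itv/= => /andP[/(le_trans (ltW n0))-> ->].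
  have [bn|nb] := ltP b n.+1%:R^-1.
    rewrite /B set_itv_ge ?integral_set0 ?lee_fin ?divr_ge0 ?powR_ge0 ?(ltW al0)//.
    by rewrite bnd_simp -ltNge.
  pose F x := al^-1 * x `^ al.
  have dF x : 0 < x -> der F x (f x).
    by move=> x0; apply: der_eq (derZ al^-1 (der_powR al x0)) _; rewrite mulKf ?gt_eqF.
  have pos x : x \in `[n.+1%:R^-1, b] -> 0 < x.
    by rewrite in_itv/= => /andP[/(lt_le_trans n0)].
  case: (ltgtP n.+1%:R^-1 b) nb => // [nb _|nb _]; last first.
    by rewrite /B nb set_itv1 integral_set1 lee_fin ?divr_ge0 ?powR_ge0 ?(ltW al0).
  rewrite (@continuous_FTC2 _ f F)//.
  - rewrite -EFinB lee_fin /F mulrC lerBlDr lerDl mulr_ge0 ?invr_ge0 ?powR_ge0//; exact: ltW.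
  - apply: derivable_within_continuous => x /pos x0; exact: der_derivable (der_powR _ x0).
  - split.
    + by move=> x; rewrite in_itv/= => /andP[nx _]; apply: der_derivable (dF x _); apply: lt_trans nx.
    + by apply: cvg_at_right_filter; exact: der_cont (dF _ n0).
    + by apply: cvg_at_left_filter; exact: der_cont (dF _ b0).
  - by move=> x; rewrite in_itv/= => /andP[nx _]; apply: der_derive1 (dF x _); apply: lt_trans nx.
have g0' (n : nat) (x : R) : [set` `[0, b]] x -> (0 <= g n x)%E by [].
have ndg' (x : R) : [set` `[0, b]] x -> {homo g^~ x : m n / (m <= n)%N >-> (m <= n)%E}.
  by move=> _ m n; exact: ndg.
have cv := @cvg_monotone_convergence _ _ _ mu _ (measurable_itv `[0, b]) g mg g0' ndg'.
have e x : x \in [set` `[0, b]] -> limn (g^~ x) = (f x)%:E.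
  rewrite inE/= in_itv/= => /andP[x0 xb]; apply: cvg_lim => //.
  move: x0; rewrite le_eqVlt => /predU1P[<-|x0].
    (* 0 to a nonzero power is 0 by convention, even to a negative one, and 0 lies in no [B n]: both
       sides are 0 there. *)
    rewrite (_ : g^~ 0 = cst (f 0)%:E); first by apply: cvg_cst.
    apply/funext => n; rewrite /g /= /restrict memNset.
      by rewrite /f /powR eqxx subr_eq0 lt_eqF.
    by rewrite /B /= in_itv/= => /andP[]; rewrite leNgt invr_gt0 ltr0n.
  apply: cvg_near_cst; exists (Num.truncn x^-1).+1 => // n /= nx.
  rewrite /g /= /restrict ifT// inE /B /= in_itv/= xb andbT.
  rewrite -(invrK x) lef_pV2 ?posrE ?invr_gt0//.
  have x1 : 0 <= x^-1 by rewrite invr_ge0 ltW.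
  have /andP[_ /ltW h] := truncn_itv x1; apply: le_trans h _.
  by rewrite ler_nat (leq_trans nx).
have le : (\int[mu]_(x in [set` `[0%R, b]]) (f x)%:E <= (b `^ al / al)%:E)%E.
  have -> : (\int[mu]_(x in [set` `[0%R, b]]) (f x)%:E =
      \int[mu]_(x in [set` `[0%R, b]]) limn (g^~ x))%E.
    by apply: eq_integral => x xb; rewrite e.
  have := cv; move=> /cvg_lim <-//; apply: lime_le; last by apply: nearW.
  by apply/cvg_ex; eexists; exact: cv.
have ifn : integ `[0, b] f.
  apply/integrableP; split; first by apply/measurable_EFinP; exact: measurable_funTS.
  under eq_integral do rewrite /= ger0_norm ?powR_ge0//.
  by apply: le_lt_trans le _; rewrite ltry.
split => //; rewrite IntE -lee_fin fineK//; exact: integrable_fin_num.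
Qed.

Lemma Int_ae i f g c : measurable_fun [set` i] g -> integ i f ->
  {in i, forall x, x != c -> f x = g x} -> integ i g /\ Int i f = Int i g.
Proof.
move=> mg fi fg.
have m1 : mu [set c] = 0%E by exact: lebesgue_measure_set1.
have mc : measurable [set c] by exact: measurable_set1.
have e : {in [set` i] `\` [set c], (EFin \o f) =1 (EFin \o g)}.
  move=> x; rewrite inE /= => -[xi xc]; congr EFin; apply: fg => //.
  exact/eqP.
have mg' : measurable_fun [set` i] (EFin \o g) by apply/measurable_EFinP.
have mf1 := integ_meas fi.
have mf' : measurable_fun [set` i] (EFin \o f) by apply/measurable_EFinP.
have gi : integ i g.
  rewrite /integ; apply: (iffRL (@negligible_integrable _ _ _ mu _ _ _ mc (measurable_itv i) mg' m1)).
  apply: (@eq_integrable _ _ _ mu _ _ _ _ e); first exact: measurableD.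
  exact: (iffLR (@negligible_integrable _ _ _ mu _ _ _ mc (measurable_itv i) mf' m1)).
split=> //; rewrite !IntE /Rintegral.
rewrite (@negligible_integral _ _ _ mu _ _ _ mc (measurable_itv i) fi m1).
rewrite (@negligible_integral _ _ _ mu _ _ _ mc (measurable_itv i) gi m1).
by congr fine; apply: eq_integral => x xi; exact: e.
Qed.

(** Raising or lowering f to g c at the single point c does not change its integral. The exceptional
    point is where the kernel has its default value. *)
Lemma Int_le_except i f g c : integ i f -> integ i g ->
  {in i, forall x, x != c -> f x <= g x} -> Int i f <= Int i g.
Proof.
move=> fi gi fg; pose f' x := f x + (g c - f c) * \1_[set c] x.
have mf' : measurable_fun [set` i] f'.
  apply: measurable_funD; first exact: integ_meas.
  apply: measurable_funM => //; apply: measurable_funTS.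

have nc x : x != c -> \1_[set c] x = 0 :> R.
  by move=> xc; rewrite indicE memNset// => /eqP; exact/negP.
have e : {in i, forall x, x != c -> f x = f' x}.
  by move=> x _ xc; rewrite /f' nc// mulr0 addr0.
have [f'i ->] := Int_ae mf' fi e.
apply: Int_le => // x xi; case: (eqVneq x c) => [->|xc].
  by rewrite /f' indicE mem_set// mulr1 addrC subrK.
by rewrite -e//; exact: fg.
Qed.

Lemma per_int f (z : int) x : periodic f (2 * pi) -> f (x + 2 * pi * z%:~R) = f x.
Proof.
move=> pf; have H n y : f (y + 2 * pi * n%:R) = f y by rewrite mulr_natr periodicn.
case: z => n; first exact: H.
rewrite NegzE -[in RHS](subrK (2 * pi * n.+1%:R) x) H; congr f.
by rewrite mulrNz mulrN.
Qed.

Lemma Int_per_shift f c : measurable_fun setT f -> periodic f (2 * pi) ->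
  integ `[- pi, pi] f -> integ `[- pi, pi] (fun x => f (x + c)) /\
  Int `[- pi, pi] (fun x => f (x + c)) = Int `[- pi, pi] f.
Proof.
(* Only the residue d of c modulo 2 pi matters; periodicity then carries [-pi, -pi + d] to
   [pi, pi + d]. *)
move=> mf pf fi; pose z : int := Num.floor (c / (2 * pi)).
have p0 : 0 < pi :> R := pi_gt0 R.
pose d := c - 2 * pi * z%:~R.
have d01 : 0 <= d <= 2 * pi.
  have /andP[z1 z2] : z%:~R <= c / (2 * pi) < (z + 1)%:~R by rewrite floor_itv.
  move: z1 z2; rewrite intrD ler_pdivlMr ?ltr_pdivrMr ?mulr_gt0// => z1 z2.
  rewrite /d; nra.
have e x : f (x + c) = f (x + d).
  by rewrite -(per_int (z) (x + d) pf) /d; congr f; ring.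
rewrite (_ : (fun x => f (x + c)) = (fun x => f (x + d))); last by apply/funext.
have /andP[d0 d2] := d01.
have msh y : measurable_fun setT (fun x => f (x + y)).
  by apply: measurableT_comp => //; exact: measurable_funD.
have fi1 : integ `[- pi + d, pi] f.
  by apply: integS fi => x; rewrite !in_itv/= => /andP[h ->]; rewrite andbT (le_trans _ h)// lerDl.
have fi0 : integ `[- pi, - pi + d] f.
  by apply: integS fi => x; rewrite !in_itv/= => /andP[-> h] /=; rewrite (le_trans h)//; lra.
have fi0' : integ `[- pi, - pi + d] (fun x => f (x + 2 * pi)).
  by apply: eq_integ fi0 => x _; rewrite pf.
have [fi2 e2] := Int_shift mf fi0'.
have q1 : - pi + 2 * pi = pi :> R by ring.
have q2 : - pi + d + 2 * pi = pi + d :> R by ring.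
rewrite q1 q2 in fi2 e2.
have fi3 : integ `[- pi + d, pi + d] f by apply: integ_split fi1 fi2.
have fi4 : integ `[- pi + d + - d, pi + d + - d] (fun x => f (x + d)).
  apply: (Int_shift (msh d) _).1.
  by apply: eq_integ fi3 => x _; rewrite subrK.
rewrite !addrK in fi4; split => //.
rewrite -(Int_shift mf fi4).2 (Int_split (b := pi))//; try lra.
rewrite e2 [RHS](Int_split (b := - pi + d))//; try lra.
by rewrite addrC; congr (_ + _); apply: eq_Int => x _; rewrite pf.
Qed.

Lemma Int_fold f a : 0 <= a -> measurable_fun setT f -> integ `[- a, a] f ->
  integ `[0, a] (fun x => f x + f (- x)) /\
  Int `[- a, a] f = Int `[0, a] (fun x => f x + f (- x)).
Proof.
move=> a0 mf fi.
have f1 : integ `[0, a] f.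
  by apply: integS fi => x; rewrite !in_itv/= => /andP[h ->]; rewrite andbT (le_trans _ h)// oppr_le0.
have f2 : integ `[- a, 0] f.
  by apply: integS fi => x; rewrite !in_itv/= => /andP[-> /le_trans]; apply.
have mg : measurable_fun setT (fun x => f (- x)) by apply: measurableT_comp.
have f2' : integ `[- a, 0] (fun x => f (- - x)) by apply: eq_integ f2 => x _; rewrite opprK.
have [g1 e1] := Int_refl mg f2'; rewrite oppr0 opprK in g1 e1.
split; first exact: integD.
rewrite IntD// e1 [LHS](Int_split (b := 0)) ?oppr_le0// addrC; congr (_ + _).
by apply: eq_Int => x _; rewrite opprK.
Qed.

End PeriodicIntegrals.

(** * The operator L and its symmetric increments *)

Section Convolution.
Context {R : realType} (alpha : R) (h0 : 0 < alpha) (h1 : alpha < 1).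
Implicit Types (f g : R -> R) (s x y h m M : R).

Notation Ker := (Ker alpha).

Lemma cos_lt1 x : 0 < `|x| -> `|x| <= pi -> cos x < 1.
Proof.
move=> x0 xp; have := cos_le xp; rewrite -(real_normK (num_real x)).
have h : 0 < `|x| ^+ 2 by rewrite exprn_gt0.
by lra.
Qed.

Lemma integ_even f a : 0 <= a -> (forall x, f (- x) = f x) -> measurable_fun setT f ->
  integ `[0, a] f -> integ `[- a, a] f /\ Int `[- a, a] f = 2 * Int `[0, a] f.
Proof.
move=> a0 ef mf fi.
have fi' : integ `[0, a] (fun x => f (- x)) by apply: eq_integ fi => x _; rewrite ef.
have [i1 _] := Int_refl mf fi'; rewrite oppr0 in i1.
have i2 := integ_split i1 fi; split=> //.
have [_ ->] := Int_fold a0 mf i2.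
by rewrite -IntZ//; apply: eq_Int => x _; rewrite ef; ring.
Qed.

Lemma abs_powR_meas (r : R) : measurable_fun setT (fun x : R => `|x| `^ r).
Proof.
have mp : measurable_fun setT (fun x : R => x `^ r) by exact: measurable_powR.
by apply: (measurableT_comp mp).
Qed.

Lemma abs_powR_integ a : 0 < a -> integ `[- a, a] (fun x => `|x| `^ (alpha - 1)) /\
  Int `[- a, a] (fun x => `|x| `^ (alpha - 1)) <= 2 * (a `^ alpha / alpha).
Proof.
move=> a0; have [i1 e1] := integ_powR0 a0 h0 h1.
have e : {in `[0, a], (fun x => x `^ (alpha - 1)) =1 (fun x => `|x| `^ (alpha - 1))}.
  by move=> x; rewrite in_itv/= => /andP[x0 _]; rewrite ger0_norm.
have m := abs_powR_meas (alpha - 1).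
have ev (x : R) : `|- x| `^ (alpha - 1) = `|x| `^ (alpha - 1) by rewrite normrN.
have [i2 ->] := integ_even (ltW a0) ev m (eq_integ e i1).
split=> //.
rewrite ler_pM2l; last exact: ltr0n.
by rewrite -(eq_Int e); exact: e1.
Qed.

Lemma powR_int_le a b (r : R) : 0 < a -> 1 < r ->
  integ `[a, b] (fun x => x `^ (- r)) /\ Int `[a, b] (fun x => x `^ (- r)) <= a `^ (1 - r) / (r - 1).
Proof.
move=> a0 r1; have [i1 e1] := powR_tail a0 r1.
have i2 : integ `[a, b] (fun x => x `^ (- r)).
  by apply: integS i1 => x; rewrite !in_itv/= andbT => /andP[].
split=> //; rewrite -e1.
have [ab|ba] := leP a b; last first.
  rewrite [leLHS]IntE set_itv_ge ?Rintegral_set0; last by rewrite bnd_simp -ltNge.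
  by apply: Int_ge0 => x _; exact: powR_ge0.
have i3 : integ `[b, +oo[ (fun x => x `^ (- r)).
  by apply: integS i1 => x; rewrite !in_itv/= !andbT; exact: le_trans.
have -> : Int `[a, +oo[ (fun x => x `^ (- r)) =
    Int `[a, b] (fun x => x `^ (- r)) + Int `[b, +oo[ (fun x => x `^ (- r)).
  rewrite !IntE -(@Rintegral_itv_obnd_cbnd _ b); last first.
    by apply: integS i3 => x; rewrite !in_itv/= !andbT => /ltW.
  by rewrite -(@Rintegral_itvB _ _ (BLeft a) +oo%O b)// addrC subrK.
by rewrite lerDl; apply: Int_ge0 => x _; exact: powR_ge0.
Qed.

Lemma Ker_bound : exists2 C : R, 0 < C & forall x, `|x| <= pi -> `|Ker x| <= C * `|x| `^ (alpha - 1).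
Proof.
have [C C0 H] := KN_bound h0 h1; exists C => // x xp.
have [->|x0] := eqVneq x 0; first by rewrite /Ker cos0 eqxx normr0 mulr_ge0 ?powR_ge0// ltW.
have x0' : 0 < `|x| by rewrite normr_gt0.
by rewrite KerE ?cos_lt1//; have [] := H 0%N x x0' xp.
Qed.

Lemma Ker_integ : integ `[- pi, pi] Ker.
Proof.
have [C C0 H] := Ker_bound; have [i1 _] := abs_powR_integ (pi_gt0 R).
apply: (integ_le (integZ C i1)); first by apply: measurable_funTS; exact: Ker_meas.
by move=> x; rewrite in_itv/= => xp; apply: H; rewrite ler_norml.
Qed.

Definition normK : R := Int `[- pi, pi] (fun s => `|Ker s|).

Lemma normK_ge0 : 0 <= normK.
Proof. by apply: Int_ge0. Qed.

Definition bper f M := [/\ measurable_fun setT f, periodic f (2 * pi) & forall x, `|f x| <= M].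

(** Convolution with the kernel, which is even: hence x + s in place of x - s. *)
Definition Lop f x := Int `[- pi, pi] (fun s => Ker s * f (x + s)).

Lemma bper_ge0 f M : bper f M -> 0 <= M.
Proof. by move=> [_ _ H]; apply: le_trans (H 0). Qed.

Lemma meas_shift f c : measurable_fun setT f -> measurable_fun setT (fun s => f (c + s)).
Proof. by move=> mf; apply: measurableT_comp => //; exact: measurable_funD. Qed.

Lemma Lop_integ f M x : bper f M -> integ `[- pi, pi] (fun s => Ker s * f (x + s)).
Proof.
move=> [mf _ fM]; apply: (integM (M := M)); first exact: Ker_integ.
  by apply: measurable_funTS; exact: meas_shift.
by move=> s _; exact: fM.
Qed.

Lemma Lop_bound f M x : bper f M -> `|Lop f x| <= normK * M.
Proof.
move=> bf; rewrite /normK mulrC -IntZ; last exact: integ_norm Ker_integ.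
apply: Int_norm_le; first exact: Lop_integ bf.
  by apply: integZ; exact: integ_norm Ker_integ.
by move=> s _; rewrite normrM mulrC ler_wpM2r//; case: bf.
Qed.

Lemma LopB f g M N x : bper f M -> bper g N -> Lop (fun y => f y - g y) x = Lop f x - Lop g x.
Proof.
move=> bf bg; rewrite /Lop -IntB; [|exact: Lop_integ bf|exact: Lop_integ bg].
by apply: eq_Int => s _; ring.
Qed.

Lemma LopZ f M k x : bper f M -> Lop (fun y => k * f y) x = k * Lop f x.
Proof.
move=> bf; rewrite /Lop -IntZ; last exact: Lop_integ bf.
by apply: eq_Int => s _; ring.
Qed.

Lemma Lop_per f : periodic f (2 * pi) -> periodic (Lop f) (2 * pi).
Proof. by move=> pf x; apply: eq_Int => s _; rewrite addrAC pf. Qed.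

Definition wt h s := Ker (s - h) - Ker (s + h).

Lemma wt_meas h : measurable_fun setT (wt h).
Proof.
apply: measurable_funB.
  by apply: (measurableT_comp (Ker_meas h0 h1)); exact: measurable_funD.
by apply: (measurableT_comp (Ker_meas h0 h1)); exact: measurable_funD.
Qed.

Lemma Ker_shift_integ c : integ `[- pi, pi] (fun s => Ker (s + c)).
Proof.
apply: (Int_per_shift c (Ker_meas h0 h1) _ Ker_integ).1.
exact: Ker_periodic.
Qed.

Lemma wt_integ h : integ `[- pi, pi] (wt h).
Proof. by apply: integB; exact: Ker_shift_integ. Qed.

Lemma sub0pi a b : 0 <= a -> b <= pi -> {subset `[a, b] <= `[- pi, pi : R]}.
Proof.
move=> a0 bp x; rewrite !in_itv/= => /andP[ax xb].
by rewrite (le_trans xb bp) andbT (le_trans _ (le_trans a0 ax))// oppr_le0 pi_ge0.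
Qed.

Lemma wtf_integ f M m h : bper f M ->
  integ `[0, pi] (fun s => wt h s * (f (m + s) - f (m - s))).
Proof.
move=> [mf pf fM]; apply: (integM (M := 2 * M)).
- by apply: integS (wt_integ h); exact: sub0pi.
- apply: measurable_funTS; apply: measurable_funB; first exact: meas_shift.
  by apply: measurableT_comp => //; exact: measurable_funB.
- move=> s _; apply: le_trans (ler_normB _ _) _.
  by have := fM (m + s); have := fM (m - s); lra.
Qed.

(** Translation over a period moves the shift from f to the kernel, so that f (m + s) is common to
    both terms; folding s and -s together, with the kernel even, leaves the weight against the part
    of f that is odd about m. *)
Lemma Lop_diff f M m h : bper f M ->
  Lop f (m + h) - Lop f (m - h) = Int `[0, pi] (fun s => wt h s * (f (m + s) - f (m - s))).
Proof.
move=> bf; have [mf pf fM] := bf.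
have key c : integ `[- pi, pi] (fun s => Ker (s + c) * f (m + s)) /\
    Int `[- pi, pi] (fun s => Ker (s + c) * f (m + s)) = Lop f (m - c).
  have mG : measurable_fun setT (fun s => Ker (s + c) * f (m + s)).
    apply: measurable_funM; last exact: meas_shift.
    by apply: (measurableT_comp (Ker_meas h0 h1)); exact: measurable_funD.
  have pG : periodic (fun s => Ker (s + c) * f (m + s)) (2 * pi).
    by move=> s; rewrite [s + _ + c]addrAC Ker_periodic addrA pf.
  have iG : integ `[- pi, pi] (fun s => Ker (s + c) * f (m + s)).
    apply: (integM (M := M)); first exact: Ker_shift_integ.
      by apply: measurable_funTS; exact: meas_shift.
    by move=> s _; exact: fM.
  split=> //; rewrite -(Int_per_shift (- c) mG pG iG).2.
  by apply: eq_Int => s _; rewrite subrK; congr (_ * f _); ring.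
have [i1 e1] := key (- h); have [i2 e2] := key h.
rewrite opprK in e1; rewrite -e1 -e2 -IntB//.
have i3 := integB i1 i2.
have mG : measurable_fun setT (fun s => Ker (s - h) * f (m + s) - Ker (s + h) * f (m + s)).
  rewrite (_ : (fun s => _) = (fun s => wt h s * f (m + s))); last first.
    by apply/funext => s; rewrite /wt mulrBl.
  by apply: measurable_funM; [exact: wt_meas|exact: meas_shift].
rewrite (Int_fold (pi_ge0 R) mG i3).2; apply: eq_Int => s _.
have -> : Ker (- s - h) = Ker (s + h) by rewrite -opprD KerN.
have -> : Ker (- s + h) = Ker (s - h) by rewrite -[- s + h]opprK opprD opprK KerN.
by rewrite /wt; ring.
Qed.

Lemma Ker_del : exists2 d : R, 0 < d &
  forall x y, cos y <= cos x -> cos x < 1 -> d * (cos x - cos y) <= Ker x - Ker y.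
Proof.
have [d d0 H] := KK_del h0 h1; exists d => // x y cyx cx.
have A (z : R) : 0 <= acos (cos z) <= pi /\ cos (acos (cos z)) = cos z.
  by apply: acos_def; rewrite cos_geN1 cos_le1.
have [/andP[x0 xp] ex] := A x; have [/andP[y0 yp] ey] := A y.
have x0' : 0 < acos (cos x).
  rewrite lt_neqAle x0 andbT; apply/eqP => e.
  by move: cx; rewrite -ex -e cos0 ltxx.
have xy : acos (cos x) <= acos (cos y).
  by rewrite leNgt; apply/negP => /(cos_decr y0)/(_ xp); rewrite ex ey ltNge cyx.
have := H _ _ x0' xy yp; rewrite ex ey.
rewrite -(Ker_cos alpha ex) -(Ker_cos alpha ey) !KerE ?ex ?ey//.
by apply: le_lt_trans cx.
Qed.

(** This is [Ker_del], because cos(s - h) - cos(s + h) = 2 sin s sin h. At s = h the default value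
    of [Ker] at 0 may break it; integrations across that point go through [Int_le_except]. *)
Lemma wt_ge : exists2 d : R, 0 < d & forall h s, 0 <= s <= pi -> 0 <= h <= pi -> s != h ->
  d * (2 * sin s * sin h) <= wt h s.
Proof.
have [d d0 H] := Ker_del; exists d => // h s /andP[s0 sp] /andP[hh0 hp] sh.
have e : cos (s - h) - cos (s + h) = 2 * sin s * sin h by rewrite cosB cosD; ring.
have ss : 0 <= sin s by apply: sin_ge0_pi; rewrite s0.
have sh0 : 0 <= sin h by apply: sin_ge0_pi; rewrite hh0.
rewrite -e; apply: H; first by rewrite -subr_ge0 e !mulr_ge0.
apply: cos_lt1; first by rewrite normr_gt0 subr_eq0.
by rewrite ler_norml; lra.
Qed.

Lemma wt_ge0 h s : 0 <= s <= pi -> 0 <= h <= pi -> s != h -> 0 <= wt h s.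
Proof.
have [d d0 H] := wt_ge => hs hh sh; apply: le_trans (H h s hs hh sh).
by rewrite !mulr_ge0 ?(ltW d0)// sin_ge0_pi.
Qed.

Lemma wt_le : exists2 C : R, 0 < C & forall h s, 0 < h -> 2 * h <= s -> s <= pi ->
  wt h s <= C * h * s `^ (alpha - 2).
Proof.
have [C C0 H] := KK_lip h0 h1; exists (8 * C); first by rewrite mulr_gt0.
move=> h s hh0 hs sp; have a0 : 0 < s - h by lra.
have s0 : 0 < s by lra.
have ap : s - h <= pi by lra.
(* s + h may exceed pi, beyond which [KK_lip] says nothing. Then b is the reflected point 2 pi - (s
   + h), which has the same cosine and is still within 2 h of s - h. *)
have key b : s - h <= b -> b <= pi -> b - (s - h) <= 2 * h -> cos b = cos (s + h) ->
    wt h s <= 8 * C * h * s `^ (alpha - 2).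
  move=> ab bp bh cb; rewrite /wt -(Ker_cos alpha cb) !KerE; last 2 first.
  - by apply: cos_lt1; rewrite gtr0_norm//; lra.
  - by apply: cos_lt1; rewrite gtr0_norm//; lra.
  apply: le_trans (H _ _ a0 ab bp) _.
  have p1 : (s - h) `^ (alpha - 2) <= 4 * s `^ (alpha - 2).
    have : (s - h) `^ (alpha - 2) <= (2^-1 * s) `^ (alpha - 2).
      rewrite -[alpha - 2]opprB !powRN lef_pV2 ?posrE ?powR_gt0//; last by rewrite mulr_gt0.
      by apply: ge0_ler_powR; rewrite ?nnegrE ?mulr_ge0//; have h1' := h1; lra.
    move/le_trans; apply; rewrite powRM ?(ltW s0)// ler_wpM2r ?powR_ge0//.
    have -> : (2^-1 : R) `^ (alpha - 2) = 2 `^ (2 - alpha).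
      by rewrite -powR_inv1// -powRrM; congr (_ `^ _); ring.
    have -> : (4 : R) = 2 `^ 2%:R by rewrite powR_mulrn// expr2; ring.
    by apply: ler_powR; [rewrite ler1n|have h0' := h0; lra].
  have q0 : 0 <= (s - h) `^ (alpha - 2) by exact: powR_ge0.
  apply: le_trans (_ : C * (2 * h) * (4 * s `^ (alpha - 2)) <= _); last by lra.
  by apply: ler_pM => //; rewrite ?mulr_ge0 ?(ltW C0)//?ler_wpM2l ?(ltW C0)//; lra.
have [shp|shp] := leP (s + h) pi; first by apply: (key (s + h)) => //; lra.
apply: (key (2 * pi - (s + h))); [lra|lra|lra|].
by rewrite -cosN opprB mulr_natl -[in LHS](subrK (pi *+ 2) (s + h)) addrK -(cosD2pi (_ - _)) subrK.
Qed.

Lemma wt_small_pt : exists2 C : R, 0 < C & forall h s, 0 < h -> h <= 1 / 2 -> 0 <= s <= 2 * h ->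
  `|wt h s| <= C * `|s - h| `^ (alpha - 1) + C * h `^ (alpha - 1).
Proof.
have [C C0 H] := Ker_bound; exists C => // h s hh0 hh hs.
have [p1 p2] : `|s - h| <= pi /\ `|s + h| <= pi.
  by have := @pi_ge2 R; rewrite !ler_norml; lra.
apply: le_trans (ler_normB _ _) _; apply: lerD; first exact: H.
apply: le_trans (H _ p2) _; rewrite ler_wpM2l ?(ltW C0)//.
rewrite ger0_norm; last by lra.
have sh : 0 < s + h by lra.
have hsh : h <= s + h by lra.
rewrite -[alpha - 1]opprB !powRN lef_pV2 ?posrE ?powR_gt0//.
by apply: ge0_ler_powR; rewrite ?nnegrE ?subr_ge0 ?(ltW h1) ?(ltW hh0) ?(ltW sh).
Qed.

Lemma wt_small : exists2 C : R, 0 < C & forall h, 0 < h -> h <= 1 / 2 ->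
  Int `[0, 2 * h] (fun s => `|wt h s|) <= C * h `^ alpha.
Proof.
have [C C0 H] := wt_small_pt.
exists (C * (2 / alpha + 2)); first by rewrite mulr_gt0// addr_gt0// divr_gt0.
move=> h hh0 hh.
have hp : 2 * h <= pi by have := @pi_ge2 R; lra.
have eh : h `^ alpha = h `^ (alpha - 1) * h.
  by rewrite -[X in _ * X]powRr1 ?(ltW hh0)// -powRD ?subrK// (gt_eqF hh0) implybT.
have h20 : 0 <= 2 * h by rewrite mulr_ge0// ltW.
have [i1 e1] := abs_powR_integ hh0.
have i2 : integ `[0, 2 * h] (fun s => `|s - h| `^ (alpha - 1)) /\
   Int `[0, 2 * h] (fun s => `|s - h| `^ (alpha - 1)) = Int `[- h, h] (fun x => `|x| `^ (alpha - 1)).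
  have q1 : - h + h = 0 by rewrite addNr.
  have q2 : h + h = 2 * h by rewrite mulr_natl.
  rewrite -q1 -q2.
  have := @Int_shift R (- h) h h (fun s => `|s - h| `^ (alpha - 1)).
  have -> : (fun x => `|x + h - h| `^ (alpha - 1)) = (fun x => `|x| `^ (alpha - 1)).
    by apply/funext => x; rewrite addrK.
  apply; last exact: i1.
  by apply: (measurableT_comp (abs_powR_meas (alpha - 1))); exact: measurable_funD.
have ic : integ `[0, 2 * h] (fun s => C * `|s - h| `^ (alpha - 1)) by apply: integZ; exact: i2.1.
have iw : integ `[0, 2 * h] (wt h) by apply: integS (wt_integ h); exact: sub0pi.
have le1 : Int `[0, 2 * h] (fun s => `|wt h s|) <=
    Int `[0, 2 * h] (fun s => C * `|s - h| `^ (alpha - 1) + C * h `^ (alpha - 1)).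
  apply: Int_le; [exact: integ_norm|apply: integD; [exact: ic|exact: integ_cst]|].
  by move=> s; rewrite in_itv/=; exact: H.
apply: le_trans le1 _; rewrite IntD; [|exact: ic|exact: integ_cst].
rewrite IntZ; last exact: i2.1.
rewrite i2.2 Int_cst; last exact: h20.
rewrite subr0.
have := ler_wpM2l (ltW C0) e1; rewrite eh.
move: (Int _ _) (h `^ (alpha - 1)) => I P; clear; lra.
Qed.

(** The common source of the Hoelder and growth estimates for L. For s <= 2 h the weight has
    integral of order h^alpha and multiplies the bound A; for larger s it is at most of order h
    s^(alpha - 2) and multiplies the bound g. *)
Lemma diff_bound : exists2 C : R, 0 < C & forall f M m h (A : R) (g : R -> R), bper f M ->
  0 < h -> h <= 1 / 2 -> 0 <= A ->
  (forall s, 0 <= s <= 2 * h -> `|f (m + s) - f (m - s)| <= A) ->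
  integ `[2 * h, pi] (fun s => s `^ (alpha - 2) * g s) ->
  (forall s, 2 * h <= s <= pi -> `|f (m + s) - f (m - s)| <= g s) ->
  `|Lop f (m + h) - Lop f (m - h)| <=
    C * A * h `^ alpha + C * h * Int `[2 * h, pi] (fun s => s `^ (alpha - 2) * g s).
Proof.
have [C1 C10 H1] := wt_small; have [C2 C20 H2] := wt_le; have p2 := @pi_ge2 R.
exists (C1 + C2); first by rewrite addr_gt0.
move=> f M m h A g bf hh0 hh A0 fA ig fg.
have iw := wtf_integ m h bf; rewrite (Lop_diff m h bf).
have hp : 2 * h <= pi by lra.
have h20 : 0 <= 2 * h by lra.
have iw1 : integ `[0, 2 * h] (fun s => wt h s * (f (m + s) - f (m - s))).
  by apply: integS iw => s; rewrite !in_itv/= => /andP[-> /le_trans]; apply.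
have iw2 : integ `[2 * h, pi] (fun s => wt h s * (f (m + s) - f (m - s))).
  by apply: integS iw => s; rewrite !in_itv/= => /andP[/(le_trans h20)-> ->].
have iwt : integ `[0, 2 * h] (wt h) by apply: integS (wt_integ h); exact: sub0pi.
rewrite (Int_split h20 hp iw); apply: le_trans (ler_normD _ _) _.
have I0 : 0 <= Int `[2 * h, pi] (fun s => s `^ (alpha - 2) * g s).
  apply: Int_ge0 => s; rewrite in_itv/= => hs; rewrite mulr_ge0 ?powR_ge0//.
  exact: le_trans (fg s hs).
have b1 : `|Int `[0, 2 * h] (fun s => wt h s * (f (m + s) - f (m - s)))| <= C1 * A * h `^ alpha.
  rewrite mulrAC; apply: le_trans (ler_wpM2r A0 (H1 h hh0 hh)); rewrite [leRHS]mulrC -IntZ; last exact: integ_norm.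
  apply: Int_norm_le => //; first by apply: integZ; exact: integ_norm.
  by move=> s; rewrite in_itv/= => /fA hA; rewrite normrM mulrC ler_wpM2r.
have b2 : `|Int `[2 * h, pi] (fun s => wt h s * (f (m + s) - f (m - s)))| <=
    C2 * h * Int `[2 * h, pi] (fun s => s `^ (alpha - 2) * g s).
  rewrite -IntZ//; apply: Int_norm_le => //; first exact: integZ.
  move=> s; rewrite in_itv/= => hs; have /andP[s1 s2] := hs.
  rewrite normrM mulrA; apply: ler_pM => //; last exact: fg.
  rewrite ger0_norm; first exact: H2.
  by apply: wt_ge0; rewrite ?gt_eqF//; clear - h0 h1 hh0 hh hp s1 s2; lra.
apply: le_trans (lerD b1 b2) _; apply: lerD.
  by rewrite -!mulrA ler_wpM2r ?mulr_ge0 ?powR_ge0// lerDl ltW.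
by rewrite -!mulrA ler_wpM2r ?mulr_ge0 ?(ltW hh0)// lerDr ltW.
Qed.

Lemma Lop_holder : exists2 C : R, 0 < C & forall f M x y, bper f M ->
  `|Lop f x - Lop f y| <= C * M * `|x - y| `^ alpha.
Proof.
have [C C0 H] := diff_bound.
pose D := C * 2 + C * 2 / (1 - alpha) + 2 * normK + 1.
have D1 : 0 <= C * 2 / (1 - alpha) by rewrite divr_ge0 ?mulr_ge0 ?(ltW C0)// subr_ge0 ltW.
exists D; first by have := normK_ge0; rewrite /D; lra.
move=> f M x y bf; have M0 := bper_ge0 bf.
wlog xy : x y / y <= x.
  by move=> W; have [/W//|/ltW/W] := leP y x; rewrite (distrC x) (distrC (Lop f x)).
move: xy; rewrite le_eqVlt => /predU1P[->|xy].
  by rewrite !subrr !normr0 mulr_ge0 ?powR_ge0// mulr_ge0// /D; have := normK_ge0; lra.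
rewrite [`|x - y|]gtr0_norm ?subr_gt0//.
have [xy1|xy1] := leP (x - y) 1; last first.
  have : `|Lop f x - Lop f y| <= 2 * normK * M.
    by apply: le_trans (ler_normB _ _) _; have := Lop_bound x bf; have := Lop_bound y bf; lra.
  move/le_trans; apply.
  have p1 : 1 <= (x - y) `^ alpha.
    have e1 : (1 : R) `^ alpha = 1 by rewrite powR1.
    by rewrite -[leLHS]e1; apply: ge0_ler_powR; rewrite ?nnegrE ?(ltW h0)//; lra.
  have DM : 2 * normK * M <= D * M by rewrite ler_wpM2r// /D; lra.
  apply: le_trans DM _; rewrite ler_peMr// mulr_ge0// /D; have := normK_ge0; lra.
pose h := (x - y) / 2; pose m := (x + y) / 2.
have -> : x = m + h by rewrite /m /h; lra.
have -> : y = m - h by rewrite /m /h; lra.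
have hh0 : 0 < h by rewrite /h; lra.
have hh : h <= 1 / 2 by rewrite /h; lra.
have fb s : `|f (m + s) - f (m - s)| <= 2 * M.
  by apply: le_trans (ler_normB _ _) _; case: bf => _ _ fM; have := fM (m + s); have := fM (m - s); lra.
have h20 : 0 < 2 * h by lra.
have r1 : 1 < 2 - alpha by have h1' := h1; lra.
have [i1 e1] := powR_int_le pi h20 r1; rewrite opprB in i1 e1.
have ig : integ `[2 * h, pi] (fun s => s `^ (alpha - 2) * (2 * M)).
  by apply: eq_integ (integZ (2 * M) i1) => s _; rewrite mulrC.
have := H f M m h (2 * M) (fun=> 2 * M) bf hh0 hh _ (fun s _ => fb s) ig (fun s _ => fb s).
move=> /(_ (mulr_ge0 (ler0n _ 2) M0))/le_trans; apply.
have -> : Int `[2 * h, pi] (fun s => s `^ (alpha - 2) * (2 * M)) =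
    2 * M * Int `[2 * h, pi] (fun s => s `^ (alpha - 2)).
  by rewrite -IntZ//; apply: eq_Int => s _; rewrite mulrC.
have e3 : m + h - (m - h) = 2 * h by ring.
rewrite e3; set P := (2 * h) `^ alpha.
have P0 : 0 <= P by exact: powR_ge0.
have hP : h `^ alpha <= P by apply: ge0_ler_powR; rewrite ?nnegrE ?(ltW h0)//; clear - h0 h1 hh0; lra.
have e2 : 2 * h * (2 * h) `^ (1 + (alpha - 2)) = P.
  have -> : 1 + (alpha - 2) = alpha - 1 by ring.
  by rewrite mulrC -[X in _ * X]powRr1 ?(ltW h20)// -powRD ?subrK// (gt_eqF h20) implybT.
have e4 : h * Int `[2 * h, pi] (fun s => s `^ (alpha - 2)) <= P / (1 - alpha).
  have : 2 * h * Int `[2 * h, pi] (fun s => s `^ (alpha - 2)) <= P / (2 - alpha - 1).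
    by rewrite -e2 -[leRHS]mulrA; apply: (ler_wpM2l (ltW h20)); exact: e1.
  have -> : 2 - alpha - 1 = 1 - alpha by ring.
  have : 0 <= Int `[2 * h, pi] (fun s => s `^ (alpha - 2)) by apply: Int_ge0 => s _; exact: powR_ge0.
  by move=> I0; have := mulr_ge0 (ltW hh0) I0; lra.
have t1 : C * (2 * M) * h `^ alpha <= C * 2 * (M * P).
  have : M * h `^ alpha <= M * P by rewrite ler_wpM2l.
  by move/(ler_wpM2l (ltW C0)); lra.
have t2 : C * h * (2 * M * Int `[2 * h, pi] (fun s => s `^ (alpha - 2))) <= C * 2 / (1 - alpha) * (M * P).
  have := ler_wpM2l (mulr_ge0 (ltW C0) M0) e4; lra.
have MP : 0 <= M * P by rewrite mulr_ge0.
have := mulr_ge0 normK_ge0 MP; rewrite /D; lra.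
Qed.

Lemma Lop_continuous f M : bper f M -> continuous (Lop f).
Proof.
move=> bf x; have [C C0 H] := Lop_holder; have M0 := bper_ge0 bf.
apply/cvgrPdist_le => e e0.
have : (fun y => C * M * `|x - y| `^ alpha) y @[y --> x] --> C * M * `|x - x| `^ alpha.
  apply: cvgM; first exact: cvg_cst.
  apply: (@continuous_comp _ _ _ (fun y => x - y) (fun z => `|z| `^ alpha)).
    by apply: continuousB; [exact: cst_continuous|exact: cvg_id].
  exact: powR_abs_continuous.
rewrite subrr normr0 powR0 ?gt_eqF// mulr0 => /cvgrPdist_le /(_ e e0).
apply: filterS => y; rewrite sub0r normrN => hy.
by apply: le_trans (H f M x y bf) _; apply: le_trans hy; exact: ler_norm.
Qed.

End Convolution.

(** * A cubical lemma modulo 2, by cup products *)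

Section Kuhn.
Context {n : nat} (p : nat).
Implicit Types (z : 'I_n -> nat) (S : {set 'I_n}) (s : seq 'I_n) (k l i : 'I_n).

Definition up k z : 'I_n -> nat := fun j => if j == k then (z j).+1 else z j.
Definition put k (c : nat) z : 'I_n -> nat := fun j => if j == k then c else z j.

Context (f : 'I_n -> ('I_n -> nat) -> bool).

(* The cup product over F_2 of the coboundaries of the labels f i, i in s,
   evaluated on the lattice cube based at z with edge directions S. *)
Fixpoint cup s z S : bool :=
  if s is i :: s' then
    \big[addb/false]_(k in S) ((f i (up k z) (+) f i z) && cup s' (up k z) (S :\ k))
  else true.

Lemma up_comm k l z : up k (up l z) = up l (up k z).
Proof.
apply/funext => j; rewrite /up.
by case: (eqVneq j k) => [->|jk]; case: (eqVneq _ l).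
Qed.

(** Each unordered pair is counted twice, which is zero over F_2. *)
Lemma sym_cancel S (G : 'I_n -> 'I_n -> bool) : (forall k l, G k l = G l k) ->
  \big[addb/false]_(k in S) \big[addb/false]_(l in S :\ k) G k l = false.
Proof.
move=> sG.
have e : \big[addb/false]_(k in S) \big[addb/false]_(l in S :\ k) G k l =
   (\big[addb/false]_(k in S) \big[addb/false]_(l in S | (l < k)%N) G k l) (+)
   (\big[addb/false]_(k in S) \big[addb/false]_(l in S | (k < l)%N) G k l).
  rewrite -big_split; apply: eq_bigr => k kS.
  rewrite (bigID (fun l : 'I_n => (l < k)%N)) /=; congr (_ (+) _); apply: eq_bigl => l.
    by rewrite in_setD1; case: (ltngtP l k) => [lk|lk|/val_inj ->]; rewrite ?andbF ?eqxx ?andbT//= -val_eqE /= ltn_eqF.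
  rewrite in_setD1; case: (ltngtP l k) => [lk|lk|/val_inj ->]; rewrite ?andbF ?eqxx ?andbT//=.
  by rewrite -val_eqE /= gtn_eqF.
rewrite e (exchange_big_dep (mem S)) //=; last by move=> k l _ /andP[].
rewrite (eq_bigr (fun l => \big[addb/false]_(k in S | (l < k)%N) G l k)) ?addbb//.
move=> l lS; apply: eq_big => k; first by rewrite lS.
by rewrite sG.
Qed.

(** A product of coboundaries is closed. In the expansion the terms containing [f i] at the doubly
    shifted point are symmetric in the two directions and cancel in pairs; the others reduce, by the
    closedness of the remaining factors, to another symmetric sum. *)
Lemma cup_closed s : forall z S, #|S| = (size s).+1 ->
  \big[addb/false]_(k in S) (cup s (up k z) (S :\ k) (+) cup s z (S :\ k)) = false.
Proof.
elim: s => [|i s IH] z S cS; first by rewrite big1.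
have cSk k : k \in S -> #|S :\ k| = (size s).+1.
  by move=> kS; move: cS; rewrite (cardsD1 k) kS => -[].
rewrite big_split /=.
pose fz w := f i w.
pose U k l := cup s (up l (up k z)) (S :\ k :\ l).
have Us k l : U k l = U l k by rewrite /U up_comm finset.setDDl finset.setUC -finset.setDDl.
have E1 : \big[addb/false]_(k in S) \big[addb/false]_(l in S :\ k)
     ((fz (up l (up k z)) (+) fz (up k z)) && U k l) =
   \big[addb/false]_(k in S) \big[addb/false]_(l in S :\ k) (fz (up k z) && U k l).
  transitivity ((\big[addb/false]_(k in S) \big[addb/false]_(l in S :\ k)
      (fz (up l (up k z)) && U k l)) (+)
    \big[addb/false]_(k in S) \big[addb/false]_(l in S :\ k) (fz (up k z) && U k l)); last first.
    by rewrite sym_cancel// => k l; rewrite up_comm Us.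
  rewrite -big_split; apply: eq_bigr => k kS; rewrite -big_split; apply: eq_bigr => l lS /=.
  by rewrite andb_addl.
have E2 : \big[addb/false]_(k in S) \big[addb/false]_(l in S :\ k)
     ((fz (up l z) (+) fz z) && cup s (up l z) (S :\ k :\ l)) =
   \big[addb/false]_(k in S) \big[addb/false]_(l in S :\ k) ((fz (up k z) (+) fz z) && cup s (up k z) (S :\ k :\ l)).
  rewrite (exchange_big_dep (mem S)) /=; last by move=> k l _; rewrite in_setD1 => /andP[].
  apply: eq_bigr => l lS; apply: eq_big => k.
    by rewrite !in_setD1 lS andbT eq_sym; case: (eqVneq k l); rewrite ?andbT ?andbF.
  by move=> _; rewrite finset.setDDl finset.setUC -finset.setDDl.
have E3 k : k \in S -> \big[addb/false]_(l in S :\ k) U k l =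
    \big[addb/false]_(l in S :\ k) cup s (up k z) (S :\ k :\ l).
  move=> kS; have := IH (up k z) (S :\ k) (cSk k kS); rewrite big_split /= /U.
  by case: (\big[_/_]_(_ in _) _); case: (\big[_/_]_(_ in _) _).
rewrite /= E1 E2 -big_split /=.
transitivity (fz z && \big[addb/false]_(k in S) \big[addb/false]_(l in S :\ k) U k l); last first.
  by rewrite sym_cancel ?andbF.
rewrite big_distrr /=; apply: eq_bigr => k kS.
rewrite -!big_distrr /= -(E3 k kS).
by case: (fz _); case: (fz _); case: (\big[_/_]_(_ in _) _).
Qed.

Fixpoint boxsum s (g : ('I_n -> nat) -> bool) z : bool :=
  if s is i :: s' then \big[addb/false]_(0 <= c < p) boxsum s' g (put i c z) else g z.

Lemma boxsum_add s g h z :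
  boxsum s (fun w => g w (+) h w) z = boxsum s g z (+) boxsum s h z.
Proof.
elim: s z => [//|i s IH] z /=; rewrite -big_split; apply: eq_bigr => c _; exact: IH.
Qed.

Lemma boxsum0 s z : boxsum s (fun=> false) z = false.
Proof. by elim: s z => [//|i s IH] z /=; rewrite big1. Qed.

Lemma boxsum_sum s S (g : 'I_n -> ('I_n -> nat) -> bool) z :
  boxsum s (fun w => \big[addb/false]_(k in S) g k w) z =
  \big[addb/false]_(k in S) boxsum s (g k) z.
Proof.
have e : \big[addb/false]_(k in S) boxsum s (g k) z = \big[addb/false]_(k <- enum S) boxsum s (g k) z.
  by rewrite big_enum.
rewrite e (_ : (fun w => _) = (fun w => \big[addb/false]_(k <- enum S) g k w)); last first.
  by apply/funext => w; rewrite big_enum.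
elim: (enum S) => [|k r IH].
  rewrite big_nil -[RHS](boxsum0 s z); congr (boxsum _ _ _).
  by apply/funext => w; rewrite big_nil.
rewrite big_cons -IH -boxsum_add; congr (boxsum _ _ _).
by apply/funext => w; rewrite big_cons.
Qed.

Lemma eq_boxsum s k g h z : k \notin s -> (forall w, w k = z k -> g w = h w) ->
  boxsum s g z = boxsum s h z.
Proof.
elim: s z => [|i s IH] z /=; first by move=> _; apply.
rewrite inE negb_or => /andP[ki ks] H; apply: eq_bigr => c _; apply: IH => // w.
by rewrite /put (negbTE ki); exact: H.
Qed.

Lemma boxsum_up s k g z : k \notin s -> boxsum s (fun w => g (up k w)) z = boxsum s g (up k z).
Proof.
elim: s z => [//|i s IH] z /=; rewrite inE negb_or => /andP[ki ks].
apply: eq_bigr => c _; rewrite IH//; congr boxsum; apply/funext => j; rewrite /up /put.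
by case: (eqVneq j k) => [->|//]; rewrite (negbTE ki).
Qed.

Lemma telescope_addb (A : nat -> bool) m :
  \big[addb/false]_(0 <= c < m) (A c.+1 (+) A c) = A m (+) A 0%N.
Proof.
elim: m => [|m IH]; first by rewrite big_geq// addbb.
by rewrite big_nat_recr//= IH; case: (A m); case: (A m.+1); case: (A 0%N).
Qed.

Lemma boxsum_tele_head s k g z : k \notin s ->
  boxsum (k :: s) (fun w => g (up k w) (+) g w) z =
  boxsum s g (put k p z) (+) boxsum s g (put k 0%N z).
Proof.
move=> ks /=; rewrite -(telescope_addb (fun c => boxsum s g (put k c z))).
apply: eq_bigr => c _; rewrite boxsum_add boxsum_up//; congr (boxsum _ _ _ (+) _).
by apply/funext => j; rewrite /up /put; case: eqVneq.
Qed.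

Lemma boxsum_tele s k g z : uniq s -> k \in s ->
  (forall w, (w k == 0%N) || (w k == p) -> g w = false) ->
  boxsum s (fun w => g (up k w) (+) g w) z = false.
Proof.
move=> us ks H; elim: s z us ks => [//|i s IH] z /= /andP[iS us]; rewrite inE.
case: (eqVneq k i) => [ki _|ki /= ks]; last first.
  by rewrite big1// => c _; exact: IH.
subst i; have := @boxsum_tele_head s k g z iS; rewrite /= => ->.
have e c : (c == 0%N) || (c == p) -> boxsum s g (put k c z) = false.
  move=> hc; rewrite -(boxsum0 s (put k c z)); apply: (eq_boxsum iS) => w wk.
  by apply: H; rewrite wk /put eqxx.
by rewrite !e// eqxx ?orbT.
Qed.

Context (f0 : forall i z, z i = 0%N -> f i z = false)
  (fp : forall i z, z i = p -> f i z = true).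

(** When k is not a direction of the cube, the cube lies in the face, along which [f k] is constant.
    The factor of k is then zero whatever direction it takes. *)
Lemma cup_face s k z S : k \in s -> k \notin S -> (z k == 0%N) || (z k == p) ->
  cup s z S = false.
Proof.
elim: s z S => [//|i s IH] z S; rewrite inE => /orP[/eqP<-|ks] kS zk /=; apply: big1 => l lS.
  have kl : k != l by apply: contraNneq kS => ->.
  have e : up l z k = z k by rewrite /up (negbTE kl).
  case/orP: zk => /eqP zk; first by rewrite !f0 ?e.
  by rewrite !fp ?e.
have kl : k != l by apply: contraNneq kS => ->.
rewrite IH ?andbF//; first by rewrite in_setD1 negb_and kS orbT.
by rewrite /up (negbTE kl).
Qed.

(** Stokes modulo 2. By [cup_closed] the product is a sum, over the directions k, of differences of
    [f i] times the remaining product, and these telescope to the faces. The faces with k != i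
    vanish by [cup_face]; for k = i the label is 1 on one face and 0 on the other, which leaves the
    same sum in one dimension less. *)
Lemma boxsum_cup s z : uniq s -> boxsum s (fun w => cup s w [set i in s]) z = true.
Proof.
elim: s z => [//|i s IH] z us; have /= /andP[iS us'] := us.
set S := [set j in i :: s].
have cS : #|S| = (size s).+1 by rewrite cardsE (card_uniqP us).
have e : (fun w => cup (i :: s) w S) = (fun w => \big[addb/false]_(k in S)
    ((fun w => f i w && cup s w (S :\ k)) (up k w) (+) (f i w && cup s w (S :\ k)))).
  apply/funext => w /=.
  have C := cup_closed w cS.
  transitivity ((\big[addb/false]_(k in S) ((f i (up k w) (+) f i w) && cup s (up k w) (S :\ k))) (+)
     (f i w && \big[addb/false]_(k in S) (cup s (up k w) (S :\ k) (+) cup s w (S :\ k)))).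
    by rewrite C andbF addbF.
  rewrite big_distrr /= -big_split /=.
  apply: eq_bigr => k kS.
  by case: (f i w); case: (f i _); case: (cup _ (up k w) _); case: (cup _ w _).
pose h k w := f i w && cup s w (S :\ k).
have iS' : i \in S by rewrite inE mem_head.
have R0 : \big[addb/false]_(k in S | k != i)
    boxsum (i :: s) (fun w => h k (up k w) (+) h k w) z = false.
  apply: big1 => k /andP[kS ki]; apply: boxsum_tele => //; first by move: kS; rewrite inE.
  move=> w wk; rewrite /h (@cup_face s k) ?andbF//; last by rewrite in_setD1 eqxx.
  by move: kS; rewrite !inE (negbTE ki).
have Si : S :\ i = [set j in s].
  by apply/setP => j; rewrite !inE; case: eqVneq => [->|//]; rewrite (negbTE iS).
have R1 : boxsum (i :: s) (fun w => h i (up i w) (+) h i w) z = true.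
  rewrite boxsum_tele_head// /h Si -[RHS](IH (put i p z) us') -[RHS]addbF; congr (_ (+) _).
    by apply: (eq_boxsum iS) => w; rewrite {1}/put eqxx => wi; rewrite fp.
  rewrite -(boxsum0 s (put i 0%N z)); apply: (eq_boxsum iS) => w.
  by rewrite {1}/put eqxx => wi; rewrite f0.
rewrite -[LHS]/(boxsum (i :: s) (fun w => cup (i :: s) w S) z) e.
by rewrite (boxsum_sum _ S (fun k w => h k (up k w) (+) h k w)) (bigD1 i iS') R0 R1.
Qed.

Lemma boxsum_ex s g z : boxsum s g z = true ->
  exists2 w, g w = true & forall j, (w j < p)%N || (w j == z j).
Proof.
elim: s z => [|i s IH] z /=; first by move=> gz; exists z => // j; rewrite eqxx orbT.
move=> H; have : exists2 c, (c < p)%N & boxsum s g (put i c z) = true.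
  apply: contrapT => H'; move: H; rewrite big_nat_cond big1// => c /andP[/andP[_ cp] _].
  by apply/negbTE/negP => hc; apply: H'; exists c.
move=> [c cp /IH[w gw hw]]; exists w => // j; have := hw j; rewrite /put.
by case: (eqVneq j i) => // _ /orP[->//|/eqP->]; rewrite cp.
Qed.

Lemma cup_labels s z S : cup s z S = true -> forall i, i \in s ->
  exists w w', [/\ f i w = true, f i w' = false,
    forall j, (z j <= w j <= z j + (j \in S))%N & forall j, (z j <= w' j <= z j + (j \in S))%N].
Proof.
elim: s z S => [//|i0 s IH] z S /= H i.
have : exists2 k, k \in S & (f i0 (up k z) (+) f i0 z) && cup s (up k z) (S :\ k).
  apply: contrapT => H'; move: H; rewrite big1// => k kS.
  by apply/negbTE/negP => hk; apply: H'; exists k.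
move=> [k kS /andP[fk ck]].
have zk j : (z j <= up k z j <= z j + (j \in S))%N.
  rewrite /up; case: (eqVneq j k) => [->|_]; last by rewrite leqnn leq_addr.
  by rewrite kS addn1 leqnSn leqnn.
have zz j : (z j <= z j <= z j + (j \in S))%N by rewrite leqnn leq_addr.
rewrite inE => /orP[/eqP->|/(IH _ _ ck)[w [w' [fw fw' hw hw']]]].
  by move: fk; case E1: (f i0 (up k z)); case E2: (f i0 z) => // _;
    [exists (up k z), z|exists z, (up k z)].
have sub v : (forall j, (up k z j <= v j <= up k z j + (j \in S :\ k))%N) ->
    forall j, (z j <= v j <= z j + (j \in S))%N.
  move=> hv j; have := hv j; rewrite /up in_setD1; case: (eqVneq j k) => [->|jk] /=.
    by rewrite kS addn0 addn1 => /andP[/ltnW -> ->].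
  by [].
by exists w, w'; split=> //; exact: sub.
Qed.

Lemma kuhn : exists2 z : 'I_n -> nat, (forall j, (z j < p)%N) & forall i,
  exists w w', [/\ f i w = true, f i w' = false,
    forall j, (z j <= w j <= (z j).+1)%N & forall j, (z j <= w' j <= (z j).+1)%N].
Proof.
have [n0|n0] := posnP n.
  have no (i : 'I_n) : False by case: i => m; rewrite n0.
  by exists (fun=> 0%N) => i; case: (no i).
have p0 : (0 < p)%N.
  rewrite lt0n; apply/eqP => p0.
  by have := @f0 (Ordinal n0) (fun=> 0%N) erefl; rewrite fp.
have := @boxsum_cup (enum 'I_n) (fun=> 0%N) (enum_uniq _) => /boxsum_ex[z cz hz].
have zp j : (z j < p)%N by case/orP: (hz j) => [//|/eqP->].
exists z => // i; have [w [w' [fw fw' hw hw']]] := cup_labels cz (mem_enum _ i : i \in enum 'I_n).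
exists w, w'; split=> // j.
  by have := hw j; rewrite inE mem_enum inE addn1.
by have := hw' j; rewrite inE mem_enum inE addn1.
Qed.

End Kuhn.

(** * The Poincare-Miranda theorem on a product of countably many intervals *)

Section HilbertCube.
Context {R : realType}.
Implicit Types (l r : nat -> R).

(** Tychonoff's theorem. A cluster point of the product topology is approached in finitely many
    coordinates at a time, for arbitrarily large n, and this is all that continuity in the sense of
    [cube_continuous] uses. *)
Lemma box_cluster l r (z : nat -> nat -> R) : (forall n i, l i <= z n i <= r i) ->
  exists zz : nat -> R, (forall i, l i <= zz i <= r i) /\
    forall (K : nat) (d : R) (m : nat), 0 < d ->
      exists2 n, (m <= n)%N & forall i, (i < K)%N -> `|z n i - zz i| < d.
Proof.
move=> zb.
pose X : topologicalType := prod_topology (fun _ : nat => R).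
pose A : set X := [set f | forall i, [set` `[l i, r i]] (f i)].
have cA : compact A.
  apply: (@tychonoff nat (fun _ : nat => R) (fun i => [set` `[l i, r i]])) => i.
  exact: segment_compact.
pose zX : nat -> X := z.
have FA : (zX @ \oo) A by exists 0%N => // n _ i /=; rewrite in_itv/=; exact: zb.
have [zz [Azz czz]] := cA (zX @ \oo) _ FA.
exists zz; split=> [i|K d m d0]; first by have := Azz i; rewrite /= in_itv.
pose B : set X := [set w | forall i, (i < K)%N -> `|w i - zz i| < d].
have FF : Filter (nbhs zz) by exact: nbhs_filter.
have nB : nbhs zz B.
  rewrite /B; elim: K {B} => [|K IH]; first by apply: (@filterE _ _ FF) => w i.
  have h : nbhs zz [set w : X | `|w K - zz K| < d].
    have := @proj_continuous nat (fun _ : nat => R) K zz.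
    move=> /cvgrPdist_lt /(_ d d0); apply: (@filterS _ _ FF) => w /=; by rewrite distrC.
  apply: (@filterS _ _ FF) (@filterI _ _ FF _ _ IH h) => w [/= h1 h2] i; rewrite ltnS leq_eqVlt => /predU1P[->//|].
  exact: h1.
have FM : (zX @ \oo) [set w | exists2 n, (m <= n)%N & w = zX n].
  by exists m => // n /= mn; exists n.
by have [w [[n mn ->] Bw]] := czz _ _ FM nB; exists n.
Qed.

Definition cube l r (z : nat -> R) := forall i, l i <= z i <= r i.

Definition cube_continuous l r (F : (nat -> R) -> R) := forall z, cube l r z ->
  forall e, 0 < e -> exists K d, 0 < d /\
    forall z', cube l r z' -> (forall j, (j < K)%N -> `|z' j - z j| < d) -> `|F z' - F z| < e.

Lemma hilbert_miranda l r (F : nat -> (nat -> R) -> R) : (forall i, l i <= r i) ->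
  (forall i, cube_continuous l r (F i)) ->
  (forall i z, cube l r z -> z i = l i -> 0 <= F i z) ->
  (forall i z, cube l r z -> z i = r i -> F i z <= 0) ->
  exists2 z, cube l r z & forall i, F i z = 0.
Proof.
move=> lr cF Fl Fr.
(* Coordinates at least n are frozen at l; the grid has mesh (r - l) / n.+1. *)
pose pt n (w : 'I_n -> nat) (i : nat) : R :=
  if insub i is Some j then l i + (r i - l i) * ((minn (w j) n.+1)%:R / n.+1%:R) else l i.
have frac01 (k n : nat) (q : R := (minn k n.+1)%:R / n.+1%:R) : 0 <= q <= 1.
  by rewrite /q divr_ge0//= ler_pdivrMr ?ltr0n// mul1r ler_nat geq_minr.
have ptc n w : cube l r (@pt n w).
  move=> i; rewrite /pt; case: insubP => [j _ _|_]; last by rewrite lexx lr.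
  have /andP[f0 f1] := frac01 (w j) n; have lri := lr i.
  by rewrite lerDl mulr_ge0 ?subr_ge0//= -lerBrDl ler_piMr ?subr_ge0.
have ptE n w (j : 'I_n) : @pt n w j = l j + (r j - l j) * ((minn (w j) n.+1)%:R / n.+1%:R).
  by rewrite /pt valK.
(* Kuhn's lemma prescribes the labels on the faces. The weak signs assumed of F there keep [labT]
   and [labF] valid for the imposed values. *)
pose lab n (i : 'I_n) (w : 'I_n -> nat) : bool :=
  if w i == 0%N then false else if w i == n.+1 then true else F i (pt n w) <= 0.
have l0 n i w : w i = 0%N -> @lab n i w = false by move=> wi; rewrite /lab wi.
have lp n i w : w i = n.+1 -> @lab n i w = true by move=> wi; rewrite /lab wi eqxx.
have labT n i w : @lab n i w = true -> F i (pt n w) <= 0.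
  rewrite /lab; case: (eqVneq (w i) 0%N) => // _; case: (eqVneq (w i) n.+1) => [wi _|//].
  apply: Fr => //; rewrite ptE wi minnn divff ?pnatr_eq0// mulr1; lra.
have labF n i w : @lab n i w = false -> 0 <= F i (pt n w).
  rewrite /lab; case: (eqVneq (w i) 0%N) => [wi _|_].
    by apply: Fl => //; rewrite ptE wi min0n mul0r mulr0 addr0.
  by case: (eqVneq (w i) n.+1) => // _; move/negbT; rewrite -ltNge => /ltW.
have Hex : forall n, exists z : 'I_n -> nat, (forall j, (z j < n.+1)%N) /\
    forall i, exists w w', [/\ lab n i w = true, lab n i w' = false,
      forall j, (z j <= w j <= (z j).+1)%N & forall j, (z j <= w' j <= (z j).+1)%N].
  by move=> n; have [z z1 z2] := kuhn (l0 n) (lp n); exists z.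
pose zz n := sval (cid (Hex n)); have Hz n := svalP (cid (Hex n)); rewrite -/(zz _) in Hz.
have [z [zc zcl]] := @box_cluster l r (fun n => pt n (zz n)) (fun n => ptc n (zz n)).
exists z => // i.
have near n (w : 'I_n -> nat) : (forall j, (zz n j <= w j <= (zz n j).+1)%N) ->
    forall j, `|pt n w j - pt n (zz n) j| <= (r j - l j) / n.+1%:R.
  move=> hw j; rewrite /pt; case: insubP => [k _ _|_]; last first.
    by rewrite subrr normr0 divr_ge0// subr_ge0 lr.
  have lrj := lr j; have /andP[h1 h2] := hw k.
  have -> : l j + (r j - l j) * ((minn (w k) n.+1)%:R / n.+1%:R) -
     (l j + (r j - l j) * ((minn (zz n k) n.+1)%:R / n.+1%:R)) =
     (r j - l j) / n.+1%:R * ((minn (w k) n.+1)%:R - (minn (zz n k) n.+1)%:R) by ring.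
  have c : (minn (zz n k) n.+1 <= minn (w k) n.+1 <= (minn (zz n k) n.+1).+1)%N.
    by have [zk _] := Hz n; have := zk k; lia.
  have /andP[c1 c2] := c.
  have q0 : 0 <= (r j - l j) / n.+1%:R by rewrite divr_ge0// subr_ge0.
  rewrite normrM (ger0_norm q0) ler_piMr// ger0_norm ?subr_ge0 ?ler_nat//.
  by rewrite lerBlDr addrC natr1 ler_nat.
apply/eqP; rewrite -normr_eq0; apply/eqP; apply/le_anti; rewrite normr_ge0 andbT.
apply/ler_addgt0Pr => e e0; rewrite add0r.
have [K [d [d0 Hd]]] := cF i z zc e e0.
pose B := \sum_(j < K) (r j - l j).
have Bj j : (j < K)%N -> r j - l j <= B.
  move=> jK; rewrite /B (bigD1 (Ordinal jK)) //= lerDl sumr_ge0// => k _.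
  by rewrite subr_ge0.
have B0 : 0 <= B by apply: sumr_ge0 => k _; rewrite subr_ge0.
(* The level n must exceed i, so that [F i] carries a label, and be large enough for the mesh in the
   K relevant coordinates to be below d / 2. *)
pose m := (maxn i.+1 (Num.truncn (B / (d / 2))).+1)%N.
have d2 : 0 < d / 2 by lra.
have [n mn Hn] := zcl K (d / 2) m d2.
have iN : (i < n)%N by apply: leq_trans mn; exact: leq_maxl.
have [_ /(_ (Ordinal iN))[w [w' [lw lw' hw hw']]]] := Hz n.
have mesh j : (j < K)%N -> (r j - l j) / n.+1%:R < d / 2.
  move=> jK; rewrite ltr_pdivrMr ?ltr0n//.
  apply: le_lt_trans (Bj j jK) _; rewrite mulrC -ltr_pdivrMr//.
  have b0 : 0 <= B / (d / 2) by rewrite divr_ge0// ltW.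
  have /andP[_ h] := truncn_itv b0; apply: lt_le_trans h _; rewrite ler_nat.
  by apply: leqW; apply: leq_trans mn; exact: leq_maxr.
have close v : (forall j, (zz n j <= v j <= (zz n j).+1)%N) -> `|F i (pt n v) - F i z| < e.
  move=> hv; apply: Hd => // j jK.
  have := near n v hv j; have := mesh j jK; have := Hn j jK => a b c; have {b c} bc := le_lt_trans c b.
  have -> : pt n v j - z j = (pt n v j - pt n (zz n) j) + (pt n (zz n) j - z j) by ring.
  by apply: le_lt_trans (ler_normD _ _) _; lra.
have := close w hw; have := close w' hw'; have := labT n _ w lw; have := labF n _ w' lw'.
rewrite /= !ltr_norml => a b /andP[c1 c2] /andP[c3 c4]; rewrite ler_norml; lra.
Qed.

End HilbertCube.

(** * Cosine coefficients and the Fourier series of L f *)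

Section Fourier.
Context {R : realType}.
Implicit Types (f g : R -> R) (s x y h m M : R) (k N : nat).

(** For even functions this is all of the Fourier data, since the sine coefficients vanish. The
    factor 1 / pi is left to the series. *)
Definition coef f k : R := Int `[- pi, pi] (fun s => cos (k%:R * s) * f s).

Lemma cosM_meas (c d : R) : measurable_fun setT (fun s : R => cos (c * s + d)).
Proof.
apply: continuous_measurable_fun => s.
apply: (@continuous_comp _ _ _ (fun s => c * s + d) cos); last exact: continuous_cos.
by apply: (der_cont (derD (derZ c (der_id s)) (derC d s))).
Qed.

Lemma sinM_meas (c d : R) : measurable_fun setT (fun s : R => sin (c * s + d)).
Proof.
apply: continuous_measurable_fun => s.
apply: (@continuous_comp _ _ _ (fun s => c * s + d) sin); last exact: continuous_sin.
by apply: (der_cont (derD (derZ c (der_id s)) (derC d s))).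
Qed.

Lemma cosk_per k x : cos (k%:R * (x + 2 * pi)) = cos (k%:R * x).
Proof.
have -> : k%:R * (x + 2 * pi) = k%:R * x + (pi *+ 2) *+ k.
  by rewrite mulrDr -(mulr_natl (pi *+ 2) k) -(mulr_natl pi 2).
by rewrite periodicn//; exact: cosD2pi.
Qed.

Lemma sink_per k x : sin (k%:R * (x + 2 * pi)) = sin (k%:R * x).
Proof.
have -> : k%:R * (x + 2 * pi) = k%:R * x + (pi *+ 2) *+ k.
  by rewrite mulrDr -(mulr_natl (pi *+ 2) k) -(mulr_natl pi 2).
by rewrite periodicn//; exact: sinD2pi.
Qed.

Lemma abs_cos_le1 x : `|cos x| <= 1.
Proof. by rewrite ler_norml cos_geN1 cos_le1. Qed.

Lemma abs_sin_le1 x : `|sin x| <= 1.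
Proof. by rewrite ler_norml sin_geN1 sin_le1. Qed.

Lemma bper_integ f M a b : bper f M -> integ `[a, b] f.
Proof. by move=> [mf _ fM]; apply: (integ_bnd (M := M)) => //; apply: measurable_funTS. Qed.

Lemma cos_integ f M k x a b : bper f M -> integ `[a, b] (fun s => cos (k%:R * s + x) * f s).
Proof.
move=> bf; apply: (integ_bnd (M := M)).
  by apply: measurable_funTS; apply: measurable_funM; [exact: cosM_meas|case: bf].
move=> s _; rewrite normrM -[M]mul1r; apply: ler_pM => //; first exact: abs_cos_le1.
by case: bf.
Qed.

Lemma sin_integ f M k x a b : bper f M -> integ `[a, b] (fun s => sin (k%:R * s + x) * f s).
Proof.
move=> bf; apply: (integ_bnd (M := M)).
  by apply: measurable_funTS; apply: measurable_funM; [exact: sinM_meas|case: bf].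
move=> s _; rewrite normrM -[M]mul1r; apply: ler_pM => //; first exact: abs_sin_le1.
by case: bf.
Qed.

Lemma coef_integ f M k a b : bper f M -> integ `[a, b] (fun s => cos (k%:R * s) * f s).
Proof. by move=> /(@cos_integ f M k 0 a b); apply: eq_integ => s _; rewrite addr0. Qed.

Lemma sinf_integ f M k a b : bper f M -> integ `[a, b] (fun s => sin (k%:R * s) * f s).
Proof. by move=> /(@sin_integ f M k 0 a b); apply: eq_integ => s _; rewrite addr0. Qed.

Lemma sinf0 f M k : bper f M -> (forall x, f (- x) = f x) ->
  Int `[- pi, pi] (fun s => sin (k%:R * s) * f s) = 0.
Proof.
move=> bf ef; have [mf _ _] := bf.
have mg : measurable_fun setT (fun s => sin (k%:R * s) * f s).
  apply: measurable_funM => //; have := sinM_meas k%:R 0.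
  by under eq_fun do rewrite addr0.
rewrite (Int_fold (pi_ge0 R) mg (sinf_integ k _ _ bf)).2.
rewrite (@eq_Int _ _ _ (fun=> 0)) ?Int_cst ?pi_ge0 ?mul0r//.
by move=> s _; rewrite mulrN sinN ef mulNr subrr.
Qed.

Lemma coef_phase f M k c : bper f M -> (forall x, f (- x) = f x) ->
  Int `[- pi, pi] (fun s => cos (k%:R * s + c) * f s) = cos c * coef f k.
Proof.
move=> bf ef.
rewrite (@eq_Int _ _ _ (fun s => cos c * (cos (k%:R * s) * f s) - sin c * (sin (k%:R * s) * f s))).
  rewrite IntB; [|by apply: integZ; exact: coef_integ bf|by apply: integZ; exact: sinf_integ bf].
  rewrite !IntZ; [|exact: sinf_integ bf|exact: coef_integ bf].
  by rewrite (sinf0 k bf ef) mulr0 subr0.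
by move=> s _; rewrite cosD; ring.
Qed.

Lemma coef_shift f M k x : bper f M -> (forall x, f (- x) = f x) ->
  Int `[- pi, pi] (fun s => cos (k%:R * s) * f (x + s)) = cos (k%:R * x) * coef f k.
Proof.
move=> bf ef; have [mf pf _] := bf.
have := coef_phase k (- (k%:R * x)) bf ef; rewrite cosN => <-.
have mG : measurable_fun setT (fun s => cos (k%:R * s - k%:R * x) * f s).
  by apply: measurable_funM => //; exact: cosM_meas.
have pG : periodic (fun s => cos (k%:R * s - k%:R * x) * f s) (2 * pi).
  by move=> s; rewrite pf -!mulrBr addrAC cosk_per.
rewrite -(Int_per_shift x mG pG (cos_integ k _ _ _ bf)).2.
apply: eq_Int => s _; rewrite [s + x]addrC; congr (cos _ * _); ring.
Qed.

Lemma Int_cosk (k : nat) : (0 < k)%N -> Int `[- pi, pi] (fun s : R => cos (k%:R * s)) = 0.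
Proof.
move=> k0; have k0' : k%:R != 0 :> R by rewrite pnatr_eq0 -lt0n.
have dF (s : R) : der (fun s => k%:R^-1 * sin (k%:R * s)) s (cos (k%:R * s)).
  have H := derZ k%:R^-1 (der_comp (derZ k%:R (der_id s)) (der_sin (k%:R * s))).
  by apply: der_eq H _; rewrite mulr1 mulrC mulfK.
rewrite (Int_FTC _ dF).
- have e := sink_per k (- pi : R).
  have q : - pi + 2 * pi = pi :> R by ring.
  by rewrite q in e; rewrite e subrr.
- by have := pi_ge0 R; lra.
- by move=> s; apply: (der_cont (der_comp (derZ k%:R (der_id s)) (der_cos (k%:R * s)))).
Qed.

Lemma cosk_integ k a b : integ `[a, b] (fun s : R => cos (k%:R * s)).
Proof.
apply: (integ_bnd (M := 1)); last by move=> s _; exact: abs_cos_le1.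
apply: measurable_funTS; have := cosM_meas k%:R 0; by under eq_fun do rewrite addr0.
Qed.

Lemma Int_cosk_cosj k (j : nat) : (0 < j)%N ->
  Int `[- pi, pi] (fun s : R => cos (k%:R * s) * cos (j%:R * s)) = if k == j then pi else 0.
Proof.
move=> j0; pose d := (maxn k j - minn k j)%N.
have e (s : R) : cos (k%:R * s) * cos (j%:R * s) =
    2^-1 * cos ((k + j)%N%:R * s) + 2^-1 * cos (d%:R * s).
  have -> : cos (d%:R * s) = cos (k%:R * s - j%:R * s).
    rewrite /d; have [kj|jk] := leqP k j.
      by rewrite natrB// mulrBl -cosN opprB.
    by rewrite natrB ?(ltnW jk)// mulrBl.
  by rewrite natrD mulrDl cosD cosB; lra.
rewrite (eq_Int (g := fun s => 2^-1 * cos ((k + j)%N%:R * s) + 2^-1 * cos (d%:R * s))) => [|s _]; last exact: e.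
rewrite IntD; [|by apply: integZ; exact: cosk_integ|by apply: integZ; exact: cosk_integ].
rewrite !IntZ; [|exact: cosk_integ|exact: cosk_integ].
rewrite Int_cosk ?addn_gt0 ?j0 ?orbT// mulr0 add0r.
have [kj|kj] := eqVneq k j.
  have -> : d = 0%N by rewrite /d kj; lia.
  rewrite (eq_Int (g := fun=> 1)) => [|s _]; last by rewrite mul0r cos0.
  by rewrite Int_cst; [lra|have := pi_ge0 R; lra].
by rewrite Int_cosk ?mulr0// /d; move/eqP: kj; lia.
Qed.

Context (alpha : R) (h0 : 0 < alpha) (h1 : alpha < 1).
Notation Ker := (Ker alpha).
Notation Lop := (Lop alpha).
Notation KN := (KN alpha).

Definition PN f N x : R := pi^-1 * \sum_(1 <= k < N.+1) k%:R `^ (- alpha) * (cos (k%:R * x) * coef f k).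

Lemma KN_meas N : measurable_fun setT (KN N).
Proof.
rewrite /KN; apply: measurable_funM => //; elim: N => [|N IH].
  by rewrite (_ : (fun x => _) = cst 0)//; apply/funext => s; rewrite big_geq.
rewrite (_ : (fun x => _) = (fun x => \sum_(1 <= k < N.+1) k%:R `^ (- alpha) * cos (k%:R * x) +
    N.+1%:R `^ (- alpha) * cos (N.+1%:R * x))); last by apply/funext => s; rewrite big_nat_recr.
apply: measurable_funD => //; apply: measurable_funM => //.
by have := cosM_meas N.+1%:R 0; under eq_fun do rewrite addr0.
Qed.

Lemma PN_Int f M N x : bper f M -> (forall x, f (- x) = f x) ->
  PN f N x = Int `[- pi, pi] (fun s => KN N s * f (x + s)).
Proof.
move=> bf ef.
have bfx : bper (fun s => f (x + s)) M.
  case: bf => mf pf fM; split=> [|s|s]; [exact: meas_shift|by rewrite addrA pf|exact: fM].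
have iF k : integ `[- pi, pi] (fun s => k%:R `^ (- alpha) * (cos (k%:R * s) * f (x + s))).
  by apply: integZ; exact: coef_integ bfx.
have [e i] := Int_sum (index_iota 1 N.+1) iF.
rewrite (eq_Int (g := fun s => pi^-1 * \sum_(1 <= k < N.+1) k%:R `^ (- alpha) * (cos (k%:R * s) * f (x + s)))).
  rewrite IntZ// e; congr (_ * _); apply: eq_bigr => k _.
  rewrite IntZ; last exact: coef_integ bfx.
  by rewrite (coef_shift k x bf ef).
by move=> s _; rewrite /KN -mulrA mulr_suml; congr (_ * _); apply: eq_bigr => k _; rewrite mulrA.
Qed.

(** Pointwise convergence for merely bounded f: by [KN_bound] the partial kernels share the
    integrable majorant C s^(alpha - 1), so dominated convergence applies to the convolution. *)
Lemma PN_cvg f M x : bper f M -> (forall x, f (- x) = f x) ->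
  PN f N x @[N --> \oo] --> Lop f x.
Proof.
move=> bf ef; have [mf _ fM] := bf; have M0 := bper_ge0 bf.
have [C C0 HC] := KN_bound h0 h1; have [CK CK0 HK] := Ker_bound h0 h1.
under eq_fun do rewrite (PN_Int _ _ bf ef).
(* The integrals are folded onto ]0, pi], which leaves out s = 0, where the partial kernels
   diverge. *)
have fold (k : R -> R) : measurable_fun setT k -> (forall s, k (- s) = k s) ->
    integ `[- pi, pi] (fun s => k s * f (x + s)) ->
    Int `[- pi, pi] (fun s => k s * f (x + s)) = Int `]0, pi] (fun s => k s * (f (x + s) + f (x - s))).
  move=> mk ek ik.
  have mG : measurable_fun setT (fun s => k s * f (x + s)).
    by apply: measurable_funM => //; exact: meas_shift.
  have [i1 ->] := Int_fold (pi_ge0 R) mG ik.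
  rewrite (eq_Int (g := fun s => k s * (f (x + s) + f (x - s)))) => [|s _]; last by rewrite ek; ring.
  rewrite !IntE Rintegral_itv_obnd_cbnd//.
  have i2 : integ `[0, pi] (fun s => k s * (f (x + s) + f (x - s))).
    by apply: eq_integ i1 => s _; rewrite ek; ring.
  by apply: (@integS _ _ _ _ _ i2) => s; rewrite !in_itv/= => /andP[/ltW-> ->].
have KNi N : integ `[- pi, pi] (fun s => KN N s * f (x + s)).
  have bfx : bper (fun s => f (x + s)) M.
    case: bf => mf' pf fM'; split=> [|s|s]; [exact: meas_shift|by rewrite addrA pf|exact: fM'].
  apply: (integM (M := M)); [|by apply: measurable_funTS; case: bfx|by move=> s _; exact: fM].
  apply: integZ; apply: (Int_sum _ _).2 => k; apply: integZ; exact: cosk_integ.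
rewrite /Lop (fold Ker (Ker_meas h0 h1) (KerN alpha) (Lop_integ h0 h1 x bf)).
have -> : (fun N => Int `[- pi, pi] (fun s => KN N s * f (x + s))) =
    (fun N => Int `]0, pi] (fun s => KN N s * (f (x + s) + f (x - s)))).
  apply/funext => N; apply: fold; [exact: KN_meas| |exact: KNi].
  by move=> s; rewrite /KN; congr (_ * _); apply: eq_bigr => k _; rewrite mulrN cosN.
have [ip _] := integ_powR0 (pi_gt0 R) h0 h1.
have ig : integ `]0, pi] (fun s => C * (2 * M) * s `^ (alpha - 1)).
  apply: (@integS _ _ `[0, pi]); last exact: integZ.
  by move=> s; rewrite !in_itv/= => /andP[/ltW-> ->].
have f2 s : `|f (x + s) + f (x - s)| <= 2 * M.
  by apply: le_trans (ler_normD _ _) _; have := fM (x + s); have := fM (x - s); lra.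
have D1 N : measurable_fun [set` `]0, pi]] (fun s => KN N s * (f (x + s) + f (x - s))).
  apply: measurable_funTS; apply: measurable_funM; first exact: KN_meas.
  apply: measurable_funD; first exact: meas_shift.
  by apply: measurableT_comp => //; exact: measurable_funB.
have D2 : {in `]0, pi], forall s, KN N s * (f (x + s) + f (x - s)) @[N --> \oo] -->
    Ker s * (f (x + s) + f (x - s))}.
  move=> s; rewrite in_itv/= => /andP[s0 sp]; apply: cvgM; last exact: cvg_cst.
  have as0 : 0 < `|s| by rewrite gtr0_norm.
  have asp : `|s| <= pi by rewrite gtr0_norm.
  rewrite KerE ?cos_lt1//; exact: KN_cvg.
have D3 N : {in `]0, pi], forall s, `|KN N s * (f (x + s) + f (x - s))| <=
    C * (2 * M) * s `^ (alpha - 1)}.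
  move=> s; rewrite in_itv/= => /andP[s0 sp].
  have as0 : 0 < `|s| by rewrite gtr0_norm.
  have asp : `|s| <= pi by rewrite gtr0_norm.
  have [kb _ _ _] := HC N s as0 asp; rewrite (gtr0_norm s0) in kb.
  by rewrite normrM mulrAC; apply: ler_pM.
by have [] := Int_dct D1 D2 ig D3.
Qed.

Lemma PN_bound : exists2 C : R, 0 < C & forall f M N x, bper f M -> (forall x, f (- x) = f x) ->
  `|PN f N x| <= C * M.
Proof.
have [C C0 HC] := KN_bound h0 h1.
have [ip ep] := abs_powR_integ h0 h1 (pi_gt0 R).
have I0 : 0 <= C * Int `[- pi, pi] (fun s => `|s| `^ (alpha - 1)).
  by rewrite mulr_ge0 ?(ltW C0)//; apply: Int_ge0 => s _; exact: powR_ge0.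
exists (C * Int `[- pi, pi] (fun s => `|s| `^ (alpha - 1)) + 1); first by rewrite ltr_wpDl.
move=> f M N x bf ef; have M0 := bper_ge0 bf; rewrite (PN_Int _ _ bf ef).
have bfx : bper (fun s => f (x + s)) M.
  case: bf => mf' pf fM'; split=> [|s|s]; [exact: meas_shift|by rewrite addrA pf|exact: fM'].
have iK : integ `[- pi, pi] (KN N).
  apply: integZ; apply: (Int_sum _ _).2 => k; apply: integZ; exact: cosk_integ.
have i1 : integ `[- pi, pi] (fun s => KN N s * f (x + s)).
  apply: (integM (M := M)) => //; first by apply: measurable_funTS; case: bfx.
  by move=> s _; case: bfx.
apply: le_trans (Int_norm i1) _.
apply: (@le_trans _ _ (Int `[- pi, pi] (fun s => C * M * `|s| `^ (alpha - 1)))).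
  apply: (@Int_le_except _ _ _ _ 0); [exact: integ_norm|exact: integZ|].
  move=> s; rewrite in_itv/= => sp s0; have as0 : 0 < `|s| by rewrite normr_gt0.
  have asp : `|s| <= pi by rewrite ler_norml.
  have [kb _ _ _] := HC N s as0 asp.
  by rewrite normrM mulrAC; apply: ler_pM => //; case: bfx.
rewrite IntZ//; have := ip => _; rewrite [leRHS]mulrDl mul1r.
by rewrite mulrAC lerDl.
Qed.

Lemma coef_PN f M N k : bper f M -> (forall x, f (- x) = f x) ->
  Int `[- pi, pi] (fun s => cos (k%:R * s) * PN f N s) =
  if (0 < k <= N)%N then k%:R `^ (- alpha) * coef f k else 0.
Proof.
move=> bf ef.
pose G j (s : R) := (pi^-1 * (j%:R `^ (- alpha) * coef f j)) * (cos (k%:R * s) * cos (j%:R * s)).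
have icc j : integ `[- pi, pi] (fun s : R => cos (k%:R * s) * cos (j%:R * s)).
  apply: (integM (M := 1)); first exact: cosk_integ.
    exact: integ_meas (cosk_integ _ _ _).
  by move=> s _; exact: abs_cos_le1.
have iG j : integ `[- pi, pi] (G j) by apply: integZ; exact: icc.
have [e i] := Int_sum (index_iota 1 N.+1) iG.
rewrite (eq_Int (g := fun s => \sum_(1 <= j < N.+1) G j s)); last first.
  move=> s _; rewrite /PN mulrCA !mulr_sumr; apply: eq_bigr => j _; rewrite /G; ring.
rewrite e; have p0 : pi != 0 :> R by rewrite gt_eqF// pi_gt0.
have H j : (1 <= j < N.+1)%N -> Int `[- pi, pi] (G j) = if k == j then k%:R `^ (- alpha) * coef f k else 0.
  move=> /andP[j1 _]; rewrite /G IntZ; last exact: icc.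
  rewrite Int_cosk_cosj//; case: eqVneq => [->|_]; last by rewrite mulr0.
  by rewrite mulrC mulrA mulfV// mul1r.
rewrite big_nat (eq_bigr _ H) -big_nat -big_mkcond /=.
case: ifP => [/andP[k0 kN]|kN].
  rewrite (big_cat_nat (n := k)) //=; last by rewrite ltnW.
  rewrite big_nat_cond big1 ?add0r; last by move=> j /andP[/andP[_ jk] /eqP kj]; move: jk; rewrite kj ltnn.
  rewrite big_ltn_cond ?ltnS// eqxx big_nat_cond big1 ?addr0// => j /andP[/andP[kj _] /eqP e2].
  by move: kj; rewrite e2 ltnn.
rewrite big_nat_cond big1// => j /andP[/andP[j1 jN] /eqP kj].
by move: kN; rewrite kj j1 -ltnS jN.
Qed.

Lemma coef_Lop f M k : bper f M -> (forall x, f (- x) = f x) ->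
  coef (Lop f) k = if (0 < k)%N then k%:R `^ (- alpha) * coef f k else 0.
Proof.
move=> bf ef; have [C C0 HC] := PN_bound.
have mPN N : measurable_fun setT (PN f N).
  rewrite /PN; apply: measurable_funM => //; elim: N => [|N IH].
    by rewrite (_ : (fun x => _) = cst 0)//; apply/funext => s; rewrite big_geq.
  rewrite (_ : (fun x => _) = (fun x => \sum_(1 <= k < N.+1) k%:R `^ (- alpha) * (cos (k%:R * x) * coef f k) +
      N.+1%:R `^ (- alpha) * (cos (N.+1%:R * x) * coef f N.+1))); last by apply/funext => s; rewrite big_nat_recr.
  apply: measurable_funD => //; apply: measurable_funM => //; apply: measurable_funM => //.
  by have := cosM_meas N.+1%:R 0; under eq_fun do rewrite addr0.
have mc : measurable_fun setT (fun s : R => cos (k%:R * s)).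
  by have := cosM_meas k%:R 0; under eq_fun do rewrite addr0.
have D1 N : measurable_fun [set` `[- pi, pi]] (fun s => cos (k%:R * s) * PN f N s).
  by apply: measurable_funTS; apply: measurable_funM.
have D2 : {in `[- pi, pi], forall s, cos (k%:R * s) * PN f N s @[N --> \oo] --> cos (k%:R * s) * Lop f s}.
  by move=> s _; apply: cvgM; [exact: cvg_cst|exact: PN_cvg bf ef].
have D3 N : {in `[- pi, pi], forall s, `|cos (k%:R * s) * PN f N s| <= C * M}.
  move=> s _; rewrite normrM -[C * M]mul1r; apply: ler_pM => //; first exact: abs_cos_le1.
  exact: HC.
have [_ H] := Int_dct D1 D2 (integ_cst _ _ _) D3.
have {}H : Int `[- pi, pi] (fun s => cos (k%:R * s) * PN f N s) @[N --> \oo] --> coef (Lop f) k := H.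
apply: (cvg_unique _ H) => //.
apply: cvg_near_cst; exists k => // N /= kN.
by rewrite (coef_PN _ _ bf ef) kN andbT.
Qed.

End Fourier.

(** * Even periodic profiles that are nondecreasing on [0, pi] *)

Section Profile.
Context {R : realType} (alpha : R) (h0 : 0 < alpha) (h1 : alpha < 1).
Implicit Types (f g : R -> R) (s x y h m M : R) (k N : nat).
Notation Lop := (Lop alpha).

(** The same y serves all even periodic functions, so that an identity between several of them can
    be transported from [0, pi] in one stroke. *)
Lemma fold_ex x : exists2 y, 0 <= y <= pi & forall f : R -> R,
  (forall x, f (- x) = f x) -> periodic f (2 * pi) -> f x = f y.
Proof.
have p0 : 0 < pi :> R := pi_gt0 R.
pose z : int := Num.floor (x / (2 * pi)); pose d := x - 2 * pi * z%:~R.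
have /andP[d0 d2] : 0 <= d <= 2 * pi.
  have /andP[z1 z2] : z%:~R <= x / (2 * pi) < (z + 1)%:~R by rewrite floor_itv.
  move: z1 z2; rewrite intrD ler_pdivlMr ?ltr_pdivrMr ?mulr_gt0// => z1 z2.
  by rewrite /d; nra.
have e f : periodic f (2 * pi) -> f x = f d.
  by move=> pf; rewrite -(per_int z d pf) /d; congr f; ring.
have [dp|dp] := leP d pi; first by exists d; rewrite ?d0// => f _ /e.
exists (2 * pi - d) => [|f ef pf]; first lra.
by rewrite e// -ef -pf; congr f; ring.
Qed.

Definition prof f M := [/\ bper f M, forall x, f (- x) = f x &
  forall x y, 0 <= x -> x <= y -> y <= pi -> f x <= f y].

(** |m - s| is no farther from 2 pi Z than m + s is: it is at most m + s and at most 2 pi - (m + s).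
    Together with the positive weight in [Lop_diff] this makes L preserve profiles. *)
Lemma prof_diff_ge0 f M m s : prof f M -> 0 <= m <= pi -> 0 <= s <= pi -> f (m - s) <= f (m + s).
Proof.
move=> [[_ pf _] ef inc] /andP[m0 mp] /andP[s0 sp].
have -> : f (m - s) = f `|m - s|.
  by case: (ger0P (m - s)) => // _; rewrite ef.
have [a0 a1 a2] : [/\ 0 <= `|m - s|, `|m - s| <= m + s & `|m - s| <= 2 * pi - (m + s)].
  by rewrite normr_ge0 !ler_norml; split=> //; lra.
have [ms|ms] := leP (m + s) pi; first exact: inc.
have -> : f (m + s) = f (2 * pi - (m + s)) by rewrite -ef -pf; congr f; ring.
by apply: inc => //; lra.
Qed.

Lemma prof_le_pi f M x : prof f M -> f x <= f pi.
Proof.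
move=> [[_ pf _] ef inc]; have [y /andP[y0 yp] ->//] := fold_ex x.
exact: inc.
Qed.

Lemma coef_shift_phase f M k x c : bper f M -> (forall x, f (- x) = f x) ->
  Int `[- pi, pi] (fun s => cos (k%:R * s + c) * f (x + s)) = cos (c - k%:R * x) * coef f k.
Proof.
move=> bf ef; have [mf pf _] := bf.
rewrite -(coef_phase k (c - k%:R * x) bf ef).
have mG : measurable_fun setT (fun s => cos (k%:R * s + (c - k%:R * x)) * f s).
  by apply: measurable_funM => //; exact: cosM_meas.
have pG : periodic (fun s => cos (k%:R * s + (c - k%:R * x)) * f s) (2 * pi).
  move=> s; rewrite pf; congr (_ * _).
  rewrite ![k%:R * _ + _]addrC !cosD; congr (_ * _ - _ * _); [exact: cosk_per|exact: sink_per].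
rewrite -(Int_per_shift x mG pG (cos_integ k _ _ _ bf)).2.
apply: eq_Int => s _; rewrite [s + x]addrC; congr (cos _ * _); ring.
Qed.

Lemma prof_sin f M m : prof f M ->
  Int `[0, pi] (fun s => sin s * (f (m + s) - f (m - s))) = - sin m * coef f 1.
Proof.
move=> [bf ef _]; have [mf pf fM] := bf.
have e := coef_shift_phase 1 m (- (pi / 2)) bf ef.
have ms : measurable_fun setT (fun s => sin s * f (m + s)).
  by apply: measurable_funM; [exact: continuous_measurable_fun (@continuous_sin R)|exact: meas_shift].
have iG : integ `[- pi, pi] (fun s => sin s * f (m + s)).
  apply: (integ_bnd (M := M)); first exact: measurable_funTS.
  move=> s _; rewrite normrM -[M]mul1r; apply: ler_pM => //; exact: abs_sin_le1.
transitivity (Int `[- pi, pi] (fun s => sin s * f (m + s))).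
  rewrite (Int_fold (pi_ge0 R) ms iG).2; apply: eq_Int => s _.
  by rewrite sinN; ring.
transitivity (Int `[- pi, pi] (fun s => cos (1%:R * s - pi / 2) * f (m + s))).
  by apply: eq_Int => s _; rewrite mul1r cosB cos_pihalf sin_pihalf mulr0 add0r mulr1.
rewrite e; congr (_ * _).
by rewrite mul1r -opprD cosN cosD cos_pihalf sin_pihalf mul0r sub0r mul1r.
Qed.

(** The lower bound of [wt_ge] separates s from h, and sin s integrated against the symmetric
    increments of f is a multiple of its first cosine coefficient, by [prof_sin]. So one coefficient
    controls the growth of L f from below. *)
Lemma Lop_test : exists2 d : R, 0 < d & forall f M m h, prof f M -> 0 <= m <= pi -> 0 <= h <= pi ->
  d * sin h * sin m * (- coef f 1) <= Lop f (m + h) - Lop f (m - h).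
Proof.
have [d d0 H] := wt_ge h0 h1; exists (d * 2); first by rewrite mulr_gt0.
move=> f M m h pf hm hh; have [bf _ _] := pf; rewrite (Lop_diff h0 h1 m h bf).
have iD : integ `[0, pi] (fun s => sin s * (f (m + s) - f (m - s))).
  case: bf => mf _ fM; apply: (integ_bnd (M := 2 * M)).
    apply: measurable_funTS; apply: measurable_funM; first exact: continuous_measurable_fun (@continuous_sin R).
    apply: measurable_funB; first exact: meas_shift.
    by apply: measurableT_comp => //; exact: measurable_funB.
  move=> s _; rewrite normrM -[2 * M]mul1r; apply: ler_pM => //; first exact: abs_sin_le1.
  by apply: le_trans (ler_normB _ _) _; have := fM (m + s); have := fM (m - s); lra.
have -> : d * 2 * sin h * sin m * - coef f 1 =
    Int `[0, pi] (fun s => d * 2 * sin h * (sin s * (f (m + s) - f (m - s)))).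
  by rewrite IntZ// (prof_sin m pf); ring.
apply: (@Int_le_except _ _ _ _ h); [exact: integZ|exact: wtf_integ bf|].
move=> s; rewrite in_itv/= => hs sh.
have D0 : 0 <= f (m + s) - f (m - s) by rewrite subr_ge0; exact: prof_diff_ge0 pf hm hs.
have := ler_wpM2r D0 (H h s hs hh sh); lra.
Qed.

(** Folding about pi / 2, where cos changes sign, turns the coefficient into an integral of
    increments of f with the weight cos s >= 0; it is the minus sign that makes it nonnegative for
    profiles. *)
Lemma prof_coef1 f M : prof f M ->
  - coef f 1 = 2 * Int `[0, pi / 2] (fun s => cos s * (f (pi - s) - f s)) /\
  integ `[0, pi / 2] (fun s => cos s * (f (pi - s) - f s)).
Proof.
move=> [bf ef _]; have [mf pf fM] := bf.
have mc : measurable_fun setT (fun s => cos (1%:R * s) * f s).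
  by apply: measurable_funM => //; have := @cosM_meas R 1%:R 0; under eq_fun do rewrite addr0.
have p0 := pi_ge0 R; have p2 : 0 <= pi / 2 :> R by lra.
have p3 : pi / 2 <= pi :> R by lra.
have i0 a b : integ `[a, b] (fun s => cos (1%:R * s) * f s) by exact: coef_integ bf.
have eI : coef f 1 = 2 * Int `[0, pi] (fun s => cos (1%:R * s) * f s).
  rewrite /coef (Int_fold p0 mc (i0 _ _)).2 -IntZ//; apply: eq_Int => s _.
  by rewrite mulrN cosN ef; ring.
have i1 : integ `[0, pi / 2] (fun s => cos (1%:R * (pi - s)) * f (pi - s)).
  apply: (integ_bnd (M := M)).
    apply: measurable_funTS; apply: (measurableT_comp mc); exact: measurable_funB.
  by move=> s _; rewrite normrM -[M]mul1r; apply: ler_pM => //; exact: abs_cos_le1.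
have e2 : Int `[pi / 2, pi] (fun s => cos (1%:R * s) * f s) =
    Int `[0, pi / 2] (fun s => cos (1%:R * (pi - s)) * f (pi - s)).
  have m2 : measurable_fun setT (fun s => cos (1%:R * (pi + s)) * f (pi + s)).
    by apply: (measurableT_comp mc); exact: measurable_funD.
  have [i2 <-] := @Int_refl R 0 (pi / 2) (fun s => cos (1%:R * (pi + s)) * f (pi + s)) m2 i1.
  rewrite oppr0 in i2 *.
  have i4 : integ `[- (pi / 2), 0] (fun s => cos (1%:R * (s + pi)) * f (s + pi)).
    by apply: eq_integ i2 => s _; rewrite [s + pi]addrC.
  have [_ e4] := @Int_shift R _ _ _ (fun s => cos (1%:R * s) * f s) mc i4.
  have q : - (pi / 2) + pi = pi / 2 :> R by lra.
  rewrite q add0r in e4; rewrite e4.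
  by apply: eq_Int => s _; rewrite [s + pi]addrC.
have e3 : {in `[0, pi / 2], (fun s => - (cos (1%:R * s) * f s) - cos (1%:R * (pi - s)) * f (pi - s)) =1
     (fun s => cos s * (f (pi - s) - f s))}.
  by move=> s _; rewrite !mul1r cosB cospi sinpi; ring.
have i3 := integB (integN (i0 0 (pi / 2))) i1.
split; last exact: eq_integ e3 i3.
rewrite -(eq_Int e3) IntB; [|exact: integN|by []].
rewrite IntN// -e2 eI (Int_split p2 p3)//; ring.
Qed.

Lemma prof_coef1_ge0 f M : prof f M -> 0 <= - coef f 1.
Proof.
move=> pf; have [-> _] := prof_coef1 pf; rewrite mulr_ge0//; apply: Int_ge0 => s.
rewrite in_itv/= => hs; have p0 := pi_gt0 R; rewrite mulr_ge0//.
  by apply: cos_ge0_pihalf; lra.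
by rewrite subr_ge0; case: pf => _ _; apply; lra.
Qed.

Lemma prof_coef1_gt0 f M : prof f M -> continuous f -> f 0 < f pi -> 0 < - coef f 1.
Proof.
move=> pf cf f0p; have [-> i] := prof_coef1 pf; rewrite mulr_gt0//.
have p2 := @pi_ge2 R; set e := (f pi - f 0) / 3.
have e0 : 0 < e by rewrite /e; lra.
have [d1 d10 H1] : exists2 d, 0 < d & forall s, `|s| < d -> `|f 0 - f s| < e.
  have /cvgrPdist_lt /(_ e e0)/nbhs_ballP[d /= d0 H] := cf 0.
  by exists d => // s sd; apply: H; rewrite /ball/= sub0r normrN.
have [d2 d20 H2] : exists2 d, 0 < d & forall s, `|s| < d -> `|f pi - f (pi - s)| < e.
  have /cvgrPdist_lt /(_ e e0)/nbhs_ballP[d /= d0 H] := cf pi.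
  by exists d => // s sd; apply: H; rewrite /ball/= opprB addrC subrK.
pose d := Num.min (Num.min d1 d2) 1 / 2.
have d0 : 0 < d by rewrite /d divr_gt0// !lt_min d10 d20 ltr01.
have [da db dc] : [/\ d < d1, d < d2 & d <= 1 / 2].
  have : Num.min (Num.min d1 d2) 1 <= Num.min d1 d2 by rewrite ge_min lexx.
  have : Num.min d1 d2 <= d1 by rewrite ge_min lexx.
  have : Num.min d1 d2 <= d2 by rewrite ge_min lexx orbT.
  have : Num.min (Num.min d1 d2) 1 <= 1 by rewrite ge_min lexx orbT.
  by move: d0; rewrite /d; split; lra.
have pos : {in `[0, pi / 2], forall s, 0 <= cos s * (f (pi - s) - f s)}.
  move=> s; rewrite in_itv/= => hs; rewrite mulr_ge0//.
    by apply: cos_ge0_pihalf; lra.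
  by rewrite subr_ge0; case: pf => _ _; apply; lra.
have i' : integ `[0, d] (fun s => cos s * (f (pi - s) - f s)).
  by apply: integS i => s; rewrite !in_itv/= => /andP[-> h] /=; lra.
have le1 : Int `[0, d] (fun s => cos s * (f (pi - s) - f s)) <=
    Int `[0, pi / 2] (fun s => cos s * (f (pi - s) - f s)).
  by apply: Int_sub => //; lra.
apply: lt_le_trans le1.
apply: (@lt_le_trans _ _ (Int `[0, d] (fun=> e / 2))).
  by rewrite Int_cst ?(ltW d0)// subr0 mulr_gt0// divr_gt0.
apply: Int_le => //; first exact: integ_cst.
move=> s; rewrite in_itv/= => /andP[s0 sd].
have as1 : `|s| < d1 by rewrite ger0_norm//; lra.
have as2 : `|s| < d2 by rewrite ger0_norm//; lra.
have := H1 s as1; have := H2 s as2; rewrite !ltr_norml => /andP[a1 a2] /andP[a3 a4].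
have fs : e <= f (pi - s) - f s by rewrite /e in a1 a2 a3 a4 *; lra.
have cs : 1 / 2 <= cos s by have := cos_ge s0; nra.
rewrite mulrC; have := ler_pM _ _ cs fs; move=> /(_ _ (ltW e0)); rewrite mulrC => h.
by apply: le_trans (h _); clear - h0 h1 e0; lra.
Qed.

(** Shifting f by h = pi / (2 k) to either side gives the same coefficient with opposite phases, so
    twice the coefficient is an integral against f (h + s) - f (s - h). For a profile this
    difference has one sign on [0, pi], and its integral telescopes to two intervals of length 2
    h. *)
Lemma coef_bound f M k : prof f M -> (forall x, 0 <= f x) -> (0 < k)%N -> `|coef f k| <= pi * M / k%:R.
Proof.
move=> pf fge0 k0; have [bf ef _] := pf; have [mf _ fM] := bf.
have k0' : 0 < k%:R :> R by rewrite ltr0n.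
have k1 : 1 <= k%:R :> R by rewrite ler1n.
have p0 : 0 < pi :> R := pi_gt0 R.
pose h : R := pi / 2 / k%:R.
have hh0 : 0 < h by rewrite divr_gt0// divr_gt0.
have hp : h <= pi / 2 by rewrite ler_pdivrMr//; nra.
have kh : k%:R * h = pi / 2 by rewrite mulrC divfK// gt_eqF.
have s1 : h <= pi - h by lra.
have s2 : pi - h <= pi + h by lra.
have s3 : - h <= h by lra.
have e1 := coef_shift_phase k h (- (pi / 2)) bf ef.
have e2 := coef_shift_phase k (- h) (- (pi / 2)) bf ef.
have q1 : - (pi / 2) - k%:R * h = - pi :> R by rewrite kh; lra.
have q2 : - (pi / 2) - k%:R * - h = 0 :> R by rewrite mulrN kh; lra.
rewrite q1 cosN cospi in e1; rewrite q2 cos0 in e2.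
have bsh x : bper (fun s => f (x + s)) M.
  case: bf => mf' pf' fM'; split=> [|s|s]; [exact: meas_shift|by rewrite addrA pf'|exact: fM'].
pose D s := f (h + s) - f (- h + s).
have mD : measurable_fun setT D by apply: measurable_funB; exact: meas_shift.
have iD a b : integ `[a, b] D by apply: integB; exact: bper_integ (bsh _).
have ec : 2 * coef f k = Int `[- pi, pi] (fun s => - (cos (k%:R * s - pi / 2) * D s)).
  have -> : 2 * coef f k = 1 * coef f k - (-1 * coef f k) by ring.
  rewrite -e1 -e2 -IntB; [|exact: cos_integ (bsh _)|exact: cos_integ (bsh _)].
  by apply: eq_Int => s _; rewrite /D; ring.
have D0 s : 0 <= s <= pi -> 0 <= D s.
  move=> hs; rewrite subr_ge0; have hm : 0 <= h <= pi by lra.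
  have -> : f (- h + s) = f (h - s) by rewrite -ef; congr f; ring.
  exact: prof_diff_ge0 pf hm hs.
have DN s : D (- s) = - D s.
  have a : f (h - s) = f (- h + s) by rewrite -ef; congr f; ring.
  have b : f (- h - s) = f (h + s) by rewrite -ef; congr f; ring.
  by rewrite /D a b opprB.
have iaD : integ `[- pi, pi] (fun s => `|D s|) by exact: integ_norm.
have maD : measurable_fun setT (fun s => `|D s|) by apply: measurableT_comp.
have b1 : `|2 * coef f k| <= Int `[- pi, pi] (fun s => `|D s|).
  rewrite ec; apply: Int_norm_le => //.
    apply: (integ_le iaD); last first.
      by move=> s _; rewrite normrN normrM ler_piMl//; exact: abs_cos_le1.
    apply: measurable_funTS; apply: measurableT_comp => //; apply: measurable_funM => //.
    exact: cosM_meas.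
  by move=> s _; rewrite normrN normrM ler_piMl//; exact: abs_cos_le1.
have b2 : Int `[- pi, pi] (fun s => `|D s|) = 2 * Int `[0, pi] D.
  rewrite (Int_fold (ltW p0) maD iaD).2 -IntZ//; apply: eq_Int => s.
  by rewrite in_itv/= => hs; rewrite DN normrN ger0_norm ?D0//; ring.
have sh x : Int `[0, pi] (fun s => f (x + s)) = Int `[0 + x, pi + x] f.
  have := @Int_shift R 0 pi x f mf; under eq_fun do rewrite addrC.
  by move=> [|_ ->]; first exact: bper_integ (bsh x).
have iF a b : integ `[a, b] f by exact: bper_integ bf.
have b3 : Int `[0, pi] D <= 2 * h * M.
  rewrite /D IntB; [|exact: bper_integ (bsh _)|exact: bper_integ (bsh _)].
  rewrite !sh !add0r (@Int_split _ h (pi - h) (pi + h))//.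
  rewrite (@Int_split _ (- h) h (pi - h))//.
  have c1 : Int `[pi - h, pi + h] f <= Int `[pi - h, pi + h] (fun=> M).
    by apply: Int_le => //; [exact: integ_cst|move=> s _; exact: le_trans (ler_norm _) (fM s)].
  have c2 : 0 <= Int `[- h, h] f by apply: Int_ge0.
  rewrite Int_cst// in c1; clear - h0 h1 c1 c2; lra.
have -> : pi * M / k%:R = 2 * h * M by rewrite /h; lra.
rewrite normrM ger0_norm// b2 in b1; lra.
Qed.

End Profile.

(** * The nonlinear function W and its inverse on the half-line *)

Section Inverse.
Context {R : realType}.

(* The properties of the equation W (u) = lam (Lop u - Lop u 0) used for
   existence; adm_super and adm_big drive the a priori bounds. *)
Record admissible (W Lp : R -> R) : Prop := Admissible {
  adm0 : W 0 = 0;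
  adm_cont : continuous W;
  adm_quad : forall M, exists2 c : R, 0 < c &
    forall a b, 0 <= a -> a <= b -> b <= M -> c * (b - a) ^+ 2 <= W b - W a;
  adm_lip : forall M a b, 0 <= a -> a <= b -> b <= M -> W b - W a <= Lp M * (b - a);
  adm_Lp_gt0 : forall M, 0 <= M -> 0 < Lp M;
  adm_Lp_mono : forall M N, 0 <= M -> M <= N -> Lp M <= Lp N;
  adm_super : forall a b, exists2 M : R, 1 <= M & a * M + b <= W M;
  adm_big : exists c M1 : R, [/\ 0 < c, 1 <= M1 & forall M, M1 <= M -> c * M * Lp M <= W M] }.

Context (W Lp : R -> R) (adm : admissible W Lp).

Lemma W_lt a b : 0 <= a -> a < b -> W a < W b.
Proof.
move=> a0 ab; have [c c0 H] := adm_quad adm b.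
rewrite -subr_gt0; apply: lt_le_trans (H a b a0 (ltW ab) (lexx b)).
by rewrite mulr_gt0// exprn_gt0// subr_gt0.
Qed.

Lemma W_le a b : 0 <= a -> a <= b -> W a <= W b.
Proof. by move=> a0; rewrite le_eqVlt => /predU1P[->//|ab]; rewrite ltW// W_lt. Qed.

Lemma W_ge0 a : 0 <= a -> 0 <= W a.
Proof. by move=> a0; rewrite -(adm0 adm); exact: W_le. Qed.

Lemma W_inverse : exists2 H : R -> R, (forall y, 0 <= y -> 0 <= H y /\ W (H y) = y) &
  forall x, 0 <= x -> H (W x) = x.
Proof.
have ex y : exists x, 0 <= y -> 0 <= x /\ W x = y.
  have [y0|y0] := leP 0 y; last by exists 0.
  have [M M1 HM] := adm_super adm 0 y; rewrite mul0r add0r in HM.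
  have M0 : 0 <= M by apply: le_trans M1.
  have [|x xM Wx] := @IVT R W 0 M y M0 (continuous_subspaceT (adm_cont adm)).
    rewrite (adm0 adm) ge_min y0/= le_max HM orbT//.
  by exists x => _; split=> //; move: xM; rewrite in_itv/= => /andP[].
have [H HH] := choice ex; exists H => // x x0.
have [h1 h2] := HH (W x) (W_ge0 x0).
case: (ltgtP (H (W x)) x) => // h.
  by have := W_lt h1 h; rewrite h2 ltxx.
by have := W_lt x0 h; rewrite h2 ltxx.
Qed.

Context (H : R -> R) (HW : forall y, 0 <= y -> 0 <= H y /\ W (H y) = y).

Lemma H_mono y y' : 0 <= y -> y <= y' -> H y <= H y'.
Proof.
move=> y0 yy; have [h1 h2] := HW y0; have [h3 h4] := HW (le_trans y0 yy).
by rewrite leNgt; apply/negP => /(W_lt h3); rewrite h2 h4 ltNge yy.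
Qed.

Lemma H_le y M : 0 <= y -> 0 <= M -> y <= W M -> H y <= M.
Proof.
move=> y0 M0 yM; have [h1 h2] := HW y0.
by rewrite leNgt; apply/negP => /(W_lt M0); rewrite h2 ltNge yM.
Qed.

Lemma H_ge y M : 0 <= y -> 0 <= M -> W M <= y -> M <= H y.
Proof.
move=> y0 M0 yM; have [h1 h2] := HW y0.
by rewrite leNgt; apply/negP => /(W_lt h1); rewrite h2 ltNge yM.
Qed.

Lemma H0 : H 0 = 0.
Proof.
have [h1 h2] := HW (lexx 0); apply/le_anti; rewrite h1 andbT.
by apply: H_le => //; rewrite (adm0 adm).
Qed.

(** The quadratic lower bound on the increments of W makes H Hoelder continuous with exponent 1/2 on
    bounded sets, which is what the degeneracy of W at 0 permits. *)
Lemma H_mod (Y e : R) : 0 < e -> exists2 d, 0 < d & forall y y', 0 <= y <= Y -> 0 <= y' <= Y ->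
  `|y - y'| < d -> `|H y - H y'| < e.
Proof.
move=> e0; have [Y0|Y0] := leP 0 Y; last first.
  by exists 1 => // y y' /andP[y0 /(le_trans y0)]; rewrite leNgt Y0.
have [c c0 Hc] := adm_quad adm (H Y).
exists (c * e ^+ 2); first by rewrite mulr_gt0// exprn_gt0.
move=> y y'; wlog yy : y y' / y' <= y.
  move=> K hy hy'; have [/K|/ltW/K] := leP y' y; first exact.
  by move=> K' h; rewrite distrC; apply: K' => //; rewrite distrC.
move=> /andP[y0 yY] /andP[y'0 y'Y]; rewrite ger0_norm ?subr_ge0// => h.
have mm := H_mono y'0 yy; rewrite ger0_norm ?subr_ge0//.
have [h1 h2] := HW y0; have [h3 h4] := HW y'0.
have := Hc _ _ h3 mm (H_mono y0 yY); rewrite h2 h4 => /le_lt_trans /(_ h).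
by rewrite ltr_pM2l// ltr_sqr ?nnegrE ?subr_ge0// ltW.
Qed.

End Inverse.

(** * The Fourier series as a function of its coefficients; running maxima *)

Section Series.
Context {R : realType} (alpha : R) (h0 : 0 < alpha) (h1 : alpha < 1).
Implicit Types (q : nat -> R) (x y B : R) (k N K : nat).

(* The Fourier series of Lop f (x) - Lop f 0, when q k is the cosine coefficient
   of f. *)
Definition aS q N x : R :=
  \sum_(1 <= k < N.+1) k%:R `^ (- alpha) * (pi^-1 * q k * (cos (k%:R * x) - 1)).

Definition aL q x : R := limn (fun N => aS q N x).

Definition boxed B q := forall k, (0 < k)%N -> `|q k| <= B / k%:R.

Lemma zeta_tail (m n : nat) : (0 < m)%N ->
  \sum_(m.+1 <= k < n) k%:R `^ (- (1 + alpha)) <= m%:R `^ (- alpha) / alpha :> R.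
Proof.
move=> m0; have [mn|nm] := leqP m.+1 n; last first.
  by rewrite big_geq ?(ltnW nm)// divr_ge0 ?powR_ge0 ?(ltW h0)//; exact: ltnW.
suff : \sum_(m.+1 <= k < n) k%:R `^ (- (1 + alpha)) <=
    (m%:R `^ (- alpha) - n.-1%:R `^ (- alpha)) / alpha :> R.
  move/le_trans; apply; rewrite ler_pM2r ?invr_gt0// gerBl; exact: powR_ge0.
elim: n mn => [//|n IH]; rewrite ltnS leq_eqVlt => /predU1P[<-|mn].
  by rewrite big_geq// subrr mul0r.
rewrite big_nat_recr//=; apply: le_trans (lerD (IH mn) (lexx _)) _.
have n0 : (0 < n)%N by apply: leq_trans mn.
have n1 : 0 < n.-1%:R :> R by rewrite ltr0n; lia.
have nn : n%:R = n.-1%:R + 1 :> R by rewrite natr1 prednK.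
have [||c /andP[c1 c2] ec] := @mvt _ (fun x : R => x `^ (- alpha)) (fun x => - alpha * x `^ (- alpha - 1)) n.-1%:R n%:R.
- by rewrite nn ltrDl.
- by move=> x /andP[xn _]; apply: der_powR; apply: lt_le_trans xn.
have c0 : 0 < c by apply: lt_trans c1.
have n0' : 0 < n%:R :> R by rewrite ltr0n.
have p1 : n%:R `^ (- (1 + alpha)) <= c `^ (- (1 + alpha)).
  rewrite !powRN lef_pV2 ?posrE ?powR_gt0//; apply: ge0_ler_powR; rewrite ?nnegrE ?(ltW c0) ?(ltW n0') ?(ltW c2)//.
  by rewrite addr_ge0// ltW.
have e1 : - alpha - 1 = - (1 + alpha) by ring.
have e2 : n%:R - n.-1%:R = 1 :> R by rewrite nn; ring.
rewrite e1 e2 mulr1 in ec.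
have a0 : alpha != 0 by rewrite gt_eqF.
have -> : (m%:R `^ (- alpha) - n%:R `^ (- alpha)) / alpha =
   (m%:R `^ (- alpha) - n.-1%:R `^ (- alpha)) / alpha + c `^ (- (1 + alpha)).
  have -> : n%:R `^ (- alpha) = n.-1%:R `^ (- alpha) - alpha * c `^ (- (1 + alpha)).
    by rewrite -mulNr -ec; ring.
  by field.
by rewrite lerD2l.
Qed.

Lemma aS_term q B k x : boxed B q -> (0 < k)%N ->
  `|k%:R `^ (- alpha) * (pi^-1 * q k * (cos (k%:R * x) - 1))| <= B * k%:R `^ (- (1 + alpha)).
Proof.
move=> bq k0; have k0' : 0 < k%:R :> R by rewrite ltr0n.
rewrite !normrM (ger0_norm (powR_ge0 _ _)).
have -> : B * k%:R `^ (- (1 + alpha)) = k%:R `^ (- alpha) * (B / k%:R).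
  have -> : - (1 + alpha) = - alpha - 1 by ring.
  by rewrite powRB ?(gt_eqF k0') ?implybT// powRr1 ?(ltW k0')//; ring.
rewrite ler_wpM2l ?powR_ge0//.
have B0 : 0 <= B / k%:R by apply: le_trans (bq k k0).
have c2 : `|cos (k%:R * x) - 1| <= 2.
  by rewrite ler_norml; have := cos_geN1 (k%:R * x); have := cos_le1 (k%:R * x); lra.
have p2 : `|pi^-1| <= 2^-1 :> R.
  by rewrite gtr0_norm ?invr_gt0 ?pi_gt0// lef_pV2 ?posrE ?pi_gt0// pi_ge2.
have := ler_pM (mulr_ge0 (normr_ge0 _) (normr_ge0 _)) (normr_ge0 _)
  (ler_pM (normr_ge0 _) (normr_ge0 _) p2 (bq k k0)) c2.
by move/le_trans; apply; lra.
Qed.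

(** K coordinates and a tail that is small uniformly over the box: continuity of the series for the
    product topology, uniform in x and N. *)
Lemma aS_diff q q' B (K : nat) N x : boxed B q -> boxed B q' -> (0 < K)%N ->
  `|aS q N x - aS q' N x| <=
    2 * \sum_(1 <= k < K.+1) `|q k - q' k| + 2 * B * (K%:R `^ (- alpha) / alpha).
Proof.
move=> bq bq' K0.
have B0 : 0 <= B by have := le_trans (normr_ge0 _) (bq 1%N isT); rewrite divr1.
pose t k := k%:R `^ (- alpha) * (pi^-1 * q k * (cos (k%:R * x) - 1)) -
  k%:R `^ (- alpha) * (pi^-1 * q' k * (cos (k%:R * x) - 1)).
have t1 k : (0 < k)%N -> `|t k| <= 2 * `|q k - q' k|.
  move=> k0; have k1 : 1 <= k%:R :> R by rewrite ler1n.
  have -> : t k = (k%:R `^ (- alpha) * pi^-1) * (cos (k%:R * x) - 1) * (q k - q' k) by rewrite /t; ring.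
  rewrite normrM ler_wpM2r// normrM -[2]mul1r; apply: ler_pM => //.
    rewrite ger0_norm ?mulr_ge0 ?powR_ge0 ?invr_ge0 ?pi_ge0//.
    rewrite -[leRHS]mulr1; apply: ler_pM; rewrite ?powR_ge0 ?invr_ge0 ?pi_ge0//.
      rewrite powRN invf_le1; last by apply: powR_gt0; lra.
      have e1 : (1 : R) `^ alpha = 1 by rewrite powR1.
      by rewrite -[leLHS]e1; apply: ge0_ler_powR; rewrite ?nnegrE ?(ltW h0)//; lra.
    by rewrite invf_le1 ?pi_gt0//; have := @pi_ge2 R; lra.
  by rewrite ler_norml; have := cos_geN1 (k%:R * x); have := cos_le1 (k%:R * x); lra.
have t2 k : (0 < k)%N -> `|t k| <= 2 * B * k%:R `^ (- (1 + alpha)).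
  by move=> k0; apply: le_trans (ler_normB _ _) _; have := aS_term x bq k0; have := aS_term x bq' k0; lra.
have e : aS q N x - aS q' N x = \sum_(1 <= k < N.+1) t k by rewrite /aS -sumrB.
rewrite e; apply: le_trans (ler_norm_sum _ _ _) _.
have S1 m n : (0 < m)%N -> \sum_(m <= k < n) `|t k| <= 2 * \sum_(m <= k < n) `|q k - q' k|.
  move=> m0; rewrite mulr_sumr [leLHS]big_nat [leRHS]big_nat; apply: ler_sum => k /andP[mk _].
  by apply: t1; apply: leq_trans mk.
have z0 : 0 <= 2 * B * (K%:R `^ (- alpha) / alpha).
  apply: mulr_ge0; first by rewrite mulr_ge0.
  by rewrite divr_ge0 ?powR_ge0// ltW.
have [NK|KN] := leqP N K.
  apply: le_trans (S1 1%N N.+1 isT) _; rewrite -[leLHS]addr0; apply: lerD => //.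
  rewrite ler_wpM2l// [leRHS](big_cat_nat (n := N.+1)) //= lerDl; exact: sumr_ge0.
rewrite (big_cat_nat (n := K.+1)) //=; last by rewrite ltnS ltnW.
apply: lerD; first exact: S1.
apply: le_trans (_ : \sum_(K.+1 <= k < N.+1) 2 * B * k%:R `^ (- (1 + alpha)) <= _).
  rewrite [leLHS]big_nat [leRHS]big_nat; apply: ler_sum => k /andP[kK _].
  by apply: t2; apply: leq_trans kK.
by rewrite -mulr_sumr ler_wpM2l ?mulr_ge0// zeta_tail.
Qed.

Lemma aS_bound q B N x : boxed B q -> `|aS q N x| <= B * (2 + 2 / alpha).
Proof.
move=> bq; have b0 : boxed B (fun=> 0).
  by move=> k k0; rewrite normr0; apply: le_trans (bq k k0).
have B0 : 0 <= B by have := le_trans (normr_ge0 _) (bq 1%N isT); rewrite divr1.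
have := aS_diff N x bq b0 (isT : (0 < 1)%N).
have -> : aS (fun=> 0) N x = 0 by rewrite /aS big1// => k _; rewrite mulr0 mul0r mulr0.
rewrite subr0 big_nat1 subr0 powRN powR1 invr1.
have := bq 1%N isT; rewrite divr1 => h; lra.
Qed.

Lemma aS_cvg q B x : boxed B q -> aS q N x @[N --> \oo] --> aL q x.
Proof.
move=> bq; pose t k := k%:R `^ (- alpha) * (pi^-1 * q k * (cos (k%:R * x) - 1)).
pose b k := B * k%:R `^ (- (1 + alpha)).
have B0 : 0 <= B by have := le_trans (normr_ge0 _) (bq 1%N isT); rewrite divr1.
have cb : cvgn (fun N => \sum_(1 <= k < N.+1) b k).
  apply: nondecreasing_is_cvgn.
    apply/nondecreasing_seqP => n; rewrite [leRHS]big_nat_recr//= lerDl.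
    by rewrite mulr_ge0// powR_ge0.
  exists (B * (1 + 1 / alpha)) => _ [n _ <-].
  rewrite -mulr_sumr ler_wpM2l//; case: n => [|n]; first by rewrite big_geq// addr_ge0// divr_ge0// ltW.
  rewrite big_ltn// powRN powR1 invr1 lerD2l.
  by have := @zeta_tail 1%N n.+2 isT; rewrite powRN powR1 invr1.
(* By [aS_term] the terms t + b are nonnegative, so convergence follows from boundedness, as for b
   alone. *)
have ct : cvgn (fun N => \sum_(1 <= k < N.+1) (t k + b k)).
  apply: nondecreasing_is_cvgn.
    apply/nondecreasing_seqP => n; rewrite [leRHS]big_nat_recr//= lerDl.
    by have := aS_term x bq (ltn0Sn n); rewrite ler_norml /t /b; lra.
  exists (B * (2 + 2 / alpha) + limn (fun N => \sum_(1 <= k < N.+1) b k)) => _ [n _ <-].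
  rewrite big_split/=; apply: lerD.
    exact: le_trans (ler_norm _) (aS_bound n x bq).
  apply: (nondecreasing_cvgn_le _ cb); apply/nondecreasing_seqP => m.
  by rewrite [leRHS]big_nat_recr//= lerDl mulr_ge0// powR_ge0.
have e : (fun N => aS q N x) = (fun N => \sum_(1 <= k < N.+1) (t k + b k) - \sum_(1 <= k < N.+1) b k).
  by apply/funext => N; rewrite big_split/= addrK.
have : cvgn (fun N => aS q N x) by rewrite e; apply: is_cvgB.
by [].
Qed.

Lemma aL_diff q q' B (K : nat) x : boxed B q -> boxed B q' -> (0 < K)%N ->
  `|aL q x - aL q' x| <=
    2 * \sum_(1 <= k < K.+1) `|q k - q' k| + 2 * B * (K%:R `^ (- alpha) / alpha).
Proof.
move=> bq bq' K0.
have c : `|aS q N x - aS q' N x| @[N --> \oo] --> `|aL q x - aL q' x|.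
  by apply: cvg_norm; apply: cvgB; [exact: aS_cvg bq|exact: aS_cvg bq'].
rewrite -(cvg_lim _ c)//; apply: limr_le; first by apply/cvg_ex; eexists; exact: c.
by apply: nearW => N; exact: aS_diff.
Qed.

Lemma aL_bound q B x : boxed B q -> `|aL q x| <= B * (2 + 2 / alpha).
Proof.
move=> bq; have c : `|aS q N x| @[N --> \oo] --> `|aL q x| by apply: cvg_norm; exact: aS_cvg bq.
rewrite -(cvg_lim _ c)//; apply: limr_le; first by apply/cvg_ex; eexists; exact: c.
by apply: nearW => N; exact: aS_bound.
Qed.

(* The running maximum of a, as a function of c = cos x on [0, pi]; it makes the
   profiles of the regularised problem nondecreasing on [0, pi] by construction. *)
Definition rm (a : R -> R) (c : R) : R :=
  sup [set r | r = 0 \/ exists y, [/\ 0 <= y <= pi, c <= cos y & r = a y]].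

Lemma rm_has_sup (a : R -> R) c A : (forall y, `|a y| <= A) ->
  has_sup [set r | r = 0 \/ exists y, [/\ 0 <= y <= pi, c <= cos y & r = a y]].
Proof.
move=> aA; split; first by exists 0; left.
exists A => r [->|[y [_ _ ->]]]; first exact: le_trans (aA 0).
exact: le_trans (ler_norm _) (aA y).
Qed.

Lemma rm_ge0 a c A : (forall y, `|a y| <= A) -> 0 <= rm a c.
Proof.
by move=> aA; apply: ub_le_sup; [exact: (rm_has_sup c aA).2|left].
Qed.

Lemma rm_le a c A : (forall y, `|a y| <= A) -> rm a c <= A.
Proof.
move=> aA; apply: ge_sup; first by exists 0; left.
move=> r [->|[y [_ _ ->]]]; first exact: le_trans (aA 0).
exact: le_trans (ler_norm _) (aA y).
Qed.

Lemma rm_mono a c c' A : (forall y, `|a y| <= A) -> c' <= c -> rm a c <= rm a c'.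
Proof.
move=> aA cc; apply: ge_sup; first by exists 0; left.
move=> r [->|[y [yp cy ->]]]; first exact: rm_ge0 aA.
apply: ub_le_sup; first exact: (rm_has_sup c' aA).2.
by right; exists y; split=> //; apply: le_trans cy.
Qed.

Lemma rm_diff a a' c A e : (forall y, `|a y| <= A) -> (forall y, `|a' y| <= A) ->
  (forall y, `|a y - a' y| <= e) -> rm a c - rm a' c <= e.
Proof.
move=> aA a'A ae; rewrite lerBlDr; apply: ge_sup; first by exists 0; left.
move=> r [->|[y [yp cy ->]]].
  by rewrite addr_ge0 ?(rm_ge0 c a'A)//; apply: le_trans (ae 0).
have : a' y <= rm a' c.
  apply: ub_le_sup; first exact: (rm_has_sup c a'A).2.
  by right; exists y.
have := ae y; rewrite ler_norml; lra.
Qed.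

Lemma rm_id a A x : (forall y, `|a y| <= A) -> a 0 = 0 ->
  (forall x y, 0 <= x -> x <= y -> y <= pi -> a x <= a y) -> 0 <= x <= pi ->
  rm a (cos x) = a x.
Proof.
move=> aA a0 inc /andP[x0 xp]; apply/le_anti/andP; split; last first.
  apply: ub_le_sup; first exact: (rm_has_sup (cos x) aA).2.
  by right; exists x; rewrite x0 xp.
apply: ge_sup; first by exists 0; left.
move=> r [->|[y [/andP[y0 yp] cy ->]]]; first by rewrite -a0 inc.
apply: inc => //; rewrite leNgt; apply/negP => xy.
by have := cos_decr x0 xy yp; rewrite ltNge cy.
Qed.

End Series.

(** * The antisymmetric part under translation by half a period *)

Section Half.
Context {R : realType}.
Implicit Types (u f g : R -> R) (M x : R) (k : nat) (sg : bool).

Definition sgn_coef sg k : R := if sg then (odd k)%:R else 1.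

(* For the odd nonlinearity the nonlocal term acts on the part of u - 1 which is
   antisymmetric under x |-> x + pi, and the symmetry of u itself is a consequence. *)
Definition half_odd sg u x : R := if sg then (u x - u (x + pi)) / 2 else u x.

Lemma sgn_coef01 sg k : sgn_coef sg k = 0 \/ sgn_coef sg k = 1.
Proof. by rewrite /sgn_coef; case: sg; [case: odd; [right|left]|right]. Qed.

Lemma cos_natpi k : cos (k%:R * pi) = (-1) ^+ k :> R.
Proof.
elim: k => [|k IH]; first by rewrite mul0r cos0.
by rewrite -natr1 mulrDl mul1r cosDpi IH exprS mulN1r.
Qed.

Lemma bper_addpi u M : bper u M -> bper (fun x => u (x + pi)) M.
Proof.
move=> [mu pu bu]; split=> //.
  have := meas_shift pi mu; congr (measurable_fun _ _).
  by apply/funext => x; rewrite addrC.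
by move=> x; rewrite addrAC pu.
Qed.

Lemma prof_reflpi u M x : prof u M -> u (x + pi) = u (pi - x).
Proof.
move=> [[mu pu bu] eu _]; rewrite -(eu (pi - x)) -(pu (- (pi - x))).
by congr u; ring.
Qed.

(** For a profile u (x + pi) = u (pi - x), so - u (x + pi) is nondecreasing on [0, pi] as well. *)
Lemma half_odd_prof sg u M : prof u M -> prof (half_odd sg u) M.
Proof.
rewrite /half_odd; case: sg => // pu.
have [bu eu iu] := pu; have bs := bper_addpi bu.
split.
- split.
  + apply: measurable_funM => //; apply: measurable_funB; first by case: bu.
    by case: bs.
  + by move=> x; case: bu => _ p _; case: bs => _ p' _; rewrite p p'.
  + move=> x; case: bu => _ _ b.
    by have := b x; have := b (x + pi); rewrite !ler_norml; lra.
- move=> x; rewrite eu (prof_reflpi _ pu) opprK; congr ((_ - _) / 2).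
  by rewrite addrC.
- move=> x y x0 xy yp; rewrite ler_pM2r// !(prof_reflpi _ pu).
  have := iu _ _ x0 xy yp; have : u (pi - y) <= u (pi - x) by apply: iu; lra.
  by lra.
Qed.

Lemma coef_half_odd sg u M k : prof u M -> coef (half_odd sg u) k = sgn_coef sg k * coef u k.
Proof.
rewrite /half_odd /sgn_coef; case: sg => pu; last by rewrite mul1r; congr coef.
have [bu eu iu] := pu; have bs := bper_addpi bu.
have e1 : coef (fun x => u (x + pi)) k = (-1) ^+ k * coef u k.
  rewrite -cos_natpi -(coef_shift _ _ bu eu); apply: eq_Int => s _.
  by rewrite [s + pi]addrC.
have -> : coef (fun x => (u x - u (x + pi)) / 2) k =
    2^-1 * (coef u k - coef (fun x => u (x + pi)) k).
  rewrite /coef -IntB; [|exact: coef_integ bu|exact: coef_integ bs].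
  rewrite -IntZ; last by apply: integB; [exact: coef_integ bu|exact: coef_integ bs].
  by apply: eq_Int => s _; ring.
rewrite e1 -signr_odd; case: odd => /=; by [rewrite expr1; lra|rewrite expr0; lra].
Qed.

Lemma coef0_Int f : coef f 0 = Int `[- pi, pi] f.
Proof. by apply: eq_Int => s _; rewrite mul0r cos0 mul1r. Qed.

Lemma coef_near f g M N k e : bper f M -> bper g N -> (forall x, `|f x - g x| <= e) ->
  `|coef f k - coef g k| <= e * (2 * pi).
Proof.
move=> bf bg fg; have p0 := @pi_ge0 R.
have i1 := coef_integ k (- pi) pi bf; have i2 := coef_integ k (- pi) pi bg.
rewrite -IntB//.
have -> : e * (2 * pi) = Int `[- pi, pi] (fun=> e) by rewrite Int_cst; lra.
apply: Int_norm_le; [exact: integB|exact: integ_cst|].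
move=> s _; rewrite -mulrBr normrM -[leRHS]mul1r.
by apply: ler_pM => //; exact: abs_cos_le1.
Qed.

End Half.

(** * The regularised equation in the coefficients *)

Section Existence.
Context {R : realType} (alpha : R) (h0 : 0 < alpha) (h1 : alpha < 1).
Notation Lop := (Lop alpha).
Notation aL := (aL alpha).
Context (W Lp H : R -> R) (adm : admissible W Lp).
Context (HW : forall y, 0 <= y -> 0 <= H y /\ W (H y) = y) (sg : bool).
Implicit Types (z q : nat -> R) (eps B Lam E M e x : R).

(* The unknowns are z 0, the inverse wave speed, and z k, the k-th cosine
   coefficient of u for k > 0. *)
Definition uu eps z x := H (z 0%N * (rm (aL z) (cos x) + eps * Num.max 0 (1 - cos x))).

Definition param Lam B z := 0 <= z 0%N <= Lam /\ boxed B z.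

(** The constant of [aL_bound]: on the box of size B the series is at most [B * Zc]. *)
Definition Zc : R := 2 + 2 / alpha.

Lemma Zc_ge0 : 0 <= Zc.
Proof. by rewrite addr_ge0// divr_ge0// ltW. Qed.

Lemma max1cos (x : R) : Num.max 0 (1 - cos x) = 1 - cos x.
Proof. by apply/max_idPr; rewrite subr_ge0 cos_le1. Qed.

Lemma uu_arg Lam B z eps x : param Lam B z -> 0 <= eps ->
  0 <= z 0%N * (rm (aL z) (cos x) + eps * Num.max 0 (1 - cos x)) <= Lam * (B * Zc + 2 * eps).
Proof.
move=> [/andP[z0 zL] bz] e0; have aA y := aL_bound h0 h1 y bz.
have c1 := cos_le1 x; have c2 := cos_geN1 x.
have r0 := rm_ge0 (cos x) aA; have r1 := rm_le (cos x) aA.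
rewrite max1cos; apply/andP; split.
  by rewrite mulr_ge0// addr_ge0// mulr_ge0// subr_ge0.
apply: ler_pM => //; first by rewrite addr_ge0// mulr_ge0// subr_ge0.
by apply: lerD => //; rewrite mulrC; apply: ler_wpM2r => //; lra.
Qed.

Lemma uu_ge0 Lam B z eps x : param Lam B z -> 0 <= eps -> 0 <= uu eps z x.
Proof. by move=> pz e0; have /andP[a0 _] := uu_arg x pz e0; exact: (HW a0).1. Qed.

Lemma uu_prof Lam B z eps M : param Lam B z -> 0 <= eps -> 0 <= M ->
  Lam * (B * Zc + 2 * eps) <= W M -> prof (uu eps z) M.
Proof.
move=> pz e0 M0 WM; have [/andP[z0 zL] bz] := pz; have aA y := aL_bound h0 h1 y bz.
(* The maximum with 0 in [uu] makes V nonincreasing for all real c, hence measurable; [uu] is V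
   composed with cos. *)
pose V c := H (z 0%N * (rm (aL z) c + eps * Num.max 0 (1 - c))).
have Vm c c' : c <= c' -> V c' <= V c.
  move=> cc; apply: (H_mono adm HW).
    rewrite mulr_ge0// addr_ge0 ?(rm_ge0 _ aA)// mulr_ge0// le_max lexx//.
  apply: ler_wpM2l => //; apply: lerD; first exact: rm_mono aA cc.
  by apply: ler_wpM2l => //; rewrite ge_max !le_max lexx/=; apply/orP; right; lra.
split.
- split.
  + have -> : uu eps z = V \o cos by [].
    apply: measurableT_comp; last by apply: continuous_measurable_fun; exact: continuous_cos.
    by apply: nonincreasing_measurable => // c c' _ _; exact: Vm.
  + by move=> x; rewrite /uu -(mul1r (x + _)) -[1]/(1%:R) cosk_per mul1r.
  + move=> x; rewrite ger0_norm ?(uu_ge0 _ pz)//.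
    have /andP[a0 a1] := uu_arg x pz e0.
    by apply: (H_le adm HW) => //; exact: le_trans WM.
- by move=> x; rewrite /uu cosN.
- move=> x y x0; rewrite le_eqVlt => /predU1P[->//|xy] yp.
  by apply: Vm; apply: ltW; exact: cos_decr.
Qed.

(** Uniform in x and joint in z and eps. For fixed eps it is the continuity that [hilbert_miranda]
    requires; for varying eps it lets the equations pass to the limit. *)
Lemma uu_near Lam B E e : 0 <= Lam -> 0 <= B -> 0 <= E -> 0 < e ->
  exists K d, [/\ 0 < d, d <= e & forall z z' eps eps', param Lam B z -> param Lam B z' ->
  0 <= eps <= E -> 0 <= eps' <= E -> `|eps' - eps| < d ->
  (forall j, (j < K)%N -> `|z' j - z j| < d) -> forall x, `|uu eps' z' x - uu eps z x| < e].
Proof.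
move=> L0 B0 E0 e0.
pose T := B * Zc + 2 * E.
have T0 : 0 <= T by rewrite addr_ge0 ?mulr_ge0 ?Zc_ge0.
have [d0 d00 Hd] := H_mod adm HW (Lam * T) e0.
have [K K0 HK] : exists2 K, (0 < K)%N & Lam * (2 * B * (K%:R `^ (- alpha) / alpha)) < d0 / 2.
  have c : Lam * (2 * B * (n.+1%:R `^ (- alpha) / alpha)) @[n --> \oo] --> (0 : R).
    have -> : 0 = Lam * (2 * B * (0 / alpha)) by rewrite mul0r !mulr0.
    apply: cvgMl_tmp; apply: cvgMl_tmp; apply: cvgMr_tmp.
    have cn : ((n.+1)%:R : R) @[n --> \oo] --> +oo.
      by rewrite (cvg_shiftS (fun n => n%:R : R)); exact: cvgr_idn.
    exact: cvg_comp cn (powR_cvgy0 h0).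
  have d20 : 0 < d0 / 2 by lra.
  move/cvgr0Pnorm_lt: c => /(_ _ d20) [N _ HN].
  exists N.+1 => //; apply: le_lt_trans (ler_norm _) (HN N _); exact: leqnn.
pose c := T + Lam * (2 * K%:R + 2) + 1.
have c0 : 0 < c.
  by rewrite ltr_wpDl// addr_ge0// mulr_ge0// addr_ge0// mulr_ge0.
exists K.+1, (Num.min e (d0 / 2 / c)); split.
- by rewrite lt_min e0/= !divr_gt0.
- by rewrite ge_min lexx.
move=> z z' eps eps' pz pz' /andP[ep0 epE] /andP[ep0' epE']; rewrite lt_min => /andP[_ de] dz x.
set d := d0 / 2 / c in de dz.
have dz' j : (j < K.+1)%N -> `|z' j - z j| < d by move=> /dz; rewrite lt_min => /andP[].
have [/andP[z0 zL] bz] := pz; have [/andP[z0' zL'] bz'] := pz'.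
have aA y := aL_bound h0 h1 y bz; have aA' y := aL_bound h0 h1 y bz'.
have sub eps1 z1 : param Lam B z1 -> 0 <= eps1 <= E ->
    0 <= z1 0%N * (rm (aL z1) (cos x) + eps1 * Num.max 0 (1 - cos x)) <= Lam * T.
  move=> p1 /andP[e1 e2]; have /andP[-> /=] := uu_arg x p1 e1.
  by move/le_trans; apply; apply: ler_wpM2l => //; rewrite lerD2l ler_pM2l.
apply: Hd; [by apply: sub => //; rewrite ep0'|by apply: sub => //; rewrite ep0|].
set t := rm (aL z) _ + _; set t' := rm (aL z') _ + _.
pose A := 2 * B * (K%:R `^ (- alpha) / alpha).
have dd : forall y, `|aL z' y - aL z y| <= 2 * K%:R * d + A.
  move=> y; apply: le_trans (aL_diff h0 h1 y bz' bz K0) _; rewrite lerD2r -mulrA ler_pM2l//.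
  have -> : K%:R * d = \sum_(1 <= k < K.+1) d by rewrite big_const_nat iter_addr_0 subSS subn0 mulr_natl.
  rewrite big_nat [leRHS]big_nat; apply: ler_sum => k /andP[_ kK]; exact: ltW (dz' _ kK).
have dd' y : `|aL z y - aL z' y| <= 2 * K%:R * d + A by rewrite distrC.
have r1 := rm_diff (cos x) aA' aA dd; have r2 := rm_diff (cos x) aA aA' dd'.
have tt : `|t' - t| <= 2 * K%:R * d + A + 2 * d.
  have c1 := cos_le1 x; have c2 := cos_geN1 x.
  rewrite /t /t' max1cos.
  have ee : `|(eps' - eps) * (1 - cos x)| <= d * 2.
    rewrite normrM; apply: ler_pM => //; first exact: ltW.
    by rewrite ger0_norm; clear - h0 h1 adm HW sg c1 c2; lra.
  move: ee; clear - h0 h1 adm HW sg r1 r2; rewrite !ler_norml; lra.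
have t'T : `|t'| <= T.
  rewrite ger0_norm; last first.
    by rewrite /t' max1cos addr_ge0 ?(rm_ge0 _ aA')// mulr_ge0// subr_ge0 cos_le1.
  rewrite /t' max1cos; apply: lerD; first exact: rm_le aA'.
  have c1 := cos_geN1 x; apply: le_trans (_ : eps' * 2 <= _); last by clear - h0 h1 adm HW sg epE'; lra.
  by apply: ler_wpM2l => //; clear - h0 h1 adm HW sg c1; lra.
have -> : z' 0%N * t' - z 0%N * t = (z' 0%N - z 0%N) * t' + z 0%N * (t' - t) by ring.
apply: le_lt_trans (ler_normD _ _) _; rewrite !normrM (ger0_norm z0).
have b1 : `|z' 0%N - z 0%N| * `|t'| <= d * T.
  by apply: ler_pM => //; apply: ltW; exact: dz'.
have b2 : z 0%N * `|t' - t| <= Lam * (2 * K%:R * d + A + 2 * d) by apply: ler_pM.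
have cd : c * d = d0 / 2 by rewrite /d; field; rewrite gt_eqF.
have d_gt0 : 0 < d by rewrite /d !divr_gt0.
have : d * T + Lam * (2 * K%:R * d + A + 2 * d) = c * d - d + Lam * A by rewrite /c; ring.
move: b1 b2 HK; rewrite -/A cd; lra.
Qed.

(* The equation of index 0 fixes the mean of u to 1. *)
Definition FF eps i z : R :=
  if i is 0%N then 2 * pi - coef (uu eps z) 0 else sgn_coef sg i * coef (uu eps z) i - z i.

Lemma FF_near Lam B E M i e : 0 <= Lam -> 0 <= B -> 0 <= E -> 0 <= M ->
  Lam * (B * Zc + 2 * E) <= W M -> 0 < e ->
  exists K d, 0 < d /\ forall z z' eps eps', param Lam B z -> param Lam B z' ->
  0 <= eps <= E -> 0 <= eps' <= E -> `|eps' - eps| < d ->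
  (forall j, (j < K)%N -> `|z' j - z j| < d) -> `|FF eps' i z' - FF eps i z| < e.
Proof.
move=> L0 B0 E0 M0 WM e0.
have pp := @pi_ge0 R.
pose e' := e / 2 / (2 * pi + 1).
have c0 : 0 < 2 * pi + 1 :> R by lra.
have e'0 : 0 < e' by rewrite !divr_gt0.
have ee : e' * (2 * pi) + e' = e / 2.
  have -> : e' * (2 * pi) + e' = e' * (2 * pi + 1) by ring.
  by rewrite /e' divfK// gt_eqF.
have [K [d [d0 de HK]]] := uu_near L0 B0 E0 e'0.
exists (maxn K i.+1), d; split => // z z' eps eps' pz pz' he he' dd dz.
have nn x := HK _ _ _ _ pz pz' he he' dd (fun j jK => dz j (leq_trans jK (leq_maxl _ _))) x.
have pf eps1 z1 : param Lam B z1 -> 0 <= eps1 <= E -> bper (uu eps1 z1) M.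
  move=> p1 /andP[e1 e2]; have [] // := @uu_prof Lam B z1 eps1 M p1 e1 M0 _.
  by apply: le_trans WM; apply: ler_wpM2l => //; rewrite lerD2l ler_pM2l.
have cn := coef_near i (pf _ _ pz' he') (pf _ _ pz he) (fun x => ltW (nn x)).
have zi := dz i (leq_maxr _ _).
rewrite /FF; case: i cn {dz} zi => [|i] cn zi.
  move: cn; rewrite !ler_norml ltr_norml; lra.
have [->|->] := @sgn_coef01 R sg i.+1; move: cn zi; rewrite !ler_norml !ltr_norml; lra.
Qed.

Lemma aL_Lop z v M x : prof v M -> (forall k, (0 < k)%N -> z k = coef v k) ->
  aL z x = Lop v x - Lop v 0.
Proof.
move=> [bv ev iv] zk.
have c : (PN alpha v N x - PN alpha v N 0) @[N --> \oo] --> Lop v x - Lop v 0.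
  by apply: cvgB; exact: PN_cvg bv ev.
rewrite -(cvg_lim (@Rhausdorff R) c) /aL; congr (limn _); apply/funext => N.
rewrite /PN -mulrBr -sumrB mulr_sumr /aS big_nat [RHS]big_nat; apply: eq_bigr => k /andP[k0 _].
by rewrite zk// mulr0 cos0; ring.
Qed.

Lemma LopN v M : bper v M -> (forall x, v (- x) = v x) -> forall x, Lop v (- x) = Lop v x.
Proof.
move=> bv ev x.
rewrite -(cvg_lim (@Rhausdorff R) (PN_cvg h0 h1 (x := - x) bv ev)).
rewrite -(cvg_lim (@Rhausdorff R) (PN_cvg h0 h1 (x := x) bv ev)); congr (limn _).
by apply/funext => N; congr (_ * _); apply: eq_bigr => k _; rewrite mulrN cosN.
Qed.

Lemma Lop_mono v M x y : prof v M -> 0 <= x -> x <= y -> y <= pi -> Lop v x <= Lop v y.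
Proof.
move=> pv x0 xy yp; have [d d0 Hd] := Lop_test h0 h1.
have h : 0 <= (y + x) / 2 <= pi by lra.
have h' : 0 <= (y - x) / 2 <= pi by lra.
have := Hd v M _ _ pv h h'.
have -> : (y + x) / 2 + (y - x) / 2 = y by field.
have -> : (y + x) / 2 - (y - x) / 2 = x by field.
rewrite -[Lop v x <= _]subr_ge0; apply: le_trans.
by rewrite !mulr_ge0 ?(prof_coef1_ge0 pv) ?sin_ge0_pi// ltW.
Qed.

Lemma uu_solution Lam B z eps M : param Lam B z -> 0 <= eps -> prof (uu eps z) M ->
  (forall k, (0 < k)%N -> z k = coef (half_odd sg (uu eps z)) k) ->
  forall x, W (uu eps z x) =
    z 0%N * (Lop (half_odd sg (uu eps z)) x - Lop (half_odd sg (uu eps z)) 0 + eps * (1 - cos x)).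
Proof.
move=> pz e0 pu zk; set v := half_odd sg (uu eps z).
have pv : prof v M by exact: half_odd_prof.
have aE x : aL z x = Lop v x - Lop v 0 := aL_Lop x pv zk.
have aA y := aL_bound h0 h1 y pz.2.
have main y : 0 <= y <= pi -> W (uu eps z y) = z 0%N * (Lop v y - Lop v 0 + eps * (1 - cos y)).
  move=> hy; have /andP[a0 _] := uu_arg y pz e0.
  rewrite /uu (HW a0).2 max1cos (rm_id aA _ _ hy) ?aE ?subrr//.
  by move=> a b a0' ab bp; rewrite !aE lerD2r; exact: Lop_mono pv a0' ab bp.
move=> x; have [y hy Hy] := fold_ex x.
have [[mu pu' bu] eu _] := pu; have [[_ pv' _] ev _] := pv.
have [bv _ _] := pv; have eL := LopN bv ev.
rewrite (Hy (uu eps z) eu pu') main// (Hy (Lop v)) ?(Hy cos)//.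
- exact: cosN.
- by move=> t; rewrite -(mul1r (t + _)) -[1]/(1%:R) cosk_per mul1r.
- exact: Lop_per.
Qed.

End Existence.

(** * Solutions for positive eps, and bounds uniform in eps *)

Section Apriori.
Context {R : realType} (alpha : R) (h0 : 0 < alpha) (h1 : alpha < 1).
Notation Lop := (Lop alpha).
Notation Zc := (Zc alpha).
Context (W Lp H : R -> R) (adm : admissible W Lp).
Context (HW : forall y, 0 <= y -> 0 <= H y /\ W (H y) = y) (sg : bool).
Implicit Types (z q : nat -> R) (eps B Lam E M e x : R) (u v f : R -> R).
Notation uu := (uu alpha H).
Notation FF := (FF alpha H sg).

Lemma prof_tight u M : prof u M -> (forall x, 0 <= u x) -> prof u (u pi).
Proof.
move=> pu u0; have [[mu pu' bu] eu iu] := pu; split=> //; split=> // x.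
by rewrite ger0_norm// (prof_le_pi _ pu).
Qed.

Lemma FF_zero_exists eps : 0 < eps -> exists Lam B M z,
  [/\ param Lam B z, 0 <= M, prof (uu eps z) M & forall i, FF eps i z = 0].
Proof.
move=> e0; have W2 : 0 <= W 2 by apply: (W_ge0 adm).
(* On the face where z 0 = L, the term eps (1 - cos x) >= eps alone gives u >= 2 on [pi / 2, pi], so
   the integral of u over a period is at least 2 pi. *)
pose L := W 2 / eps; have L0 : 0 <= L by rewrite divr_ge0// ltW.
(* The size of the box, pi M, depends on the bound M that it must imply. The loop closes because the
   requirement on W M is only linear in M. *)
have [M M1 HM] := adm_super adm (L * pi * Zc) (L * 2 * eps).
have M0 : 0 <= M by apply: le_trans M1.
have pp := @pi_gt0 R.
pose B := pi * M; have B0 : 0 <= B by rewrite mulr_ge0// ltW.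
have WM : L * (B * Zc + 2 * eps) <= W M.
  by apply: le_trans HM; rewrite /B le_eqVlt; apply/orP; left; apply/eqP; ring.
pose l (i : nat) : R := if i is 0%N then 0 else - (B / i%:R).
pose r (i : nat) : R := if i is 0%N then L else B / i%:R.
have Bi i : 0 <= B / i%:R by rewrite divr_ge0.
have cp z : cube l r z -> param L B z.
  move=> cz; split; first exact: cz 0%N.
  by case=> // i _; rewrite ler_norml; exact: cz i.+1.
have e0' := ltW e0.
have pr z : cube l r z -> prof (uu eps z) M by move=> /cp pz; exact: (uu_prof h0 h1 adm HW pz e0' M0 WM).
have lr i : l i <= r i.
  by case: i => [|i]//=; rewrite (le_trans _ (Bi _))// oppr_le0.
have [|||z cz Fz] := @hilbert_miranda R l r (FF eps) lr.
- move=> i z cz e ee.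
  have [K [d [d0 HK]]] := FF_near h0 h1 adm HW sg i L0 B0 e0' M0 WM ee.
  exists K, d; split=> // z' cz' dz.
  by apply: HK => //; rewrite ?lexx ?e0' ?subrr ?normr0//; exact: cp.
- move=> i z cz; have pz := pr z cz; have [bu _ _] := pz; case: i => [|i] /= zi.
    have -> : coef (uu eps z) 0 = coef (fun=> 0 : R) 0.
      by congr coef; apply/funext => x; rewrite /uu zi mul0r (H0 adm HW).
    by rewrite coef0_Int Int_cst; lra.
  have := coef_bound pz (fun x => uu_ge0 h0 h1 HW x (cp z cz) e0') (ltn0Sn i).
  have := Bi i.+1; rewrite zi -/B ler_norml.
  move: (B / i.+1%:R) (coef (uu eps z) i.+1) => b c.
    by have [->|->] := @sgn_coef01 R sg i.+1; lra.
- move=> i z cz; have pz := pr z cz; have [bu eu _] := pz; case: i => [|i] /= zi; last first.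
    have := coef_bound pz (fun x => uu_ge0 h0 h1 HW x (cp z cz) e0') (ltn0Sn i).
    have := Bi i.+1; rewrite zi -/B ler_norml.
    move: (B / i.+1%:R) (coef (uu eps z) i.+1) => b c.
    by have [->|->] := @sgn_coef01 R sg i.+1; lra.
  rewrite coef0_Int subr_le0.
  have u0 x : 0 <= uu eps z x by exact: (uu_ge0 h0 h1 HW x (cp z cz) e0').
  have iu a b := bper_integ a b bu; case: bu => mu _ _.
  have [_ ->] := integ_even (ltW pp) eu mu (iu 0 pi).
  have s1 : Int `[pi / 2, pi] (uu eps z) <= Int `[0, pi] (uu eps z) by apply: Int_sub => //; lra.
  have s2 : Int `[pi / 2, pi] (fun=> 2 : R) <= Int `[pi / 2, pi] (uu eps z).
    apply: Int_le => //; first exact: integ_cst.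
    move=> x; rewrite in_itv/= => /andP[x1 x2].
    have /andP[a0 _] := uu_arg h0 h1 x (cp z cz) e0'.
    apply: (H_ge adm HW) => //; rewrite zi max1cos /=.
    have c0 : cos x <= 0.
      rewrite -(cos_pihalf R); have [->//|xn] := eqVneq x (pi / 2).
      by apply: ltW; apply: cos_decr => //; [lra|rewrite lt_neqAle eq_sym xn].
    have -> : W 2 = L * eps by rewrite /L divfK// gt_eqF.
    apply: ler_wpM2l => //.
    have r0 := rm_ge0 (cos x) (fun y => aL_bound h0 h1 y (cp z cz).2).
    have : eps * 1 <= eps * (1 - cos x) by apply: ler_wpM2l => //; lra.
    lra.
  rewrite Int_cst in s2; lra.
- exists L, B, M, z; split=> //; [exact: cp|exact: pr].
Qed.

(** Split at |s| = 1 / M. Inside, f is at most M and the singularity has integral of order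
    M^(-alpha); outside, the kernel is at most C M^(1 - alpha) and the L^1 norm of f is at most 2
    pi. *)
Lemma Lop_L1_bound : exists2 C : R, 0 < C & forall f N M x, bper f N -> 1 <= M ->
  (forall x, `|f x| <= M) -> Int `[- pi, pi] (fun s => `|f s|) <= 2 * pi ->
  `|Lop f x| <= C * M `^ (1 - alpha).
Proof.
have [C C0 HC] := Ker_bound h0 h1; have pp := @pi_gt0 R; have p2 := @pi_ge2 R.
exists (C * (2 / alpha + 2 * (2 * pi))).
  by rewrite mulr_gt0// addr_gt0 ?divr_gt0// !mulr_gt0.
move=> f N M x bf M1 fM fI; have M0 : 0 < M by apply: lt_le_trans M1.
pose d := M^-1; have d0 : 0 < d by rewrite invr_gt0.
have d1 : d <= 1 by rewrite invf_le1.
have [mf pf _] := bf.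
have i1 := Lop_integ h0 h1 x bf.
have pi0 : - pi <= - d by lra.
have dd : - d <= d by lra.
have dpi : d <= pi by lra.
have sub (a b : R) : - pi <= a -> b <= pi -> {subset `[a, b] <= `[- pi, pi]}.
  by move=> pa bp s; rewrite !in_itv/= => /andP[a1 a2]; rewrite (le_trans pa a1) (le_trans a2 bp).
have dM : d `^ (alpha - 1) = M `^ (1 - alpha).
  by rewrite /d -powR_inv1 ?(ltW M0)// -powRrM; congr (_ `^ _); ring.
have nf : bper (fun s => `|f s|) N.
  case: bf => _ _ b; split=> //; first exact: measurableT_comp.
    by move=> s; rewrite pf.
  by move=> s; rewrite normr_id.
have [mn pn _] := nf.
have [] := Int_per_shift x mn pn (bper_integ (- pi) pi nf).
have -> : (fun s => `|f (s + x)|) = (fun s => `|f (x + s)|) by apply/funext => s; rewrite addrC.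
move=> iN eN.
have outer (a b : R) : - pi <= a -> a <= b -> b <= pi -> (forall s : R, a <= s <= b -> d <= `|s|) ->
    `|Int `[a, b] (fun s => Ker alpha s * f (x + s))| <= C * M `^ (1 - alpha) * (2 * pi).
  move=> pa ab bp ds.
  have sab := sub a b pa bp.
  have i2 : integ `[a, b] (fun s => C * M `^ (1 - alpha) * `|f (x + s)|).
    by apply: integZ; apply: integS iN.
  apply: le_trans (Int_norm_le (integS sab i1) i2 _) _ => [s sI|].
    have := sI; rewrite in_itv/= => /ds sd; have := sab s sI; rewrite in_itv/= => /andP[s1 s2].
    rewrite normrM; apply: ler_wpM2r => //; apply: le_trans (HC s _) _.
      by rewrite ler_norml s1 s2.
    rewrite ler_pM2l// -dM; have -> : alpha - 1 = - (1 - alpha) by ring.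
    rewrite !powRN lef_pV2 ?posrE ?powR_gt0 ?(lt_le_trans d0)//.
    have h1' := h1; apply: ge0_ler_powR; rewrite ?nnegrE ?(ltW d0)//; clear - h0 h1 adm HW sg h1' d0 sd; lra.
  rewrite IntZ; last exact: integS iN.
  apply: ler_wpM2l; first by rewrite mulr_ge0 ?powR_ge0// ltW.
  apply: le_trans fI; rewrite -eN; apply: Int_sub => //.
have inner : `|Int `[- d, d] (fun s => Ker alpha s * f (x + s))| <= C * M `^ (1 - alpha) * (2 / alpha).
  have [ip bp] := abs_powR_integ h0 h1 d0.
  have i2 : integ `[- d, d] (fun s => C * M * `|s| `^ (alpha - 1)) by exact: integZ.
  apply: le_trans (Int_norm_le (integS (sub _ _ pi0 dpi) i1) i2 _) _ => [s|].
    rewrite in_itv/= => /andP[s1 s2].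
    rewrite normrM mulrAC; apply: ler_pM => //; apply: HC; rewrite ler_norml; clear - h0 h1 adm HW sg s1 s2 d1 dpi; lra.
  rewrite IntZ//; have -> : C * M `^ (1 - alpha) * (2 / alpha) = C * M * (2 * (d `^ alpha / alpha)).
    have -> : d `^ alpha = M `^ (- alpha) by rewrite /d -powR_inv1 ?(ltW M0)// -powRrM mulN1r.
    by rewrite powRD ?powRr1 ?(ltW M0)// ?(gt_eqF M0) ?implybT//; field; rewrite gt_eqF.
  by apply: ler_wpM2l bp; rewrite mulr_ge0// ltW.
have -> : Lop f x = Int `[- pi, pi] (fun s => Ker alpha s * f (x + s)) by [].
rewrite (Int_split (b := - d))//; last by lra.
rewrite (Int_split (a := - d) (b := d))//; last by apply: integS i1; apply: sub; clear - h0 h1 adm HW sg p2 d1 d0; lra.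
have o1 : `|Int `[- pi, - d] (fun s => Ker alpha s * f (x + s))| <= C * M `^ (1 - alpha) * (2 * pi).
  by apply: outer => // [|s /andP[_ sd]]; [clear - h0 h1 adm HW sg d0 dpi p2; lra|rewrite ler0_norm; clear - h0 h1 adm HW sg sd d0; lra].
have o2 : `|Int `[d, pi] (fun s => Ker alpha s * f (x + s))| <= C * M `^ (1 - alpha) * (2 * pi).
  by apply: outer => // [|s /andP[sd _]]; [clear - h0 h1 adm HW sg d0 dpi p2; lra|rewrite ger0_norm; clear - h0 h1 adm HW sg sd d0; lra].
apply: le_trans (ler_normD _ _) _.
have n1 := ler_normD (Int `[- d, d] (fun s => Ker alpha s * f (x + s))) (Int `[d, pi] (fun s => Ker alpha s * f (x + s))).
move: (Int _ _) (Int `[- d, d] _) (Int `[d, pi] _) o1 o2 inner n1 => I1 I2 I3.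
have -> : C * (2 / alpha + 2 * (2 * pi)) * M `^ (1 - alpha) =
  C * M `^ (1 - alpha) * (2 / alpha) + (C * M `^ (1 - alpha) * (2 * pi) + C * M `^ (1 - alpha) * (2 * pi)) by ring.
move: (C * M `^ (1 - alpha) * (2 / alpha)) (C * M `^ (1 - alpha) * (2 * pi)) => a b; lra.
Qed.

Lemma half_odd_ge0_bound u M (x : R) : prof u M -> (forall x, 0 <= u x) ->
  `|half_odd sg u x| <= u pi.
Proof.
move=> pu u0; have [_ _] := half_odd_prof sg (prof_tight pu u0); have := half_odd_prof sg (prof_tight pu u0).
by move=> [[_ _ +] _ _] _; apply.
Qed.

Lemma half_odd_L1 u M : prof u M -> (forall x, 0 <= u x) ->
  Int `[- pi, pi] (fun s => `|half_odd sg u s|) <= Int `[- pi, pi] u.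
Proof.
move=> pu u0; have [bu _ _] := pu; rewrite /half_odd; case: sg; last first.
  by rewrite (eq_Int (g := u))// => s _; rewrite ger0_norm.
have bs := bper_addpi bu; have iu := bper_integ (- pi) pi bu; have [mu pu' _] := bu.
have [is_ es] := Int_per_shift pi mu pu' iu.
have -> : Int `[- pi, pi] u = Int `[- pi, pi] (fun x => 2^-1 * (u x + u (x + pi))).
  rewrite IntZ ?IntD ?es//; [by lra|exact: integD].
have [bh _ _] := half_odd_prof true pu; have ih := bper_integ (- pi) pi bh.
apply: Int_le; first exact: integ_norm ih.
  by apply: integZ; exact: integD.
move=> s _; have := u0 s; have := u0 (s + pi); rewrite ler_norml; lra.
Qed.

Section Bounds.
Context (u : R -> R) (M lam eps : R) (pu : prof u M) (u0 : forall x, 0 <= u x).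
Context (e0 : 0 < eps).
Let v := half_odd sg u.
Context (uW : forall x, W (u x) = lam * (Lop v x - Lop v 0 + eps * (1 - cos x))).

Lemma coef_Wu : - coef (W \o u) 1 = lam * (- coef u 1 + eps * pi).
Proof.
have pv := half_odd_prof sg pu; have [bv ev _] := pv; have pp := @pi_ge0 R.
have L1 : coef (Lop v) 1 = coef u 1.
  rewrite (coef_Lop h0 h1 _ bv ev)// powRN powR1 invr1 mul1r (coef_half_odd sg _ pu).
  by rewrite /sgn_coef; case: sg; rewrite mul1r.
have bL : bper (Lop v) (normK alpha * M).
  have [_ pv' _] := bv; split; [|exact: Lop_per|by move=> x; exact: Lop_bound].
  by apply: continuous_measurable_fun => x; exact: Lop_continuous bv x.
have i1 := coef_integ 1 (- pi) pi bL.
have i2 : integ `[- pi, pi] (fun s : R => cos (1%:R * s)) by exact: cosk_integ.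
have i3 : integ `[- pi, pi] (fun s : R => cos (1%:R * s) * cos (1%:R * s)).
  by apply: (integM (M := 1)) => //; [exact: integ_meas i2|move=> s _; exact: abs_cos_le1].
have i23 : integ `[- pi, pi] (fun s : R => eps * (cos (1%:R * s) * cos (1%:R * s))) by exact: integZ.
have i22 : integ `[- pi, pi] (fun s : R => (eps - Lop v 0) * cos (1%:R * s)) by exact: integZ.
have -> : coef (W \o u) 1 = Int `[- pi, pi] (fun s => lam * ((cos (1%:R * s) * Lop v s + (eps - Lop v 0) * cos (1%:R * s)) - eps * (cos (1%:R * s) * cos (1%:R * s)))).
  by apply: eq_Int => s _; rewrite /= uW mul1r; ring.
rewrite IntZ; last by apply: integB => //; apply: integD.
rewrite IntB//; last by apply: integD.
rewrite IntD// !IntZ// Int_cosk// Int_cosk_cosj// eqxx -/(coef (Lop v) 1) L1.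
by rewrite mulr0 addr0; ring.
Qed.

(** Compares the two values of the first coefficient of W(u): [coef_Wu] gives lam (- coef u 1 + eps
    pi), and the Lipschitz bound on W gives at most [Lp (u pi)] times - coef u 1. The positive term
    eps pi makes the comparison conclusive even if the coefficient of u were 0. *)
Lemma speed_bound : lam <= Lp (u pi).
Proof.
have [bu eu iu] := pu; have [mu pu' _] := bu; have pp := @pi_gt0 R.
have tu := prof_tight pu u0; have upi x : u x <= u pi := prof_le_pi x pu.
have Lp0 := adm_Lp_gt0 adm (u0 pi).
have pW : prof (W \o u) (W (u pi)).
  split; [split| |].
  - by apply: measurableT_comp => //; apply: continuous_measurable_fun; exact: adm_cont adm.
  - by move=> x; rewrite /= pu'.
  - by move=> x; rewrite /= ger0_norm ?(W_ge0 adm)//; exact: (W_le adm).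
  - by move=> x; rewrite /= eu.
  - by move=> x y x0 xy yp; apply: (W_le adm) => //; exact: iu.
have [eWu iWu] := prof_coef1 pW; have [eu1 iu1] := prof_coef1 pu.
have key : - coef (W \o u) 1 <= Lp (u pi) * - coef u 1.
  rewrite eWu eu1 mulrCA ler_pM2l// -IntZ//; apply: Int_le => //; first exact: integZ.
  move=> s; rewrite in_itv/= => /andP[s0 s1].
  have c0 : 0 <= cos s by apply: cos_ge0_pihalf; lra.
  rewrite mulrCA; apply: ler_wpM2l => //; apply: (adm_lip adm) => //.
  by apply: iu; lra.
rewrite coef_Wu in key.
have c0 := prof_coef1_ge0 pu; set c := - coef u 1 in key c0.
rewrite leNgt; apply/negP => ll.
have : Lp (u pi) * c <= lam * c by apply: ler_wpM2r => //; exact: ltW.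
have : 0 < lam * (eps * pi) by rewrite !mulr_gt0// (lt_trans Lp0).
lra.
Qed.

Lemma mean_max : Int `[- pi, pi] u = 2 * pi -> 1 <= u pi.
Proof.
move=> mu; have pp := @pi_gt0 R; have [bu _ _] := pu.
have : Int `[- pi, pi] u <= Int `[- pi, pi] (fun=> u pi).
  apply: Int_le; [exact: bper_integ bu|exact: integ_cst|by move=> x _; exact: prof_le_pi pu].
rewrite mu Int_cst; last by lra.
have -> : u pi * (pi - - pi) = u pi * (2 * pi) by ring.
by rewrite -[leLHS]mul1r ler_pM2r; lra.
Qed.

End Bounds.

(** With m = u pi, [speed_bound] and [Lop_L1_bound] give W m <= C' Lp m m^(1 - alpha), while
    [adm_big] gives W m >= c m Lp m once m exceeds M1. Division leaves a bound on m^alpha. *)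
Lemma apriori_bound : exists2 M0 : R, 1 <= M0 & forall u M lam eps, prof u M -> (forall x, 0 <= u x) ->
  0 < eps -> eps <= 1 -> 0 <= lam -> Int `[- pi, pi] u = 2 * pi ->
  (forall x, W (u x) = lam * (Lop (half_odd sg u) x - Lop (half_odd sg u) 0 + eps * (1 - cos x))) ->
  u pi <= M0.
Proof.
have [C C0 HC] := Lop_L1_bound.
have [c [M1 [c0 M11 HM]]] := adm_big adm.
exists (Num.max M1 (((2 * C + 2) / c) `^ alpha^-1)); first by rewrite le_max M11.
move=> u M lam eps pu u0 e0 e1 l0 mu uW.
have sp := speed_bound pu u0 e0 uW; have m1 := mean_max pu mu.
set m := u pi in sp m1 *; rewrite le_max; have [mM|Mm] := leP m M1; first by [].
rewrite orFb; have m0 : 0 < m by lra.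
have Lp0 := adm_Lp_gt0 adm (ltW m0).
have [bv _ _] := half_odd_prof sg pu.
have vI : Int `[- pi, pi] (fun s => `|half_odd sg u s|) <= 2 * pi by rewrite -mu; exact: half_odd_L1 pu u0.
have vb x := half_odd_ge0_bound x pu u0.
have Lb x := HC _ _ _ x bv m1 vb vI.
have p1 : 1 <= m `^ (1 - alpha).
  have h1' := h1; have e : (1 : R) `^ (1 - alpha) = 1 by rewrite powR1.
  by rewrite -[leLHS]e; apply: ge0_ler_powR; rewrite ?nnegrE; clear - h0 h1 adm HW sg h1' m1; lra.
have Wm : W m <= Lp m * ((2 * C + 2) * m `^ (1 - alpha)).
  have X0 : 0 <= (2 * C + 2) * m `^ (1 - alpha) by rewrite mulr_ge0 ?powR_ge0//; lra.
  apply: le_trans (ler_wpM2r X0 sp); rewrite uW; apply: ler_wpM2l => //.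
  have := Lb pi; have := Lb 0; rewrite !ler_norml cospi.
  move: (Lop _ pi) (Lop _ 0) => L1 L2.
  have : 2 * 1 <= 2 * m `^ (1 - alpha) by rewrite ler_pM2l.
  have -> : (2 * C + 2) * m `^ (1 - alpha) = 2 * (C * m `^ (1 - alpha)) + 2 * m `^ (1 - alpha) by ring.
  lra.
have k1 := le_trans (HM m (ltW Mm)) Wm.
have k2 : c * m `^ alpha <= 2 * C + 2.
  have mm : m = m `^ alpha * m `^ (1 - alpha).
    by rewrite -powRD ?(gt_eqF m0) ?implybT// addrC subrK powRr1// ltW.
  have pos : 0 < Lp m * m `^ (1 - alpha) by rewrite mulr_gt0// powR_gt0.
  rewrite -(ler_pM2r pos); move: k1; rewrite {1}mm; congr (_ <= _); ring.
have k3 : m `^ alpha <= (2 * C + 2) / c by rewrite ler_pdivlMr// mulrC.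
have -> : m = (m `^ alpha) `^ alpha^-1 by rewrite -powRrM mulfV ?gt_eqF// powRr1// ltW.
by apply: ge0_ler_powR; rewrite ?nnegrE ?invr_ge0 ?(ltW h0) ?powR_ge0//; apply: le_trans k3; exact: powR_ge0.
Qed.

End Apriori.

(** * Removal of the regularisation *)

Section Limit.
Context {R : realType} (alpha : R) (h0 : 0 < alpha) (h1 : alpha < 1).
Notation Lop := (Lop alpha).
Notation Zc := (Zc alpha).
Context (W Lp : R -> R) (adm : admissible W Lp) (sg : bool).
Implicit Types (z q : nat -> R) (eps B Lam E M e x lam : R) (u v f : R -> R).

(** Since lam and u are bounded independently of eps, the solutions for eps = 1 / (n + 1) lie in one
    box. A cluster point solves every equation at eps = 0, the limit being taken one equation at a
    time. Its inverse speed is positive, for otherwise u would be H 0 = 0, against the mean. *)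
Theorem profile_exists : exists lam M u, [/\ 0 < lam, prof u M, continuous u,
  forall x, 0 <= u x & Int `[- pi, pi] u = 2 * pi] /\ u 0 = 0 /\
  forall x, W (u x) = lam * (Lop (half_odd sg u) x - Lop (half_odd sg u) 0).
Proof.
have [H HW HK] := W_inverse adm; pose U := uu alpha H; pose F := FF alpha H sg.
have pp := @pi_gt0 R.
have [M0 M01 HM0] := apriori_bound h0 h1 adm sg.
have M0p : 0 < M0 by lra.
pose L := Lp M0; have L0 : 0 <= L by apply: ltW; exact: (adm_Lp_gt0 adm (ltW M0p)).
pose B := pi * M0; have B0 : 0 <= B by rewrite mulr_ge0// ltW.
pose ep (n : nat) : R := n.+1%:R^-1.
have ep0 n : 0 < ep n by rewrite invr_gt0 ltr0n.
have ep1 n : ep n <= 1 by rewrite invf_le1 ?ltr0n// ler1n.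
have ex n : exists z, param L B z /\ forall i, F (ep n) i z = 0.
  have [Lam' [B' [M [z [pz M0' pu Fz]]]]] := FF_zero_exists h0 h1 adm HW sg (ep0 n).
  exists z; split=> //.
  have e0 := ltW (ep0 n).
  have u0 x : 0 <= U (ep n) z x := uu_ge0 h0 h1 HW x pz e0.
  have Iu : Int `[- pi, pi] (U (ep n) z) = 2 * pi.
    by apply/eqP; rewrite -coef0_Int eq_sym -subr_eq0; apply/eqP; exact: Fz 0%N.
  have zk k : (0 < k)%N -> z k = coef (half_odd sg (U (ep n) z)) k.
    case: k => // k _; rewrite (coef_half_odd sg _ pu).
    by apply/eqP; rewrite eq_sym -subr_eq0; apply/eqP; exact: Fz k.+1.
  have uW := uu_solution h0 h1 HW pz e0 pu zk.
  have l0 : 0 <= z 0%N by case: pz => /andP[].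
  have m1 := HM0 _ _ _ _ pu u0 (ep0 n) (ep1 n) l0 Iu uW.
  have sp := speed_bound h0 h1 adm pu u0 (ep0 n) uW.
  split.
    rewrite l0/=; apply: le_trans sp _; apply: (adm_Lp_mono adm) => //; exact: u0.
  case=> // k _; rewrite zk// (coef_half_odd sg _ pu).
  have b := coef_bound (prof_tight pu u0) u0 (ltn0Sn k).
  have b' : pi * U (ep n) z pi / k.+1%:R <= B / k.+1%:R.
    by rewrite ler_pM2r ?invr_gt0 ?ltr0n// ler_pM2l.
  rewrite normrM; apply: le_trans (le_trans b b'); rewrite ler_piMl//.
  by have [->|->] := @sgn_coef01 R sg k.+1; rewrite ?normr0 ?normr1.
have [zn Hzn] := choice ex.
pose l (i : nat) : R := if i is 0%N then 0 else - (B / i%:R).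
pose r (i : nat) : R := if i is 0%N then L else B / i%:R.
have [|zz [zzb zzc]] := @box_cluster R l r zn.
  move=> n i; have [[z0 bz] _] := Hzn n; case: i => [|i] //=.
  by have := bz i.+1 isT; rewrite ler_norml.
have pzz : param L B zz.
  split; first exact: zzb 0%N.
  by case=> // i _; rewrite ler_norml; exact: zzb i.+1.
have [M M1 HM] := adm_super adm 0 (L * (B * Zc + 2 * 1)).
have {}HM : L * (B * Zc + 2 * 1) <= W M by move: HM; rewrite mul0r add0r.
have M0' : 0 <= M by lra.
have F0 i : F 0 i zz = 0.
  apply/eqP; rewrite -normr_le0; apply/ler_addgt0Pl => e e0; rewrite addr0.
  have [K [d [d0 HF]]] := FF_near h0 h1 adm HW sg i L0 B0 ler01 M0' HM e0.
  have [m _ Hm] : \forall n \near \oo, ep n < d.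
    have : (ep n @[n --> \oo] --> (0 : R)) by exact: cvg_harmonic.
    move/cvgr0Pnorm_lt => /(_ _ d0); apply: filterS => n; exact: le_lt_trans (ler_norm _).
  have [n mn Hn] := zzc K d m d0.
  have [pzn Fn] := Hzn n.
  have -> : `|F 0 i zz| = `|F (ep n) i (zn n) - F 0 i zz| by rewrite Fn sub0r normrN.
  apply: ltW; apply: HF => //; rewrite ?lexx ?ler01 ?(ltW (ep0 n)) ?ep1//.
  by rewrite subr0 ger0_norm ?(ltW (ep0 n))//; exact: Hm.
have WM0 : L * (B * Zc + 2 * 0) <= W M.
  apply: le_trans HM; apply: ler_wpM2l => //; lra.
have pu : prof (U 0 zz) M by exact: uu_prof h0 h1 _ _ _ adm HW _ _ _ _ _ pzz (lexx 0) M0' WM0.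
have u0 x : 0 <= U 0 zz x := uu_ge0 h0 h1 HW x pzz (lexx 0).
have Iu : Int `[- pi, pi] (U 0 zz) = 2 * pi.
  by apply/eqP; rewrite -coef0_Int eq_sym -subr_eq0; apply/eqP; exact: F0 0%N.
have zk k : (0 < k)%N -> zz k = coef (half_odd sg (U 0 zz)) k.
  case: k => // k _; rewrite (coef_half_odd sg _ pu).
  by apply/eqP; rewrite eq_sym -subr_eq0; apply/eqP; exact: F0 k.+1.
have uW x : W (U 0 zz x) = zz 0%N * (Lop (half_odd sg (U 0 zz)) x - Lop (half_odd sg (U 0 zz)) 0).
  by rewrite (uu_solution h0 h1 HW pzz (lexx 0) pu zk) mul0r addr0.
have l0 : 0 < zz 0%N.
  have /andP[z0 _] := pzz.1; rewrite lt_neqAle z0 andbT; apply/eqP => ze.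
  move: Iu; rewrite (eq_Int (g := fun=> 0)); first by rewrite Int_cst; lra.
  by move=> x _; rewrite /U /uu -ze mul0r (H0 adm HW).
exists (zz 0%N), M, (U 0 zz); split; [split=> //|split=> //].
- have [[_ _ bu] _ _] := pu; have [bv _ _] := half_odd_prof sg pu.
  move=> x; apply/cvgrPdist_lt => e e0.
  have [d d0 Hd] := H_mod adm HW (W M) e0.
  have dl : 0 < d / zz 0%N by rewrite divr_gt0.
  have := Lop_continuous h0 h1 bv (x := x) => /cvgrPdist_lt /(_ _ dl).
  apply: filterS => y hy; rewrite -(HK _ (u0 x)) -(HK _ (u0 y)).
  have WM t : 0 <= W (U 0 zz t) <= W M.
    rewrite (W_ge0 adm)//=; apply: (W_le adm) => //.
    by have := bu t; rewrite ger0_norm.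
  apply: Hd => //; rewrite !uW -mulrBr normrM gtr0_norm//.
  have -> : forall a b c : R, a - c - (b - c) = a - b by move=> *; ring.
  by rewrite mulrC -ltr_pdivlMr.
- apply/le_anti; rewrite u0 andbT leNgt; apply/negP => up.
  by have := W_lt adm (lexx 0) up; rewrite uW subrr mulr0 (adm0 adm) ltxx.
Qed.

End Limit.

Lemma der_limit {R : realType} (f : R -> R) (x d : R) :
  h^-1 * (f (h + x) - f x) @[h --> 0^'] --> d -> der f x d.
Proof.
move=> c; have e : (fun h : R => h^-1 *: (f (h *: 1 + x) - f x)) = (fun h => h^-1 * (f (h + x) - f x)).
  by apply/funext => h; rewrite [h *: 1]mulr1.
apply: DeriveDef.
  by rewrite /derivable e; apply/cvg_ex; exists d.
by rewrite /derive e; exact: cvg_lim c.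
Qed.

(** * The function W of the two power nonlinearities *)

Section Nonlinearity.
Context {R : realType} (p : R) (hp : 1 < p).
Implicit Types (n : nonlinearity) (x y t a b c M : R).

Definition dnonlin n x : R :=
  match n with
  | nl_abs => p * (Num.sg x * `|x| `^ (p - 1))
  | nl_sgn => p * `|x| `^ (p - 1)
  end.

Lemma nonlin_pos n x : 0 <= x -> nonlin n p x = x `^ p.
Proof.
case: n => x0 /=; rewrite ger0_norm//.
move: x0; rewrite le_eqVlt => /predU1P[<-|x0]; first by have hp' := hp; rewrite mul0r powR0// gt_eqF//; lra.
by rewrite -{1}(powRr1 (ltW x0)) -powRD ?(gt_eqF x0) ?implybT//; congr (_ `^ _); ring.
Qed.

Lemma nonlinN n x : nonlin n p (- x) = (if n is nl_abs then 1 else -1) * nonlin n p x.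
Proof. by case: n => /=; rewrite normrN ?mul1r// mulN1r mulNr. Qed.

Lemma dnonlinN n x : dnonlin n (- x) = (if n is nl_abs then - 1 else 1) * dnonlin n x.
Proof. by case: n => /=; rewrite normrN ?mul1r// sgrN mulN1r mulNr mulrN. Qed.

Lemma der_nonlin n x : der (nonlin n p) x (dnonlin n x).
Proof.
have pos y : 0 < y -> der (nonlin n p) y (dnonlin n y).
  move=> y0; apply: (@der_ext _ (fun z => z `^ p)).
    near=> z; rewrite nonlin_pos//; near: z.
    by near=> z; apply: ltW; near: z; exact: lt_nbhsr.
  apply: der_eq (der_powR p y0) _.
  by case: n => /=; rewrite gtr0_norm// gtr0_sg// mul1r.
case: (ltgtP x 0) => [x0|x0|->]; last 2 first.
- exact: pos.
(* At 0 the difference quotient has modulus |h|^(p - 1), which tends to 0. *)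
- apply: der_limit.
  have d0 : dnonlin n 0 = 0.
    by have hp' := hp; case: n {pos} => /=; rewrite ?sgr0 ?mul0r ?mulr0// normr0 powR0 ?mulr0// gt_eqF//; lra.
  have n0 : nonlin n p 0 = 0 by rewrite nonlin_pos// powR0// gt_eqF//; have hp' := hp; lra.
  rewrite d0 n0; apply: norm_cvg0.
  have p1 : 0 < p - 1 by have hp' := hp; lra.
  have := powR_abs_continuous p1 (x := 0 : R).
  rewrite /continuous_at normr0 powR0 ?gt_eqF// => /cvg_within_filter c.
  apply: cvg_trans (c (fun y => y != 0)); apply: near_eq_cvg.
  near=> h; have h0 : h != 0 by near: h; exact: nbhs_dnbhs_neq.
  have nE : `|nonlin n p h| = `|h| * `|h| `^ (p - 1).
    rewrite -[RHS]ger0_norm ?mulr_ge0 ?powR_ge0//; case: n {pos d0 n0} => /=; rewrite !normrM ?normr_id//.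
    rewrite !(ger0_norm (powR_ge0 _ _)) -{2}(powRr1 (normr_ge0 h)) -powRD ?normr_eq0 ?h0 ?implybT//.
    by congr (_ `^ _); ring.
  by rewrite addr0 subr0 normrM nE normfV mulKf ?normr_eq0.
- have -> : nonlin n p = (fun z => (if n is nl_abs then 1 else -1) * nonlin n p (- z)).
    by apply/funext => z; rewrite nonlinN; case: n {pos}; ring.
  have nx : 0 < - x by lra.
  apply: der_eq (derZ _ (der_comp (derN (der_id x)) (pos _ nx))) _.
  by rewrite dnonlinN; case: n {pos}; ring.
Unshelve. all: by end_near.
Qed.

Lemma bernoulli q t : 0 < q -> 0 <= t <= 1 -> Num.min 1 q * t <= 1 - (1 - t) `^ q.
Proof.
move=> q0 /andP[t0]; rewrite le_eqVlt => /predU1P[->|t1].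
  by rewrite subrr powR0 ?gt_eqF// mulr1 subr0 ge_min lexx.
have [q1|q1] := leP 1 q.
  by have := @ge1r_powR R (1 - t) q; rewrite q1 => /(_ _ isT); rewrite mul1r; lra.
move: t0; rewrite le_eqVlt => /predU1P[<-|t0]; first by rewrite subr0 powR1; lra.
have [||c /andP[c1 c2]] := @mvt _ (fun x : R => x `^ q) (fun x => q * x `^ (q - 1)) (1 - t) 1; first lra.
  by move=> x /andP[x1 _]; apply: der_powR; lra.
rewrite powR1 => ->; have -> : 1 - (1 - t) = t by ring.
rewrite ler_pM2r// ler_peMr ?(ltW q0)//.
have -> : q - 1 = - (1 - q) by ring.
have c0 : 0 < c by lra.
rewrite powRN invf_ge1 ?powR_gt0//.
have e : (1 : R) `^ (1 - q) = 1 by rewrite powR1.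
by rewrite -[leRHS]e; apply: ge0_ler_powR; rewrite ?nnegrE; lra.
Qed.

(* The decrease of c x - n(x) from x = mu to x = mu (1 - u), divided by c mu. *)
Definition Wf n u : R := (1 - p^-1) - ((1 - u) - nonlin n p (1 - u) / p).

Definition dWf n u : R := 1 - dnonlin n (1 - u) / p.

Lemma der_Wf n u : der (Wf n) u (dWf n u).
Proof.
have d1 : der (fun v : R => 1 - v) u (0 - 1) by apply: derB; [exact: derC|exact: der_id].
have d2 := derZ p^-1 (der_comp d1 (der_nonlin n (1 - u))).
have -> : Wf n = (fun v => 1 - p^-1 - (1 - v - p^-1 * nonlin n p (1 - v))).
  by apply/funext => v; rewrite /Wf [p^-1 * _]mulrC.
apply: der_eq (derB (derC (1 - p^-1) u) (derB d1 d2)) _.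
by rewrite /dWf; ring.
Qed.

Lemma p_gt0 : 0 < p. Proof. by have := hp; lra. Qed.

Lemma Wf0 n : Wf n 0 = 0.
Proof. by rewrite /Wf subr0 nonlin_pos// powR1 mul1r; ring. Qed.

Lemma Wf2_sgn : Wf nl_sgn 2 = 2 * (1 - p^-1).
Proof.
rewrite /Wf; have -> : 1 - 2 = - 1 :> R by ring.
by rewrite nonlinN nonlin_pos// powR1; ring.
Qed.

Lemma Wf_sgn_refl u : Wf nl_sgn (2 - u) = 2 * (1 - p^-1) - Wf nl_sgn u.
Proof.
rewrite /Wf; have -> : 1 - (2 - u) = - (1 - u) by ring.
by rewrite nonlinN; ring.
Qed.

Lemma dWf_le1 n u : 0 <= u <= 1 -> dWf n u = 1 - (1 - u) `^ (p - 1).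
Proof.
have p0 := p_gt0; move=> /andP[u0 u1]; rewrite /dWf; have v0 : 0 <= 1 - u by lra.
case: n => /=; rewrite ger0_norm// mulrC mulKf ?gt_eqF//.
move: v0; rewrite le_eqVlt => /predU1P[<-|v0]; last by rewrite gtr0_sg// mul1r.
by rewrite sgr0 mul0r powR0// gt_eqF//; have := hp; lra.
Qed.

Lemma dWf_abs_ge1 u : 1 <= u -> dWf nl_abs u = 1 + (u - 1) `^ (p - 1).
Proof.
have p0 := p_gt0; move=> u1; rewrite /dWf /= -normrN opprB ger0_norm ?subr_ge0// mulrC mulKf ?gt_eqF//.
move: u1; rewrite le_eqVlt => /predU1P[<-|u1]; last by rewrite ltr0_sg; lra.
by rewrite subrr sgr0 powR0 ?mul0r; [ring|rewrite gt_eqF//; have := hp; lra].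
Qed.

Lemma dWf_sgn_refl u : dWf nl_sgn (2 - u) = dWf nl_sgn u.
Proof.
rewrite /dWf; have -> : 1 - (2 - u) = - (1 - u) by ring.
by rewrite dnonlinN mul1r.
Qed.

Definition kap : R := Num.min 1 (p - 1).

Lemma kap_gt0 : 0 < kap. Proof. by rewrite lt_min ltr01; have := hp; lra. Qed.

Lemma dWf_ge n u : 0 <= u <= 1 -> kap * u <= dWf n u.
Proof. by move=> hu; rewrite dWf_le1//; apply: bernoulli => //; have := hp; lra. Qed.

Lemma dWf_abs_ge u : 0 <= u -> kap * Num.min 1 u <= dWf nl_abs u.
Proof.
move=> u0; have [u1|u1] := leP 1 u; last by apply: dWf_ge; rewrite u0 ltW.
rewrite dWf_abs_ge1// mulr1; have := powR_ge0 (u - 1) (p - 1).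
have : kap <= 1 by rewrite ge_min lexx.
  lra.
Qed.

Lemma dWf_le n u : 0 <= u -> dWf n u <= 1 + (if n is nl_abs then u `^ (p - 1) else 0).
Proof.
move=> u0; have p0 := p_gt0; have [u1|u1] := leP u 1.
  rewrite dWf_le1 ?u0//; have := powR_ge0 (1 - u) (p - 1); have := powR_ge0 u (p - 1); case: n; lra.
case: n.
  rewrite (dWf_abs_ge1 (ltW u1)) lerD2l; apply: ge0_ler_powR; rewrite ?nnegrE; have := hp; lra.
rewrite /dWf /= mulrC mulKf ?gt_eqF//; have := powR_ge0 `|1 - u| (p - 1); lra.
Qed.

(* In the odd case Wf decreases for u > 2; the modification is never reached by
   the solution, where u <= 2. *)
Definition Wx n u : R :=
  if n is nl_sgn then (if u <= 2 then Wf n u else Wf n 2 + (u - 2) ^+ 2) else Wf n u.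

Definition Lx n M : R := if n is nl_abs then 1 + M `^ (p - 1) else 1 + 2 * M.

Definition quad_on (W : R -> R) m M := exists2 c : R, 0 < c &
  forall a b, m <= a -> a <= b -> b <= M -> c * (b - a) ^+ 2 <= W b - W a.

(** An increment across t splits in two, and (x + y)^2 <= 2 x^2 + 2 y^2 costs the factor 1/2. *)
Lemma quad_glue W m t M : quad_on W m t -> quad_on W t M -> quad_on W m M.
Proof.
move=> [c c0 H1] [d d0 H2]; exists (Num.min c d / 2); first by rewrite divr_gt0// lt_min c0.
have c1 : Num.min c d <= c by rewrite ge_min lexx.
have d1 : Num.min c d <= d by rewrite ge_min lexx orbT.
have m0 : 0 < Num.min c d by rewrite lt_min c0.
set k := Num.min c d in c1 d1 m0 *.
move=> a b ma ab bM; have [bt|tb] := leP b t.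
  apply: le_trans (H1 _ _ ma ab bt); apply: ler_wpM2r; [exact: sqr_ge0|lra].
have [at_|ta] := leP a t; last first.
  apply: le_trans (H2 _ _ (ltW ta) ab bM); apply: ler_wpM2r; [exact: sqr_ge0|lra].
have e1 := H1 _ _ ma at_ (lexx t); have e2 := H2 _ _ (lexx t) (ltW tb) bM.
have f1 : k * (t - a) ^+ 2 <= c * (t - a) ^+ 2 by apply: ler_wpM2r => //; exact: sqr_ge0.
have f2 : k * (b - t) ^+ 2 <= d * (b - t) ^+ 2 by apply: ler_wpM2r => //; exact: sqr_ge0.
have f3 : k / 2 * (b - a) ^+ 2 <= k * ((t - a) ^+ 2 + (b - t) ^+ 2).
  rewrite -mulrA ler_pM2l//; have := sqr_ge0 ((t - a) - (b - t)).
  by rewrite !expr2; lra.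
lra.
Qed.

Lemma quad_inc (W dW : R -> R) m M k : 0 < k -> (forall t, m <= t <= M -> der W t (dW t)) ->
  (forall t, m <= t <= M -> k * (t - m) <= dW t) -> quad_on W m M.
Proof.
move=> k0 dd dk; exists (k / 2); first by rewrite divr_gt0.
move=> a b ma ab bM.
have H : W a - k / 2 * (a - m) ^+ 2 <= W b - k / 2 * (b - m) ^+ 2.
  apply: (@derive_mono _ (fun t => W t - k / 2 * (t - m) ^+ 2) (fun t => dW t - k * (t - m))) => //.
    move=> t /andP[at_ tb]; have tm : m <= t <= M by rewrite (le_trans ma at_) (le_trans tb bM).
    have d1 : der (fun t => t - m) t (1 - 0) by apply: derB; [exact: der_id|exact: derC].
    apply: der_eq (derB (dd _ tm) (derZ (k / 2) (derM d1 d1))) _.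
    by rewrite subr0; field.
  by move=> t /andP[at_ tb]; rewrite subr_ge0; apply: dk; lra.
have : k / 2 * (b - a) ^+ 2 <= k / 2 * ((b - m) ^+ 2 - (a - m) ^+ 2).
  rewrite ler_pM2l ?divr_gt0//; have : 0 <= (a - m) * (b - a) by rewrite mulr_ge0; lra.
  by rewrite !expr2; lra.
lra.
Qed.

Lemma quad_refl (W : R -> R) C m M : quad_on W (C - M) (C - m) ->
  (forall a b, m <= a -> a <= b -> b <= M -> W b - W a = W (C - a) - W (C - b)) -> quad_on W m M.
Proof.
move=> [c c0 H] e; exists c => // a b ma ab bM; rewrite e//.
have -> : b - a = (C - a) - (C - b) by ring.
by apply: H; lra.
Qed.

(** On [0, 1] the derivative is at least [kap] u. Beyond 1, in case (abs), it stays above [kap]; in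
    case (sgn) the reflection u to 2 - u carries the estimate to [1, 2], and the quadratic
    continuation has it from 2 on. *)
Lemma Wx_quad n M : quad_on (Wx n) 0 M.
Proof.
have k0 := kap_gt0; have ext W W' m N : quad_on W m N -> (forall t, m <= t <= N -> W' t = W t) -> quad_on W' m N.
  by move=> [c c0 H] e; exists c => // a b ma ab bN; rewrite !e ?ma ?(le_trans ma ab) ?bN ?(le_trans ab bN)//; exact: H.
have q1 : quad_on (Wf n) 0 1.
  apply: (quad_inc k0 (fun t _ => der_Wf n t)) => t ht; rewrite subr0; exact: dWf_ge.
case: n q1 => q1.
  have q2 : quad_on (Wf nl_abs) 1 (Num.max 1 M).
    apply: (quad_inc (k := kap / Num.max 1 M) _ (fun t _ => der_Wf _ t)).
      by rewrite divr_gt0// lt_max ltr01.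
    move=> t /andP[t1 tM]; apply: le_trans (dWf_abs_ge _); last lra.
    rewrite -mulrA ler_pM2l// (min_idPl t1) mulrC ler_pdivrMr ?lt_max ?ltr01// mul1r.
    by lra.
  have [c c0 H] := quad_glue q1 q2; exists c => // a b a0 ab bM.
  by apply: H => //; rewrite le_max bM orbT.
have q2 : quad_on (Wf nl_sgn) 1 2.
  apply: (@quad_refl _ 2).
    have -> : 2 - 2 = 0 :> R by ring.
    by have -> : 2 - 1 = 1 :> R by ring.
  by move=> a b _ _ _; rewrite !Wf_sgn_refl; ring.
have q3 : quad_on (Wx nl_sgn) 0 2.
  by apply: ext (quad_glue q1 q2) _ => t /andP[_ t2]; rewrite /Wx t2.
have q4 : quad_on (Wx nl_sgn) 2 M.
  have e t : 2 <= t -> Wx nl_sgn t = Wf nl_sgn 2 + (t - 2) ^+ 2.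
    rewrite /Wx; case: (ltgtP t 2) => // -> _; by rewrite subrr expr0n addr0.
  exists 1; rewrite ?ltr01// => a b a2 ab bM; rewrite !e ?(le_trans a2 ab)//.
  have : 0 <= (a - 2) * (b - a) by rewrite mulr_ge0; lra.
  by rewrite !expr2; lra.
exact: quad_glue q3 q4.
Qed.

Lemma Wf_lip n M a b : 0 <= a -> a <= b -> b <= M -> (n = nl_sgn -> b <= 2) ->
  Wf n b - Wf n a <= (1 + (if n is nl_abs then M `^ (p - 1) else 0)) * (b - a).
Proof.
move=> a0 ab bM b2; set L := 1 + _.
have H : L * a - Wf n a <= L * b - Wf n b.
  have dd t : a <= t <= b -> der (fun t => L * t - Wf n t) t (L * 1 - dWf n t).
    by move=> _; apply: derB (der_Wf n t); apply: derZ; exact: der_id.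
  apply: (derive_mono ab dd).
  move=> t /andP[at_ tb]; have t0 : 0 <= t by lra.
  rewrite subr_ge0 mulr1; apply: le_trans (dWf_le n t0) _; rewrite lerD2l.
  case: n {b2 L dd} => //; apply: ge0_ler_powR; rewrite ?nnegrE; have := hp; lra.
lra.
Qed.

Lemma Wx_lip n M a b : 0 <= a -> a <= b -> b <= M -> Wx n b - Wx n a <= Lx n M * (b - a).
Proof.
case: n => a0 ab bM; first by apply: Wf_lip.
have M0 : 0 <= M by lra.
rewrite /Wx; have [b2|b2] := leP b 2.
  rewrite (le_trans ab b2); have := @Wf_lip nl_sgn M a b a0 ab bM (fun _ => b2).
  have : 0 <= 2 * M * (b - a) by rewrite !mulr_ge0; lra.
  by rewrite /Lx addr0; lra.
have sq c : 2 <= c -> c <= b -> (b - 2) ^+ 2 - (c - 2) ^+ 2 <= 2 * M * (b - c).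
  move=> c2 cb; have : 0 <= (b - c) * (2 * M - b - c + 4) by rewrite mulr_ge0; lra.
  by rewrite !expr2; lra.
have [a2|a2] := leP a 2; rewrite /Lx.
  have := @Wf_lip nl_sgn 2 a 2 a0 a2 (lexx 2) (fun _ => lexx 2).
  have := sq 2 (lexx 2) (ltW b2); rewrite subrr expr0n addr0 subr0.
  have : 0 <= 2 * M * (2 - a) by rewrite !mulr_ge0; lra.
  lra.
by have := sq a (ltW a2) ab; lra.
Qed.

Lemma Wx_continuous n : continuous (Wx n).
Proof.
have cW m : continuous (Wf m) by move=> x; exact: der_cont (der_Wf m x).
case: n; first exact: cW.
have -> : Wx nl_sgn = (fun u => Wf nl_sgn (Num.min u 2) + (Num.max u 2 - 2) ^+ 2).
  apply/funext => u; rewrite /Wx; case: (leP u 2) => u2; first by rewrite subrr expr0n addr0.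
  by [].
move=> x; apply: cvgD.
  apply: (@continuous_comp _ _ _ (fun u : R => Num.min u 2) (Wf nl_sgn)); last exact: cW.
  by apply: continuous_min; [exact: cvg_id|exact: cvg_cst].
have c1 : {for x, continuous (fun u : R => Num.max u 2 - 2)}.
  apply: (@continuousB _ _ _ (fun u : R => Num.max u 2) (fun=> 2)); last exact: cvg_cst.
  by apply: continuous_max; [exact: cvg_id|exact: cvg_cst].
exact: (continuous_comp c1 (@exprn_continuous _ _ _)).
Qed.

Lemma Wx_big n : exists c M1 : R, [/\ 0 < c, 1 <= M1 & forall M, M1 <= M -> c * M * Lx n M <= Wx n M].
Proof.
have p0 := p_gt0; case: n; last first.
  (* For M >= 4, (M - 2)^2 is at least M (1 + 2 M) / 12, and W is nonnegative at 2. *)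
  exists (12^-1), 4; split; [by rewrite invr_gt0|lra|] => M M4.
  rewrite /Wx ifF; last by apply/negbTE; rewrite -ltNge; lra.
  have W2 : 0 <= Wf nl_sgn 2.
    have [c c0 H] := Wx_quad nl_sgn 2.
    have := H 0 2 (lexx 0) (ler0n _ 2) (lexx 2); rewrite /Wx lexx ler0n Wf0 !subr0.
    by apply: le_trans; rewrite mulr_ge0 ?sqr_ge0// ltW.
  have : 0 <= (M - 4) * (M - 4) + (M - 4) * M by rewrite addr_ge0// mulr_ge0; lra.
  have : 0 <= (M - 1) * M by rewrite mulr_ge0; lra.
  by rewrite /Lx !expr2; lra.
(* For M >= 2, M - 1 >= M / 2 gives W M >= (M / 2)^p / p; the extra 2 in the denominator absorbs M +
   M^p <= 2 M^p. *)
exists (2^-1 `^ p / (2 * p)), 2; split; [by rewrite divr_gt0 ?powR_gt0 ?invr_gt0 ?mulr_gt0|lra|] => M M2.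
have M0 : 0 < M by lra.
have W1 : (M - 1) `^ p / p <= Wf nl_abs M.
  rewrite /Wf -(opprB M) nonlinN mul1r nonlin_pos; last by lra.
  by have : p^-1 <= 1; [rewrite invf_le1//; have := hp; lra|lra].
have W2 : (2^-1 * M) `^ p / p <= (M - 1) `^ p / p.
  by rewrite ler_pM2r ?invr_gt0//; apply: ge0_ler_powR; rewrite ?nnegrE; lra.
apply: le_trans W1; apply: le_trans W2.
rewrite powRM ?invr_ge0 ?(ltW M0)//.
have e : M * M `^ (p - 1) = M `^ p.
  by rewrite -{1}(powRr1 (ltW M0)) -powRD ?(gt_eqF M0) ?implybT//; congr (_ `^ _); ring.
have q1 : 1 <= M `^ (p - 1).
  have e1 : (1 : R) `^ (p - 1) = 1 by rewrite powR1.
  by rewrite -[leLHS]e1; apply: ge0_ler_powR; rewrite ?nnegrE; have := hp; lra.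
have -> : 2^-1 `^ p / (2 * p) * M * Lx nl_abs M = 2^-1 `^ p / p * (2^-1 * (M + M * M `^ (p - 1))).
  by rewrite /Lx; field; rewrite gt_eqF.
rewrite e -mulrA [p^-1 * _]mulrC mulrA ler_pM2r ?invr_gt0// ler_pM2l ?powR_gt0 ?invr_gt0//.
have : M * 1 <= M * M `^ (p - 1) by rewrite ler_pM2l.
rewrite e; lra.
Qed.

Lemma Wx_admissible n : admissible (Wx n) (Lx n).
Proof.
have p1 : 0 < p - 1 by have := hp; lra.
have Lmono M N : 0 <= M -> M <= N -> Lx n M <= Lx n N.
  by move=> M0 MN; rewrite /Lx; case: n; [rewrite lerD2l; apply: ge0_ler_powR; rewrite ?nnegrE; lra|lra].
split => //.
- by rewrite /Wx ler0n !Wf0; case: n {Lmono}.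
- exact: Wx_continuous.
- move=> M; exact: Wx_quad.
- move=> M a b; exact: Wx_lip.
- by move=> M M0; rewrite /Lx; case: n {Lmono}; [have := powR_ge0 M (p - 1)|]; lra.
- move=> a b; have [c [M1 [c0 M11 H]]] := Wx_big n.
  (* With this T, c M T = (|a| + |b|) M dominates a M + b for M >= 1, and [Lx n] is unbounded. *)
  pose T := (`|a| + `|b|) / c; have T0 : 0 <= T by rewrite divr_ge0 ?addr_ge0// ltW.
  have [M [MM1 MT]] : exists M, M1 <= M /\ T <= Lx n M.
    rewrite /Lx; case: n {H Lmono}; last by exists (Num.max M1 T); rewrite le_max lexx; split=> //; have : T <= Num.max M1 T; [by rewrite le_max lexx orbT|lra].
    exists (Num.max M1 (T `^ (p - 1)^-1)); rewrite le_max lexx; split=> //.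
    set m := Num.max _ _; have tm : T `^ (p - 1)^-1 <= m by rewrite /m le_max lexx orbT.
    have t0 := powR_ge0 T (p - 1)^-1.
    have : (T `^ (p - 1)^-1) `^ (p - 1) <= m `^ (p - 1).
      apply: ge0_ler_powR; rewrite ?nnegrE//; [exact: ltW|exact: le_trans tm].
    rewrite -powRrM mulVf ?gt_eqF// powRr1//; lra.
  exists M; first exact: le_trans MM1.
  apply: le_trans (H M MM1).
  have M1' : 1 <= M := le_trans M11 MM1; have M0 : 0 < M by lra.
  apply: le_trans (_ : c * M * T <= _); last by rewrite ler_pM2l// mulr_gt0.
  have -> : c * M * T = `|a| * M + `|b| * M by rewrite /T; field; rewrite gt_eqF.
  apply: lerD; first by apply: ler_wpM2r; [exact: ltW|exact: ler_norm].
  by apply: le_trans (ler_norm b) _; rewrite ler_peMr.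
- exact: Wx_big.
Qed.

End Nonlinearity.

(** * Existence of the profile for both nonlinearities *)

Section WaveProfile.
Context {R : realType} (alpha : R) (h0 : 0 < alpha) (h1 : alpha < 1).
Notation Lop := (Lop alpha).
Context (p : R) (hp : 1 < p).
Implicit Types (u v f : R -> R) (x y lam M c : R).

Lemma Lop_cst c x : Lop (fun=> c) x = 0.
Proof.
have bc : bper (fun=> c) `|c| by split=> //; exact: measurable_cst.
have := PN_cvg h0 h1 (x := x) bc (fun _ => erefl) => /(cvg_lim (@Rhausdorff R)) <-.
have -> : (fun N => PN alpha (fun=> c) N x) = (fun=> 0).
  apply/funext => N; rewrite /PN big_nat big1 ?mulr0// => k /andP[k0 _].
  have -> : coef (fun=> c) k = 0.
    rewrite /coef (eq_Int (g := fun s => c * cos (k%:R * s))).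
      by rewrite IntZ ?Int_cosk ?mulr0//; exact: cosk_integ.
    by move=> s _; rewrite mulrC.
  by rewrite !mulr0.
exact: lim_cst.
Qed.

Lemma Int_gt0 (a b : R) f : a < b -> continuous f -> (forall x, a <= x <= b -> 0 < f x) -> 0 < Int `[a, b] f.
Proof.
move=> ab cf f0; have [c cab Hc] := @EVT_min R f a b (ltW ab) (continuous_subspaceT cf).
have fc : 0 < f c by apply: f0; move: cab; rewrite in_itv.
have : Int `[a, b] (fun=> f c) <= Int `[a, b] f.
  apply: Int_le; [exact: integ_cst|exact: integ_cont (continuous_subspaceT cf)|exact: Hc].
by rewrite Int_cst ?(ltW ab)//; apply: lt_le_trans; rewrite mulr_gt0// subr_gt0.
Qed.

(** L v changes sign under translation by pi, so W(u (x + pi)) + W(u x) is a constant A. If A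
    differed from W 2, then u x + u (x + pi) - 2 would have the same strict sign for all x, against
    its zero mean. So A = W 2, and injectivity of W gives the reflection. *)
Lemma half_odd_refl u M lam : 0 < lam -> prof u M -> continuous u -> (forall x, 0 <= u x) ->
  Int `[- pi, pi] u = 2 * pi ->
  (forall x, Wx p nl_sgn (u x) = lam * (Lop (half_odd true u) x - Lop (half_odd true u) 0)) ->
  forall x, u (x + pi) = 2 - u x.
Proof.
move=> l0 pu cu u0 Iu uW; have pp := @pi_gt0 R.
have adm := Wx_admissible hp nl_sgn; set W := Wx p nl_sgn in adm uW.
set v := half_odd true u in uW; have [bv ev iv] := half_odd_prof true pu; rewrite -/v in bv ev iv.
have [bu eu iu] := pu; have [mu pu' _] := bu.
pose A := - 2 * lam * Lop v 0.
have vpi x : Lop v (x + pi) = - Lop v x.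
  have -> : - Lop v x = Lop (fun y => -1 * v y) x by rewrite (LopZ h0 h1 _ _ bv) mulN1r.
  apply: eq_Int => s _; congr (_ * _); rewrite /v /half_odd.
  have -> : x + pi + s + pi = x + s + 2 * pi by ring.
  by rewrite pu' [x + pi + s]addrAC; field.
have GA x : W (u (x + pi)) = A - W (u x) by rewrite !uW vpi /A; ring.
have W2 t : 0 <= t <= 2 -> W (2 - t) = W 2 - W t.
  move=> /andP[t0 t2]; rewrite /W /Wx t2 lexx; have -> : 2 - t <= 2 by lra.
  by rewrite Wf_sgn_refl Wf2_sgn.
pose r x := u x + u (x + pi) - 2.
have iu1 := bper_integ (- pi) pi bu.
have [is_ es] := Int_per_shift pi mu pu' iu1.
have Ir : Int `[- pi, pi] r = 0.
  rewrite /r IntB; [|exact: integD|exact: integ_cst].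
  by rewrite IntD// es Iu Int_cst; lra.
have cs : continuous (fun x => u (x + pi)).
  move=> x; apply: (@continuous_comp _ _ _ (fun x => x + pi) u); last exact: cu.
  by apply: cvgD; [exact: cvg_id|exact: cvg_cst].
have cr : continuous r.
  by move=> x; apply: cvgB; [apply: cvgD; [exact: cu|exact: cs]|exact: cvg_cst].
have ppi : - pi < pi :> R by lra.
have lt_W a b : 0 <= a -> 0 <= b -> W a < W b -> a < b.
  by move=> a0 b0; apply: contraTT; rewrite -!leNgt => /(W_le adm b0).
case: (ltgtP A (W 2)) => AW.
- have rn x : r x < 0.
    rewrite /r subr_lt0; have [u2|u2] := leP (u x) 2.
      have : u (x + pi) < 2 - u x by apply: lt_W => //; [lra|rewrite GA W2 ?u0//; lra].
      lra.
    have := W_lt adm (ler0n _ 2) u2; have := W_ge0 adm (u0 (x + pi)); rewrite GA; lra.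
  have cN : continuous (fun x => - r x) by move=> x; apply: cvgN; exact: cr.
  have : 0 < Int `[- pi, pi] (fun x => - r x) by apply: Int_gt0 => // x _; rewrite oppr_gt0.
  rewrite IntN ?Ir ?oppr0 ?ltxx//; exact: integ_cont (continuous_subspaceT cr).
- have rp x : 0 < r x.
    rewrite /r subr_gt0; have [u2|u2] := leP (u x) 2; last by have := u0 (x + pi); lra.
    have : 2 - u x < u (x + pi) by apply: lt_W => //; [lra|rewrite GA W2 ?u0//; lra].
    lra.
  by have := @Int_gt0 _ _ r ppi cr (fun x _ => rp x); rewrite Ir ltxx.
- move=> x; have u2 : u x <= 2.
    rewrite leNgt; apply/negP => u2.
    have := W_lt adm (ler0n _ 2) u2; have := W_ge0 adm (u0 (x + pi)); rewrite GA; lra.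
  have e : W (u (x + pi)) = W (2 - u x) by rewrite GA W2 ?u0// AW.
  have v0 : 0 <= 2 - u x by lra.
  case: (ltgtP (u (x + pi)) (2 - u x)) => // h.
    by have := W_lt adm (u0 _) h; rewrite e ltxx.
  by have := W_lt adm v0 h; rewrite e ltxx.
Qed.

Theorem wave_profile_exists n : exists lam M u, [/\ 0 < lam, prof u M, continuous u,
  forall x, 0 <= u x & Int `[- pi, pi] u = 2 * pi] /\
  [/\ u 0 = 0, forall x, Wf p n (u x) = lam * (Lop u x - Lop u 0) &
    n = nl_sgn -> forall x, u (x + pi) = 2 - u x].
Proof.
case: n.
  have [lam [M [u [H1 [H2 H3]]]]] := profile_exists h0 h1 (Wx_admissible hp nl_abs) false.
  by exists lam, M, u; split.
have [lam [M [u [H1 [H2 H3]]]]] := profile_exists h0 h1 (Wx_admissible hp nl_sgn) true.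
exists lam, M, u; split=> //; split=> //; have [l0 pu cu u0 Iu] := H1; last first.
  by move=> _; exact: half_odd_refl l0 pu cu u0 Iu H3.
have rf := half_odd_refl l0 pu cu u0 Iu H3.
have bc : bper (fun=> 1 : R) 1 by split=> // x; rewrite normr1.
have [bu _ _] := pu.
(* By the reflection [half_odd] is u - 1, and L annihilates constants. *)
have Lv x : Lop (half_odd true u) x = Lop u x.
  have -> : half_odd true u = (fun x => u x - 1) by apply/funext => y; rewrite /half_odd rf; field.
  by rewrite (LopB h0 h1 _ bu bc) Lop_cst subr0.
move=> x; rewrite -!Lv -H3 /Wx; have -> // : u x <= 2.
by have := u0 (x + pi); rewrite rf; lra.
Qed.

End WaveProfile.

(** * Weighted increments of a profile of growth x^alpha *)

Section MonotoneIncrements.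
Context {R : realType} (alpha : R) (h0 : 0 < alpha) (h1 : alpha < 1).
Notation Lop := (Lop alpha).
Implicit Types (u f : R -> R) (x y s t h m M B : R).

Lemma powR_shift_diff m t : 0 < m -> 3 * m <= t ->
  (t - m) `^ (alpha - 2) - (t + m) `^ (alpha - 2) <= 4 * m * (3 / 2) `^ (3 - alpha) * t `^ (alpha - 3).
Proof.
move=> m0 mt; have h1' := h1; have h0' := h0.
have [||c /andP[c1 c2] ec] := @mvt _ (fun x : R => x `^ (alpha - 2)) (fun x => (alpha - 2) * x `^ (alpha - 2 - 1)) (t - m) (t + m).
- lra.
- by move=> x /andP[x1 _]; apply: der_powR; lra.
have t0 : 0 < t by lra.
have t23 : 0 < 2 / 3 * t by rewrite mulr_gt0// divr_gt0.
have e1 : alpha - 2 - 1 = - (3 - alpha) by ring.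
have e2 : alpha - 3 = - (3 - alpha) by ring.
have k1 : c `^ (- (3 - alpha)) <= (3 / 2) `^ (3 - alpha) * t `^ (- (3 - alpha)).
  have -> : (3 / 2) `^ (3 - alpha) * t `^ (- (3 - alpha)) = (2 / 3 * t) `^ (- (3 - alpha)).
    rewrite [RHS]powRM ?(ltW t0) ?divr_ge0//; congr (_ * _).
    have -> : 2 / 3 = (3 / 2)^-1 :> R by rewrite invf_div.
    by rewrite -[(3 / 2)^-1]powR_inv1 ?divr_ge0// -powRrM mulrNN mul1r.
  rewrite !powRN lef_pV2 ?posrE ?powR_gt0//; last by lra.
  by apply: ge0_ler_powR; rewrite ?nnegrE; lra.
have -> : (t - m) `^ (alpha - 2) - (t + m) `^ (alpha - 2) = (2 - alpha) * (2 * m) * c `^ (- (3 - alpha)).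
  rewrite -opprB ec e1; ring.
rewrite e2; set X := c `^ _ in k1 *; set Y := _ `^ (3 - alpha) * t `^ _ in k1.
have X0 : 0 <= X by exact: powR_ge0.
have -> : 4 * m * (3 / 2) `^ (3 - alpha) * t `^ (- (3 - alpha)) = 4 * m * Y by rewrite /Y; ring.
apply: ler_pM => //; first by rewrite !mulr_ge0; lra.
have : 0 <= m * alpha by rewrite mulr_ge0 ?ltW.
lra.
Qed.

Lemma weighted_integ u M (c r a b : R) : bper u M -> c < a ->
  integ `[a, b] (fun t => (t - c) `^ r * u t).
Proof.
move=> [mu _ bu] ca.
have mp : measurable_fun setT (fun t : R => (t - c) `^ r).
  apply: (measurableT_comp (measurable_powR r)).
  by apply: measurable_funB.
apply: (integ_bnd (M := ((a - c) `^ r + (`|b| + `|c|) `^ r) * M)).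
  by apply: measurable_funTS; apply: measurable_funM.
move=> t; rewrite in_itv/= => /andP[at_ tb]; rewrite normrM ger0_norm ?powR_ge0//.
apply: ler_pM; rewrite ?powR_ge0//.
have tc : 0 < t - c by lra.
have [r0|r0] := leP 0 r.
  apply: le_trans (_ : (`|b| + `|c|) `^ r <= _); last by rewrite lerDr powR_ge0.
  have bc : t - c <= `|b| + `|c| by have := ler_norm b; have := ler_norm (- c); rewrite normrN; lra.
  by apply: ge0_ler_powR; rewrite ?nnegrE ?(ltW tc) ?addr_ge0//.
apply: le_trans (_ : (a - c) `^ r <= _); last by rewrite lerDl powR_ge0.
have -> : r = - - r by ring.
rewrite !(powRN _ (- r)) lef_pV2 ?posrE ?powR_gt0//; last by lra.
by apply: ge0_ler_powR; rewrite ?nnegrE; lra.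
Qed.

(** Only the size of u is known, not that of its increments, so the shift is moved onto the weight.
    Where the shifted integrals overlap this leaves a difference of weights, of order m t^(alpha -
    3), against B t^alpha. Of the end pieces, the one near 0 has a favourable sign and is dropped;
    the one near pi is of order m, hence at most a multiple of the target since m <= 1. *)
Lemma shift_increment : exists2 C : R, 0 < C & forall u M B m, prof u M -> (forall x, 0 <= u x) ->
  0 < m -> 4 * m <= pi -> (forall y, m <= y <= pi -> u y <= B * y `^ alpha) ->
  Int `[2 * m, pi] (fun s => s `^ (alpha - 2) * (u (s + m) - u (s - m))) <= C * B * (m `^ alpha * m `^ (alpha - 1)).
Proof.
have h1' := h1; have h0' := h0; have pp := @pi_gt0 R; have p2 := @pi_ge2 R.
pose K := 4 * (3 / 2) `^ (3 - alpha) : R.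
have K0 : 0 < K by rewrite mulr_gt0// powR_gt0 divr_gt0.
exists (K / (2 - 2 * alpha) + 2 * pi `^ alpha).
  by rewrite addr_gt0 ?divr_gt0 ?mulr_gt0 ?powR_gt0//; lra.
move=> u M B m pu u0 m0 m4 uB; have [bu eu iu] := pu; have [mu _ ub] := bu.
have upi x : u x <= u pi := prof_le_pi x pu.
have B0 : 0 <= B.
  have : 0 <= B * pi `^ alpha by apply: le_trans (u0 pi) (uB _ _); lra.
  by rewrite pmulr_lge0// powR_gt0.
have UB : u pi <= B * pi `^ alpha by apply: uB; lra.
have e1 : 2 * m + m = 3 * m by ring.
have e2 : 2 * m - m = m by ring.
have m3 : m < 3 * m by clear - h0 h1 m0 m4 p2 h0' h1'; lra.
have r1 : 1 < 3 - 2 * alpha by clear - h0 h1 m0 m4 p2 h0' h1'; lra.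
have m30 : 0 < 3 * m by clear - h0 h1 m0 m4 p2 h0' h1'; lra.
have l1 : 3 * m <= pi - m by clear - h0 h1 m0 m4 p2 h0' h1'; lra.
have l2 : pi - m <= pi + m by clear - h0 h1 m0 m4 p2 h0' h1'; lra.
have l3 : m < pi - m by clear - h0 h1 m0 m4 p2 h0' h1'; lra.
have l4 : 0 < 2 * m by clear - h0 h1 m0 m4 p2 h0' h1'; lra.
have l5 : 0 < 2 - 2 * alpha by clear - h0 h1 m0 m4 p2 h0' h1'; lra.
have l6 : m <= 3 * m by clear - h0 h1 m0 m4 p2 h0' h1'; lra.
have l7 t : pi - m <= t -> 1 <= t - m by clear - h0 h1 m0 m4 p2; move=> ?; lra.
have l8 : 0 <= 2 - alpha by clear - h0 h1 m0 m4 p2 h0' h1'; lra.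
have l9 t : 3 * m <= t -> t <= pi - m -> m <= t <= pi by clear - h0 h1 m0 m4 p2; move=> ? ?; lra.
have m1 : m <= 1 by have := @pi_le4 R; lra.
have l10 : alpha - 1 <= 1 - alpha by clear - h0 h1 h1'; lra.
have fin (I1 I2 I3 I4 I5 a b c : R) : I4 <= I2 -> I3 <= a -> I1 - I4 <= I5 -> I5 <= b -> a <= c ->
    I1 + I3 - I2 <= b + c by clear - h0 h1; move=> *; lra.
have em : m `^ alpha * m `^ (1 - alpha) = m.
  by rewrite -powRD ?(gt_eqF m0) ?implybT// addrC subrK powRr1// ltW.
have mw c r : measurable_fun setT (fun t : R => (t - c) `^ r * u t).
  by apply: measurable_funM => //; apply: (measurableT_comp (measurable_powR r)); exact: measurable_funB.
have iA a b : m < a -> integ `[a, b] (fun t => (t - m) `^ (alpha - 2) * u t) by exact: weighted_integ bu.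
have iB a b : 0 < a -> integ `[a, b] (fun t => (t - - m) `^ (alpha - 2) * u t).
  by move=> a0; apply: weighted_integ bu _; lra.
have iS c : integ `[2 * m, pi] (fun s => s `^ (alpha - 2) * u (s + c)).
  have bs : bper (fun s => u (s + c)) M.
    split; [|by move=> x; rewrite addrAC; case: bu|by move=> x; exact: ub].
    have := meas_shift c mu; congr (measurable_fun _ _).
    by apply/funext => x; rewrite addrC.
  apply: eq_integ (weighted_integ (c := 0) (alpha - 2) pi bs l4) => s _.
  by rewrite subr0.
have eS c : Int `[2 * m, pi] (fun s => s `^ (alpha - 2) * u (s + c)) =
    Int `[2 * m + c, pi + c] (fun t => (t - c) `^ (alpha - 2) * u t).
  have [|_ ->] := @Int_shift _ (2 * m) pi c _ (mw c (alpha - 2)).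
    by apply: eq_integ (iS c) => s _; rewrite addrK.
  by apply: eq_Int => s _; rewrite addrK.
have -> : Int `[2 * m, pi] (fun s => s `^ (alpha - 2) * (u (s + m) - u (s - m))) =
    Int `[3 * m, pi + m] (fun t => (t - m) `^ (alpha - 2) * u t) -
    Int `[m, pi - m] (fun t => (t - - m) `^ (alpha - 2) * u t).
  rewrite -e1 -eS -[in X in _ - Int `[X, _] _]e2 -eS -IntB//; apply: eq_Int => s _; ring.
have q1 : Int `[3 * m, pi - m] (fun t => (t - - m) `^ (alpha - 2) * u t) <=
    Int `[m, pi - m] (fun t => (t - - m) `^ (alpha - 2) * u t).
  apply: Int_sub; [exact: l6|exact: l1|exact: lexx|exact: iB|].
  by move=> t _; rewrite mulr_ge0 ?powR_ge0.
have q2 : Int `[pi - m, pi + m] (fun t => (t - m) `^ (alpha - 2) * u t) <= 2 * m * (B * pi `^ alpha).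
  have -> : 2 * m * (B * pi `^ alpha) = Int `[pi - m, pi + m] (fun=> B * pi `^ alpha).
    by rewrite (Int_cst _ l2); ring.
  apply: Int_le; [exact: iA|exact: integ_cst|].
  move=> t; rewrite in_itv/= => /andP[t1 t2]; rewrite -[leRHS]mul1r.
  apply: ler_pM => //; rewrite ?powR_ge0//; last exact: le_trans (upi t) UB.
  have -> : alpha - 2 = - (2 - alpha) by ring.
  have tm := l7 t t1; have tm0 := lt_le_trans ltr01 tm.
  rewrite powRN invf_le1 ?powR_gt0//.
  have e : (1 : R) `^ (2 - alpha) = 1 by rewrite powR1.
  by rewrite -[leLHS]e; apply: ge0_ler_powR; rewrite ?nnegrE ?(ltW tm0).
have [iP eP] := powR_int_le (pi - m) m30 r1.
have q3 : Int `[3 * m, pi - m] (fun t => (t - m) `^ (alpha - 2) * u t) -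
    Int `[3 * m, pi - m] (fun t => (t - - m) `^ (alpha - 2) * u t) <=
    K * m * B * Int `[3 * m, pi - m] (fun t => t `^ (- (3 - 2 * alpha))).
  rewrite -IntB; [|exact: iA|exact: iB]; rewrite -IntZ//.
  apply: Int_le; [by apply: integB; [exact: iA|exact: iB]|exact: integZ|].
  move=> t; rewrite in_itv/= => /andP[t1 t2]; rewrite opprK -mulrBl.
  have d := powR_shift_diff m0 t1.
  have t0 := lt_le_trans m30 t1.
  have ut : u t <= B * t `^ alpha by apply: uB; exact: l9.
  apply: le_trans (ler_wpM2r (u0 t) d) _.
  have -> : K * m * B * t `^ (- (3 - 2 * alpha)) = K * m * t `^ (alpha - 3) * (B * t `^ alpha).
    have -> : - (3 - 2 * alpha) = (alpha - 3) + alpha by ring.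
    by rewrite (powRD (r := alpha - 3)) ?(gt_eqF t0) ?implybT//; ring.
  have -> : 4 * m * (3 / 2) `^ (3 - alpha) * t `^ (alpha - 3) = K * m * t `^ (alpha - 3) by rewrite /K; ring.
  by apply: ler_wpM2l ut; rewrite !mulr_ge0 ?powR_ge0 ?(ltW K0) ?(ltW m0).
have split1 : Int `[3 * m, pi + m] (fun t => (t - m) `^ (alpha - 2) * u t) =
   Int `[3 * m, pi - m] (fun t => (t - m) `^ (alpha - 2) * u t) +
   Int `[pi - m, pi + m] (fun t => (t - m) `^ (alpha - 2) * u t).
  by apply: Int_split l1 l2 _; exact: iA.
rewrite split1.
set P := m `^ alpha * m `^ (alpha - 1).
have P0 : 0 <= P by rewrite mulr_ge0 ?powR_ge0.
have mP : m <= P.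
  rewrite -[leLHS]em; apply: ler_wpM2l; first exact: powR_ge0.
  by apply: ger_powR l10; rewrite m0.
have q4 : K * m * B * Int `[3 * m, pi - m] (fun t => t `^ (- (3 - 2 * alpha))) <= K / (2 - 2 * alpha) * B * P.
  have -> : K / (2 - 2 * alpha) * B * P = K * m * B * (m `^ (2 * alpha - 2) / (2 - 2 * alpha)).
    have -> : P = m * m `^ (2 * alpha - 2).
      rewrite /P -{3}(powRr1 (ltW m0)) -!powRD ?(gt_eqF m0) ?implybT//.
      by congr (_ `^ _); ring.
    by ring.
  apply: ler_wpM2l; first by rewrite !mulr_ge0// ltW.
  apply: le_trans eP _; have -> : 3 - 2 * alpha - 1 = 2 - 2 * alpha by ring.
  have -> : 1 - (3 - 2 * alpha) = - (2 - 2 * alpha) by ring.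
  have -> : 2 * alpha - 2 = - (2 - 2 * alpha) by ring.
  rewrite ler_pM2r ?invr_gt0//.
  rewrite !powRN lef_pV2 ?posrE ?powR_gt0//.
  by apply: ge0_ler_powR; rewrite ?nnegrE ?(ltW l5) ?(ltW m0) ?(ltW m30).
have q5 : 2 * m * (B * pi `^ alpha) <= 2 * pi `^ alpha * B * P.
  have -> : 2 * m * (B * pi `^ alpha) = 2 * pi `^ alpha * B * m by ring.
  by apply: ler_wpM2l mP; rewrite !mulr_ge0 ?powR_ge0.
have -> : (K / (2 - 2 * alpha) + 2 * pi `^ alpha) * B * P = K / (2 - 2 * alpha) * B * P + 2 * pi `^ alpha * B * P by ring.
exact: (fin _ _ _ _ _ _ _ _ q1 q2 q3 q4 q5).
Qed.
End MonotoneIncrements.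

(** * Increments of L u at distance m from the crest *)

Section MonotoneIncrementBound.
Context {R : realType} (alpha : R) (h0 : 0 < alpha) (h1 : alpha < 1).
Notation Lop := (Lop alpha).
Implicit Types (u f : R -> R) (x y s t h m M B : R).

Lemma weight_int_le a b : 0 < a -> integ `[a, b] (fun s : R => s `^ (alpha - 2)) /\
  Int `[a, b] (fun s => s `^ (alpha - 2)) <= a `^ (alpha - 1) / (1 - alpha).
Proof.
move=> a0; have r1 : 1 < 2 - alpha by have := h1; lra.
have [i e] := powR_int_le b a0 r1; rewrite opprB in i e; split=> //; apply: le_trans e _.
have -> : 1 + (alpha - 2) = alpha - 1 by ring.
by have -> : 2 - alpha - 1 = 1 - alpha by ring.
Qed.

(** The factor m^alpha, on top of the Hoelder factor h^alpha, is what will compensate the smallness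
    of W'(u) near the crest. Up to s = 2 m, or everywhere if 4 m >= pi, the increments of u are of
    order B m^alpha; beyond, [shift_increment] takes over, and m >= h turns m^(alpha - 1) into
    h^(alpha - 1). *)
Lemma Lop_increment : exists2 C : R, 0 < C & forall u M B m h, prof u M -> (forall x, 0 <= u x) ->
  0 < h -> h <= 1 / 2 -> h <= m -> m <= pi -> (forall y, m <= y <= pi -> u y <= B * y `^ alpha) ->
  0 <= B /\ Lop u (m + h) - Lop u (m - h) <= C * B * (m `^ alpha * h `^ alpha).
Proof.
have h1' := h1; have h0' := h0; have pp := @pi_gt0 R; have p2 := @pi_ge2 R.
have [C1 C10 H1] := diff_bound h0 h1; have [C2 C20 H2] := shift_increment h0 h1.
pose k : R := 4 `^ alpha; have k0 : 0 < k by exact: powR_gt0.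
have a1 : 0 < 1 - alpha by lra.
exists (C1 * k + C1 * (k / (1 - alpha) + C2)).
  by rewrite addr_gt0 ?mulr_gt0// addr_gt0 ?divr_gt0.
move=> u M B m h pu u0 hh0 h12 hm mp uB; have [bu eu iu] := pu; have [mu _ ub] := bu.
have m0 : 0 < m by lra.
have upi x : u x <= u pi := prof_le_pi x pu.
have UB : u pi <= B * pi `^ alpha by apply: uB; rewrite mp lexx.
have B0 : 0 <= B.
  have : 0 <= B * pi `^ alpha by apply: le_trans (u0 pi) UB.
  by rewrite pmulr_lge0// powR_gt0.
split => //.
have crude y : m <= y -> y <= 4 * m \/ pi <= 4 * m -> u y <= B * (k * m `^ alpha).
  have -> : k * m `^ alpha = (4 * m) `^ alpha by rewrite powRM// ltW.
  move=> my ym; have [yp|py] := leP y pi.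
    apply: le_trans (uB y _) _; first by rewrite my yp.
    by apply: ler_wpM2l => //; apply: ge0_ler_powR; rewrite ?nnegrE; clear - h0 h1 h0' ym my m0 pp yp; lra.
  apply: le_trans (upi y) (le_trans UB _).
  by apply: ler_wpM2l => //; apply: ge0_ler_powR; rewrite ?nnegrE; clear - h0 h1 h0' ym my m0 pp py; lra.
have mpi : 0 <= m <= pi by rewrite (ltW m0).
have D0 s : 0 <= s <= pi -> 0 <= u (m + s) - u (m - s).
  by move=> hs; rewrite subr_ge0; exact: prof_diff_ge0 pu mpi hs.
set P := m `^ alpha; set Q := h `^ alpha.
have P0 : 0 <= P by exact: powR_ge0.
have Q0 : 0 <= Q by exact: powR_ge0.
have A0 : 0 <= B * (k * P) by rewrite !mulr_ge0// ltW.
have Dc s : 0 <= s <= pi -> m + s <= 4 * m \/ pi <= 4 * m -> u (m + s) - u (m - s) <= B * (k * P).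
  move=> /andP[s0 sp] sm; have ms : m <= m + s by rewrite lerDl.
  have H := crude (m + s) ms sm; have := u0 (m - s); rewrite -/P in H; clear - h0 h1 H; lra.
have l1 : 0 < 2 * h by clear - h0 h1 hh0; lra.
have hQ : h * h `^ (alpha - 1) = Q.
  by rewrite /Q -{1}(powRr1 (ltW hh0)) -powRD ?(gt_eqF hh0) ?implybT//; congr (_ `^ _); ring.
have l2h : (2 * h) `^ (alpha - 1) <= h `^ (alpha - 1).
  have -> : alpha - 1 = - (1 - alpha) by ring.
  by rewrite !powRN lef_pV2 ?posrE ?powR_gt0//; apply: ge0_ler_powR; rewrite ?nnegrE; clear - h0 h1 a1 hm hh0 m0; lra.
have mh : m `^ (alpha - 1) <= h `^ (alpha - 1).
  have -> : alpha - 1 = - (1 - alpha) by ring.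
  by rewrite !powRN lef_pV2 ?posrE ?powR_gt0//; apply: ge0_ler_powR; rewrite ?nnegrE; clear - h0 h1 a1 hm hh0 m0; lra.
have hh1 : 0 <= h `^ (alpha - 1) by exact: powR_ge0.
have l2 : 0 <= 2 * h by exact: ltW.
have l3 : 2 * h <= 2 * m by clear - h0 h1 hm; lra.
have l4 : 0 <= C1 * h by rewrite mulr_ge0 ?(ltW C10) ?(ltW hh0).
have l5 s : 2 * h <= s <= pi -> 0 <= s <= pi by clear - h0 h1 hh0; move=> ?; lra.
have l6 s : 0 <= s <= 2 * h -> m + s <= 4 * m by clear - h0 h1 hm; move=> ?; lra.
have l7 s : 0 <= s <= 2 * h -> 0 <= s <= pi by clear - h0 h1 h12 p2; move=> ?; lra.
have l8 : m + 2 * m <= 4 * m by clear - h0 h1 m0; lra.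
have l9 s b : s <= b -> m + b <= 4 * m -> m + s <= 4 * m by clear - h0 h1; move=> ? ?; lra.
have l10 : 4 * m < pi -> 2 * m <= pi by clear - h0 h1 m0; move=> ?; lra.
have fin (I1 I2 X Y : R) : I1 <= X -> I2 <= Y -> I1 + I2 <= X + Y by move=> ? ?; exact: lerD.
pose D s := u (m + s) - u (m - s).
have mD : measurable_fun setT D.
  apply: measurable_funB; first exact: meas_shift.
  by apply: (measurableT_comp mu); exact: measurable_funB.
have bD s : `|D s| <= 2 * M.
  by apply: le_trans (ler_normB _ _) _; rewrite mulr_natl mulr2n; exact: lerD.
have iD b : integ `[2 * h, b] (fun s => s `^ (alpha - 2) * D s).
  have [iw _] := weight_int_le b l1.
  by apply: (integM (M := 2 * M)) => //; exact: measurable_funTS.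
have crudeI b : b <= pi -> m + b <= 4 * m \/ pi <= 4 * m ->
    Int `[2 * h, b] (fun s => s `^ (alpha - 2) * D s) <= B * (k * P) * (h `^ (alpha - 1) / (1 - alpha)).
  move=> bp hb; have [iw ew] := weight_int_le b l1.
  apply: le_trans (_ : B * (k * P) * Int `[2 * h, b] (fun s => s `^ (alpha - 2)) <= _); last first.
    by apply: ler_wpM2l => //; apply: le_trans ew _; rewrite ler_pM2r ?invr_gt0.
  rewrite -IntZ//; apply: Int_le => //; first exact: integZ.
  move=> s; rewrite in_itv/= => /andP[s1 s2]; rewrite mulrC; apply: ler_wpM2r; first exact: powR_ge0.
  apply: Dc; first by apply: l5; rewrite s1 (le_trans s2).
  by case: hb => hb; [left; exact: l9 hb|right].
have I_le : Int `[2 * h, pi] (fun s => s `^ (alpha - 2) * D s) <=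
    B * P * h `^ (alpha - 1) * (k / (1 - alpha) + C2).
  have e : B * P * h `^ (alpha - 1) * (k / (1 - alpha) + C2) =
    B * (k * P) * (h `^ (alpha - 1) / (1 - alpha)) + C2 * B * (P * h `^ (alpha - 1)) by ring.
  have X0 : 0 <= C2 * B * (P * h `^ (alpha - 1)) by rewrite !mulr_ge0// ltW.
  rewrite e; have [m4|m4] := leP pi (4 * m).
    by apply: le_trans (crudeI pi (lexx _) (or_intror m4)) _; rewrite lerDl.
  rewrite (Int_split l3 (l10 m4))//; apply: fin; first by apply: crudeI; [exact: l10|left].
  apply: le_trans (_ : C2 * B * (m `^ alpha * m `^ (alpha - 1)) <= _); last first.
    apply: ler_wpM2l; first by rewrite mulr_ge0// ltW.
    exact: ler_wpM2l.
  rewrite (eq_Int (g := fun s => s `^ (alpha - 2) * (u (s + m) - u (s - m)))).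
    by apply: H2 pu u0 m0 (ltW m4) uB.
  by move=> s _; rewrite /D -(eu (m - s)) opprB [s + m]addrC.
have Dn s : 0 <= s <= pi -> `|D s| = D s by move=> hs; rewrite ger0_norm ?D0.
have main := H1 u M m h (B * (k * P)) D bu hh0 h12 A0 _ (iD pi) _.
apply: le_trans (ler_norm _) _; apply: le_trans (main _ _) _ => [s hs|s hs|].
- by rewrite -/(D s) Dn ?l7//; apply: Dc; [exact: l7|left; exact: l6].
- by rewrite -/(D s) Dn ?l5.
have -> : (C1 * k + C1 * (k / (1 - alpha) + C2)) * B * (P * Q) =
  C1 * (B * (k * P)) * Q + C1 * h * (B * P * h `^ (alpha - 1) * (k / (1 - alpha) + C2)).
  by rewrite -hQ; ring.
by rewrite lerD2l; exact: ler_wpM2l.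
Qed.

End MonotoneIncrementBound.

(** * Order of vanishing at the crest and global Hoelder continuity *)

Section Asymptotics.
Context {R : realType} (alpha : R) (h0 : 0 < alpha) (h1 : alpha < 1) (p : R) (hp : 1 < p).
Notation Lop := (Lop alpha).
Implicit Types (u f : R -> R) (x y s t h m M B : R).

(* Here u = 1 - phi / mu and lam = 1 / c. *)
Record wave n lam M u : Prop := Wave {
  wave_lam : 0 < lam;
  wave_prof : prof u M;
  wave_cont : continuous u;
  wave_ge0 : forall x, 0 <= u x;
  wave_mean : Int `[- pi, pi] u = 2 * pi;
  wave_0 : u 0 = 0;
  wave_eq : forall x, Wf p n (u x) = lam * (Lop u x - Lop u 0);
  wave_sgn : n = nl_sgn -> forall x, u (x + pi) = 2 - u x }.

Context (n : nonlinearity) (lam M : R) (u : R -> R) (wu : wave n lam M u).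
Let l0 := wave_lam wu.
Let pu := wave_prof wu.
Let u0 := wave_ge0 wu.
Let U := u pi.

Lemma u_le_pi x : u x <= U. Proof. exact: prof_le_pi pu. Qed.

Lemma u_sgn_le2 : n = nl_sgn -> forall x, u x <= 2.
Proof. by move=> ns x; have := u0 (x + pi); rewrite (wave_sgn wu ns); lra. Qed.

Lemma u_pi_ge1 : 1 <= U.
Proof.
have pp := @pi_gt0 R; have [bu _ _] := pu.
have : Int `[- pi, pi] u <= Int `[- pi, pi] (fun=> U).
  apply: Int_le; [exact: bper_integ bu|exact: integ_cst|by move=> x _; exact: u_le_pi].
rewrite (wave_mean wu) Int_cst; last by lra.
have -> : U * (pi - - pi) = U * (2 * pi) by ring.
by rewrite -[leLHS]mul1r ler_pM2r; lra.
Qed.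

Lemma u_incr x y : 0 <= x -> x < y -> y <= pi -> u x < u y.
Proof.
move=> x0 xy yp; have [bu eu iu] := pu.
have [d d0 Hd] := Lop_test h0 h1.
have hm : 0 <= (y + x) / 2 <= pi by lra.
have hh : 0 <= (y - x) / 2 <= pi by lra.
have c0 : 0 < - coef u 1.
  apply: prof_coef1_gt0 pu (wave_cont wu) _; rewrite (wave_0 wu).
  exact: lt_le_trans ltr01 u_pi_ge1.
have := Hd u M _ _ pu hm hh.
have -> : (y + x) / 2 + (y - x) / 2 = y by field.
have -> : (y + x) / 2 - (y - x) / 2 = x by field.
have s1 : 0 < sin ((y - x) / 2) by apply: sin_gt0_pi; lra.
have s2 : 0 < sin ((y + x) / 2) by apply: sin_gt0_pi; lra.
have pos : 0 < d * sin ((y - x) / 2) * sin ((y + x) / 2) * - coef u 1 by rewrite !mulr_gt0.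
move/(lt_le_trans pos); rewrite subr_gt0 => LL.
rewrite lt_neqAle iu ?(ltW xy)// andbT; apply/eqP => uxy.
have := wave_eq wu y; rewrite -uxy (wave_eq wu) => /(mulfI (lt0r_neq0 l0)); lra.
Qed.

Lemma u_gt0 x : 0 < x -> x <= pi -> 0 < u x.
Proof. by move=> x0 xp; rewrite -{1}(wave_0 wu); exact: u_incr. Qed.

Lemma Wx_wave x : Wx p n (u x) = Wf p n (u x).
Proof.
have H := u_sgn_le2; rewrite /Wx; case: n H => // H.
by rewrite H.
Qed.

Lemma Wf_ge_sqr : exists2 c : R, 0 < c & forall x, c * u x ^+ 2 <= Wf p n (u x).
Proof.
have [c c0 H] := Wx_quad hp n U; exists c => // x.
have := H 0 (u x) (lexx 0) (u0 x) (u_le_pi x).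
by rewrite subr0 Wx_wave -{1}(wave_0 wu) Wx_wave (wave_0 wu) Wf0// subr0.
Qed.

Lemma dWf_le_lin : exists2 C : R, 0 < C & forall t, 0 <= t <= U -> dWf p n t <= C * t.
Proof.
have U1 := u_pi_ge1; have Up := powR_ge0 U (p - 1).
exists (1 + U `^ (p - 1) + p); first by have := hp; lra.
move=> t /andP[t0 tU]; have [t1|t1] := leP t 1.
  rewrite dWf_le1 ?t0//; apply: le_trans (_ : p * t <= _); last first.
    by apply: ler_wpM2r => //; lra.
  have [q1|q1] := leP (p - 1) 1.
    have [->|tn] := eqVneq t 1; first by have := powR_ge0 (1 - 1 : R) (p - 1); have := hp; lra.
    have tlt : t < 1 by rewrite lt_neqAle tn.
    have : 1 - t <= (1 - t) `^ (p - 1).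
      rewrite -[leLHS](@powRr1 _ (1 - t)); last lra.
      by apply: ger_powR => //; lra.
    have : 1 * t <= p * t by apply: ler_wpM2r => //; have := hp; lra.
    lra.
  have [->|t0'] := eqVneq t 0; first by rewrite subr0 powR1; lra.
  have tgt : 0 < t by rewrite lt_neqAle eq_sym t0'.
  have [->|tn] := eqVneq t 1; first by have := powR_ge0 (1 - 1 : R) (p - 1); have := hp; lra.
  have tlt : t < 1 by rewrite lt_neqAle tn.
  have [||c /andP[c1 c2]] := @mvt _ (fun x : R => x `^ (p - 1)) (fun x => (p - 1) * x `^ (p - 1 - 1)) (1 - t) 1; first lra.
    by move=> x /andP[x1 _]; apply: der_powR; lra.
  rewrite powR1 => ->; have -> : 1 - (1 - t) = t by ring.
  apply: ler_wpM2r => //; rewrite -[leRHS]mulr1; apply: ler_pM; rewrite ?powR_ge0//; try lra.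
  have e : (1 : R) `^ (p - 1 - 1) = 1 by rewrite powR1.
  by rewrite -[leRHS]e; apply: ge0_ler_powR; rewrite ?nnegrE; lra.
apply: le_trans (dWf_le hp n t0) _; rewrite -[leLHS]mulr1; apply: ler_pM => //; try lra.
  by rewrite addr_ge0//; case: n; rewrite ?powR_ge0.
  have tU' : t `^ (p - 1) <= U `^ (p - 1) by apply: ge0_ler_powR; rewrite ?nnegrE; have := hp; lra.
by have := hp; case: n; lra.
Qed.

Lemma Wf_le_sqr : exists2 C : R, 0 < C & forall x, Wf p n (u x) <= C * u x ^+ 2.
Proof.
have [C C0 H] := dWf_le_lin; exists C => // x.
have dd t : 0 <= t <= u x -> der (fun t => C * t ^+ 2 - Wf p n t) t (C * (t * 1 + t * 1) - dWf p n t).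
  by move=> _; apply: derB (der_Wf hp n t); apply: derZ; apply: derM; exact: der_id.
have := derive_mono (u0 x) dd; rewrite Wf0// expr0n mulr0 subrr subr_ge0; apply.
move=> t /andP[t0 tx]; have tU : 0 <= t <= U by rewrite (ltW t0) (le_trans (ltW tx))// u_le_pi.
have := H t tU; have : 0 <= C * t by rewrite mulr_ge0// ltW.
rewrite subr_ge0; lra.
Qed.

(** Let z maximise q = u / x^alpha over [x, pi]. [Lop_increment] with m = h = z / 2 bounds W(u z) by
    a multiple of q(z) z^(2 alpha), whereas W(u z) >= c q(z)^2 z^(2 alpha). So q(z) is bounded
    independently of x. Maximising over [x, pi] avoids assuming that q is bounded near 0. *)
Lemma u_upper : exists2 B : R, 0 < B & forall x, 0 <= x <= pi -> u x <= B * x `^ alpha.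
Proof.
have pp := @pi_gt0 R; have p2 := @pi_ge2 R; have U1 := u_pi_ge1.
have [C C0 HC] := Lop_increment h0 h1; have [c c0 Hc] := Wf_ge_sqr.
pose q x := u x / x `^ alpha.
have k0 : 0 < 2 `^ alpha :> R by exact: powR_gt0.
pose B := U + lam * C / (c * 2 `^ alpha).
have B1 : 0 <= lam * C / (c * 2 `^ alpha).
  by rewrite divr_ge0 ?mulr_ge0 ?(ltW l0) ?(ltW C0) ?(ltW c0) ?(ltW k0).
have B0 : 0 < B by rewrite /B; lra.
exists B => // x /andP[x0 xp].
have [->|xn] := eqVneq x 0; first by rewrite (wave_0 wu) mulr_ge0 ?powR_ge0// ltW.
have {xn}x0 : 0 < x by rewrite lt_neqAle eq_sym xn.
have qc : {within `[x, pi], continuous q}.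
  apply: continuous_in_subspaceT => y; rewrite inE/= in_itv/= => /andP[xy yp].
  have y0 : 0 < y by lra.
  apply: cvgM; first exact: wave_cont wu y.
  apply: cvgV; first by rewrite gt_eqF// powR_gt0.
  exact: der_cont (der_powR alpha y0).
have [z zI Hz] := @EVT_max R q x pi xp qc.
move: zI; rewrite in_itv/= => /andP[xz zp]; have z0 : 0 < z by lra.
have qx : q x <= q z by apply: Hz; rewrite in_itv/= lexx xp.
rewrite -ler_pdivrMr ?powR_gt0//; apply: le_trans qx _.
have [z1|z1] := leP z 1; last first.
  apply: le_trans (_ : U <= B); last by rewrite lerDl.
  rewrite /q ler_pdivrMr ?powR_gt0//.
  have : 1 <= z `^ alpha.
    have e : (1 : R) `^ alpha = 1 by rewrite powR1.
    by rewrite -[leLHS]e; apply: ge0_ler_powR; rewrite ?nnegrE ?(ltW h0) ?ler01 ?(ltW z0)// ltW.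
  by move=> k1; rewrite -[leLHS]mulr1; apply: ler_pM => //; exact: u_le_pi.
have uz : u z = q z * z `^ alpha by rewrite /q divfK// gt_eqF// powR_gt0.
have q0 : 0 < q z by rewrite divr_gt0 ?powR_gt0// u_gt0.
(* Between z / 2 and z maximality says nothing; there u y <= u z by monotonicity, at the price of
   2^alpha. *)
have zB y : z / 2 <= y <= pi -> u y <= 2 `^ alpha * q z * y `^ alpha.
  move=> /andP[zy yp]; have y0 : 0 < y by lra.
  have yy : y `^ alpha <= 2 `^ alpha * y `^ alpha.
    rewrite -powRM ?(ltW y0)//; apply: ge0_ler_powR; rewrite ?nnegrE ?(ltW h0)//; clear - h0 h1 hp wu l0 pu u0 U y0; lra.
  have [yz|yz] := leP z y.
    have : q y <= q z by apply: Hz; rewrite in_itv/= yp (le_trans xz).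
    rewrite /q ler_pdivrMr ?powR_gt0// -/(q z) => /le_trans; apply.
    have -> : 2 `^ alpha * q z * y `^ alpha = q z * (2 `^ alpha * y `^ alpha) by ring.
    by rewrite ler_pM2l.
  have [_ _ iu] := pu; apply: le_trans (iu y z (ltW y0) (ltW yz) zp) _.
  have -> : 2 `^ alpha * q z * y `^ alpha = q z * (2 `^ alpha * y `^ alpha) by ring.
  rewrite uz ler_pM2l// -powRM ?(ltW y0)//.
  apply: ge0_ler_powR; rewrite ?nnegrE ?(ltW h0) ?(ltW z0)//; clear - h0 h1 hp wu l0 pu u0 U y0 zy; lra.
have z20 : 0 < z / 2 by lra.
have z21 : z / 2 <= 1 / 2 by lra.
have z2p : z / 2 <= pi by lra.
have [_] := HC u M _ _ _ pu u0 z20 z21 (lexx _) z2p zB.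
have -> : z / 2 + z / 2 = z by field.
rewrite subrr => HL.
have z2 : (z / 2) `^ alpha = z `^ alpha / 2 `^ alpha.
  have -> : z `^ alpha = (2 * (z / 2)) `^ alpha by congr (_ `^ _); field.
  by rewrite [(2 * _) `^ _]powRM ?(ltW z20)//; field; rewrite gt_eqF.
have HW : c * (q z * z `^ alpha) ^+ 2 <= lam * (C * (2 `^ alpha * q z) * ((z / 2) `^ alpha * (z / 2) `^ alpha)).
  rewrite -uz; apply: le_trans (Hc z) _; rewrite (wave_eq wu).
  by apply: ler_wpM2l => //; exact: ltW.
have za : 0 < z `^ alpha by exact: powR_gt0.
have : c * q z <= lam * C / 2 `^ alpha.
  have pos : 0 < q z * z `^ alpha * z `^ alpha by apply: mulr_gt0 => //; exact: mulr_gt0.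
  rewrite -(ler_pM2r pos); have -> : c * q z * (q z * z `^ alpha * z `^ alpha) = c * (q z * z `^ alpha) ^+ 2 by ring.
  apply: le_trans HW _; rewrite z2 le_eqVlt; apply/orP; left; apply/eqP.
  by field; rewrite gt_eqF.
rewrite mulrC -ler_pdivlMr// => /le_trans; apply; rewrite /B.
have -> : lam * C / 2 `^ alpha / c = lam * C / (c * 2 `^ alpha) by field; rewrite !gt_eqF.
lra.
Qed.

(** The increment is taken about the midpoint h. By positivity only s in [h, 5 h] is kept, where
    [KK_steep] bounds the weight from below. Evenness of u turns the integral of u (h + s) - u (h -
    s) into the integral of u over [4 h, 6 h] minus that over [0, 2 h], and monotonicity
    concludes. *)
Lemma kernel_increment_lower : exists2 c : R, 0 < c & forall h, 0 < h -> 6 * h <= 1 ->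
  c * (h `^ alpha * (u (4 * h) - u (2 * h))) <= Lop u (2 * h) - Lop u 0.
Proof.
have pp := @pi_gt0 R; have p2 := @pi_ge2 R.
have [c c0 Hc] := KK_steep h0 h1; have [bu eu iu] := pu; have [mu pu' ub] := bu.
exists (c * 4 * 6 `^ (alpha - 2)); first by rewrite !mulr_gt0// powR_gt0.
move=> h hh0 h6.
have pi6 : 6 * h <= pi by lra.
have hp' : 0 <= h <= pi by lra.
have l1 : 0 <= h by lra.
have l2 : h <= 5 * h by lra.
have l3 : 5 * h <= pi by lra.
have l4 : h <= pi by lra.
have l10 : 0 <= 2 - alpha by have := h1; lra.
have l5 s : h <= s -> s <= 5 * h -> s != h -> [/\ 0 < s - h, s - h <= s + h, s + h <= 6 * h, s + h <= 1 & 0 < s + h].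
  by move=> a b ab; have : h < s; [rewrite lt_neqAle eq_sym ab|clear - h0 h1 hp wu l0 pu u0 U a b h6 hh0 => hs; split; lra].
pose D s := u (h + s) - u (h - s).
have D0 s : 0 <= s <= pi -> 0 <= D s by move=> hs; rewrite subr_ge0; exact: prof_diff_ge0 pu hp' hs.
have -> : Lop u (2 * h) - Lop u 0 = Int `[0, pi] (fun s => wt alpha h s * D s).
  by rewrite -(Lop_diff h0 h1 _ _ bu) subrr; congr (Lop u _ - _); ring.
have iw := wtf_integ h0 h1 h h bu.
have sub a b : 0 <= a -> b <= pi -> {subset `[a, b] <= `[0, pi : R]}.
  by move=> a0 bp s; rewrite !in_itv/= => /andP[a1 a2]; rewrite (le_trans a0 a1) (le_trans a2 bp).
have iw' a b : 0 <= a -> b <= pi -> integ `[a, b] (fun s => wt alpha h s * D s).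
  by move=> a0 bp; apply: integS iw; exact: sub.
have ge0I a b : 0 <= a -> a <= b -> b <= pi -> 0 <= Int `[a, b] (fun s => wt alpha h s * D s).
  move=> a0 ab bp; have <- : Int `[a, b] (fun=> 0 : R) = 0 by rewrite Int_cst// mul0r.
  apply: (Int_le_except (c := h)); [exact: integ_cst|exact: iw'|].
  move=> s /(sub _ _ a0 bp); rewrite in_itv/= => hs sh.
  by rewrite mulr_ge0 ?D0// wt_ge0.
rewrite (Int_split l1 l4)// (Int_split l2 l3); last exact: iw'.
have iD a b : integ `[a, b] D.
  apply: (integ_bnd (M := M + M)).
    apply: measurable_funTS; apply: measurable_funB; first exact: meas_shift.
    by apply: (measurableT_comp mu); exact: measurable_funB.
  by move=> s _; apply: le_trans (ler_normB _ _) _; apply: lerD.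
have h6' : 0 < 6 * h by lra.
have main : c * (2 * h) * (6 * h) `^ (alpha - 2) * Int `[h, 5 * h] D <=
    Int `[h, 5 * h] (fun s => wt alpha h s * D s).
  rewrite -IntZ//; apply: (Int_le_except (c := h)); [exact: integZ|exact: iw'|].
  move=> s; rewrite in_itv/= => /andP[s1 s2] sh; have [k1 k2 k3 k4 k5] := l5 s s1 s2 sh.
  apply: ler_wpM2r; first by apply: D0; rewrite (le_trans l1 s1) (le_trans s2 l3).
  have sp1 : s + h <= pi by apply: le_trans k4 (le_trans _ p2); rewrite ler1n.
  have kk1 : cos (s - h) < 1.
    by apply: cos_lt1; rewrite gtr0_norm//; exact: le_trans k2 sp1.
  have kk2 : cos (s + h) < 1 by apply: cos_lt1; rewrite gtr0_norm.
  have := Hc _ _ k1 k2 k4; rewrite /wt (KerE _ kk1) (KerE _ kk2); apply: le_trans.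
  have -> : s + h - (s - h) = 2 * h by ring.
  apply: ler_wpM2l; first by rewrite !mulr_ge0// ltW.
  have -> : alpha - 2 = - (2 - alpha) by ring.
  rewrite !powRN lef_pV2 ?posrE ?powR_gt0//; apply: ge0_ler_powR; rewrite ?nnegrE ?(ltW k5) ?(ltW h6')//.
have ub' a b := bper_integ a b bu.
have l6 : 0 <= 2 * h by clear - h0 h1 hp wu l0 pu u0 U hh0 h6 p2; lra.
have l7 : 2 * h <= 4 * h by clear - h0 h1 hp wu l0 pu u0 U hh0 h6 p2; lra.
have l8 : 4 * h <= 6 * h by clear - h0 h1 hp wu l0 pu u0 U hh0 h6 p2; lra.
have l9 : 4 * h <= pi by clear - h0 h1 hp wu l0 pu u0 U hh0 h6 p2; lra.
have fin0 (A B C E F : R) : E <= C -> F <= B -> E - B <= A + C - (F + A) by clear - h0 h1 hp wu l0 pu u0 U; move=> *; lra.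
have ID : 2 * h * (u (4 * h) - u (2 * h)) <= Int `[h, 5 * h] D.
  have -> : Int `[h, 5 * h] D = Int `[2 * h, 6 * h] u - Int `[0, 4 * h] u.
    have b1 : bper (fun s => u (s + h)) M.
      split; [|by move=> x; rewrite addrAC pu'|by move=> x; exact: ub].
      have := meas_shift h mu; congr (measurable_fun _ _); by apply/funext => x; rewrite addrC.
    have b2 : bper (fun s => u (s + - h)) M.
      split; [|by move=> x; rewrite addrAC pu'|by move=> x; exact: ub].
      have := meas_shift (- h) mu; congr (measurable_fun _ _); by apply/funext => x; rewrite addrC.
    have [_] := Int_shift mu (bper_integ h (5 * h) b1).
    have [_] := Int_shift mu (bper_integ h (5 * h) b2).
    rewrite subrr; have -> : h + h = 2 * h by ring.
    have -> : 5 * h + h = 6 * h by ring.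
    have -> : 5 * h - h = 4 * h by ring.
    move=> -> ->; rewrite -IntB; [|exact: bper_integ b1|exact: bper_integ b2].
    by apply: eq_Int => s _; rewrite /D -(eu (h - s)) opprB [h + s]addrC.
  rewrite (Int_split l7 l8)// (Int_split l6 l7)//.
  have a1 : Int `[4 * h, 6 * h] (fun=> u (4 * h)) <= Int `[4 * h, 6 * h] u.
    apply: Int_le => //; first exact: integ_cst.
    move=> s; rewrite in_itv/= => /andP[s1 s2]; apply: iu => //; first exact: le_trans l6 l7.
    exact: le_trans s2 pi6.
  have a2 : Int `[0, 2 * h] u <= Int `[0, 2 * h] (fun=> u (2 * h)).
    apply: Int_le => //; first exact: integ_cst.
    move=> s; rewrite in_itv/= => /andP[s1 s2]; apply: iu => //; exact: le_trans l7 l9.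
  rewrite (Int_cst _ l8) in a1; rewrite (Int_cst _ l6) subr0 in a2.
  have e1 : 6 * h - 4 * h = 2 * h by ring.
  rewrite e1 in a1; have -> : 2 * h * (u (4 * h) - u (2 * h)) = u (4 * h) * (2 * h) - u (2 * h) * (2 * h) by ring.
  exact: fin0.
have g1 := ge0I 0 h (lexx _) l1 l4.
have g2 := ge0I (5 * h) pi (le_trans l1 l2) l3 (lexx _).
apply: le_trans (_ : Int `[h, 5 * h] (fun s => wt alpha h s * D s) <= _); last first.
  by rewrite -[leLHS]add0r; apply: lerD => //; rewrite lerDl.
apply: le_trans main.
have pos : 0 <= c * (2 * h) * (6 * h) `^ (alpha - 2) by rewrite !mulr_ge0 ?powR_ge0 ?(ltW c0) ?l1.
apply: le_trans (ler_wpM2l pos ID); rewrite le_eqVlt; apply/orP; left; apply/eqP.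
have -> : h `^ alpha = h * h * h `^ (alpha - 2).
  have -> : h * h = h `^ 2 by rewrite powR_mulrn// expr2.
  by rewrite -powRD ?(gt_eqF hh0) ?implybT//; congr (_ `^ _); ring.
by rewrite powRM//; ring.
Qed.

(** Dual to [u_upper], at a minimiser z = 2 h of the quotient. Minimality compared with 4 h gives u
    (4 h) - u (2 h) >= q(z) (4^alpha - 2^alpha) h^alpha, so W(u z) is at least a multiple of q(z)
    h^(2 alpha), while it is at most a multiple of u z squared. *)
Lemma u_lower : exists2 b : R, 0 < b & forall x, 0 <= x <= pi -> b * x `^ alpha <= u x.
Proof.
have pp := @pi_gt0 R; have p2 := @pi_ge2 R.
have [c c0 Hc] := kernel_increment_lower; have [C C0 HC] := Wf_le_sqr.
pose q x := u x / x `^ alpha.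
pose k : R := 4 `^ alpha - 2 `^ alpha.
have t0 : 0 < 2 `^ alpha :> R by exact: powR_gt0.
have k0 : 0 < k.
  have -> : k = 2 `^ alpha * (2 `^ alpha - 1).
    rewrite /k; have -> : 4 = 2 * 2 :> R by ring.
    by rewrite powRM//; ring.
  rewrite mulr_gt0// subr_gt0.
  have e : (1 : R) `^ alpha = 1 by rewrite powR1.
  by rewrite -[ltLHS]e; apply: gt0_ltr_powR; rewrite ?nnegrE// ltr1n.
have u13 : 0 < u (1 / 3) by apply: u_gt0; lra.
pose b1 := u (1 / 3) / pi `^ alpha.
pose b2 := lam * c * k / (C * (2 `^ alpha * 2 `^ alpha)).
have b10 : 0 < b1 by rewrite divr_gt0// powR_gt0.
have b20 : 0 < b2 by rewrite divr_gt0 ?mulr_gt0.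
exists (Num.min b1 b2); first by rewrite lt_min b10.
move=> x /andP[x0 xp].
have [->|xn] := eqVneq x 0; first by rewrite powR0 ?gt_eqF// mulr0.
have {xn}x0 : 0 < x by rewrite lt_neqAle eq_sym xn.
have qc : {within `[x, pi], continuous q}.
  apply: continuous_in_subspaceT => y; rewrite inE/= in_itv/= => /andP[xy yp].
  have y0 : 0 < y by lra.
  apply: cvgM; first exact: wave_cont wu y.
  apply: cvgV; first by rewrite gt_eqF// powR_gt0.
  exact: der_cont (der_powR alpha y0).
have [z zI Hz] := @EVT_min R q x pi xp qc.
move: zI; rewrite in_itv/= => /andP[xz zp]; have z0 : 0 < z by lra.
have qx : q z <= q x by apply: Hz; rewrite in_itv/= lexx xp.
rewrite -ler_pdivlMr ?powR_gt0//; apply: le_trans qx; rewrite ge_min.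
have [_ _ iu] := pu.
have [z1|z1] := leP z (1 / 3); apply/orP; [right|left]; last first.
  rewrite /b1 /q; apply: ler_pM => //; rewrite ?invr_ge0 ?powR_ge0 ?(ltW u13)//.
    by apply: iu => //; lra.
  by rewrite lef_pV2 ?posrE ?powR_gt0//; apply: ge0_ler_powR; rewrite ?nnegrE ?(ltW h0) ?(ltW z0) ?(ltW pp).
have uz : u z = q z * z `^ alpha by rewrite /q divfK// gt_eqF// powR_gt0.
have q0 : 0 < q z by rewrite divr_gt0 ?powR_gt0// u_gt0.
pose h := z / 2; have hh0 : 0 < h by rewrite divr_gt0.
have zh : z = 2 * h by rewrite /h; field.
have h6 : 6 * h <= 1 by rewrite /h; lra.
have ha : 0 < h `^ alpha by exact: powR_gt0.
have u4 : q z * (4 `^ alpha * h `^ alpha) <= u (4 * h).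
  have : q z <= q (4 * h) by apply: Hz; rewrite in_itv/=; apply/andP; split; lra.
  by rewrite {2}/q ler_pdivlMr ?powR_gt0 ?mulr_gt0// powRM// ltW.
have u2 : u (2 * h) = q z * (2 `^ alpha * h `^ alpha) by rewrite -zh uz -powRM ?(ltW hh0)// -zh.
have H1 : lam * (c * (h `^ alpha * (q z * (k * h `^ alpha)))) <= C * (q z * (2 `^ alpha * h `^ alpha)) ^+ 2.
  rewrite -u2; apply: le_trans (HC (2 * h)); rewrite (wave_eq wu).
  apply: ler_wpM2l; first exact: ltW.
  apply: le_trans (Hc h hh0 h6); apply: ler_wpM2l; first exact: ltW.
  apply: ler_wpM2l; first exact: ltW.
  rewrite u2 /k; lra.
rewrite /b2 ler_pdivrMr ?mulr_gt0//.
have pos : 0 < q z * (h `^ alpha * h `^ alpha) by apply: mulr_gt0 => //; exact: mulr_gt0.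
by rewrite -(ler_pM2r pos); move: H1; congr (_ <= _); ring.
Qed.

Lemma Wf_diff_ge : exists2 c : R, 0 < c & forall x y, u x <= u y -> (n = nl_sgn -> u y <= 1) ->
  c * u y * (u y - u x) <= Wf p n (u y) - Wf p n (u x).
Proof.
have U1 := u_pi_ge1; have U0 : 0 < U by lra.
have k0 := kap_gt0 hp; pose k := kap p / U; have kk : 0 < k by rewrite divr_gt0.
exists (k / 2); first by rewrite divr_gt0.
move=> x y xy ys.
have dd t : u x <= t <= u y -> der (fun t => Wf p n t - k / 2 * t ^+ 2) t (dWf p n t - k / 2 * (t * 1 + t * 1)).
  by move=> _; apply: derB (der_Wf hp n t) _; apply: derZ; apply: derM; exact: der_id.
have H : Wf p n (u x) - k / 2 * u x ^+ 2 <= Wf p n (u y) - k / 2 * u y ^+ 2.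
  apply: derive_mono xy dd _ => t /andP[xt ty].
  have t0 : 0 < t by apply: le_lt_trans xt.
  have tU : t <= U by apply: le_trans (ltW ty) (u_le_pi y).
  have -> : k / 2 * (t * 1 + t * 1) = k * t by field.
  rewrite subr_ge0; have [t1|t1] := leP t 1.
    apply: le_trans (dWf_ge hp n _); last by rewrite (ltW t0) t1.
    by rewrite ler_pM2r// /k ler_pdivrMr// ler_peMr// ltW.
  case: n ys => [_|ys]; last by have := ys erefl; lra.
  apply: le_trans (dWf_abs_ge hp (ltW t0)); rewrite (min_idPl (ltW t1)) mulr1.
  by rewrite /k mulrAC ler_pdivrMr// ler_pM2l.
have : k / 2 * u y * (u y - u x) <= k / 2 * (u y ^+ 2 - u x ^+ 2).
  rewrite -mulrA ler_pM2l ?divr_gt0//.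
  have : 0 <= (u y - u x) * u x by rewrite mulr_ge0// subr_ge0.
  by rewrite !expr2; lra.
lra.
Qed.

(** By [Wf_diff_ge] the increment of W(u) is at least c u (m + k) times that of u, and u (m + k) >=
    b m^alpha cancels the factor m^alpha of [Lop_increment]. In case (sgn) the bound u <= 1 keeps
    away from u = 2, the second zero of W'. *)
Lemma u_holder_good : exists2 C : R, 0 < C & forall m k, 0 < k -> k <= m -> m + k <= pi ->
  (n = nl_sgn -> u (m + k) <= 1) -> u (m + k) - u (m - k) <= C * k `^ alpha.
Proof.
have pp := @pi_gt0 R; have p2 := @pi_ge2 R; have U1 := u_pi_ge1.
have [C C0 HC] := Lop_increment h0 h1; have [B B0 HB] := u_upper; have [b b0 Hb] := u_lower.
have [c c0 Hc] := Wf_diff_ge.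
have K0 : 0 < lam * C * B / (c * b) by rewrite divr_gt0 ?mulr_gt0.
exists (2 * U + lam * C * B / (c * b)); first by lra.
move=> m k k0 km mkp ns; have [_ _ iu] := pu.
have ka : 0 < k `^ alpha by exact: powR_gt0.
have [k1|k1] := leP k (1 / 2); last first.
  have : U * 1 <= U * (2 * k `^ alpha).
    rewrite ler_pM2l; last by lra.
    have l1 : 1 <= (2 * k) `^ alpha.
      have e : (1 : R) `^ alpha = 1 by rewrite powR1.
      by rewrite -[leLHS]e; apply: ge0_ler_powR; rewrite ?nnegrE ?(ltW h0)//; lra.
    apply: le_trans l1 _; rewrite powRM ?(ltW k0)// ler_pM2r//.
    by apply: ler1_powR; [rewrite ler1n|exact: ltW].
  have := u_le_pi (m + k); have := u0 (m - k).
  have : 0 <= lam * C * B / (c * b) * k `^ alpha by rewrite mulr_ge0 ?ltW.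
  lra.
have m0 : 0 < m by lra.
have mp : m <= pi by lra.
have xy : u (m - k) <= u (m + k) by apply: iu; clear - h0 h1 hp wu l0 pu u0 U km k0 mkp; lra.
have hB y : m <= y <= pi -> u y <= B * y `^ alpha by move=> /andP[my yp]; apply: HB; rewrite yp (le_trans (ltW m0)).
have [_ HL] := HC u M B m k pu u0 k0 k1 km mp hB.
have := Hc _ _ xy ns; rewrite !(wave_eq wu) => H1.
have ma : 0 < m `^ alpha by exact: powR_gt0.
have um : b * m `^ alpha <= u (m + k).
  by apply: le_trans (Hb m _) (iu _ _ _ _ _); clear - h0 h1 hp wu l0 pu u0 U m0 k0 mkp mp; lra.
have H2 : c * (b * m `^ alpha) * (u (m + k) - u (m - k)) <= lam * (C * B * (m `^ alpha * k `^ alpha)).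
  apply: le_trans (_ : c * u (m + k) * (u (m + k) - u (m - k)) <= _).
    by apply: ler_wpM2r; [rewrite subr_ge0|rewrite ler_pM2l].
  apply: le_trans H1 _; rewrite -mulrBr ler_pM2l//; apply: le_trans HL.
  by rewrite le_eqVlt; apply/orP; left; apply/eqP; ring.
have H3 : u (m + k) - u (m - k) <= lam * C * B / (c * b) * k `^ alpha.
  have pos : 0 < c * (b * m `^ alpha) by rewrite !mulr_gt0.
  rewrite -(ler_pM2l pos); apply: le_trans H2 _; rewrite le_eqVlt; apply/orP; left; apply/eqP.
  by field; rewrite !gt_eqF.
have : 0 <= 2 * U * k `^ alpha by rewrite !mulr_ge0 ?ltW//; lra.
lra.
Qed.

Lemma u_refl_pi x : n = nl_sgn -> u (pi - x) = 2 - u x.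
Proof.
by move=> ns; have [_ eu _] := pu; rewrite -(eu x) -(wave_sgn wu ns) addrC.
Qed.

(** In case (sgn) the reflection u (pi - x) = 2 - u x carries [pi / 2, pi] to [0, pi / 2]; intervals
    with pi / 2 inside are cut there, whence the constant 2 C. *)
Lemma u_holder_half : exists2 C : R, 0 < C & forall m k, 0 < k -> k <= m -> m + k <= pi ->
  u (m + k) - u (m - k) <= C * k `^ alpha.
Proof.
have pp := @pi_gt0 R; have p2 := @pi_ge2 R.
have [C C0 HC] := u_holder_good; exists (2 * C); first by lra.
have Cle k : 0 < k -> C * k `^ alpha <= 2 * C * k `^ alpha.
  by move=> k0; rewrite ler_pM2r ?powR_gt0//; lra.
move=> m k k0 km mkp; case: (eqVneq (if n is nl_sgn then true else false) true) => [ns|nn]; last first.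
  by apply: le_trans (Cle k k0); apply: HC => // ns; move: nn; rewrite ns.
have {}ns : n = nl_sgn by move: ns; case: n.
have [_ _ iu] := pu.
have e2 : pi - pi / 2 = pi / 2 :> R by field.
have uh : u (pi / 2) = 1 by have := u_refl_pi (pi / 2) ns; rewrite e2; lra.
have ul y : 0 <= y -> y <= pi / 2 -> u y <= 1 by move=> y0 yp; rewrite -uh; apply: iu; lra.
have lo m' k' : 0 < k' -> k' <= m' -> m' + k' <= pi / 2 -> u (m' + k') - u (m' - k') <= C * k' `^ alpha.
  by move=> a1 a2 a3; apply: HC => //; [lra|move=> _; apply: ul; lra].
have hi m' k' : 0 < k' -> m' + k' <= pi -> pi / 2 <= m' - k' -> u (m' + k') - u (m' - k') <= C * k' `^ alpha.
  move=> a1 a2 a3; have l1 : k' <= pi - m' by lra.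
  have l2 : pi - m' + k' <= pi / 2 by lra.
  have := lo (pi - m') k' a1 l1 l2.
  have -> : pi - m' + k' = pi - (m' - k') by ring.
  have -> : pi - m' - k' = pi - (m' + k') by ring.
  by rewrite !u_refl_pi//; lra.
have [c1|c1] := leP (m + k) (pi / 2); first by apply: le_trans (lo m k k0 km c1) (Cle k k0).
have [c2|c2] := leP (pi / 2) (m - k); first by apply: le_trans (hi m k k0 mkp c2) (Cle k k0).
pose a := (m + k + pi / 2) / 2; pose a' := (m + k - pi / 2) / 2.
pose b := (pi / 2 + (m - k)) / 2; pose b' := (pi / 2 - (m - k)) / 2.
have ea : a + a' = m + k by rewrite /a /a'; field.
have ea' : a - a' = pi / 2 by rewrite /a /a'; field.
have eb : b + b' = pi / 2 by rewrite /b /b'; field.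
have eb' : b - b' = m - k by rewrite /b /b'; field.
have a0 : 0 < a' by rewrite /a'; lra.
have b0 : 0 < b' by rewrite /b'; lra.
have H1 := hi a a' a0; rewrite ea ea' in H1; have {}H1 := H1 mkp (lexx _).
have bb : b' <= b by rewrite /b' /b; lra.
have H2 := lo b b' b0 bb; rewrite eb eb' in H2; have {}H2 := H2 (lexx _).
have pk t : 0 < t -> t <= k -> C * t `^ alpha <= C * k `^ alpha.
  by move=> t0 tk; rewrite ler_pM2l//; apply: ge0_ler_powR; rewrite ?nnegrE ?(ltW h0) ?(ltW t0) ?(ltW k0).
have K1 : C * a' `^ alpha <= C * k `^ alpha by apply: pk => //; rewrite /a'; lra.
have K2 : C * b' `^ alpha <= C * k `^ alpha by apply: pk => //; rewrite /b'; lra.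
have -> : 2 * C * k `^ alpha = C * k `^ alpha + C * k `^ alpha by ring.
lra.
Qed.

Lemma u_holder : exists2 C : R, 0 < C & forall x y, `|u x - u y| <= C * `|x - y| `^ alpha.
Proof.
have pp := @pi_gt0 R; have p2 := @pi_ge2 R; have U1 := u_pi_ge1.
have [C C0 HC] := u_holder_half; exists (C + 2 * U); first by lra.
have [[mu pu' ub] eu iu] := pu.
have main m h : 0 < h -> `|u (m + h) - u (m - h)| <= (C + 2 * U) * h `^ alpha.
  move=> hh0; have ha : 0 < h `^ alpha by exact: powR_gt0.
  have [h1'|h1'] := leP h (1 / 2); last first.
    have l1 : 1 <= 2 * h `^ alpha.
      apply: le_trans (_ : (2 * h) `^ alpha <= _).
        have e : (1 : R) `^ alpha = 1 by rewrite powR1.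
        by rewrite -[leLHS]e; apply: ge0_ler_powR; rewrite ?nnegrE ?(ltW h0)//; lra.
      by rewrite powRM ?(ltW hh0)// ler_pM2r//; apply: ler1_powR; [rewrite ler1n|exact: ltW].
    have : U * 1 <= U * (2 * h `^ alpha) by rewrite ler_pM2l//; lra.
    have : 0 <= C * h `^ alpha by rewrite mulr_ge0 ?ltW.
    have := u0 (m + h); have := u0 (m - h); have := u_le_pi (m + h); have := u_le_pi (m - h).
    by rewrite ler_norml; lra.
  have CU : C * h `^ alpha <= (C + 2 * U) * h `^ alpha by rewrite ler_pM2r//; lra.
  (* The modulus of the symmetric increment is an even periodic function of the midpoint, which may
     therefore be taken in [0, pi]. If the interval then sticks out at an end, reflection at that
     end shortens it. *)
  have [y hy Hy] := fold_ex m.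
  have := Hy (fun m => `|u (m + h) - u (m - h)|); rewrite /= => -> /=.
  - apply: le_trans CU; have hk t : 0 < t -> t <= h -> C * t `^ alpha <= C * h `^ alpha.
      by move=> t0 th; rewrite ler_pM2l//; apply: ge0_ler_powR; rewrite ?nnegrE ?(ltW h0) ?(ltW t0) ?(ltW hh0).
    have nn a b : 0 <= a -> a <= b -> b <= pi -> `|u b - u a| = u b - u a.
      by move=> a0 ab bp; rewrite ger0_norm// subr_ge0 iu.
    case/andP: hy => y0 yp; have [hy|yh] := leP h y.
      have [yhp|yhp] := leP (y + h) pi.
        by rewrite nn; [exact: HC|lra|lra|lra].
      have -> : u (y + h) = u (pi - h + (pi - y)).
        by rewrite -(eu (y + h)) -(pu' (- (y + h))); congr u; ring.
      have -> : u (y - h) = u (pi - h - (pi - y)) by congr u; ring.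
      have [ype|yp'] := eqVneq y pi.
        by rewrite ype subrr addr0 subr0 subrr normr0 mulr_ge0 ?powR_ge0// ltW.
      have yp0 : 0 < pi - y by rewrite subr_gt0 lt_neqAle yp'.
      rewrite nn; [|lra|lra|lra]; apply: le_trans (HC _ _ yp0 _ _) (hk _ yp0 _); clear - h0 h1 hp wu l0 pu u0 U y0 yp hy yhp h1' hh0 yp0 p2; lra.
    have -> : u (y - h) = u (h - y) by rewrite -(eu (h - y)); congr u; ring.
    rewrite [y + h]addrC; have [ye|yn] := eqVneq y 0.
      by rewrite ye addr0 subr0 subrr normr0 mulr_ge0 ?powR_ge0// ltW.
    have y00 : 0 < y by rewrite lt_neqAle eq_sym yn.
    rewrite nn; [|lra|lra|lra]; apply: le_trans (HC _ _ y00 _ _) (hk _ y00 _); clear - h0 h1 hp wu l0 pu u0 U y0 yp yh y00 h1' hh0 p2; lra.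
  - move=> x; rewrite distrC; congr (`|_ - _|).
      by rewrite -(eu (x + h)); congr u; ring.
    by rewrite -(eu (x - h)); congr u; ring.
  - move=> x; congr (`|_ - _|); first by rewrite addrAC pu'.
    by rewrite addrAC pu'.
move=> x y; wlog xy : x y / y <= x.
  move=> K; have [/K|/ltW/K] := leP y x; first exact.
  by rewrite distrC [`|y - x|]distrC.
move: xy; rewrite le_eqVlt => /predU1P[->|xy].
  by rewrite !subrr normr0 mulr_ge0 ?powR_ge0//; lra.
have hh : 0 < (x - y) / 2 by lra.
have := main ((x + y) / 2) _ hh.
have -> : (x + y) / 2 + (x - y) / 2 = x by field.
have -> : (x + y) / 2 - (x - y) / 2 = y by field.
move/le_trans; apply; apply: ler_wpM2l; first by lra.
rewrite gtr0_norm ?subr_gt0//; apply: ge0_ler_powR; rewrite ?nnegrE ?(ltW h0) ?(ltW hh)//; lra.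
Qed.

End Asymptotics.

(** * Gain of Hoelder exponents under L *)

Section Bootstrap.
Context {R : realType} (alpha : R) (h0 : 0 < alpha) (h1 : alpha < 1).
Notation Lop := (Lop alpha).
Implicit Types (f : R -> R) (x y s t h m M r b g C : R).

Definition holder_near f x0 b := exists C r, 0 < r /\
  forall x y, `|x - x0| < r -> `|y - x0| < r -> `|f x - f y| <= C * `|x - y| `^ b.

(** The loss de = alpha + b - g > 0 allows one argument for all signs of alpha + b - 1: write
    s^(alpha - 2 + b) = s^(g - 1) s^(de - 1), bound the first factor by its value at 2 h, and
    integrate the second over [0, pi]. *)
Lemma Lop_gain f M x0 b g : bper f M -> holder_near f x0 b -> 0 <= b -> g <= 1 ->
  alpha + b - 1 < g -> g < alpha + b -> holder_near (Lop f) x0 g.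
Proof.
move=> bf [C [r [r0 Hf]]] b0 g1 g2 g3; have [_ _ fb] := bf; have M0 := bper_ge0 bf.
have pp := @pi_gt0 R.
have [C1 C10 H1] := diff_bound h0 h1.
pose r' := Num.min r 1; have r'0 : 0 < r' by rewrite lt_min r0 ltr01.
have r'1 : r' <= 1 by rewrite ge_min lexx orbT.
have r'r : r' <= r by rewrite ge_min lexx.
have r20 : 0 < (r' / 2) `^ b by rewrite powR_gt0// divr_gt0.
pose H := `|C| * 2 `^ b + 2 * M / (r' / 2) `^ b.
have H0 : 0 <= H by rewrite addr_ge0 ?mulr_ge0 ?powR_ge0// invr_ge0 ltW.
pose de := alpha + b - g; have de0 : 0 < de by rewrite /de; lra.
have de1 : de < 1 by rewrite /de; lra.
have [iK eK] := integ_powR0 pp de0 de1.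
set K := Int `[0, pi] (fun x => x `^ (de - 1)) in eK.
have K0 : 0 <= K by apply: Int_ge0 => s _; exact: powR_ge0.
exists (C1 * H * (1 + K / 2)), (r' / 2); split; first by rewrite divr_gt0.
have Hm m s : `|m - x0| < r' / 2 -> 0 <= s -> `|f (m + s) - f (m - s)| <= H * s `^ b.
  move=> hm s0; have [sr|sr] := ltP s (r' / 2).
    apply: le_trans (Hf _ _ _ _) _.
    - by move: hm; clear - h0 h1 sr s0 r'r; rewrite !ltr_norml; lra.
    - by move: hm; clear - h0 h1 sr s0 r'r; rewrite !ltr_norml; lra.
    have -> : m + s - (m - s) = 2 * s by ring.
    rewrite ger0_norm ?mulr_ge0// powRM// mulrA; apply: ler_wpM2r; first exact: powR_ge0.
    apply: le_trans (_ : `|C| * 2 `^ b <= _).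
      by apply: ler_wpM2r; [exact: powR_ge0|exact: ler_norm].
    by rewrite lerDl mulr_ge0 ?mulr_ge0// invr_ge0 ltW.
  apply: le_trans (_ : 2 * M <= _).
    by apply: le_trans (ler_normB _ _) _; rewrite mulr_natl mulr2n; exact: lerD.
  apply: le_trans (_ : 2 * M / (r' / 2) `^ b * s `^ b <= _); last first.
    by apply: ler_wpM2r; [exact: powR_ge0|rewrite lerDr mulr_ge0 ?powR_ge0].
  rewrite -mulrA ler_peMr ?mulr_ge0// mulrC ler_pdivlMr// mul1r.
  by apply: ge0_ler_powR; rewrite ?nnegrE//; clear - h0 h1 b0 sr r'0 s0; lra.
have main x y : y < x -> `|x - x0| < r' / 2 -> `|y - x0| < r' / 2 ->
    `|Lop f x - Lop f y| <= C1 * H * (1 + K / 2) * `|x - y| `^ g.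
  move=> yx hx hy; pose m := (x + y) / 2; pose h := (x - y) / 2.
  have hm : `|m - x0| < r' / 2 by move: hx hy; clear - h0 h1; rewrite /m !ltr_norml; lra.
  have hh0 : 0 < h by clear - h0 h1 yx; rewrite /h; lra.
  have hh1 : 2 * h <= 1 by rewrite /h; move: hx hy; clear - h0 h1 r'1; rewrite !ltr_norml; lra.
  have em : m + h = x by rewrite /m /h; field.
  have em' : m - h = y by rewrite /m /h; field.
  have eh : `|x - y| = 2 * h by rewrite gtr0_norm ?subr_gt0// /h; field.
  have h20 : 0 < 2 * h by rewrite mulr_gt0.
  have Hh : h <= 1 / 2 by clear - h0 h1 hh1; lra.
  rewrite eh; have A0 : 0 <= H * (2 * h) `^ b by rewrite mulr_ge0 ?powR_ge0.
  have sE s : 0 < s -> s `^ (alpha - 2) * (H * s `^ b) = H * (s `^ (g - 1) * s `^ (de - 1)).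
    move=> s0; rewrite mulrCA -!powRD ?(gt_eqF s0) ?implybT//; congr (_ * _ `^ _).
    by rewrite /de; ring.
  have sub : {subset `[2 * h, pi] <= `[0, pi : R]}.
    by move=> s; rewrite !in_itv/= => /andP[s1 ->]; rewrite (le_trans (ltW h20) s1).
  have iK' := integS sub iK.
  have mP (c : R) : measurable_fun [set` `[2 * h, pi : R]] (fun s : R => s `^ c).
    by apply: measurable_funTS; exact: measurable_powR.
  have gle s : 2 * h <= s -> s `^ (g - 1) <= (2 * h) `^ (g - 1).
    move=> hs; have -> : g - 1 = - (1 - g) by ring.
    have s0 := lt_le_trans h20 hs.
    by rewrite !powRN lef_pV2 ?posrE ?powR_gt0//; apply: ge0_ler_powR; rewrite ?nnegrE ?(ltW h20) ?(ltW s0)// subr_ge0.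
  have ig : integ `[2 * h, pi] (fun s => s `^ (alpha - 2) * (H * s `^ b)).
    apply: (integ_le (g := fun s => H * ((2 * h) `^ (g - 1) * s `^ (de - 1)))).
    - by apply: integZ; exact: integZ.
    - by apply: measurable_funM => //; apply: measurable_funM.
    - move=> s; rewrite in_itv/= => /andP[s1 s2]; have s0 := lt_le_trans h20 s1.
      rewrite sE// ger0_norm ?mulr_ge0 ?powR_ge0//.
      by apply: ler_wpM2l => //; apply: ler_wpM2r; [exact: powR_ge0|exact: gle].
  have := H1 f M m h _ (fun s => H * s `^ b) bf hh0 Hh A0 _ ig _.
  rewrite em em' => /(_ _ _) Hd; apply: le_trans (Hd _ _) _.
  - move=> s /andP[s0 s2]; apply: le_trans (Hm m s hm s0) _.
    by apply: ler_wpM2l => //; apply: ge0_ler_powR; rewrite ?nnegrE ?(ltW h20).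
  - by move=> s /andP[s0 s2]; apply: Hm => //; exact: le_trans (ltW h20) s0.
  have I1 : Int `[2 * h, pi] (fun s => s `^ (alpha - 2) * (H * s `^ b)) <= H * ((2 * h) `^ (g - 1) * K).
    apply: le_trans (_ : Int `[2 * h, pi] (fun s => H * ((2 * h) `^ (g - 1) * s `^ (de - 1))) <= _).
      apply: Int_le => //; first by apply: integZ; exact: integZ.
      move=> s; rewrite in_itv/= => /andP[s1 s2]; have s0 := lt_le_trans h20 s1.
      rewrite sE//.
      by apply: ler_wpM2l => //; apply: ler_wpM2r; [exact: powR_ge0|exact: gle].
    rewrite !IntZ//; last exact: integZ.
    apply: ler_wpM2l => //; apply: ler_wpM2l; first exact: powR_ge0.
    have [hp|hp] := leP (2 * h) pi; last by have := @pi_ge2 R; clear - h0 h1 hp hh1; lra.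
    apply: Int_sub => //; [exact: ltW|by move=> s _; exact: powR_ge0].
  have P1 : (2 * h) `^ b * h `^ alpha <= (2 * h) `^ g.
    apply: le_trans (_ : (2 * h) `^ b * (2 * h) `^ alpha <= _).
      apply: ler_wpM2l; first exact: powR_ge0.
      by apply: ge0_ler_powR; rewrite ?nnegrE ?(ltW h0) ?(ltW hh0) ?(ltW h20)//; clear - h0 h1 hh0; lra.
    rewrite -powRD ?(gt_eqF h20) ?implybT//.
    by apply: ger_powR; [rewrite h20|clear - h0 h1 g3; lra].
  have P2 : h * (2 * h) `^ (g - 1) = (2 * h) `^ g / 2.
    have -> : (2 * h) `^ g = 2 * h * (2 * h) `^ (g - 1).
      by rewrite -{2}(powRr1 (ltW h20)) -powRD ?(gt_eqF h20) ?implybT//; congr (_ `^ _); ring.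
    by field.
  have -> : C1 * H * (1 + K / 2) * (2 * h) `^ g = C1 * H * (2 * h) `^ g + C1 * h * (H * ((2 * h) `^ (g - 1) * K)).
    have -> : C1 * h * (H * ((2 * h) `^ (g - 1) * K)) = C1 * H * K * (h * (2 * h) `^ (g - 1)) by ring.
    by rewrite P2; field.
  apply: lerD; last by apply: ler_wpM2l I1; rewrite mulr_ge0 ?ltW.
  have -> : C1 * (H * (2 * h) `^ b) * h `^ alpha = C1 * H * ((2 * h) `^ b * h `^ alpha) by ring.
  by apply: ler_wpM2l P1; rewrite mulr_ge0// ltW.
move=> x y hx hy; case: (ltgtP x y) => [xy|xy|->].
- by rewrite distrC [`|x - y|]distrC; exact: main.
- exact: main.
- by rewrite !subrr normr0 mulr_ge0 ?powR_ge0// !mulr_ge0 ?(ltW C10)// addr_ge0 ?divr_ge0.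
Qed.

(** Boundedness is exponent 0. Steps of size 1 / N < alpha leave room for the loss in [Lop_gain] and
    arrive exactly at exponent 1. *)
Lemma bootstrap f M x0 C0 r0 : bper f M -> 0 < r0 ->
  (forall x y, `|x - x0| < r0 -> `|y - x0| < r0 ->
     `|f x - f y| <= C0 * (`|Lop f x - Lop f y| + `|x - y|)) ->
  holder_near f x0 1.
Proof.
move=> bf r00 Hf; have [_ _ fb] := bf.
pose N := (Num.truncn alpha^-1).+1; have N0 : 0 < N%:R :> R by rewrite ltr0n.
have Na : N%:R^-1 < alpha.
  by rewrite invf_plt ?posrE//; have := Num.Theory.truncn_itv (ltW (_ : 0 < alpha^-1)); rewrite invr_gt0 => /(_ h0) /andP[].
suff H j : (j <= N)%N -> holder_near f x0 (j%:R / N%:R).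
  by have := H N (leqnn N); rewrite divff// gt_eqF.
elim: j => [_|j IH jN].
  exists (2 * M), 1; split=> // x y _ _; rewrite mul0r powRr0 mulr1.
  by apply: le_trans (ler_normB _ _) _; have := fb x; have := fb y; lra.
have jN1 : j.+1%:R / N%:R <= 1 :> R by rewrite ler_pdivrMr// mul1r ler_nat.
have j0 : 0 <= j%:R / N%:R :> R by rewrite divr_ge0.
have ej : j.+1%:R / N%:R = j%:R / N%:R + N%:R^-1 :> R by rewrite -natr1 mulrDl mul1r.
have N1 : 0 < N%:R^-1 :> R by rewrite invr_gt0.
have [||C [r [r1 HL]]] := Lop_gain bf (IH (ltnW jN)) j0 jN1.
- by rewrite ej; have := h1; lra.
- by rewrite ej; lra.
set g := j.+1%:R / N%:R in HL jN1 *.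
pose r' := Num.min (1 / 2) (Num.min r r0).
exists (`|C0| * (C + 1)), r'; split; first by rewrite !lt_min divr_gt0 ?r1.
move=> x y; rewrite !lt_min => /and3P[x1 x2 x3] /and3P[y1 y2 y3].
apply: le_trans (Hf x y x3 y3) _; rewrite -mulrA.
apply: le_trans (_ : `|C0| * (`|Lop f x - Lop f y| + `|x - y|) <= _).
  by apply: ler_wpM2r; [exact: addr_ge0|exact: ler_norm].
apply: ler_wpM2l => //; rewrite mulrDl mul1r; apply: lerD; first exact: HL.
have [->|xy] := eqVneq x y; first by rewrite subrr normr0 powR_ge0.
rewrite -[leLHS]powRr1//; apply: ger_powR => //.
by rewrite normr_gt0 subr_eq0 xy/=; move: x1 y1; rewrite ler_norml !ltr_norml; lra.
Qed.

End Bootstrap.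

(** * Differentiability from estimates on increments *)

Section Increments.
Context {R : realType}.
Implicit Types (x y h k C L e : R) (G Phi : R -> R).

(** The slope g is a limit point of n Phi(1 / n); summing the near-additivity over steps of length 1
    / n compares Phi h with g h. *)
Lemma near_additive Phi L C al : 0 <= C -> 0 < al -> (forall h, 0 <= h -> `|Phi h| <= L * h) ->
  (forall h k, 0 <= h -> 0 <= k -> `|Phi (h + k) - Phi k - Phi h| <= C * h * k `^ al) ->
  exists g, forall h, 0 <= h -> `|Phi h - g * h| <= C * h * h `^ al.
Proof.
move=> C0 al0 bP aP.
have L0 : 0 <= L by have := le_trans (normr_ge0 _) (bP 1 ler01); rewrite mulr1.
(* All coordinates are equal and only the first is used: this is Bolzano-Weierstrass. *)
have [|zz [_ zc]] := @box_cluster R (fun=> - L) (fun=> L) (fun n _ => n.+1%:R * Phi n.+1%:R^-1).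
  move=> n _; rewrite -ler_norml normrM ger0_norm//.
  have i0 : 0 <= n.+1%:R^-1 :> R by rewrite invr_ge0.
  apply: le_trans (ler_wpM2l (ler0n _ _) (bP _ i0)) _.
  by rewrite mulrCA divff ?pnatr_eq0// mulr1.
exists (zz 0%N) => h hh; set g := zz 0%N.
have Q0 : 0 <= L + C * h `^ al + `|g| by rewrite !addr_ge0// mulr_ge0// powR_ge0.
set Q := L + C * h `^ al + `|g| in Q0.
apply/ler_addgt0Pr => e e0.
pose d := e / 2 / (h + 1); have d0 : 0 < d by rewrite !divr_gt0//; lra.
have [n mn Hn] := zc 1%N d (Num.truncn (2 * Q / e)) d0.
have {}Hn := Hn 0%N isT.
(* h is cut into k steps of length h' and a rest r <= h'. The choice of d makes the error in the
   slope at most e / 2, and Q collects what the rest contributes, at most h' Q <= e / 2. *)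
pose h' : R := n.+1%:R^-1; have n0 : 0 < n.+1%:R :> R by rewrite ltr0n.
have h'0 : 0 < h' by rewrite invr_gt0.
have Qh : h' * Q <= e / 2.
  have q0 : 0 <= 2 * Q / e by rewrite divr_ge0 ?mulr_ge0// ltW.
  have /andP[_ t2] := Num.Theory.truncn_itv q0.
  have : 2 * Q / e <= n.+1%:R by apply: le_trans (ltW t2) _; rewrite ler_nat ltnS.
  rewrite ler_pdivrMr// => t3; rewrite /h' mulrC ler_pdivrMr//; lra.
have hn0 : 0 <= h * n.+1%:R by rewrite mulr_ge0.
pose k := Num.truncn (h * n.+1%:R).
have /andP[k1 k2] := Num.Theory.truncn_itv hn0; rewrite -/k in k1 k2.
pose r := h - k%:R * h'.
have r0 : 0 <= r by rewrite subr_ge0 /h' ler_pdivrMr.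
have rh' : r <= h'.
  rewrite lerBlDr; have -> : h' + k%:R * h' = k.+1%:R * h' by rewrite -natr1; ring.
  by rewrite /h' ler_pdivlMr// ltW.
have kh : k%:R * h' <= h by rewrite -subr_ge0.
have hal : 0 <= h `^ al by exact: powR_ge0.
have mono t : 0 <= t -> t <= h -> t `^ al <= h `^ al.
  by move=> t0 th; apply: ge0_ler_powR; rewrite ?nnegrE// ltW.
have Phi0 : Phi 0 = 0.
  by apply/eqP; rewrite -normr_le0; have := bP 0 (lexx _); rewrite mulr0.
have S1 (j : nat) : (j <= k)%N -> `|Phi (j%:R * h') - j%:R * Phi h'| <= C * (j%:R * h') * h `^ al.
  elim: j => [_|j IH jk]; first by rewrite !mul0r Phi0 subr0 normr0 mulr0 mul0r.
  have j0 : 0 <= j%:R * h' by rewrite mulr_ge0// ltW.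
  have := aP h' (j%:R * h') (ltW h'0) j0.
  have -> : h' + j%:R * h' = j.+1%:R * h' by rewrite -natr1; ring.
  have jh : j%:R * h' <= h.
    by apply: le_trans kh; rewrite ler_pM2r// ler_nat ltnW.
  have := ler_wpM2l (mulr_ge0 C0 (ltW h'0)) (mono _ j0 jh).
  have := IH (ltnW jk); rewrite -natr1 !mulrDl !mul1r !mulrDr !mulrDl.
  move: (C * h' * _) (C * h' * _) (C * (j%:R * h') * _) (Phi (j%:R * _)) (Phi (_ + _)) (j%:R * Phi h') => a b c p1 p2 p3.
  by rewrite !ler_norml; lra.
have {}S1 := S1 k (leqnn _).
have kh0 : 0 <= k%:R * h' by rewrite mulr_ge0// ltW.
have S2 := aP r (k%:R * h') r0 kh0.
have eh : r + k%:R * h' = h by rewrite /r subrK.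
rewrite eh in S2.
have S2' : C * r * (k%:R * h') `^ al <= C * h' * h `^ al.
  by apply: ler_pM; rewrite ?mulr_ge0 ?powR_ge0//; [rewrite ler_wpM2l|exact: mono].
have S3 : `|Phi r| <= L * h' by apply: le_trans (bP r r0) _; exact: ler_wpM2l.
have S4 : `|k%:R * Phi h' - k%:R * h' * g| <= e / 2.
  have -> : k%:R * Phi h' - k%:R * h' * g = k%:R * h' * (n.+1%:R * Phi h' - g).
    have hn : h' * n.+1%:R = 1 by rewrite mulVf// pnatr_eq0.
    transitivity (k%:R * (h' * n.+1%:R) * Phi h' - k%:R * h' * g); last by ring.
    by rewrite hn mulr1.
  rewrite normrM ger0_norm//; apply: le_trans (_ : (h + 1) * d <= _).
    by apply: ler_pM => //; [lra|exact: ltW].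
  by rewrite /d mulrC divfK// gt_eqF//; lra.
have S5 : `|k%:R * h' * g - g * h| <= h' * `|g|.
  have -> : k%:R * h' * g - g * h = - (r * g) by rewrite /r; ring.
  by rewrite normrN normrM ger0_norm// ler_wpM2r.
have S1' : C * (k%:R * h') * h `^ al <= C * h * h `^ al.
  by rewrite ler_wpM2r// ler_wpM2l.
have Qe : h' * Q = L * h' + C * h' * h `^ al + h' * `|g| by rewrite /Q; ring.
move: S1 S2 S3 S4 S5 S1' S2'; rewrite Qe in Qh; move: Qh.
move: (C * (k%:R * h') * _) (C * h * _) (C * r * _) (C * h' * _) (L * h') (h' * `|g|) (k%:R * h' * g) (g * h) => a b c d' f i j l.
move: (Phi (k%:R * h')) (k%:R * Phi h') (Phi r) (Phi h) => p1 p2 p3 p4.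
rewrite !ler_norml; clear; lra.
Qed.

(** A C^1 criterion that presupposes no derivative. Closeness of increments at nearby points makes h
    to G (x + h) - G x nearly additive for h >= 0, so it has a slope g x with an explicit error. The
    same hypothesis makes g continuous, and negative h is reduced to the slope at x + h. *)
Lemma der_of_increments G al C L : 0 <= C -> 0 < al ->
  (forall x h, 0 <= h -> `|G (x + h) - G x| <= L * h) ->
  (forall x y h, 0 <= h -> `|(G (x + h) - G x) - (G (y + h) - G y)| <= C * h * `|x - y| `^ al) ->
  exists2 g, forall x, der G x (g x) & continuous g.
Proof.
move=> C0 al0 bG aG.
have ex x : exists g, forall h, 0 <= h -> `|G (x + h) - G x - g * h| <= C * h * h `^ al.
  have [||g Hg] := @near_additive (fun h => G (x + h) - G x) L C al C0 al0.
  - by move=> h hh; exact: bG.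
  - move=> h k hh k0; have := aG (x + k) x h hh; have -> : x + k - x = k by ring.
    rewrite (ger0_norm k0).
    have -> : x + k + h = x + (h + k) by ring.
    by congr (`|_| <= _); ring.
  - by exists g.
have [g Hg] := choice ex.
have gH x y : `|g x - g y| <= 3 * C * `|x - y| `^ al.
  have [->|xy] := eqVneq x y; first by rewrite !subrr normr0 mulr_ge0 ?powR_ge0// mulr_ge0.
  pose h := `|x - y|; have h0 : 0 < h by rewrite normr_gt0 subr_eq0.
  have e1 := Hg x h (ltW h0); have e2 := Hg y h (ltW h0); have e3 := aG x y h (ltW h0).
  rewrite -/h in e3; suff key : `|(g x - g y) * h| <= 3 * C * h `^ al * h.
    by rewrite -/h -(ler_pM2r h0); move: key; rewrite normrM (ger0_norm (ltW h0)).
  rewrite mulrBl; have -> : 3 * C * h `^ al * h = C * h * h `^ al + C * h * h `^ al + C * h * h `^ al by ring.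
  move: e1 e2 e3; move: (C * h * _) (g x * h) (g y * h) (G (x + h)) (G (y + h)) (G x) (G y) => a b c p1 p2 p3 p4.
  by rewrite !ler_norml; lra.
have small K e : 0 <= K -> 0 < e -> exists2 d : R, 0 < d & forall t : R, `|t| < d -> K * `|t| `^ al < e.
  move=> K0 e0; have := powR_abs_continuous al0 (x := 0 : R).
  have k1 : 0 < e / (K + 1) by rewrite divr_gt0//; lra.
  move/cvgrPdist_lt => /(_ _ k1) /nbhs_ballP[d /= d0 H]; exists d => // t td.
  have /H : ball (0 : R) d t by rewrite /ball/= sub0r normrN.
  rewrite /= normr0 powR0 ?gt_eqF// sub0r normrN ger0_norm ?powR_ge0// ltr_pdivlMr; last lra.
  by have := powR_ge0 `|t| al; lra.
exists g => x.
  apply: der_limit; apply/cvgrPdist_lt => e e0.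
  have [|d d0 Hd] := small (4 * C) e _ e0; first by rewrite mulr_ge0.
  near=> h; have hn : h != 0 by near: h; exact: nbhs_dnbhs_neq.
  have hd : `|h| < d.
    near: h; apply: dnbhs0_lt; exact: d0.
  apply: le_lt_trans (Hd h hd).
  have h0 : 0 < `|h| by rewrite normr_gt0.
  rewrite distrC -(ler_pM2r h0) -normrM mulrBl mulrAC mulVf// mul1r.
  have -> : 4 * C * `|h| `^ al * `|h| = C * `|h| * `|h| `^ al + 3 * C * `|h| `^ al * `|h| by ring.
  have X0 : 0 <= 3 * C * `|h| `^ al * `|h| by rewrite !mulr_ge0 ?powR_ge0.
  case: (leP 0 h) => hs.
    have := Hg x h hs; rewrite (ger0_norm hs) in X0 *; rewrite [h + x]addrC => H1.
    by apply: le_trans H1 _; rewrite lerDl.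
  have k0 : 0 <= - h by lra.
  have := Hg (x + h) (- h) k0; rewrite addrK (ltr0_norm hs) => H1.
  have := gH (x + h) x; have -> : x + h - x = h by ring.
  rewrite (ltr0_norm hs) => H2.
  have {}H2 : `|(g (x + h) - g x) * - h| <= 3 * C * (- h) `^ al * - h.
    by rewrite normrM (ger0_norm k0) ler_wpM2r.
  have -> : G (h + x) - G x - g x * h = - (G x - G (x + h) - g (x + h) * - h) - ((g (x + h) - g x) * - h).
    by rewrite [h + x]addrC; ring.
  by apply: le_trans (ler_normB _ _) _; rewrite normrN lerD.
apply/cvgrPdist_lt => e e0; have [|d d0 Hd] := small (3 * C) e _ e0; first by rewrite mulr_ge0.
apply/nbhs_ballP; exists d => // y; rewrite /ball/= => xy.
by apply: le_lt_trans (gH x y) _; exact: Hd.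
Unshelve. all: by end_near.
Qed.

Lemma der_quotient f x d : der f x d -> h^-1 * (f (h + x) - f x) @[h --> 0^'] --> d.
Proof.
move=> H; have [dv e] := H; rewrite -e.
have E : (fun h : R => h^-1 * (f (h + x) - f x)) = (fun h : R => h^-1 *: (f (h *: 1 + x) - f x)).
  by apply/funext => h; rewrite [h *: 1]mulr1.
by rewrite E; exact: dv.
Qed.

End Increments.

(** * Periodic cutoff functions of class C^1 *)

Section Cutoff.
Context {R : realType}.
Implicit Types (x y t r : R).

Lemma cos_lt_abs t r : `|t| < r -> r <= pi -> cos r < cos t.
Proof.
move=> tr rp; have -> : cos t = cos `|t| by case: (leP 0 t) => ht; [rewrite ger0_norm|rewrite ltr0_norm// cosN].
exact: cos_decr.
Qed.

Lemma cos_gt_near t r : 0 < r -> r <= pi -> cos r < cos t -> exists z : int, `|t - 2 * pi * z%:~R| < r.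
Proof.
move=> r0 rp ct; have p0 : 0 < pi :> R := pi_gt0 R.
pose z : int := Num.floor ((t + pi) / (2 * pi)); exists z; set d := t - _.
have /andP[d1 d2] : - pi <= d <= pi.
  have /andP[z1 z2] : z%:~R <= (t + pi) / (2 * pi) < (z + 1)%:~R by rewrite floor_itv.
  move: z1 z2; rewrite intrD ler_pdivlMr ?ltr_pdivrMr ?mulr_gt0// => z1 z2.
  by rewrite /d; nra.
have cper : periodic cos (2 * pi : R) by move=> s; rewrite mulr_natl cosD2pi.
have e : cos t = cos `|d|.
  have -> : cos t = cos d by rewrite -(per_int z d cper) /d; congr cos; ring.
  by case: (leP 0 d) => hd; [rewrite ger0_norm|rewrite ltr0_norm// cosN].
rewrite ltNge; apply/negP; rewrite le_eqVlt => /predU1P[rd|rd].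
  by move: ct; rewrite e -rd ltxx.
have dp : `|d| <= pi by rewrite ler_norml d1.
by have := cos_decr (ltW r0) rd dp; rewrite -e; move/(lt_trans ct); rewrite ltxx.
Qed.

Definition spos y : R := Num.max 0 y ^+ 2.

Lemma maxE y : Num.max 0 y = (y + `|y|) / 2.
Proof. by case: (leP 0 y) => hy; [rewrite ger0_norm//; field|rewrite ltr0_norm//; field]. Qed.

Lemma der_spos y : der spos y (2 * Num.max 0 y).
Proof.
(* max(0, y)^2 = (y^2 + y |y|) / 2, and y |y| is the odd nonlinearity with p = 2, whose derivative
   is known. *)
have e : spos = (fun y => 2^-1 * (y * y + nonlin nl_sgn 2 y)).
  apply/funext => t; rewrite /spos maxE /=; have -> : 2 - 1 = 1 :> R by ring.
  rewrite powRr1//; have : `|t| ^+ 2 = t ^+ 2 by rewrite real_normK// num_real.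
  by move=> n2; rewrite exprMn sqrrD n2; field.
have p2 : 1 < 2 :> R by rewrite ltr1n.
rewrite e; apply: der_eq (derZ _ (derD (derM (der_id y) (der_id y)) (der_nonlin p2 nl_sgn y))) _.
rewrite /= maxE; have -> : 2 - 1 = 1 :> R by ring.
by rewrite powRr1//; field.
Qed.

(* A C^1 step from 0 (y <= 0) to 1 (y >= 1), piecewise quadratic. *)
Definition sstep y : R := 2 * spos y - 4 * spos (y - 1 / 2) + 2 * spos (y - 1).

Definition dsstep y : R := 4 * Num.max 0 y - 8 * Num.max 0 (y - 1 / 2) + 4 * Num.max 0 (y - 1).

Lemma der_sstep y : der sstep y (dsstep y).
Proof.
have sh c : der (fun y => spos (y - c)) y (2 * Num.max 0 (y - c) * (1 - 0)).
  apply: der_comp (der_spos _); apply: derB; [exact: der_id|exact: derC].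
apply: der_eq (derD (derB (derZ 2 (der_spos y)) (derZ 4 (sh (1 / 2)))) (derZ 2 (sh 1))) _.
by rewrite /dsstep; ring.
Qed.

Lemma sstep_le0 y : y <= 0 -> sstep y = 0 /\ dsstep y = 0.
Proof.
move=> y0; have m t : t <= 0 -> Num.max 0 t = 0 by move=> t0; apply/max_idPl.
by rewrite /sstep /dsstep /spos !m; try lra; rewrite expr0n; split; lra.
Qed.

Lemma sstep_ge1 y : 1 <= y -> sstep y = 1.
Proof.
move=> y1; have m t : 0 <= t -> Num.max 0 t = t by move=> t0; apply/max_idPr.
by rewrite /sstep /spos !m; try lra; field.
Qed.

(** The cutoff is a step function of cos(x - x0), hence periodic. Its support condition is stated
    through the cosine in order to cover all translates by 2 pi. *)
Lemma cutoff_exists x0 r : 0 < r -> r <= pi -> exists chi dchi : R -> R, exists B : R,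
  [/\ forall x, der chi x (dchi x), periodic chi (2 * pi),
      forall x, `|chi x| <= B /\ `|dchi x| <= B,
      forall x, cos (x - x0) <= cos r -> chi x = 0 &
      forall x, `|x - x0| <= r / 2 -> chi x = 1].
Proof.
move=> r0 rp; pose D := cos (r / 2) - cos r.
have D0 : 0 < D by rewrite subr_gt0; apply: cos_decr => //; lra.
pose y x := (cos (x - x0) - cos r) / D.
have dy x : der y x (D^-1 * (- sin (x - x0) * (1 - 0) - 0)).
  have e : y = (fun x => D^-1 * (cos (x - x0) - cos r)) by apply/funext => t; rewrite /y mulrC.
  rewrite e; apply: derZ; apply: derB; last exact: derC.
  by apply: der_comp (der_cos _); apply: derB; [exact: der_id|exact: derC].
have yb x : `|y x| <= 2 / D.
  rewrite normrM [`|D^-1|]gtr0_norm ?invr_gt0// ler_pM2r ?invr_gt0//.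
  by apply: le_trans (ler_normB _ _) _; have := abs_cos_le1 (x - x0); have := abs_cos_le1 r; lra.
have Y0 : 0 <= 2 / D by rewrite divr_ge0// ltW.
set Y := 2 / D in yb Y0.
have mb t : `|t| <= Y + 1 -> 0 <= Num.max 0 t <= Y + 1.
  move=> tY; rewrite le_max lexx/= ge_max (le_trans (ler_norm t) tY) andbT; lra.
have mbs x : [/\ 0 <= Num.max 0 (y x) <= Y + 1, 0 <= Num.max 0 (y x - 1 / 2) <= Y + 1 & 0 <= Num.max 0 (y x - 1) <= Y + 1].
  by have := yb x; split; apply: mb; move: (yb x); rewrite !ler_norml; lra.
exists (sstep \o y), (fun x => dsstep (y x) * (D^-1 * (- sin (x - x0) * (1 - 0) - 0))).
exists (8 * (Y + 1) ^+ 2 + 16 * (Y + 1) / D); split.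
- by move=> x; exact: der_comp (dy x) (der_sstep (y x)).
- move=> x; rewrite /= /y; have -> : x + 2 * pi - x0 = x - x0 + 2 * pi by ring.
  by rewrite mulr_natl cosD2pi.
- move=> x; have [m1 m2 m3] := mbs x.
  have Z0 : 0 <= 8 * (Y + 1) ^+ 2 by rewrite mulr_ge0// sqr_ge0.
  have Z1 : 0 <= 16 * (Y + 1) / D by rewrite divr_ge0 ?(ltW D0)//; lra.
  split.
    apply: le_trans (_ : 8 * (Y + 1) ^+ 2 <= _); last by rewrite lerDl.
    rewrite /= /sstep /spos; have sq t : 0 <= t <= Y + 1 -> 0 <= t ^+ 2 <= (Y + 1) ^+ 2.
      by move=> /andP[t0 tY]; rewrite sqr_ge0 ler_sqr ?nnegrE// (le_trans t0).
    move: (sq _ m1) (sq _ m2) (sq _ m3); move: (Num.max _ _ ^+ 2) (Num.max _ _ ^+ 2) (Num.max _ _ ^+ 2) => a b c.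
    by rewrite ler_norml; lra.
  apply: le_trans (_ : 16 * (Y + 1) / D <= _); last by rewrite lerDr.
  rewrite normrM; apply: ler_pM => //.
    rewrite /dsstep; move: m1 m2 m3; move: (Num.max _ _) (Num.max _ _) (Num.max _ _) => a b c.
    by rewrite ler_norml; lra.
  rewrite normrM gtr0_norm ?invr_gt0// ler_piMr ?invr_ge0 ?(ltW D0)//.
  by rewrite !subr0 mulr1 normrN; exact: abs_sin_le1.
- move=> x cx; rewrite /= (proj1 (sstep_le0 _))//.
  by rewrite /y pmulr_lle0 ?invr_gt0// subr_le0.
- move=> x xr; apply: sstep_ge1; rewrite /y ler_pdivlMr// mul1r lerD2r.
  move: xr; rewrite le_eqVlt => /predU1P[xr|xr]; last by apply: ltW; apply: cos_lt_abs => //; lra.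
  rewrite -xr; case: (leP 0 (x - x0)) => hx; first by rewrite ger0_norm.
  by rewrite ltr0_norm// cosN.
Qed.

End Cutoff.

Lemma Ker_one {R : realType} (alpha x : R) : cos x = 1 -> Ker alpha x = 0.
Proof. by move=> c; rewrite /Ker c eqxx. Qed.

(** * L on Lipschitz and C^1 functions, and away from the support *)

Section LocalRegularity.
Context {R : realType} (alpha : R) (h0 : 0 < alpha) (h1 : alpha < 1).
Notation Lop := (Lop alpha).
Notation Ker := (Ker alpha).
Implicit Types (f w F g : R -> R) (x y s t h m M r C L : R).

Lemma Lop_shift F h x : Lop (fun y => F (y + h)) x = Lop F (x + h).
Proof. by apply: eq_Int => s _; congr (_ * F _); ring. Qed.

Lemma bper_shift F M h : bper F M -> bper (fun y => F (y + h)) M.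
Proof.
move=> [mF pF bF]; split=> //; last by move=> x; rewrite addrAC pF.
have := meas_shift h mF; congr (measurable_fun _ _).
by apply/funext => x; rewrite addrC.
Qed.

(** The function F (y + h) - F y is bounded by L h, so [Lop_holder] applied to it bounds the
    difference of two increments of [Lop F] by a multiple of h |x - y|^alpha, as [der_of_increments]
    demands. *)
Lemma Lop_lipschitz_C1 F M L : bper F M -> (forall x y, `|F x - F y| <= L * `|x - y|) ->
  exists2 g, forall x, der (Lop F) x (g x) & continuous g.
Proof.
move=> bF lF; have L0 : 0 <= L.
  by have := le_trans (normr_ge0 _) (lF 1 0); rewrite subr0 normr1 mulr1.
have [C C0 HC] := Lop_holder h0 h1.
have bh h : 0 <= h -> bper (fun y => F (y + h) - F y) (L * h).
  move=> hh; have [mF pF bF'] := bF; have [mS pS _] := bper_shift h bF; split.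
  - exact: measurable_funB.
  - by move=> x; rewrite pF pS.
  - move=> x; apply: le_trans (lF _ _) _.
    by rewrite addrAC subrr add0r ger0_norm.
have eL h x : Lop (fun y => F (y + h) - F y) x = Lop F (x + h) - Lop F x.
  by rewrite (LopB h0 h1 _ (bper_shift h bF) bF) Lop_shift.
apply: (der_of_increments (al := alpha) (C := C * L) (L := normK alpha * L)) => //.
- by rewrite mulr_ge0// ltW.
- by move=> x h hh; rewrite -eL -mulrA; exact: (Lop_bound h0 h1 _ (bh h hh)).
- by move=> x y h hh; rewrite -!eL; have := HC _ _ x y (bh h hh); rewrite mulrA.
Qed.

Lemma lipschitz_of_der F F' L : (forall x, der F x (F' x)) -> (forall x, `|F' x| <= L) ->
  forall x y, `|F x - F y| <= L * `|x - y|.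
Proof.
move=> dF bF x y; wlog xy : x y / y < x.
  move=> K; case: (ltgtP y x) => [|yx|->]; first exact: K.
    by rewrite distrC [`|x - y|]distrC; exact: K.
  by rewrite !subrr normr0 mulr0.
have [c _ ->] := mvt xy (fun t _ => dF t).
by rewrite normrM ler_wpM2r.
Qed.

Lemma Lop_deriv F F' M L : bper F M -> (forall x, der F x (F' x)) -> (forall x, `|F' x| <= L) ->
  forall x, der (Lop F) x (Lop F' x).
Proof.
move=> bF dF bF' x; have lF := lipschitz_of_der dF bF'.
have L0 : 0 <= L by exact: le_trans (normr_ge0 _) (bF' 0).
apply: der_limit; apply/cvgr_dnbhsP => v [v0 vc].
pose Q n s := (v n)^-1 * (F (v n + (x + s)) - F (x + s)).
have bQ n : bper (fun y => (v n)^-1 * (F (y + v n) - F y)) (`|(v n)^-1| * (M + M)).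
  have [mF pF bF''] := bF; have [mS pS bS] := bper_shift (v n) bF; split.
  - by apply: measurable_funM => //; exact: measurable_funB.
  - by move=> t; rewrite pF pS.
  - move=> t; rewrite normrM ler_wpM2l//.
    by apply: le_trans (ler_normB _ _) _; exact: lerD.
have e n : (v n)^-1 * (Lop F (v n + x) - Lop F x) = Int `[- pi, pi] (fun s => Ker s * Q n s).
  rewrite [v n + x]addrC -Lop_shift -(LopB h0 h1 _ (bper_shift (v n) bF) bF).
  have bd : bper (fun y => F (y + v n) - F y) (M + M).
    have [mF pF bF''] := bF; have [mS pS bS] := bper_shift (v n) bF; split.
    - exact: measurable_funB.
    - by move=> t; rewrite pF pS.
    - by move=> t; apply: le_trans (ler_normB _ _) _; exact: lerD.
  rewrite -(LopZ h0 h1 _ _ bd); apply: eq_Int => s _.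
  by rewrite /Q [v n + _]addrC.
under eq_fun do rewrite e.
have [||||_] := @Int_dct _ `[- pi, pi] (fun n s => Ker s * Q n s) (fun s => Ker s * F' (x + s)) (fun s => L * `|Ker s|).
- move=> n; apply: measurable_funM.
    by apply: measurable_funTS; exact: (Ker_meas h0 h1).
  apply: measurable_funTS; have [mQ _ _] := bQ n.
  have := meas_shift x mQ; congr (measurable_fun _ _); apply/funext => s.
  by rewrite /Q [v n + _]addrC.
- move=> s _; apply: cvgM; first exact: cvg_cst.
  by have /cvgr_dnbhsP := der_quotient (dF (x + s)); apply.
- by apply: integZ; apply: integ_norm; exact: Ker_integ.
- move=> n s _; rewrite normrM mulrC ler_wpM2r// /Q normrM normfV.
  have vn : 0 < `|v n| by rewrite normr_gt0.
  rewrite mulrC ler_pdivrMr//; apply: le_trans (lF _ _) _.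
  by rewrite addrK.
- exact.
Qed.

Lemma bper_far_zero w M x0 r : bper w M -> 0 < r -> r <= pi -> (forall x, `|x - x0| < r -> w x = 0) ->
  forall s x, `|x - x0| < r / 2 -> w s != 0 -> cos (s - x) <= cos (r / 2).
Proof.
move=> [_ pw _] r0 rp w0 s x xr ws; rewrite leNgt; apply/negP => c.
have [||z hz] := cos_gt_near _ _ c; [lra|lra|].
move: ws; have -> : w s = w (s - 2 * pi * z%:~R).
  by rewrite -(per_int z (s - 2 * pi * z%:~R) pw); congr w; ring.
rewrite w0 ?eqxx//; move: hz xr; rewrite !ltr_norml; lra.
Qed.

(** After a translation the variable x sits in the kernel only. For x near x0 and w s != 0 one has
    cos(s - x) <= cos(r / 2), where every derivative of the kernel is bounded, so differentiation
    under the integral can be repeated. *)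
Lemma Lop_smooth_away w M x0 r : bper w M -> 0 < r -> r <= pi ->
  (forall x, `|x - x0| < r -> w x = 0) -> exists sd : nat -> R -> R,
  (forall x, Lop w x = sd 0%N x) /\
  forall j x, `|x - x0| < r / 2 -> der (sd j) x (sd j.+1 x).
Proof.
move=> bw r0 rp w0; have [mw pw bw'] := bw.
have far := bper_far_zero bw r0 rp w0.
have [Kd [K0 dK bK]] := Ker_smooth h0 h1.
(* Nothing is known of [Kd j] where cos t = 1; the value 0 there makes it measurable. *)
pose K j t := if cos t < 1 then Kd j t else 0.
have cr : cos (r / 2) < 1 by rewrite -[ltRHS](cos0 R); apply: cos_decr; lra.
have cr0 : 0 <= cos (r / 2) by apply: cos_ge0_pihalf; lra.
have dK' j t : cos t < 1 -> der (K j) t (K j.+1 t).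
  move=> ct; rewrite {2}/K ct; apply: der_ext (dK j t ct).
  have [e /andP[e0 _] [d d0 H]] := cos_near ct.
  apply/nbhs_ballP; exists d => // y; rewrite /ball/= distrC => /H h.
  by rewrite /K; have -> : cos y < 1 by lra.
have mK j : measurable_fun setT (K j).
  have cU : open [set x : R | cos x < 1].
    rewrite (_ : [set x | _] = cos @^-1` [set y | y < 1])//.
    by apply: open_comp; [move=> x _; exact: continuous_cos|exact: open_lt].
  have mU : measurable [set x : R | cos x < 1] by exact: open_measurable.
  rewrite -(setUv [set x : R | cos x < 1]); apply/measurable_funU => //.
    exact: measurableC.
  split.
    apply: open_continuous_measurable_fun => // x; rewrite inE/= => cx.
    exact: der_cont (dK' j x cx).
  apply: (eq_measurable_fun (cst (0 : R))) => // x; rewrite inE/= => /negP.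
  by rewrite -leNgt => c1; rewrite /K ltNge c1.
have mKw j c x : measurable_fun setT (fun s => c * (K j (s - x) * w s)).
  apply: measurable_funM => //; apply: measurable_funM => //.
  by apply: (measurableT_comp (mK j)); exact: measurable_funB.
pose sd j x := Int `[- pi, pi] (fun s => (-1) ^+ j * (K j (s - x) * w s)).
exists sd; split.
  move=> x; rewrite /sd; pose f t := Ker t * w (x + t).
  have mf : measurable_fun setT f.
    by apply: measurable_funM; [exact: (Ker_meas h0 h1)|exact: meas_shift].
  have pf : periodic f (2 * pi) by move=> t; rewrite /f Ker_periodic addrA pw.
  have [_ e] := Int_per_shift (- x) mf pf (Lop_integ h0 h1 x bw).
  rewrite -[LHS]e; apply: eq_Int => s _; rewrite /f expr0 mul1r.
  have -> : x + (s - x) = s by ring.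
  congr (_ * _); rewrite /K; case: ltP => c; first by rewrite K0.
  by rewrite Ker_one//; apply/le_anti; rewrite c cos_le1.
move=> j x xr.
(* The [xget] term picks the bound on [Kd i] that [bK] provides for e = 1 - cos (r / 2). *)
have bKw i y s : `|y - x0| < r / 2 -> `|(-1) ^+ i * (K i (s - y) * w s)| <= `|xget 0 [set C | forall x, cos x <= 1 - (1 - cos (r / 2)) -> `|Kd i x| <= C]| * M.
  move=> yr; rewrite normrM normrX normrN1 expr1n mul1r normrM.
  have [->|ws] := eqVneq (w s) 0; first by rewrite normr0 mulr0 mulr_ge0// (bper_ge0 bw).
  apply: ler_pM => //; have c := far s y yr ws.
  rewrite /K; have -> : cos (s - y) < 1 by exact: le_lt_trans cr.
  case: xgetP => [C _ HC|].
    by apply: le_trans (ler_norm C); apply: HC; rewrite subKr.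
  have e01 : 0 < 1 - cos (r / 2) <= 1 by lra.
  by have [C HC] := bK i _ e01; move=> /(_ C).
apply: (@Int_derive_under _ `[- pi, pi] (fun y s => (-1) ^+ j * (K j (s - y) * w s))
  (fun y s => (-1) ^+ j.+1 * (K j.+1 (s - y) * w s))
  (fun=> `|xget 0 [set C | forall x, cos x <= 1 - (1 - cos (r / 2)) -> `|Kd j.+1 x| <= C]| * M) (x0 - r / 2) (x0 + r / 2)).
- by move: xr; rewrite ltr_norml; lra.
- move=> y hy; apply: integ_bnd => [|s _]; first by apply: measurable_funTS; exact: mKw.
  by apply: bKw; rewrite ltr_norml; lra.
- move=> y s hy _; have yr : `|y - x0| < r / 2 by rewrite ltr_norml; lra.
  have [ws|ws] := eqVneq (w s) 0.
    have -> : (fun y => (-1) ^+ j * (K j (s - y) * w s)) = fun=> 0.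
      by apply/funext => t; rewrite ws !mulr0.
    by rewrite ws !mulr0; exact: derC.
  have c : cos (s - y) < 1 by apply: le_lt_trans cr; exact: far.
  have d1 : der (fun y => s - y) y (0 - 1) by apply: derB; [exact: derC|exact: der_id].
  apply: der_eq (derZ ((-1) ^+ j) (derM (der_comp d1 (dK' j _ c)) (derC (w s) y))) _.
  by rewrite exprS; ring.
- exact: integ_cst.
- by move=> y s hy _; apply: bKw; rewrite ltr_norml; lra.
Qed.

End LocalRegularity.

(** * Local regularity of L f from local regularity of f *)

Section Localization.
Context {R : realType} (alpha : R) (h0 : 0 < alpha) (h1 : alpha < 1).
Notation Lop := (Lop alpha).
Implicit Types (f w F g chi : R -> R) (x y s t h m M r C L B : R).

Lemma bper_cut f M chi B : bper f M -> (forall x, {for x, continuous chi}) -> periodic chi (2 * pi) ->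
  (forall x, `|chi x| <= B) -> bper (fun x => f x * chi x) (M * B).
Proof.
move=> [mf pf bf] cc pc bc; split.
- by apply: measurable_funM => //; apply: continuous_measurable_fun => x; exact: cc.
- by move=> x; rewrite pf pc.
- by move=> x; rewrite normrM; exact: ler_pM.
Qed.

Lemma periodic_near f x0 r x : periodic f (2 * pi) -> 0 < r -> r <= pi -> cos r < cos (x - x0) ->
  exists c : R, `|x + c - x0| < r /\ forall t, f (t + c) = f t.
Proof.
move=> pf r0 rp c; have [z hz] := cos_gt_near r0 rp c.
exists (- (2 * pi * z%:~R)); split.
  by have -> : x - 2 * pi * z%:~R - x0 = x - x0 - 2 * pi * z%:~R by ring.
by move=> t; rewrite -(per_int z (t - 2 * pi * z%:~R) pf); congr f; ring.
Qed.

Lemma Lop_cut f M x0 r chi B : bper f M -> 0 < r -> r <= pi -> (forall x, {for x, continuous chi}) ->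
  periodic chi (2 * pi) -> (forall x, `|chi x| <= B) -> (forall x, `|x - x0| <= r -> chi x = 1) ->
  exists sd : nat -> R -> R, (forall x, Lop f x = Lop (fun x => f x * chi x) x + sd 0%N x) /\
  forall j x, `|x - x0| < r / 2 -> der (sd j) x (sd j.+1 x).
Proof.
move=> bf r0 rp cc pc bc c1; have bF := bper_cut bf cc pc bc.
have bw : bper (fun x => f x - f x * chi x) (M + M * B).
  have [mf pf b] := bf; have [mF pF b'] := bF; split.
  - exact: measurable_funB.
  - by move=> x; rewrite pF pf.
  - by move=> x; apply: le_trans (ler_normB _ _) _; exact: lerD.
have wz x : `|x - x0| < r -> f x - f x * chi x = 0.
  by move=> xr; rewrite c1 ?mulr1 ?subrr// ltW.
have [sd [H1 H2]] := Lop_smooth_away h0 h1 bw r0 rp wz.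
exists sd; split=> // x; rewrite -H1 (LopB h0 h1 _ bf bF); ring.
Qed.

Lemma Lop_C1_of_lipschitz f M x0 : bper f M -> holder_near f x0 1 -> exists r g, 0 < r /\
  forall x, `|x - x0| < r -> der (Lop f) x (g x) /\ {for x, continuous g}.
Proof.
move=> bf [C [r [r0 Hf]]]; have p2 := @pi_ge2 R.
pose r1 := Num.min (r / 2) 1; have r10 : 0 < r1 by rewrite lt_min ltr01 divr_gt0.
have r11 : r1 <= 1 by rewrite ge_min lexx orbT.
have r1r : r1 <= r / 2 by rewrite ge_min lexx.
have r1p : r1 <= pi by lra.
have [chi [dchi [B [dc pc bc c0 c1]]]] := cutoff_exists x0 r10 r1p.
have cc x : {for x, continuous chi} := der_cont (dc x).
have bc' x : `|chi x| <= B by have [] := bc x.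
have B0 : 0 <= B := le_trans (normr_ge0 _) (bc' 0).
have M0 := bper_ge0 bf; have [mf pf fb] := bf.
have lc := lipschitz_of_der dc (fun x => (bc x).2).
have r20 : 0 < r1 / 2 by rewrite divr_gt0.
have r2p : r1 / 2 <= pi by lra.
have [sd [H1 H2]] := Lop_cut bf r20 r2p cc pc bc' c1.
pose F x := f x * chi x; have bF : bper F (M * B) by exact: bper_cut.
have [_ _ Fb] := bF.
have MB0 : 0 <= M * B by rewrite mulr_ge0.
pose L := `|C| * B + M * B + 2 * (M * B) / r1.
have L1 : 0 <= 2 * (M * B) / r1 by rewrite divr_ge0 ?(ltW r10)// mulr_ge0.
have CB : 0 <= `|C| * B by rewrite mulr_ge0.
have lF1 x y : cos r1 < cos (x - x0) -> `|F x - F y| <= L * `|x - y|.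
  move=> cx; have [xy|xy] := ltP `|x - y| r1; last first.
    apply: le_trans (_ : 2 * (M * B) <= _).
      by apply: le_trans (ler_normB _ _) _; have := Fb x; have := Fb y; lra.
    apply: le_trans (_ : 2 * (M * B) / r1 * `|x - y| <= _); last first.
      by apply: ler_wpM2r => //; rewrite /L lerDr addr_ge0.
    by rewrite mulrAC ler_pdivlMr//; apply: ler_wpM2l => //; rewrite mulr_ge0.
  have [c [xc pc']] := periodic_near pf r10 r1p cx.
  have fxy : `|f x - f y| <= `|C| * `|x - y|.
    rewrite -(pc' x) -(pc' y); apply: le_trans (Hf _ _ _ _) _.
    - by apply: lt_le_trans xc _; lra.
    - by move: xc xy; rewrite !ltr_norml; lra.
    have -> : x + c - (y + c) = x - y by ring.
    by rewrite powRr1//; apply: ler_wpM2r => //; exact: ler_norm.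
  have -> : F x - F y = (f x - f y) * chi x + f y * (chi x - chi y) by rewrite /F; ring.
  apply: le_trans (ler_normD _ _) _; rewrite !normrM.
  have e1 : `|f x - f y| * `|chi x| <= `|C| * `|x - y| * B by exact: ler_pM.
  have e2 : `|f y| * `|chi x - chi y| <= M * (B * `|x - y|) by apply: ler_pM.
  have q0 : 0 <= 2 * (M * B) / r1 * `|x - y| by rewrite mulr_ge0.
  have -> : L * `|x - y| = `|C| * `|x - y| * B + M * (B * `|x - y|) + 2 * (M * B) / r1 * `|x - y|.
    by rewrite /L; ring.
  by apply: le_trans (lerD e1 e2) _; rewrite lerDl.
have lF x y : `|F x - F y| <= L * `|x - y|.
  have [cx|cx] := ltP (cos r1) (cos (x - x0)); first exact: lF1.
  have [cy|cy] := ltP (cos r1) (cos (y - x0)).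
    by rewrite distrC [`|x - y|]distrC; exact: lF1.
  by rewrite /F !c0// !mulr0 subrr normr0 mulr_ge0// addr_ge0// addr_ge0.
have [g dg cg] := Lop_lipschitz_C1 h0 h1 bF lF.
have r40 : 0 < r1 / 2 / 2 by rewrite divr_gt0.
exists (r1 / 2 / 2), (fun x => g x + sd 1%N x); split=> // x xr; split.
  have -> : Lop f = (fun x => Lop F x + sd 0%N x) by apply/funext => t; exact: H1.
  by apply: derD; [exact: dg|exact: H2].
by apply: cvgD; [exact: cg|exact: der_cont (H2 1%N x xr)].
Qed.

(** The local derivative g is extended to a bounded periodic f1, the derivative of f times a cutoff.
    Near x0 the derivative of [Lop f] is then [Lop f1] plus a smooth function, an expression of the
    kind one started from, so the argument can be repeated. *)
Lemma Lop_C1_of_C1 f M x0 r g B0 : bper f M -> 0 < r ->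
  (forall x, `|x - x0| < r -> der f x (g x)) -> (forall x, `|x - x0| < r -> `|g x| <= B0) ->
  exists rho f1 M1 (sd : nat -> R -> R), [/\ 0 < rho, bper f1 M1,
    forall x, `|x - x0| < rho -> f1 x = g x,
    forall x, `|x - x0| < rho -> der (Lop f) x (Lop f1 x + sd 0%N x) &
    forall j x, `|x - x0| < rho -> der (sd j) x (sd j.+1 x)].
Proof.
move=> bf r0 dg bg; have p2 := @pi_ge2 R.
pose r1 := Num.min (r / 2) 1; have r10 : 0 < r1 by rewrite lt_min ltr01 divr_gt0.
have r11 : r1 <= 1 by rewrite ge_min lexx orbT.
have r1r : r1 <= r / 2 by rewrite ge_min lexx.
have r1p : r1 <= pi by lra.
pose r2 := r1 / 2; have r20 : 0 < r2 by rewrite divr_gt0.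
have r21 : r2 < r1 by rewrite /r2; lra.
have r2p : r2 <= pi by lra.
have [chi [dchi [B [dc pc bc c0 c1]]]] := cutoff_exists x0 r20 r2p.
have cc x : {for x, continuous chi} := der_cont (dc x).
have bc' x : `|chi x| <= B by have [] := bc x.
have bd' x : `|dchi x| <= B by have [] := bc x.
have B00 : 0 <= B := le_trans (normr_ge0 _) (bc' 0).
have M0 := bper_ge0 bf; have [mf pf fb] := bf.
have r30 : 0 < r2 / 2 by rewrite divr_gt0.
have r3p : r2 / 2 <= pi by lra.
have [sd [H1 H2]] := Lop_cut bf r30 r3p cc pc bc' c1.
pose F x := f x * chi x; have bF : bper F (M * B) by exact: bper_cut.
have [mF pF Fb] := bF.
have gb0 : 0 <= B0 by apply: le_trans (normr_ge0 _) (bg x0 _); rewrite subrr normr0.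
have cos21 : cos r1 < cos r2 by apply: cos_decr => //; exact: ltW.
(* Two overlapping regions: where cos(x - x0) > cos r1, f is differentiable at a translate of x;
   elsewhere cos(x - x0) < cos r2 and the cutoff vanishes in a neighbourhood. *)
have dF x : exists d, der F x d /\ `|d| <= M * B + B * B0.
  have [cx|cx] := ltP (cos r1) (cos (x - x0)).
    have [c [xc pc']] := periodic_near pf r10 r1p cx.
    have xr : `|x + c - x0| < r by apply: lt_le_trans xc _; lra.
    have df : der f x (g (x + c) * (1 + 0)).
      have -> : f = (fun t => f (t + c)) by apply/funext => t; rewrite pc'.
      exact: (der_comp (derD (der_id x) (derC c x)) (dg _ xr)).
    exists (f x * dchi x + chi x * (g (x + c) * (1 + 0))); split; first exact: derM.
    rewrite addr0 mulr1; apply: le_trans (ler_normD _ _) _; rewrite !normrM.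
    by apply: lerD; apply: ler_pM => //; exact: bg.
  exists 0; split; last by rewrite normr0 addr_ge0// mulr_ge0.
  apply: der_ext (derC 0 x).
  have cx2 : cos (x - x0) < cos r2 by exact: le_lt_trans cos21.
  have cont : {for x, continuous (fun t => cos (t - x0))}.
    apply: (@continuous_comp _ _ _ (fun t => t - x0) cos); last exact: continuous_cos.
    by apply: cvgB; [exact: cvg_id|exact: cvg_cst].
  near=> y; rewrite /F c0 ?mulr0//; apply: ltW; near: y.
  exact: (cvgr_lt _ cont).
pose f1 := derive1 F.
have df1 x : der F x (f1 x).
  by have [d [Hd _]] := dF x; apply: derP; exact: der_derivable Hd.
have f1b x : `|f1 x| <= M * B + B * B0.
  by have [d [Hd Hb]] := dF x; rewrite /f1 (der_derive1 Hd).
have pf1 : periodic f1 (2 * pi).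
  move=> x; have H : der F x (f1 (x + 2 * pi) * (1 + 0)).
    have {1}-> : F = (fun t => F (t + 2 * pi)) by apply/funext => t; rewrite pF.
    exact: (der_comp (derD (der_id x) (derC (2 * pi) x)) (df1 _)).
  by rewrite /f1 [RHS](der_derive1 H) addr0 mulr1.
(* g is only known to be bounded, so measurability comes from writing f1 as a pointwise limit of
   difference quotients. *)
have mf1 : measurable_fun setT f1.
  pose v (n : nat) : R := n.+1%:R^-1.
  have v0 n : v n != 0 by rewrite invr_eq0 pnatr_eq0.
  have vc : v n @[n --> \oo] --> (0 : R) by exact: cvg_harmonic.
  apply: (measurable_fun_cvg (h := fun n x => (v n)^-1 * (F (v n + x) - F x))).
    move=> n; apply: measurable_funM => //; apply: measurable_funB => //; exact: meas_shift.
  by move=> x _; have /cvgr_dnbhsP := der_quotient (df1 x); apply.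
exists (r2 / 2 / 2), f1, (M * B + B * B0), (fun j => sd j.+1); split=> //.
- by rewrite divr_gt0.
- move=> x xr; rewrite /f1; apply: der_derive1; apply: der_ext (dg x _); last by apply: lt_le_trans xr _; rewrite /r2; lra.
  have : \forall y \near x, `|y - x0| < r2 / 2.
    have cont : {for x, continuous (fun t => `|t - x0|)}.
      by apply: cvg_norm; apply: cvgB; [exact: cvg_id|exact: cvg_cst].
    apply: (cvgr_lt _ cont); apply: lt_le_trans xr _; lra.
  by apply: filterS => y yr; rewrite /F c1 ?mulr1// ltW.
- move=> x xr; have -> : Lop f = (fun x => Lop F x + sd 0%N x) by apply/funext => t; exact: H1.
  by apply: derD; [exact: (Lop_deriv h0 h1 bF df1 f1b)|exact: H2].
- by move=> j x xr; exact: H2.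
Unshelve. all: by end_near.
Qed.

End Localization.

(** * Functions of class C^n near a point *)

Section Smoothness.
Context {R : realType}.
Implicit Types (f g G u : R -> R) (x y t : R) (n k : nat).

Lemma all_near (x : R) (P : R -> Prop) : (forall y, P y) -> \forall y \near x, P y.
Proof. by move=> H; apply: filterE. Qed.

(* f is of class C^n near x. *)
Fixpoint Cn n f x : Prop :=
  if n is k.+1 then exists2 g, \forall y \near x, der f y (g y) & Cn k g x
  else \forall y \near x, {for y, continuous f}.

Lemma Cn_ext n f g x : (\forall y \near x, f y = g y) -> Cn n f x -> Cn n g x.
Proof.
move=> /near_join fg; case: n => [|n] /=.
  move=> cf; near=> y; have fgy : \near y, f y = g y by near: y.
  have cy : {for y, continuous f} by near: y.
  have : f z @[z --> y] --> g y by rewrite -(nbhs_singleton fgy); exact: cy.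
  by apply: cvg_trans; apply: near_eq_cvg; apply: filterS fgy.
move=> [f' df cf']; exists f' => //; near=> y.
have fgy : \near y, f y = g y by near: y.
have dy : der f y (f' y) by near: y.
exact: der_ext dy.
Unshelve. all: by end_near.
Qed.

Lemma Cn_W n f x : Cn n.+1 f x -> Cn n f x.
Proof.
elim: n f => [|n IH] f [g dg cg] /=; last by exists g => //; exact: IH.
by apply: filterS dg => y; exact: der_cont.
Qed.

Lemma Cn_le n k f x : (k <= n)%N -> Cn n f x -> Cn k f x.
Proof.
elim: n => [|n IH]; first by rewrite leqn0 => /eqP ->.
by rewrite leq_eqVlt => /predU1P[->//|kn] /Cn_W; exact: IH.
Qed.

Lemma Cn_at n f x : Cn n f x -> {for x, continuous f}.
Proof. by move=> /(Cn_le (leq0n n)) /= /nbhs_singleton. Qed.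

Lemma Cn_cst n (c : R) x : Cn n (fun=> c) x.
Proof.
elim: n c => [|n IH] c /=; first by apply: all_near => y; exact: cvg_cst.
by exists (fun=> 0) => //; apply: all_near => y; exact: derC.
Qed.

Lemma Cn_add n f g x : Cn n f x -> Cn n g x -> Cn n (fun y => f y + g y) x.
Proof.
elim: n f g => [|n IH] f g /=.
  by move=> cf cg; apply: filterS2 cf cg => y; exact: cvgD.
move=> [f' df cf] [g' dg cg]; exists (fun y => f' y + g' y); last exact: IH.
by apply: filterS2 df dg => y; exact: derD.
Qed.

Lemma Cn_mul n f g x : Cn n f x -> Cn n g x -> Cn n (fun y => f y * g y) x.
Proof.
elim: n f g => [|n IH] f g.
  by move=> cf cg; apply: filterS2 cf cg => y; exact: cvgM.
move=> Cf Cg; have Cf0 := Cn_W Cf; have Cg0 := Cn_W Cg.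
move: Cf Cg => [f' df cf] [g' dg cg]; exists (fun y => f y * g' y + g y * f' y).
  by apply: filterS2 df dg => y; exact: derM.
by apply: Cn_add; exact: IH.
Qed.

Lemma Cn_comp n G u x : Cn n G (u x) -> Cn n u x -> Cn n (fun y => G (u y)) x.
Proof.
elim: n G u => [|n IH] G u CG Cu.
  have cu := Cn_at Cu; move: CG Cu => /= CG Cu.
  have {}CG : \forall y \near x, {for u y, continuous G} by exact: (cu _ CG).
  by apply: filterS2 CG Cu => y cG cu'; exact: (continuous_comp cu' cG).
have Cu0 := Cn_W Cu; have cu := Cn_at Cu.
move: CG Cu => [G' dG cG] [u' du cu']; exists (fun y => G' (u y) * u' y).
  have {}dG : \forall y \near x, der G (u y) (G' (u y)) by exact: (cu _ dG).
  by apply: filterS2 dG du => y d1 d2; exact: der_comp d2 d1.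
by apply: Cn_mul => //; exact: IH.
Qed.

Lemma Cn_powR n (r : R) t : 0 < t -> Cn n (fun y => y `^ r) t.
Proof.
elim: n r => [|n IH] r t0.
  near=> y; have y0 : 0 < y by near: y; exact: lt_nbhsr.
  exact: der_cont (der_powR r y0).
exists (fun y => r * y `^ (r - 1)); last by apply: Cn_mul; [exact: Cn_cst|exact: IH].
by near=> y; apply: der_powR; near: y; exact: lt_nbhsr.
Unshelve. all: by end_near.
Qed.

Lemma Cn_affine n (a b : R) x : Cn n (fun y => a + b * y) x.
Proof.
case: n => [|n] /=.
  by apply: all_near => y; apply: cvgD; [exact: cvg_cst|apply: cvgM; [exact: cvg_cst|exact: cvg_id]].
exists (fun=> b); last exact: Cn_cst.
apply: all_near => y; apply: der_eq (derD (derC a y) (derZ b (der_id y))) _.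
by rewrite mulr1 add0r.
Qed.

Lemma Cn_derivable n f x : Cn n.+1 f x -> derivable (derive1n n f) x 1.
Proof.
elim: n f => [|n IH] f [g dg cg].
  by rewrite derive1n0; apply: der_derivable (nbhs_singleton dg).
rewrite derive1Sn; apply: IH; have {}cg : Cn n.+1 g x by exact: cg.
apply: Cn_ext cg.
by apply: filterS dg => y /der_derive1.
Qed.

Lemma Cn_tower (sd : nat -> R -> R) x (r : R) n j : 0 < r ->
  (forall j y, `|y - x| < r -> der (sd j) y (sd j.+1 y)) -> Cn n (sd j) x.
Proof.
move=> r0 H; elim: n j => [|n IH] j.
  apply/nbhs_ballP; exists r => // y; rewrite /ball/= distrC => /H h.
  exact: der_cont (h j).
exists (sd j.+1) => //; apply/nbhs_ballP; exists r => // y; rewrite /ball/= distrC => yr.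
exact: H.
Qed.

End Smoothness.

(** * Regularity of solutions of f = a L f + b *)

Section Regularity.
Context {R : realType} (alpha : R) (h0 : 0 < alpha) (h1 : alpha < 1).
Notation Lop := (Lop alpha).
Implicit Types (f g u a b : R -> R) (x y t M C : R) (n k : nat).

Lemma near_ball (x0 : R) (P : R -> Prop) : (\forall y \near x0, P y) ->
  exists2 r : R, 0 < r & forall y, `|y - x0| < r -> P y.
Proof.
by move=> /nbhs_ballP[r /= r0 H]; exists r => // y yr; apply: H; rewrite /ball/= distrC.
Qed.

Lemma ball_near (x0 : R) (P : R -> Prop) (r : R) : 0 < r -> (forall y, `|y - x0| < r -> P y) ->
  \forall y \near x0, P y.
Proof.
by move=> r0 H; apply/nbhs_ballP; exists r => // y; rewrite /ball/= distrC; exact: H.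
Qed.

Lemma near_bounded g (x0 : R) : {for x0, continuous g} -> \forall y \near x0, `|g y| <= `|g x0| + 1.
Proof.
move=> /cvgrPdist_lt /(_ _ ltr01); apply: filterS => y gy.
have -> : g y = g x0 - (g x0 - g y) by ring.
by apply: le_trans (ler_normB _ _) _; rewrite lerD2l ltW.
Qed.

Lemma near_lipschitz f g (x0 : R) : (\forall y \near x0, der f y (g y)) -> {for x0, continuous g} ->
  exists C r, 0 < r /\ forall x y, `|x - x0| < r -> `|y - x0| < r -> `|f x - f y| <= C * `|x - y|.
Proof.
move=> dg cg; have [r r0 H] := near_ball (filterI dg (near_bounded cg)).
exists (`|g x0| + 1), r; split=> // x y; wlog xy : x y / y < x.
  move=> K hx hy; case: (ltgtP y x) => [yx|yx|->]; first exact: K.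
    by rewrite distrC [`|x - y|]distrC; exact: K.
  by rewrite !subrr normr0 mulr0.
move=> hx hy; have hb t : y <= t <= x -> `|t - x0| < r.
  by move=> /andP[t1 t2]; move: hx hy; rewrite !ltr_norml; lra.
have [c /andP[c1 c2] ->] := mvt xy (fun t ht => (H t (hb t ht)).1).
by rewrite normrM ler_wpM2r//; apply: (H c _).2; apply: hb; rewrite !ltW.
Qed.

Lemma Cn_Lop n f M (x0 : R) : bper f M -> Cn n f x0 -> Cn n (Lop f) x0.
Proof.
elim: n f M => [|n IH] f M bf Cf.
  by apply: all_near => y; exact: (Lop_continuous h0 h1 bf).
case: Cf => g dg cg; have gb := near_bounded (Cn_at cg).
have [r r0 H] := near_ball (filterI dg gb).
have [rho [f1 [M1 [sd [rho0 bf1 e1 dL dsd]]]]] :=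
  Lop_C1_of_C1 h0 h1 bf r0 (fun x hx => (H x hx).1) (fun x hx => (H x hx).2).
exists (fun y => Lop f1 y + sd 0%N y); first exact: ball_near rho0 dL.
apply: Cn_add; last exact: Cn_tower rho0 dsd.
apply: (IH _ _ bf1); apply: Cn_ext cg; apply: ball_near rho0 _ => y yr.
by rewrite e1.
Qed.

(** Increments of f are controlled by those of [Lop f] and of x, so [bootstrap] makes f Lipschitz
    near x0 and then C^1. Differentiating the equation gives one of the same form for f1, with the
    same a and with a new b one class lower, to which the induction applies. *)
Lemma Cn_fixed n f M (x0 : R) a b : bper f M -> (\forall y \near x0, f y = a y * Lop f y + b y) ->
  Cn n a x0 -> Cn n b x0 -> Cn n f x0.
Proof.
elim: n f M a b => [|n IH] f M a b bf fE Ca Cb.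
  apply: (@Cn_ext _ _ (fun y => a y * Lop f y + b y)).
    by apply: filterS fE => y ->.
  apply: Cn_add => //; apply: Cn_mul => //=.
  by apply: all_near => y; exact: (Lop_continuous h0 h1 bf).
have Cf : Cn n f x0 by apply: (IH f M a b) => //; exact: Cn_W.
have CL : Cn n (Lop f) x0 by exact: Cn_Lop bf Cf.
have Ca' := Cn_W Ca; case: (Ca) (Cb) => a' da ca [b' db cb].
have [Ka [ra [ra0 Ha]]] := near_lipschitz da (Cn_at ca).
have [Kb [rb [rb0 Hb]]] := near_lipschitz db (Cn_at cb).
have [r1 r10 H1] := near_ball (filterI fE (near_bounded (Cn_at Ca'))).
pose r := Num.min r1 (Num.min ra rb).
have r0 : 0 < r by rewrite !lt_min r10 ra0.
pose NL := normK alpha * M.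
have NL0 : 0 <= NL by apply: le_trans (normr_ge0 _) (Lop_bound h0 h1 0 bf).
pose C0 := (`|a x0| + 1) + (`|Ka| * NL + `|Kb|).
have hb : holder_near f x0 1.
  apply: (bootstrap h0 h1 (C0 := C0) bf r0) => x y.
  rewrite !lt_min => /and3P[x1 x2 x3] /and3P[y1 y2 y3].
  have [fx ax] := H1 x x1; have [fy _] := H1 y y1.
  have -> : f x - f y = a x * (Lop f x - Lop f y) + (a x - a y) * Lop f y + (b x - b y).
    by rewrite fx fy; ring.
  apply: le_trans (ler_normD _ _) _; apply: le_trans (lerD (ler_normD _ _) (lexx _)) _.
  rewrite !normrM.
  have e1 : `|a x| * `|Lop f x - Lop f y| <= (`|a x0| + 1) * `|Lop f x - Lop f y| by exact: ler_wpM2r.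
  have e2 : `|a x - a y| * `|Lop f y| <= `|Ka| * `|x - y| * NL.
    apply: ler_pM => //; last exact: Lop_bound bf.
    by apply: le_trans (Ha x y x2 y2) _; apply: ler_wpM2r => //; exact: ler_norm.
  have e3 : `|b x - b y| <= `|Kb| * `|x - y|.
    by apply: le_trans (Hb x y x3 y3) _; apply: ler_wpM2r => //; exact: ler_norm.
  have n1 : 0 <= (`|a x0| + 1) * `|x - y| by rewrite mulr_ge0// addr_ge0.
  have n2 : 0 <= (`|Ka| * NL + `|Kb|) * `|Lop f x - Lop f y| by rewrite mulr_ge0// addr_ge0// mulr_ge0.
  have -> : C0 * (`|Lop f x - Lop f y| + `|x - y|) =
    ((`|a x0| + 1) * `|Lop f x - Lop f y| + `|Ka| * `|x - y| * NL + `|Kb| * `|x - y|) +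
    ((`|a x0| + 1) * `|x - y| + (`|Ka| * NL + `|Kb|) * `|Lop f x - Lop f y|) by rewrite /C0; ring.
  by apply: le_trans (lerD (lerD e1 e2) e3) _; rewrite lerDl addr_ge0.
have [rL [g [rL0 HL]]] := Lop_C1_of_lipschitz h0 h1 bf hb.
pose df y := (a y * g y + Lop f y * a' y) + b' y.
have near_df : \forall y \near x0, der f y (df y).
  have nL : \forall y \near x0, der (Lop f) y (g y) by apply: ball_near rL0 _ => y /HL[].
  have fE' := near_join fE.
  near=> y; apply: (@der_ext _ (fun y => a y * Lop f y + b y)).
    have : \near y, f y = a y * Lop f y + b y by near: y.
    by apply: filterS => t ->.
  by apply: derD; [apply: derM|]; near: y.
have cdf : {for x0, continuous df}.
  have cL : {for x0, continuous (Lop f)} by exact: (Lop_continuous h0 h1 bf).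
  have cgx : {for x0, continuous g} by apply: (HL x0 _).2; rewrite subrr normr0.
  apply: cvgD; last exact: Cn_at cb.
  by apply: cvgD; apply: cvgM => //; [exact: Cn_at Ca|exact: Cn_at ca].
have [r2 r20 H2] := near_ball (filterI near_df (near_bounded cdf)).
have [rho [f1 [M1 [sd [rho0 bf1 ef1 dL dsd]]]]] :=
  Lop_C1_of_C1 h0 h1 bf r20 (fun x hx => (H2 x hx).1) (fun x hx => (H2 x hx).2).
exists f1.
  apply: filterS2 near_df (ball_near rho0 ef1) => y d1 e1.
  by rewrite e1.
apply: (IH f1 M1 a (fun y => (a y * sd 0%N y + Lop f y * a' y) + b' y)) => //.
  near=> y.
  have e1 : f1 y = df y by near: y; exact: ball_near rho0 ef1.
  have dg : der (Lop f) y (g y) by near: y; apply: ball_near rL0 _ => t /HL[].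
  have dg' : der (Lop f) y (Lop f1 y + sd 0%N y) by near: y; exact: ball_near rho0 dL.
  have e2 : g y = Lop f1 y + sd 0%N y by rewrite -(der_derive1 dg) (der_derive1 dg').
  by rewrite e1 /df e2; ring.
apply: Cn_add => //; apply: Cn_add; apply: Cn_mul => //.
exact: Cn_tower rho0 dsd.
Unshelve. all: by end_near.
Qed.

End Regularity.

(** * Smoothness of the profile where W is smooth and increasing *)

Section WaveRegularity.
Context {R : realType} (alpha : R) (h0 : 0 < alpha) (h1 : alpha < 1) (p : R) (hp : 1 < p).
Notation Lop := (Lop alpha).
Implicit Types (f g G : R -> R) (x y t : R) (k : nat).

(** The quotient of G o f is that of f times the Caratheodory slope of G, which tends to dG != 0
    along the continuous f. *)
Lemma der_implicit G f y (dG v : R) : der G (f y) dG -> dG != 0 -> {for y, continuous f} ->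
  der (fun t => G (f t)) y v -> der f y (v / dG).
Proof.
move=> dg dn cf dGf.
have [psi [psiE psic psi0]] := (is_derive1_caratheodory _ _ _).1 dg.
have cpsi : {for y, continuous (fun t => psi (f t))} by apply: continuous_comp => //.
have lim := der_quotient dGf.
apply: der_limit.
have shift0 : (fun h : R => h + y) h @[h --> 0^'] --> y.
  have : (fun h : R => h + y) h @[h --> (0 : R)] --> 0 + y by apply: cvgD; [exact: cvg_id|exact: cvg_cst].
  by rewrite add0r; exact: cvg_within_filter.
have lpsi : psi (f (h + y)) @[h --> 0^'] --> dG.
  by rewrite -psi0; exact: (cvg_comp _ _ shift0 cpsi).
have quot : (h^-1 * (G (f (h + y)) - G (f y))) / psi (f (h + y)) @[h --> 0^'] --> v / dG.
  by apply: cvgM => //; exact: cvgV.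
apply: cvg_trans quot; apply: near_eq_cvg.
have pn : \forall h \near 0^', psi (f (h + y)) != 0.
  have dn0 : 0 < `|dG| by rewrite normr_gt0.
  move/cvgrPdist_lt: lpsi => /(_ _ dn0); apply: filterS => h hh.
  by apply/eqP => e; move: hh; rewrite e subr0 ltxx.
by apply: filterS pn => h hn; rewrite psiE mulrCA mulrC mulKf.
Qed.

(** t = 1 is the value where the wave vanishes, the only point at which a power nonlinearity may
    fail to be smooth. *)
Lemma Cn_dWf nl k t : t != 1 -> Cn k (dWf p nl) t.
Proof.
have p0 : 0 < p by have := hp; lra.
move=> t1; case: (ltgtP t 1) t1 => // ht _.
  apply: (@Cn_ext _ _ (fun y => 1 + (-1) * (1 + (-1) * y) `^ (p - 1))).
    near=> y; have y1 : y < 1 by near: y; exact: lt_nbhsl.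
    have v0 : 0 < 1 - y by lra.
    rewrite /dWf; case: nl => /=; rewrite !mulN1r ?gtr0_sg// gtr0_norm//; field; exact: lt0r_neq0.
  apply: (@Cn_comp _ _ (fun v => 1 + (-1) * v)); first exact: Cn_affine.
  apply: (@Cn_comp _ _ (fun v => v `^ (p - 1)) (fun y => 1 + (-1) * y)); last exact: Cn_affine.
  by apply: Cn_powR; lra.
apply: (@Cn_ext _ _ (fun y => 1 + (if nl is nl_abs then 1 else -1) * (-1 + 1 * y) `^ (p - 1))).
  near=> y; have y1 : 1 < y by near: y; exact: lt_nbhsr.
  have v0 : 0 < y - 1 by lra.
  have -> : -1 + 1 * y = y - 1 by ring.
  rewrite /dWf; have -> : 1 - y = - (y - 1) by ring.
  case: nl => /=; rewrite normrN gtr0_norm// ?sgrN ?gtr0_sg//; field; exact: lt0r_neq0.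
apply: (@Cn_comp _ _ (fun v => 1 + _ * v)); first exact: Cn_affine.
apply: (@Cn_comp _ _ (fun v => v `^ (p - 1)) (fun y => -1 + 1 * y)); last exact: Cn_affine.
by apply: Cn_powR; lra.
Unshelve. all: by end_near.
Qed.

Context (n : nonlinearity) (lam M : R) (u : R -> R) (wu : wave alpha p n lam M u).

(** Positivity of W'(u) bounds the increments of u by those of L u, so u is C^1 near x0. Its
    derivative solves a linear equation f1 = a L f1 + a sd with a = lam / W'(u), which is as smooth
    as u; each use of [Cn_fixed] raises the class of u by one. *)
Lemma Cn_wave k (x0 : R) : u x0 != 1 -> 0 < dWf p n (u x0) -> Cn k u x0.
Proof.
move=> u1 w0; have l0 := wave_lam wu; have cu := wave_cont wu; have [bu eu iu] := wave_prof wu.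
have [_ _ ub] := bu.
set w := dWf p n (u x0) in w0.
have cdW : {for u x0, continuous (dWf p n)} by apply: (@Cn_at _ 0); exact: Cn_dWf.
have w20 : 0 < w / 2 by rewrite divr_gt0.
have nW : \forall t \near u x0, w / 2 <= dWf p n t.
  move/cvgrPdist_lt: cdW => /(_ _ w20); apply: filterS => t.
  by rewrite -/w ltr_norml; lra.
have [d d0 Hd] := near_ball nW.
have nu : \forall y \near x0, `|u y - u x0| < d.
  by have /cvgrPdist_lt /(_ _ d0) := cu x0; apply: filterS => y; rewrite distrC.
have [r r0 Hr] := near_ball nu.
have uW x y : `|x - x0| < r -> `|y - x0| < r -> u y < u x -> w / 2 * (u x - u y) <= lam * (Lop u x - Lop u y).
  move=> hx hy uxy.
  have [c /andP[c1 c2] e] := mvt uxy (fun t _ => der_Wf hp n t).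
  have -> : lam * (Lop u x - Lop u y) = Wf p n (u x) - Wf p n (u y) by rewrite !(wave_eq wu); ring.
  rewrite e ler_pM2r ?subr_gt0//; apply: Hd.
  by have := Hr x hx; have := Hr y hy; rewrite !ltr_norml; lra.
have hb : holder_near u x0 1.
  apply: (bootstrap h0 h1 (C0 := lam / (w / 2)) bu r0) => x y.
  wlog uxy : x y / u y < u x.
    move=> K hx hy; case: (ltgtP (u y) (u x)) => [yx|yx|->]; first exact: K.
      by rewrite distrC [`|Lop u x - _|]distrC [`|x - y|]distrC; exact: K.
    by rewrite subrr normr0 mulr_ge0 ?addr_ge0// divr_ge0 ?ltW.
  move=> hx hy; have := uW x y hx hy uxy.
  rewrite (gtr0_norm (_ : 0 < u x - u y)) ?subr_gt0// mulrC -ler_pdivlMr// => /le_trans; apply.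
  rewrite [leRHS]mulrAC; apply: ler_wpM2r; first by rewrite invr_ge0 ltW.
  by apply: ler_wpM2l; [exact: ltW|apply: le_trans (ler_norm _) _; rewrite lerDl].
have [rL [g [rL0 HL]]] := Lop_C1_of_lipschitz h0 h1 bu hb.
pose df y := lam * g y / dWf p n (u y).
have dpos y : `|y - x0| < r -> 0 < dWf p n (u y).
  by move=> /Hr /Hd; apply: lt_le_trans.
have near_df : \forall y \near x0, der u y (df y).
  apply: filterS2 (ball_near r0 dpos) (ball_near rL0 HL) => y wy [dL _].
  apply: der_implicit (der_Wf hp n (u y)) _ (cu y) _; first exact: lt0r_neq0.
  have -> : (fun t => Wf p n (u t)) = (fun t => lam * (Lop u t - Lop u 0)).
    by apply/funext => t; exact: wave_eq wu t.
  by apply: der_eq (derZ lam (derB dL (derC (Lop u 0) y))) _; rewrite subr0.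
have cdf : {for x0, continuous df}.
  have xx : `|x0 - x0| < rL by rewrite subrr normr0.
  apply: cvgM; first by apply: cvgM; [exact: cvg_cst|exact: (HL x0 xx).2].
  apply: cvgV; first exact: lt0r_neq0.
  exact: (continuous_comp (cu x0) cdW).
have [r2 r20 H2] := near_ball (filterI near_df (near_bounded cdf)).
have [rho [f1 [M1 [sd [rho0 bf1 ef1 dL dsd]]]]] :=
  Lop_C1_of_C1 h0 h1 bu r20 (fun x hx => (H2 x hx).1) (fun x hx => (H2 x hx).2).
pose a y := lam * (dWf p n (u y)) `^ (-1).
have fE : \forall y \near x0, f1 y = a y * Lop f1 y + a y * sd 0%N y.
  near=> y.
  have e1 : f1 y = df y by near: y; exact: ball_near rho0 ef1.
  have dg : der (Lop u) y (g y) by near: y; apply: ball_near rL0 _ => t /HL[].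
  have dg' : der (Lop u) y (Lop f1 y + sd 0%N y) by near: y; exact: ball_near rho0 dL.
  have e2 : g y = Lop f1 y + sd 0%N y by rewrite -(der_derive1 dg) (der_derive1 dg').
  have wy : 0 < dWf p n (u y) by near: y; exact: ball_near r0 dpos.
  by rewrite e1 /df e2 /a powR_inv1 ?(ltW wy)//; field; exact: lt0r_neq0.
elim: k => [|k IH]; first by apply: all_near => y; exact: cu.
exists f1.
  apply: filterS2 near_df (ball_near rho0 ef1) => y d1 e1.
  by rewrite e1.
have Ca : Cn k a x0.
  apply: Cn_mul; first exact: Cn_cst.
  apply: (@Cn_comp _ _ (fun v => v `^ (-1)) (fun y => dWf p n (u y))); first exact: Cn_powR.
  by apply: Cn_comp => //; exact: Cn_dWf.
apply: (Cn_fixed h0 h1 bf1 fE Ca).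
by apply: Cn_mul => //; exact: Cn_tower rho0 dsd.
Unshelve. all: by end_near.
Qed.

End WaveRegularity.

(** * Complex Fourier coefficients of even functions; the norm of the kernel *)

Section FourierEven.
Context {R : realType} (alpha : R) (h0 : 0 < alpha) (h1 : alpha < 1).
Implicit Types (f g : R -> R) (x y M : R) (k : int).

Lemma intTE f : intT f = Int `[- pi, pi] f.
Proof. by rewrite IntE. Qed.

Lemma cos_intr k x : cos (k%:~R * x) = cos (`|k|%N%:R * x).
Proof. by case: (intP k) => [|m|m]; rewrite ?mul0r// ?abszN ?absz_nat// mulrNz mulNr cosN. Qed.

Lemma sin_intr k x : sin (k%:~R * x) = (if (0 <= k)%R then 1 else - 1) * sin (`|k|%N%:R * x).
Proof.
case: (intP k) => [|m|m]; first by rewrite mul0r lexx mul1r.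
  by rewrite absz_nat mul1r.
by rewrite abszN absz_nat mulrNz mulNr sinN oppr_ge0/= mulN1r.
Qed.

Lemma fourier_even f M k : bper f M -> (forall x, f (- x) = f x) ->
  fourier f k = ((coef f `|k|%N)%:C)%C.
Proof.
move=> bf ef; rewrite /fourier /intTC !intTE.
have -> : Int `[- pi, pi] (fun x => complex.Re ((f x)%:C * expi (- (k%:~R * x)))%C) = coef f `|k|%N.
  by apply: eq_Int => s _ /=; rewrite mul0r subr0 cosN cos_intr mulrC.
have -> : Int `[- pi, pi] (fun x => complex.Im ((f x)%:C * expi (- (k%:~R * x)))%C) = 0.
  transitivity (Int `[- pi, pi] (fun s => (if (0 <= k)%R then - 1 else 1) * (sin (`|k|%N%:R * s) * f s))).
    apply: eq_Int => s _ /=; rewrite mul0r addr0 sinN sin_intr.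
    by case: ifP => _; ring.
  by rewrite IntZ ?(sinf0 _ bf ef) ?mulr0//; exact: sinf_integ bf.
by [].
Qed.

(** On [-pi, pi] the series and [Ker] can differ at 0 only; adding a multiple of the indicator of 0
    yields the measurability of the former. *)
Lemma L1normT_kernelK : L1normT (kernelK alpha) = normK alpha.
Proof.
rewrite /L1normT intTE /normK.
have kE x : 0 < `|x| -> `|x| <= pi -> kernelK alpha x = Ker alpha x.
  by move=> x0 xp; rewrite kernelK_KK// KerE//; exact: cos_lt1.
have iK := integ_norm (Ker_integ h0 h1).
have mg : measurable_fun [set` `[- pi, pi : R]] (fun x => `|kernelK alpha x|).
  pose g x := `|Ker alpha x| + (`|kernelK alpha 0| - `|Ker alpha 0|) * \1_[set 0 : R] x.
  apply: (@eq_measurable_fun _ _ _ _ _ g).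
    move=> x; rewrite inE/= in_itv/= => /andP[x1 x2]; rewrite /g indicE.
    have [->|xn] := eqVneq x 0; first by rewrite mem_set//= mulr1; ring.
    rewrite memNset/=; last by move/eqP; rewrite (negbTE xn).
    by rewrite mulr0 addr0 kE// ?normr_gt0// ler_norml x1.
  apply: measurable_funTS; apply: measurable_funD.
    by apply: (measurableT_comp (@normr_measurable R setT)); exact: (Ker_meas h0 h1).
  by apply: measurable_funM => //; exact: measurable_indic.
have H : {in `[- pi, pi], forall x, x != 0 -> `|Ker alpha x| = `|kernelK alpha x|}.
  move=> x; rewrite in_itv/= => /andP[x1 x2] xn; rewrite kE ?normr_gt0//.
  by rewrite ler_norml x1.
by rewrite (Int_ae mg iK H).2.
Qed.

End FourierEven.

(** * From the profile back to the travelling wave *)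

Section Assembly.
Context {R : realType} (alpha : R) (h0 : 0 < alpha) (h1 : alpha < 1) (p : R) (hp : 1 < p).
Notation Lop := (Lop alpha).
Implicit Types (f g : R -> R) (x y t : R).

Lemma nonlin_scale n (a t : R) : 0 < a -> nonlin n p (a * t) = a `^ p * nonlin n p t.
Proof.
move=> a0; have e : a `^ p = a * a `^ (p - 1).
  by rewrite -{2}(powRr1 (ltW a0)) -powRD ?(gt_eqF a0) ?implybT//; congr (_ `^ _); ring.
case: n => /=; rewrite normrM gtr0_norm// powRM ?(ltW a0)//.
by rewrite e; ring.
Qed.

Lemma dWf_gt0 n t : 0 < t -> (n = nl_sgn -> t < 2) -> 0 < dWf p n t.
Proof.
move=> t0 t2; have k0 := kap_gt0 hp; have [t1|t1] := leP t 1.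
  by apply: lt_le_trans (dWf_ge hp n _); rewrite ?mulr_gt0// (ltW t0).
case: n t2 => [_|t2].
  by apply: lt_le_trans (dWf_abs_ge hp (ltW t0)); rewrite (min_idPl (ltW t1)) mulr1.
rewrite -(subKr 2 t) dWf_sgn_refl; have := t2 erefl => t2'.
apply: lt_le_trans (dWf_ge hp _ _); rewrite ?mulr_gt0//; lra.
Qed.

Context (n : nonlinearity) (lam M : R) (u : R -> R) (wu : wave alpha p n lam M u).
Let c := lam^-1.
Let mu := (c / p) `^ (1 / (p - 1)).
Let phi x := mu * (1 - u x).

Let bu : bper u M. Proof. by have [] := wave_prof wu. Qed.
Let pu := wave_prof wu.
Let eu : forall x, u (- x) = u x. Proof. by have [] := wave_prof wu. Qed.
Let pu' : periodic u (2 * pi). Proof. by have [] := bu. Qed.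
Let p0 : 0 < p. Proof. by have := hp; lra. Qed.
Let c0 : 0 < c. Proof. by rewrite invr_gt0; exact: wave_lam wu. Qed.

Lemma mu_gt0 : 0 < mu. Proof. by rewrite powR_gt0// divr_gt0. Qed.

(** mu is the critical point of c x - n(x) on x > 0, where p mu^(p - 1) = c. Hence n(mu t) = c mu
    n(t) / p, and the linear and the nonlinear term scale alike. *)
Lemma mu_pow : mu `^ p = mu * (c / p).
Proof.
have cp : 0 < c / p by rewrite divr_gt0.
have e : mu `^ (p - 1) = c / p.
  rewrite /mu -powRrM mul1r mulVf ?powRr1 ?(ltW cp)// gt_eqF//; have := hp; lra.
have m0 := mu_gt0; rewrite -{1}e -{2}(powRr1 (ltW m0)) -powRD ?(gt_eqF m0) ?implybT//.
by congr (_ `^ _); ring.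
Qed.

Lemma bper_one_sub : bper (fun x => 1 - u x) (1 + M).
Proof.
have [m p' b] := bu; split.
- exact: measurable_funB.
- by move=> x; rewrite p'.
- by move=> x; apply: le_trans (ler_normB _ _) _; rewrite normr1 lerD2l.
Qed.

Lemma bper_phi : bper phi (mu * (1 + M)).
Proof.
have [m p' b] := bper_one_sub; split.
- exact: measurable_funM.
- by move=> x; rewrite /phi pu'.
- by move=> x; rewrite /phi normrM (gtr0_norm mu_gt0) ler_pM2l// mu_gt0.
Qed.

Lemma Int_one_sub : Int `[- pi, pi] (fun x => 1 - u x) = 0.
Proof.
rewrite IntB; [|exact: integ_cst|exact: bper_integ bu].
by rewrite (wave_mean wu) Int_cst; have := @pi_ge0 R; lra.
Qed.

Lemma nonlin_cont f : continuous f -> continuous (fun x => nonlin n p (f x)).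
Proof.
by move=> cf x; apply: (continuous_comp (cf x)); exact: der_cont (der_nonlin hp n (f x)).
Qed.

Lemma one_sub_cont : continuous (fun x => 1 - u x).
Proof. by move=> x; apply: cvgB; [exact: cvg_cst|exact: wave_cont wu x]. Qed.

Lemma phi_cont : continuous phi.
Proof. by move=> x; apply: cvgM; [exact: cvg_cst|exact: one_sub_cont]. Qed.

Lemma nonlin_integ : integ `[- pi, pi] (fun x => nonlin n p (1 - u x)).
Proof. by apply: integ_cont; apply: continuous_subspaceT; apply: nonlin_cont; exact: one_sub_cont. Qed.

Lemma Lop_one_sub x : Lop (fun y => 1 - u y) x = - Lop u x.
Proof.
have b1 : bper (fun=> 1 : R) 1 by split=> // t; rewrite normr1.
by rewrite (LopB h0 h1 _ b1 bu) Lop_cst// sub0r.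
Qed.

Lemma Int_Lop f N : bper f N -> (forall x, f (- x) = f x) -> Int `[- pi, pi] (Lop f) = 0.
Proof. by move=> bf ef; rewrite -coef0_Int (coef_Lop h0 h1 _ bf ef). Qed.

Definition nmean : R := (2 * pi)^-1 * Int `[- pi, pi] (fun x => nonlin n p (1 - u x)).

(** The profile equation fixes the right-hand side only up to the constant K. Integration over a
    period, where both 1 - u and its image under L have mean zero, identifies K with the mean of
    n. *)
Lemma wave_equation x :
  c * ((1 - u x) - nonlin n p (1 - u x) / p + nmean / p) = Lop (fun y => 1 - u y) x.
Proof.
have l0 := wave_lam wu; have pp := @pi_gt0 R.
have bv := bper_one_sub; pose v x := 1 - u x.
have ev t : v (- t) = v t by rewrite /v eu.
pose K := c * (1 - p^-1) - Lop v 0.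
have E t : c * (v t - nonlin n p (v t) / p) = K + Lop v t.
  have := wave_eq wu t; rewrite /Wf -/(v t) => /(congr1 (fun z => c * z)).
  rewrite mulrA /c mulVf ?gt_eqF// mul1r => e.
  have e2 : Lop v t = - Lop u t := Lop_one_sub t.
  have e3 : Lop v 0 = - Lop u 0 := Lop_one_sub 0.
  rewrite /K e2 e3; move: e; rewrite /c mulrBr; lra.
have iv := bper_integ (- pi) pi bv.
have in_ := nonlin_integ.
have i1 : integ `[- pi, pi] (fun t => v t - p^-1 * nonlin n p (v t)) by apply: integB => //; exact: integZ.
have Lc : continuous (Lop v) := Lop_continuous h0 h1 bv.
have iL : integ `[- pi, pi] (Lop v) by apply: integ_cont; exact: continuous_subspaceT.
have I1 : Int `[- pi, pi] (fun t => c * (v t - p^-1 * nonlin n p (v t))) = Int `[- pi, pi] (fun t => K + Lop v t).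
  by apply: eq_Int => s _; rewrite -E [p^-1 * _]mulrC.
have ppi : - pi <= pi :> R by lra.
move: I1; rewrite IntZ// IntB//; last exact: integZ.
rewrite IntZ// Int_one_sub IntD//; last exact: integ_cst.
rewrite (Int_cst _ ppi) (Int_Lop bv ev) addr0 sub0r => I1.
have KE : K = - (c * (nmean / p)).
  have p2 : 2 * pi != 0 :> R by rewrite gt_eqF// mulr_gt0.
  have -> : c * (nmean / p) = (2 * pi)^-1 * (c * (p^-1 * Int `[- pi, pi] (fun x => nonlin n p (1 - u x)))).
    by rewrite /nmean; ring.
  have -> : K = (2 * pi)^-1 * (K * (pi - - pi)).
    have -> : pi - - pi = 2 * pi :> R by ring.
    by rewrite mulrC mulfK.
  by rewrite -I1; ring.
rewrite mulrDr -/(v x) E KE; ring.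
Qed.

Lemma psiE x : c * phi x - nonlin n p (phi x) + (2 * pi)^-1 * intT (fun y => nonlin n p (phi y)) = - mu * Lop u x.
Proof.
have m0 := mu_gt0.
have -> : intT (fun y => nonlin n p (phi y)) = mu * (c / p) * Int `[- pi, pi] (fun y => nonlin n p (1 - u y)).
  rewrite intTE -mu_pow -IntZ; last exact: nonlin_integ.
  by apply: eq_Int => y _; rewrite /phi nonlin_scale.
rewrite /phi nonlin_scale// mu_pow.
have := wave_equation x; rewrite Lop_one_sub => e.
have -> : - mu * Lop u x = mu * (c * (1 - u x - nonlin n p (1 - u x) / p + nmean / p)) by rewrite e; ring.
by rewrite /nmean; ring.
Qed.

Lemma phi_travelling : travelling_wave alpha (nonlin n p) c phi.
Proof.
have m0 := mu_gt0.
have iv := bper_integ (- pi) pi bper_one_sub.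
have Iphi : intT phi = 0 by rewrite intTE IntZ// Int_one_sub mulr0.
split => //; [by move=> x; rewrite /phi pu'|exact: phi_cont|].
have -> : (fun x => c * phi x - nonlin n p (phi x) + (2 * pi)^-1 * intT (fun y => nonlin n p (phi y))) =
  (fun x => - mu * Lop u x) by apply/funext => x; exact: psiE.
have cL : continuous (fun x => - mu * Lop u x).
  by move=> x; apply: cvgM; [exact: cvg_cst|exact: (Lop_continuous h0 h1 bu)].
have iL : integ `[- pi, pi] (Lop u).
  by apply: integ_cont; apply: continuous_subspaceT; exact: (Lop_continuous h0 h1 bu).
have pL : periodic (Lop u) (2 * pi) by exact: Lop_per.
split => //.
- by move=> x; rewrite pL.
- by rewrite intTE IntZ// (Int_Lop bu eu) mulr0.
move=> k k0; have k0' : (0 < `|k|)%N by rewrite absz_gt0.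
have bL : bper (fun x => - mu * Lop u x) (mu * (normK alpha * M)).
  split; [|by move=> x; rewrite pL|].
    by apply: continuous_measurable_fun => x; exact: cL.
  move=> x; rewrite normrM normrN (gtr0_norm m0) ler_pM2l//.
  exact: (Lop_bound h0 h1 _ bu).
rewrite (fourier_even _ bL); last by move=> x; rewrite (LopN h0 h1 bu eu).
rewrite (fourier_even _ bper_phi); last by move=> x; rewrite /phi eu.
have e1 : coef (fun x => - mu * Lop u x) `|k|%N = - mu * coef (Lop u) `|k|%N.
  have bL' : bper (Lop u) (normK alpha * M).
    split => //; first by apply: continuous_measurable_fun; exact: (Lop_continuous h0 h1 bu).
    by move=> x; exact: (Lop_bound h0 h1 _ bu).
  rewrite /coef -IntZ; last exact: coef_integ bL'.
  by apply: eq_Int => s _; ring.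
have e2 : coef phi `|k|%N = - mu * coef u `|k|%N.
  have -> : coef phi `|k|%N = Int `[- pi, pi] (fun s => mu * (cos (`|k|%N%:R * s) - cos (`|k|%N%:R * s) * u s)).
    by apply: eq_Int => s _; rewrite /phi; ring.
  have ic : integ `[- pi, pi] (fun s : R => cos (`|k|%N%:R * s)) by exact: cosk_integ.
  have iu := coef_integ `|k|%N (- pi) pi bu.
  rewrite IntZ; last exact: integB.
  by rewrite IntB// Int_cosk// sub0r mulrN mulNr.
rewrite e1 e2 (coef_Lop h0 h1 _ bu eu) k0' /=.
have -> : (`|k%:~R : R| = `|k|%N%:R)%R by rewrite -intr_norm -abszE.
by rewrite -rmorphM/=; congr (_%:C)%C; ring.
Qed.

End Assembly.

(** * The strict upper bound on the speed *)

Section Speed.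
Context {R : realType} (alpha : R) (h0 : 0 < alpha) (h1 : alpha < 1) (p : R) (hp : 1 < p).
Notation Lop := (Lop alpha).
Notation Ker := (Ker alpha).
Context (n : nonlinearity) (lam M : R) (u : R -> R) (wu : wave alpha p n lam M u).
Let v x := 1 - u x.
Implicit Types (x y : R).

Lemma u_near_small (x e : R) : 0 < e -> exists2 d : R, 0 < d & forall y, `|y - x| < d -> `|u y - u x| < e.
Proof.
move=> e0; apply: near_ball; have cu : {for x, continuous u} by exact: (wave_cont wu).
by move/cvgrPdist_lt: cu => /(_ _ e0); apply: filterS => y; rewrite distrC.
Qed.

(* As K is strictly decreasing, it has no zero on one of the two intervals
   [b/4, b/2] and [3b/4, b]. *)
Lemma Ker_away (b : R) : 0 < b -> b <= 1 -> exists a1 b1 k0 : R,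
  [/\ 0 < k0, b / 4 <= a1, a1 < b1, b1 <= b & forall s, a1 <= s <= b1 -> k0 <= `|Ker s|].
Proof.
move=> b0 b1; have p2 := @pi_ge2 R; have [d d0 Hd] := Ker_del h0 h1.
have dec x y : 0 < x -> x < y -> y <= pi -> Ker y < Ker x.
  move=> x0 xy yp; have c := cos_decr (ltW x0) xy yp.
  have cx : cos x < 1 by apply: cos_lt1; rewrite gtr0_norm//; lra.
  by rewrite -subr_gt0; apply: lt_le_trans (Hd x y (ltW c) cx); rewrite mulr_gt0// subr_gt0.
have [K0|K0] := ltP 0 (Ker (b / 2)).
  exists (b / 4), (b / 2), (Ker (b / 2)); split => //; try lra.
  move=> s /andP[s1 s2]; apply: le_trans (ler_norm _).
  move: s2; rewrite le_eqVlt => /predU1P[->//|s2]; apply: ltW; apply: dec => //; lra.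
have K3 : Ker (3 * b / 4) < 0 by apply: lt_le_trans K0; apply: dec; lra.
exists (3 * b / 4), b, (- Ker (3 * b / 4)); split; try lra.
move=> s /andP[s1 s2]; rewrite -normrN; apply: le_trans (ler_norm _); rewrite lerN2.
by move: s1; rewrite le_eqVlt => /predU1P[->//|s1]; apply: ltW; apply: dec; lra.
Qed.

(** The difference is the integral of |K| - K v >= 0. Near 0, where u <= 1, the integrand is at
    least |K| u, and on the interval given by [Ker_away] both |K| and u are bounded away from 0. *)
Lemma Lop_lt_normK : (forall x, `|v x| <= 1) -> Lop v 0 < normK alpha.
Proof.
move=> v1; have p2 := @pi_ge2 R; have bv := bper_one_sub wu.
have [d d0 Hd] := @u_near_small 0 1 ltr01.
pose b := Num.min (d / 2) 1; have b0 : 0 < b by rewrite lt_min divr_gt0// ltr01.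
have b1 : b <= 1 by rewrite ge_min lexx orbT.
have bd : b <= d / 2 by rewrite ge_min lexx.
have ub : u b <= 1.
  have /Hd : `|b - 0| < d by rewrite subr0 gtr0_norm//; lra.
  by rewrite (wave_0 wu) subr0 ger0_norm ?(wave_ge0 wu)// => /ltW.
have [a1 [b2 [k0 [k00 ba ab bb Hk]]]] := Ker_away b0 b1.
have k1 : 0 < u (b / 4) by apply: (u_gt0 h0 h1 wu); lra.
have iK := integ_norm (Ker_integ h0 h1); have iL := Lop_integ h0 h1 0 bv.
have e : normK alpha - Lop v 0 = Int `[- pi, pi] (fun s => `|Ker s| - Ker s * v (0 + s)) by rewrite IntB.
rewrite -subr_gt0 e.
have pos s : 0 <= `|Ker s| - Ker s * v (0 + s).
  rewrite subr_ge0; apply: le_trans (ler_norm _) _; rewrite normrM -[leRHS]mulr1.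
  exact: ler_wpM2l.
have iD := integB iK iL.
apply: lt_le_trans (_ : Int `[a1, b2] (fun s => `|Ker s| - Ker s * v (0 + s)) <= _); last first.
  by apply: Int_sub => //; clear - h0 h1 hp wu v b0 b1 ba ab bb p2; lra.
apply: lt_le_trans (_ : Int `[a1, b2] (fun=> k0 * u (b / 4)) <= _).
  by rewrite Int_cst ?mulr_gt0// ?subr_gt0// ltW.
have sub : {subset `[a1, b2] <= `[- pi, pi : R]}.
  by move=> s; rewrite !in_itv/= => /andP[s1 s2]; clear - h0 h1 hp wu v b0 b1 ba ab bb p2 s1 s2; apply/andP; split; lra.
apply: Int_le; [exact: integ_cst|exact: integS iD|].
move=> s; rewrite in_itv/= => /andP[s1 s2]; rewrite add0r.
have [_ _ iu] := wave_prof wu.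
have us : u (b / 4) <= u s by apply: iu; clear - h0 h1 hp wu v b0 ba s1 s2 bb b1 p2; lra.
have vs : 0 <= v s by rewrite /v subr_ge0; apply: le_trans ub; apply: iu; clear - h0 h1 hp wu v b0 ba s1 s2 bb b1 p2; lra.
have K1 : k0 <= `|Ker s| by apply: Hk; rewrite s1 s2.
apply: le_trans (_ : `|Ker s| * u s <= _).
  by apply: ler_pM => //; exact: ltW.
have -> : `|Ker s| * u s = `|Ker s| - `|Ker s| * v s by rewrite /v; ring.
by rewrite lerD2l lerN2; apply: ler_wpM2r => //; exact: ler_norm.
Qed.

Lemma nmean_sgn : n = nl_sgn -> nmean p n u = 0.
Proof.
move=> ns; rewrite /nmean; suff -> : Int `[- pi, pi] (fun x => nonlin n p (1 - u x)) = 0 by rewrite mulr0.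
have fin (a b : R) : b = a -> b = - a -> a = 0 by move=> ->; lra.
have in_ := nonlin_integ hp wu; set N := fun x => _ in in_ *.
have [_ pu' _] := bper_one_sub wu.
have mN : measurable_fun setT N.
  apply: continuous_measurable_fun; apply: (nonlin_cont hp); exact: (one_sub_cont wu).
have pN : periodic N (2 * pi) by move=> x; rewrite /N pu'.
have NN s : N (s + pi) = - N s.
  rewrite /N (wave_sgn wu ns) ns; have -> : 1 - (2 - u s) = - (1 - u s) by ring.
  by rewrite nonlinN mulN1r.
apply: (fin _ _ (Int_per_shift pi mN pN in_).2).
by rewrite -(IntN in_); apply: eq_Int => s _; exact: NN.
Qed.

Lemma nmean_abs_ge0 : 0 <= nmean p nl_abs u.
Proof.
rewrite /nmean mulr_ge0// ?invr_ge0 ?mulr_ge0 ?pi_ge0//.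
by apply: Int_ge0 => s _; exact: powR_ge0.
Qed.

(** If u <= 2 then |v| <= 1, and since the mean of n is nonnegative the equation at the crest gives
    c (1 - 1 / p) <= L v (0), less than the norm of K. Otherwise the case is (abs), and the equation
    at pi, where |v| is largest and n(v) is at least its mean, gives that c is at most the norm of
    K, which p / (p - 1) > 1 makes strict. *)
Lemma speed_lt : lam^-1 < p / (p - 1) * L1normT (kernelK alpha).
Proof.
rewrite (L1normT_kernelK h0 h1); have pp := @pi_gt0 R.
have p1 : 0 < p - 1 by have := hp; lra.
have p0 : 0 < p by lra.
have l0 := wave_lam wu; set c := lam^-1; have c0 : 0 < c by rewrite invr_gt0.
have eq0 := wave_equation h0 h1 hp wu 0; rewrite (wave_0 wu) subr0 nonlin_pos// powR1 in eq0.
have nm : 0 <= nmean p n u.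
  by case: (n) (nmean_sgn) (nmean_abs_ge0) => [_ //|-> //].
suff H : c * (1 - p^-1) < normK alpha \/ (c <= normK alpha).
  have pos : 0 < p / (p - 1) by rewrite divr_gt0.
  case: H => H.
    have -> : c = p / (p - 1) * (c * (1 - p^-1)).
      by field; rewrite !gt_eqF.
    by rewrite ltr_pM2l.
  have K0 := lt_le_trans c0 H; apply: le_lt_trans H _.
  by rewrite ltr_pMl// ltr_pdivlMr// mul1r; lra.
have [U2|U2] := leP (u pi) 2.
  left; apply: le_lt_trans (Lop_lt_normK _); last first.
    move=> x; have := u_le_pi wu x; have := wave_ge0 wu x; rewrite /v ler_norml; lra.
  rewrite -[leRHS]eq0 -/c ler_pM2l// div1r.
  have : 0 <= nmean p n u / p by rewrite divr_ge0// ltW.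
  lra.
right; have na : n = nl_abs.
  case: (n) (u_sgn_le2 wu) => [_|H]; first by [].
  by exfalso; have := H erefl pi; lra.
pose m := u pi - 1; have m1 : 1 < m by rewrite /m; lra.
have vm x : `|v x| <= m.
  by have := u_le_pi wu x; have := wave_ge0 wu x; rewrite /v /m ler_norml; lra.
have bv := bper_one_sub wu; have [mv pv _] := bv.
have bv' : bper v m by split.
have Lb := Lop_bound h0 h1 pi bv'.
have nle : nmean p n u <= m `^ p.
  rewrite /nmean ler_pdivrMl ?mulr_gt0//.
  apply: le_trans (_ : Int `[- pi, pi] (fun=> m `^ p) <= _).
    apply: Int_le; [exact: nonlin_integ wu|exact: integ_cst|].
    move=> s _; rewrite na /=; apply: ge0_ler_powR; rewrite ?nnegrE ?(ltW p0)//; [lra|exact: vm].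
  by rewrite Int_cst ?le_eqVlt; [apply/orP; left; apply/eqP; ring|lra].
have := wave_equation h0 h1 hp wu pi; rewrite -/c.
have -> : 1 - u pi = - m by rewrite /m; ring.
rewrite na nonlinN mul1r (nonlin_pos hp); last by lra.
rewrite -na => e2.
have : c * (m + (m `^ p / p - nmean p n u / p)) <= normK alpha * m.
  have -> : c * (m + (m `^ p / p - nmean p n u / p)) = - Lop v pi by rewrite -[Lop v pi]e2; ring.
  by apply: le_trans (ler_norm _) _; rewrite normrN.
have q0 : 0 <= m `^ p / p - nmean p n u / p by rewrite subr_ge0 ler_pM2r ?invr_gt0.
have : 0 <= c * (m `^ p / p - nmean p n u / p) by rewrite mulr_ge0// ltW.
rewrite [in X in _ -> X -> _]mulrDr => q1 q2.
have : c * m <= normK alpha * m by lra.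
by rewrite ler_pM2r//; lra.
Qed.

Lemma u_pi_gt1 : 1 < u pi.
Proof.
have pp := @pi_gt0 R; have p2 := @pi_ge2 R; have [bu eu iu] := wave_prof wu.
have [mu _ _] := bu; have i01 := bper_integ 0 pi bu.
have [_ e] := integ_even (ltW pp) eu mu i01.
have lt : u (pi / 2) < u pi by apply: (u_incr h0 h1 wu); lra.
have l1 : 0 <= pi / 2 :> R by lra.
have l2 : pi / 2 <= pi :> R by lra.
have e1 : Int `[0, pi] u = Int `[0, pi / 2] u + Int `[pi / 2, pi] u by exact: Int_split.
have b1 : Int `[0, pi / 2] u <= Int `[0, pi / 2] (fun=> u (pi / 2)).
  apply: Int_le; [exact: bper_integ bu|exact: integ_cst|].
  by move=> s; rewrite in_itv/= => /andP[s1 s2]; apply: iu.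
have b2 : Int `[pi / 2, pi] u <= Int `[pi / 2, pi] (fun=> u pi).
  apply: Int_le; [exact: bper_integ bu|exact: integ_cst|].
  by move=> s _; exact: u_le_pi wu s.
rewrite Int_cst// subr0 in b1; rewrite Int_cst// in b2.
have : u (pi / 2) * (pi / 2) < u pi * (pi / 2) by rewrite ltr_pM2r// divr_gt0.
have := wave_mean wu; rewrite e e1 => e3 e4.
have : pi * 1 < pi * u pi by move: e3 b1 b2 e4; clear - h0 h1 hp wu v; rewrite [pi * u pi]mulrC; lra.
by rewrite ltr_pM2l.
Qed.

End Speed.

(** * The theorem: translates of the crest and collection of the properties *)

Lemma int_parity (m : int) : exists q : int, m = q * 2 \/ m = q * 2 + 1.
Proof. by exists (m %/ 2)%Z; lia. Qed.

Lemma exactly_holder_translate {R : realType} (al : R) (f : R -> R) a b :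
  (forall t, `|f b - f (b + t)| = `|f a - f (a + t)|) -> exactly_holder_at al f a -> exactly_holder_at al f b.
Proof.
move=> e [la [de [l0 d0 H]]]; exists la, de; split=> // x xb.
have -> : `|f b - f x| = `|f a - f (a + (x - b))| by rewrite -e; congr (`|_ - f _|); ring.
have E : a + (x - b) - a = x - b by ring.
by have := H (a + (x - b)); rewrite E; apply.
Qed.

Theorem theorem1p1 (R : realType) (alpha p : R) (n : nonlinearity)
    (halpha0 : 0 < alpha) (halpha1 : alpha < 1) (hp : 1 < p) :
  exists (c : R) (phi : R -> R),
    let mu : R := (c / p) `^ (1 / (p - 1)) in
    (0 < c /\ c < p / (p - 1) * L1normT (kernelK alpha)) /\
    travelling_wave alpha (nonlin n p) c phi /\
    (exists x, phi x <> 0) /\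
    (forall (l : int) (x : R),
       phi (2 * pi * l%:~R - x) = phi (2 * pi * l%:~R + x)) /\
    intT phi = 0 /\
    (phi 0 = mu /\ forall x, phi x <= mu) /\
    holderT alpha phi /\
    smooth_on [set x | - pi < x < 0 /\ phi x <> 0] phi /\
    (forall x y, - pi < x -> x < y -> y < 0 -> phi x < phi y) /\
    (forall l : int, exists lambda delta : R,
       [/\ 0 < lambda, 0 < delta &
        forall x, `|x - 2 * pi * l%:~R| < delta ->
          lambda^-1 * `|x - 2 * pi * l%:~R| `^ alpha <= mu - phi x
            <= lambda * `|x - 2 * pi * l%:~R| `^ alpha]) /\
    match n with
    | nl_abs =>
        exists delta : R, 0 < delta /\
          smooth_on [set x | `|x - (- pi)| < delta] phi
    | nl_sgn =>
        (forall x, phi (x + pi) = - phi x) /\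
        (forall m : int, exactly_holder_at alpha phi (pi * m%:~R)) /\
        (phi (- pi) = - mu /\ forall x, - mu <= phi x)
    end.
Proof.
have [lam [M [u [[l0 pu cu u0 Iu] [u00 uW us]]]]] := wave_profile_exists halpha0 halpha1 hp n.
have wu : wave alpha p n lam M u by split.
have pp := @pi_gt0 R; have p2 := @pi_ge2 R.
have [[_ per _] eu iu] := pu.
pose mu := (lam^-1 / p) `^ (1 / (p - 1)); pose phi x := mu * (1 - u x).
exists lam^-1, phi => mu'; rewrite {}/mu' -/mu.
have m0 : 0 < mu := mu_gt0 hp wu.
have tw := phi_travelling halpha0 halpha1 hp wu; rewrite -/mu -/phi in tw.
have phiC k x : u x != 1 -> 0 < dWf p n (u x) -> derivable (derive1n k phi) x 1.
  move=> x1 dx; apply: Cn_derivable.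
  have -> : phi = (fun y => mu + (- mu) * u y) by apply/funext => y; rewrite /phi; ring.
  apply: (@Cn_comp _ _ (fun t => mu + (- mu) * t)); first exact: Cn_affine.
  exact: (Cn_wave halpha0 halpha1 hp wu).
have upos x : - pi <= x -> x < 0 -> 0 < u x.
  by move=> x1 x2; rewrite -eu; apply: (u_gt0 halpha0 halpha1 wu); lra.
have ult2 x : n = nl_sgn -> `|x| < pi -> u x < 2.
  move=> ns xp; have -> : u x = u `|x| by case: (leP 0 x) => hx; [rewrite ger0_norm|rewrite ltr0_norm// eu].
  have -> : 2 = u pi by have := us ns 0; rewrite add0r u00; lra.
  exact: (u_incr halpha0 halpha1 wu).
have [B B0 HB] := u_upper halpha0 halpha1 hp wu; have [b b0 Hb] := u_lower halpha0 halpha1 hp wu.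
pose la := mu * B + (mu * b)^-1.
have mb0 : 0 < mu * b by rewrite mulr_gt0.
have mB0 : 0 < mu * B by rewrite mulr_gt0.
have la0 : 0 < la by rewrite addr_gt0// invr_gt0.
have la1 : la^-1 <= mu * b by rewrite -[leRHS]invrK lef_pV2 ?posrE ?invr_gt0// lerDr ltW.
have la2 : mu * B <= la by rewrite lerDl invr_ge0 ltW.
have ut t : `|t| < pi -> la^-1 * `|t| `^ alpha <= mu * u t <= la * `|t| `^ alpha.
  move=> tp; have -> : u t = u `|t| by case: (leP 0 t) => ht; [rewrite ger0_norm|rewrite ltr0_norm// eu].
  have tI : 0 <= `|t| <= pi by rewrite normr_ge0 ltW.
  have ta := powR_ge0 `|t| alpha; apply/andP; split.
    apply: le_trans (ler_wpM2r ta la1) _; rewrite -mulrA ler_pM2l//; exact: Hb.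
  apply: le_trans (ler_wpM2r ta la2); rewrite -mulrA ler_pM2l//; exact: HB.
have phi2pi l t : phi (2 * pi * l%:~R + t) = phi t.
  by rewrite /phi [_ + t]addrC (per_int l t per).
have ml t : mu - phi t = mu * u t by rewrite /phi; ring.
have hz : exactly_holder_at alpha phi 0.
  exists la, pi; split=> // x; rewrite !subr0 => xp.
  have -> : phi 0 - phi x = mu * u x by rewrite /phi u00; ring.
  by rewrite [`|mu * _|]ger0_norm ?mulr_ge0 ?(ltW m0)//; exact: ut.
split; first by split; [rewrite invr_gt0|exact: (speed_lt halpha0 halpha1 hp wu)].
split; first exact: tw.
split; first by exists 0; rewrite /phi u00 subr0 mulr1; apply/eqP; rewrite gt_eqF.
split; first by move=> l x; rewrite !phi2pi /phi eu.
split; first by case: tw.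
split.
  split; first by rewrite /phi u00 subr0 mulr1.
  by move=> x; rewrite -subr_ge0 ml mulr_ge0// ltW.
split.
  have [C C0 HC] := u_holder halpha0 halpha1 hp wu; exists (mu * C) => x y.
  have -> : phi x - phi y = - (mu * (u x - u y)) by rewrite /phi; ring.
  by rewrite normrN normrM gtr0_norm// -mulrA ler_pM2l.
split.
  (* phi x != 0 is u x != 1, where the nonlinearity is smooth; inside (-pi, 0) the value u x avoids
     the zeros of W', which are 0 and, in case (sgn), 2. *)
  move=> k x /= [/andP[x1 x2] xn]; apply: phiC.
    by apply/eqP => e; apply: xn; rewrite /phi e subrr mulr0.
  apply: (dWf_gt0 hp); first by apply: upos => //; exact: ltW.
  by move=> ns; apply: ult2 => //; rewrite ltr_norml x1 (lt_trans x2).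
split.
  move=> x y x1 xy y0; rewrite /phi ltr_pM2l// ltrD2l ltrN2 -(eu x) -(eu y).
  by apply: (u_incr halpha0 halpha1 wu); clear - x1 xy y0; lra.
split.
  move=> l; exists la, pi; split=> // x; set t := x - 2 * pi * l%:~R => tp.
  have -> : x = 2 * pi * l%:~R + t by rewrite /t; ring.
  by rewrite phi2pi ml; exact: ut.
case: (n) wu us ult2 phiC tw => [wu' _ _ phiC _|wu' us' _ _ _].
  (* In case (abs) u exceeds its mean 1 at -pi, so near this point the wave does not vanish and W' >
     0. *)
  have U1 := u_pi_gt1 halpha0 halpha1 wu'.
  have e0 : 0 < u pi - 1 by lra.
  have [d d0 Hd] := u_near_small wu' (- pi) e0.
  exists d; split=> // k x /= xd.
  have ux : 1 < u x by have := Hd x xd; rewrite eu ltr_norml; lra.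
  apply: phiC; first by rewrite gt_eqF.
  by apply: (dWf_gt0 hp) => //; lra.
have rf x : phi (x + pi) = - phi x by rewrite /phi us'//; ring.
split; first exact: rf.
split.
  (* Even multiples of pi are periods; at odd ones phi (pi + t) = - phi t, a sign that the modulus
     of the increment does not see. *)
  move=> m; apply: exactly_holder_translate hz => t.
  have [q [->|->]] := int_parity m.
    have -> : pi * (q * 2)%:~R = 2 * pi * q%:~R :> R by rewrite intrM; ring.
    by rewrite phi2pi -[2 * pi * q%:~R]addr0 phi2pi add0r.
  have -> : pi * (q * 2 + 1)%:~R = 2 * pi * q%:~R + pi :> R by rewrite intrD intrM; ring.
  have rpi : phi pi = - phi 0 by rewrite -{1}[pi]add0r rf.
  by rewrite -addrA !phi2pi [pi + t]addrC rf rpi add0r -opprD normrN.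
have u2 x : u x <= 2 := u_sgn_le2 wu' erefl x.
have upi : u pi = 2 by have := us' erefl 0; rewrite add0r u00; lra.
split; first by rewrite /phi eu upi; ring.
by move=> x; rewrite -(opprK (phi x)) lerN2 -[leRHS]mulr1 -mulrN ler_pM2l//; have := u2 x; lra.
Qed.
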